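(* Let $k\ge2$, $\alpha,\beta>0$, and let $p$ be a polynomial on $\mathbb{R}^2\cong\mathbb{C}$ invariant under $I_{2k}$. For $b\ge0$ and $\xi\in[-1,1]$ let $q=\arccos\xi$, $\lambda=\alpha+\beta$, and $$g(b,\xi)=\tfrac12\Big[\Phi_2^{(k)}\big(\lambda,\dots,\lambda;k\lambda;\big(b\cos\tfrac{q-2j\pi}{k}\big)_{j=0}^{k-1}\big)+\Phi_2^{(k)}\big(\lambda,\dots,\lambda;k\lambda;\big(b\cos\tfrac{\pi-q-2j\pi}{k}\big)_{j=0}^{k-1}\big)\Big].$$ For $z=|z|e^{i\phi_1}$ and $u,v\in[-1,1]$, the function $w=|w|e^{i\phi_2}\mapsto J_{u,v}(z,w):=g\big(|zw|,\xi_{u,v}(k\phi_1,k\phi_2)\big)$ is given by an everywhere convergent power series in the coordinates of $w$. Put $p_{u,v}(z):=[p(w),J_{u,v}(z,w)]_0=\big(p(\partial_w)J_{u,v}(z,w)\big)\big|_{w=0}$. Then $$V_\kappa(p)(z)=\int_{-1}^1\int_{-1}^1p_{u,v}(z)\,d\nu^\alpha(u)\,d\nu^\beta(v),$$ and moreover $p_{u,v}(z)=\frac1{2\pi}\int_{\mathbb{R}^2}\mathcal F\big(e^{-|\cdot|^2/2}J_{u,v}(z,\cdot)\big)(y)\,\mathcal F\big(e^{-|\cdot|^2/2}p\big)(y)\,e^{|y|^2/2}dy$.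
   Context: Identify $\mathbb{R}^2$ with $\mathbb{C}$, $\langle z,w\rangle=\mathrm{Re}(z\bar w)$. The dihedral group $I_{2k}$ (order $4k$) contains the reflections $z\mapsto\bar ze^{ij\pi/k}$, $j=0,\dots,2k-1$, forming two conjugacy classes ($j$ even, containing $z\mapsto\bar z$; $j$ odd); $\kappa=(\alpha,\beta)$ is $\alpha$ on the class with $j$ even and $\beta$ on the class with $j$ odd. $V_\kappa$ is the Dunkl intertwining operator (unique degree-preserving linear isomorphism of polynomials with $V_\kappa1=1$, $T_jV_\kappa=V_\kappa\partial_j$ for the Dunkl operators $T_j$). $p(\partial_w)$ is obtained from $p$ by replacing the coordinates of $w$ by the corresponding partial derivatives. $d\nu^\alpha(u)=\frac{\Gamma(\alpha+1/2)}{\sqrt\pi\Gamma(\alpha)}(1-u^2)^{\alpha-1}du$ on $[-1,1]$. $\xi_{u,v}(\theta_1,\theta_2)=v\cos\theta_1\cos\theta_2+u\sin\theta_1\sin\theta_2$. Humbert function $\Phi_2^{(m)}(\beta_1,\dots,\beta_m;\gamma;x_1,\dots,x_m)=\sum_{j_i\ge0}\frac{(\beta_1)_{j_1}\cdots(\beta_m)_{j_m}}{(\gamma)_{j_1+\cdots+j_m}}\prod_i\frac{x_i^{j_i}}{j_i!}$. Fourier transform $\mathcal Ff(y)=\frac1{2\pi}\int_{\mathbb{R}^2}e^{-i\langle x,y\rangle}f(x)dx$. *)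

(* Defs.v *)
From HB Require Import structures.
From mathcomp Require Import all_boot all_algebra.
From mathcomp Require Import all_classical all_reals all_analysis.
From mathcomp Require Import complex.

Set Implicit Arguments.
Unset Strict Implicit.
Unset Printing Implicit Defensive.

Import GRing.Theory Num.Theory numFieldNormedType.Exports.
Local Open Scope ring_scope.
Local Open Scope classical_set_scope.

Section Defs.
Variable R : realType.

Definition dotp (x y : R * R) : R := x.1 * y.1 + x.2 * y.2.
Definition nrm (x : R * R) : R := Num.sqrt (x.1 ^+ 2 + x.2 ^+ 2).
Definition evec (i : 'I_2) : R * R := if i == ord0 then (1, 0) else (0, 1).

(** Polynomials on R^2 : the outer variable is x2, the inner one x1. *)
Definition peval (p : {poly {poly R}}) (x : R * R) : R := (p.[x.2%:P]).[x.1].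
Definition pcoef (p : {poly {poly R}}) (a b : nat) : R := (p`_b)`_a.
Definition pder (i : 'I_2) (p : {poly {poly R}}) : {poly {poly R}} :=
  if i == ord0 then map_poly (@deriv R) p else deriv p.
Definition homog (n : nat) (p : {poly {poly R}}) : Prop :=
  forall a b : nat, (a + b != n)%N -> pcoef p a b = 0.

(** The dihedral group I_{2k}: rotations z |-> z e^{i j pi/k} and
    reflections z |-> conj(z) e^{i j pi/k}, j = 0..2k-1. *)
Definition ang (k j : nat) : R := j%:R * pi / k%:R.
Definition rotI (k j : nat) (x : R * R) : R * R :=
  (x.1 * cos (ang k j) - x.2 * sin (ang k j),
   x.1 * sin (ang k j) + x.2 * cos (ang k j)).
Definition reflI (k j : nat) (x : R * R) : R * R :=
  (x.1 * cos (ang k j) + x.2 * sin (ang k j),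
   x.1 * sin (ang k j) - x.2 * cos (ang k j)).
(** a (unit) root of the reflection reflI k j : orthogonal to its mirror line,
    which has angle ang k j / 2 *)
Definition rootI (k j : nat) : R * R :=
  (- sin (ang k j / 2), cos (ang k j / 2)).
Definition kappa (al be : R) (j : nat) : R := if odd j then be else al.

Definition dihedral_invariant (k : nat) (p : {poly {poly R}}) : Prop :=
  forall (j : nat) (x : R * R), (j < 2 * k)%N ->
    peval p (rotI k j x) = peval p x /\ peval p (reflI k j x) = peval p x.

(** Dunkl operator T_i (in direction e_i) applied to a polynomial, evaluated
    at x (off the mirrors):
    T_i p(x) = d_i p(x) + sum_{j<2k} kappa_j <a_j,e_i> (p(x) - p(s_j x))/<a_j,x>. *)
Definition dunkl (k : nat) (al be : R) (i : 'I_2) (p : {poly {poly R}})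
    (x : R * R) : R :=
  peval (pder i p) x +
  \sum_(j < 2 * k) kappa al be j * dotp (rootI k j) (evec i) *
      (peval p x - peval p (reflI k j x)) / dotp (rootI k j) x.

Definition dunkl_intertwiner (k : nat) (al be : R)
    (V : {poly {poly R}} -> {poly {poly R}}) : Prop :=
  [/\ (forall (c : R) p q, V (c%:P%:P * p + q) = c%:P%:P * V p + V q),
      bijective V,
      V 1 = 1,
      (forall n p, homog n p -> homog n (V p)) &
      (forall i p x, (forall j, (j < 2 * k)%N -> dotp (rootI k j) x != 0) ->
         dunkl k al be i (V p) x = peval (V (pder i p)) x)].

Definition poch (a : R) (n : nat) : R := \prod_(i < n) (a + i%:R).

(** Humbert function Phi_2^{(m)}(bs; ga; x), as the limit of the partial sums
    over the boxes [0,N)^m of its (absolutely convergent) multiple series. *)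
Definition humbert_part (m : nat) (bs : 'I_m -> R) (ga : R) (x : 'I_m -> R)
    (N : nat) : R :=
  \sum_(j : {ffun 'I_m -> 'I_N})
     (\prod_(i < m) poch (bs i) (j i)) / poch ga (\sum_(i < m) (j i : nat)) *
     \prod_(i < m) (x i ^+ j i / (j i)`!%:R).
Definition humbert (m : nat) (bs : 'I_m -> R) (ga : R) (x : 'I_m -> R) : R :=
  limn (humbert_part bs ga x : R^nat).

Definition gfun (k : nat) (la b xi : R) : R :=
  2^-1 * (humbert (fun _ : 'I_k => la) (k%:R * la)
            (fun j => b * cos ((acos xi - 2 * (j : nat)%:R * pi) / k%:R))
        + humbert (fun _ : 'I_k => la) (k%:R * la)
            (fun j => b * cos ((pi - acos xi - 2 * (j : nat)%:R * pi) / k%:R))).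

(** polar angle of a nonzero point (arbitrary value at 0) *)
Definition argp (x : R * R) : R :=
  if 0 <= x.2 then acos (x.1 / nrm x) else - acos (x.1 / nrm x).

Definition xi_uv (u v t1 t2 : R) : R := v * cos t1 * cos t2 + u * sin t1 * sin t2.

Definition Jfun (k : nat) (al be u v : R) (z w : R * R) : R :=
  gfun k (al + be) (nrm z * nrm w) (xi_uv u v (k%:R * argp z) (k%:R * argp w)).

Definition d1 (F : R * R -> R) : R * R -> R :=
  fun w => (fun t => F (t, w.2))^`() w.1.
Definition d2 (F : R * R -> R) : R * R -> R :=
  fun w => (fun t => F (w.1, t))^`() w.2.
Definition papply0 (p : {poly {poly R}}) (F : R * R -> R) : R :=
  \sum_(b < size p) \sum_(a < size p`_b)
     pcoef p a b * iter a d1 (iter b d2 F) (0, 0).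

Definition p_uv (k : nat) (al be : R) (p : {poly {poly R}}) (u v : R)
    (z : R * R) : R :=
  papply0 p (Jfun k al be u v z).

Definition Gamma (s : R) : R :=
  Rintegral (@lebesgue_measure R) [set t : R | 0 < t]
            (fun t => t `^ (s - 1) * expR (- t)).

Definition nu_dens (al u : R) : R :=
  Gamma (al + 2^-1) / (Num.sqrt pi * Gamma al) * (1 - u ^+ 2) `^ (al - 1).

Definition I11 : set R := [set u : R | -1 <= u <= 1].

Definition leb2 := ((@lebesgue_measure R) \x (@lebesgue_measure R))%E.

Definition Cre (z : R[i]) : R := let: Complex a _ := z in a.
Definition Cim (z : R[i]) : R := let: Complex _ b := z in b.

Definition Cintegrable (f : R * R -> R[i]) : Prop :=
  leb2.-integrable setT (fun x => (Cre (f x))%:E) /\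
  leb2.-integrable setT (fun x => (Cim (f x))%:E).
Definition Cint (f : R * R -> R[i]) : R[i] :=
  Complex (Rintegral leb2 setT (fun x => Cre (f x)))
          (Rintegral leb2 setT (fun x => Cim (f x))).

Definition Creal (x : R) : R[i] := Complex x 0.
Definition expmi (t : R) : R[i] := Complex (cos t) (- sin t).

Definition fourier (f : R * R -> R) (y : R * R) : R[i] :=
  Creal (2 * pi)^-1 * Cint (fun x => expmi (dotp x y) * Creal (f x)).

End Defs.

(* Main.v *)
(* On invariant polynomials the Dunkl operators act as partial derivatives, and the
   Fischer pairing carried over by V, <q, f>_T = (q(T) f)(0), satisfies
   <q, V p>_T = <q, p>.  The commutator of T_1^2 + T_2^2 with multiplication by x_i
   is 2 T_i, so q(T) is an iterated commutator with the Dunkl Laplacian, which is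
   explicit in |z|^2, (Re z^k)^2 and (Im z^k)^2.  This gives the reproducing kernel
   of the pairing on invariants, hence V p for invariant p.  The coefficients of the
   kernel are those of prod_i (1 - s cos ((q - 2 pi i) / k))^(- lambda), by a
   Gegenbauer-type differential equation in s and xi = cos q; multiplied by
   b^n / (k lambda)_n they give the Humbert functions.  The powers of u and v in
   J_{u,v} integrate to the beta moments that turn its expansion into the kernel.
   For the Fourier formula, the transform of x^a y^b exp(-|.|^2 / 2) is
   (-i)^(a + b) He_a He_b exp(-|.|^2 / 2), and the Hermite polynomials are
   orthogonal; power series are handled by dominated convergence. *)

Require Import Defs.
From HB Require Import structures.
From mathcomp Require Import all_boot all_order all_algebra.
From mathcomp Require Import all_classical all_reals all_analysis.
From mathcomp Require Import complex ring lra zify measurable_realfun.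

Set Implicit Arguments.
Unset Strict Implicit.
Unset Printing Implicit Defensive.

Import Order.TTheory GRing.Theory Num.Theory numFieldNormedType.Exports.
Local Open Scope ring_scope.
Local Open Scope classical_set_scope.

(** [V] is accessible only through its intertwining property, so [V p] is found by duality: an
    explicit candidate [W] has the right pairing with every invariant [q], and then the invariant
    polynomial [p - V^-1 W] has Fischer square 0. Definiteness is thus used for the ordinary product
    alone, where it is a sum of squares, and only invariant [q] have to be tested. The test
    polynomials are [rho^s Yh_j], with [Yh_j] an invariant of degree [2 k j] annihilated by the
    Dunkl Laplacian. Since [rho] is adjoint to that Laplacian, reproduction comes down to three
    facts about the kernel coefficients [d N m]: a recursion in [N], the vanishing for [k m > N],
    and the value of [d (k j) j]. The obstacle is to find this recursion in the Humbert series,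
    where [xi = cos q] is hidden in [k] cosines. The product of the [k] linear factors is a
    polynomial in [s] and [xi]; its power [- la] is cut at a finite order, so that the differential
    equation is a polynomial identity modulo a power of [s]. Averaging the two Humbert functions
    keeps the even powers of [xi], and with them only even degrees. *)

Section BivariatePolynomials.
Variable R : realType.
Local Notation P2 := {poly {poly R}}.
Implicit Types (p q : P2) (x : R * R).

Definition X1 : P2 := 'X%:P.
Definition X2 : P2 := 'X.
Definition CC (c : R) : P2 := c%:P%:P.

Lemma pevalD p q x : peval (p + q) x = peval p x + peval q x.
Proof. by rewrite /peval !hornerD. Qed.
Lemma pevalN p x : peval (- p) x = - peval p x.
Proof. by rewrite /peval !hornerN. Qed.
Lemma pevalB p q x : peval (p - q) x = peval p x - peval q x.
Proof. by rewrite pevalD pevalN. Qed.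
Lemma pevalM p q x : peval (p * q) x = peval p x * peval q x.
Proof. by rewrite /peval !hornerM. Qed.
Lemma pevalXn p n x : peval (p ^+ n) x = peval p x ^+ n.
Proof. by rewrite /peval !horner_exp. Qed.
Lemma pevalC c x : peval (CC c) x = c.
Proof. by rewrite /peval !hornerC. Qed.
Lemma peval1 x : peval 1 x = 1.
Proof. by rewrite /peval !hornerE. Qed.
Lemma peval0 x : peval 0 x = 0.
Proof. by rewrite /peval !hornerE. Qed.
Lemma pevalX1 x : peval X1 x = x.1.
Proof. by rewrite /peval !hornerE. Qed.
Lemma pevalX2 x : peval X2 x = x.2.
Proof. by rewrite /peval !hornerE. Qed.
Lemma peval_nat n x : peval n%:R x = n%:R.
Proof. by elim: n => [|n IH]; rewrite ?peval0// -natr1 pevalD peval1 IH natr1. Qed.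
Definition pevalE := (pevalD, pevalN, pevalM, pevalXn, pevalC, peval1, peval0, pevalX1, pevalX2, peval_nat).
Lemma peval_sum (I : Type) (r : seq I) (P : pred I) (F : I -> P2) x :
  peval (\sum_(i <- r | P i) F i) x = \sum_(i <- r | P i) peval (F i) x.
Proof. by elim/big_rec2: _ => [|i a b _ <-]; rewrite ?peval0 ?pevalD. Qed.
Lemma peval_prod (I : Type) (r : seq I) (P : pred I) (F : I -> P2) x :
  peval (\prod_(i <- r | P i) F i) x = \prod_(i <- r | P i) peval (F i) x.
Proof. by elim/big_rec2: _ => [|i a b _ <-]; rewrite ?peval1 ?pevalM. Qed.

Lemma CCD a b : CC (a + b) = CC a + CC b.
Proof. by rewrite /CC !polyCD. Qed.
Lemma CCN a : CC (- a) = - CC a.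
Proof. by rewrite /CC !polyCN. Qed.
Lemma CCM a b : CC (a * b) = CC a * CC b.
Proof. by rewrite /CC !polyCM. Qed.
Lemma CC1 : CC 1 = 1. Proof. by rewrite /CC. Qed.
Lemma CC0 : CC 0 = 0. Proof. by rewrite /CC !polyC0. Qed.
Lemma CCXn a n : CC (a ^+ n) = CC a ^+ n.
Proof. by rewrite /CC !polyC_exp. Qed.
Lemma CCnat n : CC n%:R = n%:R.
Proof. by elim: n => [|n IH]; rewrite ?CC0// -natr1 CCD IH CC1 natr1. Qed.
Lemma CC_sum (I : Type) (r : seq I) (P : pred I) (F : I -> R) :
  CC (\sum_(i <- r | P i) F i) = \sum_(i <- r | P i) CC (F i).
Proof. by elim/big_rec2: _ => [|i a b _ <-]; rewrite ?CC0 ?CCD. Qed.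

Lemma poly2_ind (P : P2 -> Prop) :
  (forall c, P (CC c)) -> P X1 -> P X2 ->
  (forall p q, P p -> P q -> P (p + q)) ->
  (forall p q, P p -> P q -> P (p * q)) -> forall p, P p.
Proof.
move=> hC h1 h2 hD hM.
have hP (c : {poly R}) : P c%:P.
  elim/poly_ind: c => [|c a IH]; first by rewrite -[0%:P]CC0.
  by rewrite polyCD polyCM; apply: hD; [exact: hM | exact: hC].
elim/poly_ind => [|p c IH]; first by rewrite -CC0.
by apply: hD; [exact: hM | exact: hP].
Qed.

Lemma poly_horner_inj (p q : {poly R}) : (forall t, p.[t] = q.[t]) -> p = q.
Proof.
move=> h; apply/eqP; rewrite -subr_eq0; apply/eqP.
apply: (@roots_geq_poly_eq0 _ _ [seq i%:R | i <- iota 0 (size (p - q))]).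
- by apply/allP => t _; rewrite /root hornerD hornerN h subrr.
- by rewrite map_inj_uniq ?iota_uniq // => a b /eqP; rewrite eqr_nat => /eqP.
- by rewrite size_map size_iota.
Qed.

Lemma peval_inj p q : (forall x, peval p x = peval q x) -> p = q.
Proof.
move=> h; suff h0 (r : P2) : (forall x, peval r x = 0) -> r = 0.
  by apply/eqP; rewrite -subr_eq0; apply/eqP/h0 => x; rewrite pevalB h subrr.
move=> hr; apply: (@roots_geq_poly_eq0 _ _ [seq (i%:R : R)%:P | i <- iota 0 (size r)]).
- apply/allP => _ /mapP[i _ ->]; apply/eqP; apply: poly_horner_inj => t.
  by rewrite horner0 -(hr (t, i%:R)).
- rewrite map_inj_uniq ?iota_uniq // => a b /polyC_inj /eqP.
  by rewrite eqr_nat => /eqP.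
- by rewrite size_map size_iota.
Qed.

Lemma pderD i p q : pder i (p + q) = pder i p + pder i q.
Proof.
rewrite /pder; case: ifP => _; last exact: derivD.
by rewrite raddfD.
Qed.
Lemma pderC i c : pder i (CC c) = 0.
Proof.
rewrite /pder; case: ifP => _; last exact: derivC.
by rewrite /CC map_polyC /= derivC polyC0.
Qed.
Lemma pder0 i : pder i (0 : P2) = 0. Proof. by rewrite -CC0 pderC. Qed.
Lemma pderM i p q : pder i (p * q) = pder i p * q + p * pder i q.
Proof.
rewrite /pder; case: ifP => _; last exact: derivM.
apply/polyP => n; rewrite coefD !coefM coef_map_id0 ?deriv0// coefM.
rewrite raddf_sum -big_split /=; apply: eq_bigr => j _.
by rewrite derivM !coef_map_id0 ?deriv0.
Qed.
Lemma pderN i p : pder i (- p) = - pder i p.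
Proof. by apply/eqP; rewrite -addr_eq0 -pderD addNr pder0. Qed.
Lemma pderB i p q : pder i (p - q) = pder i p - pder i q.
Proof. by rewrite pderD pderN. Qed.
Lemma pderZ i c p : pder i (CC c * p) = CC c * pder i p.
Proof. by rewrite pderM pderC mul0r add0r. Qed.
Lemma pder1 i : pder i (1 : P2) = 0. Proof. by rewrite -CC1 pderC. Qed.
Lemma pderXn i p n : pder i (p ^+ n) = n%:R * p ^+ n.-1 * pder i p.
Proof.
elim: n => [|n IH]; first by rewrite expr0 pder1 !mul0r.
rewrite exprS pderM IH /= -[in RHS]natr1; case: n {IH} => [|n] /=.
  by rewrite !expr0; ring.
by rewrite exprS; ring.
Qed.
Lemma pder_X1 i : pder i X1 = CC (i == ord0)%:R.
Proof.
by rewrite /pder /X1; case: ifP => _; rewrite ?map_polyC /= ?derivX ?derivC ?CC0 ?CC1.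
Qed.
Lemma pder_X2 i : pder i X2 = CC (i != ord0)%:R.
Proof.
rewrite /pder /X2; case: ifP => _; last by rewrite derivX CC1.
apply/polyP => n; rewrite coef_map_id0 ?deriv0// coefX CC0 coef0.
by case: eqP => _; rewrite /= ?derivC ?deriv0.
Qed.
Lemma pderC_comm i j p : pder i (pder j p) = pder j (pder i p).
Proof.
elim/poly2_ind: p => [c|||p q hp hq|p q hp hq].
- by rewrite !(pderC, pder0).
- by rewrite !pder_X1 !pderC.
- by rewrite !pder_X2 !pderC.
- by rewrite !pderD hp hq.
- by rewrite !pderM !pderD !pderM hp hq; ring.
Qed.

Lemma pcoefD p q a b : pcoef (p + q) a b = pcoef p a b + pcoef q a b.
Proof. by rewrite /pcoef !coefD. Qed.
Lemma pcoefN p a b : pcoef (- p) a b = - pcoef p a b.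
Proof. by rewrite /pcoef !coefN. Qed.
Lemma pcoef0 a b : pcoef (0 : P2) a b = 0.
Proof. by rewrite /pcoef !coef0. Qed.
Lemma pcoefZ c p a b : pcoef (CC c * p) a b = c * pcoef p a b.
Proof. by rewrite /pcoef !coefCM. Qed.
Lemma pcoef_sum (I : Type) (r : seq I) (P : pred I) (F : I -> P2) a b :
  pcoef (\sum_(i <- r | P i) F i) a b = \sum_(i <- r | P i) pcoef (F i) a b.
Proof. by elim/big_rec2: _ => [|i u v _ <-]; rewrite ?pcoef0 ?pcoefD. Qed.
Lemma pcoef_mono a b a' b' : pcoef (X1 ^+ a * X2 ^+ b) a' b' = ((a' == a) && (b' == b))%:R.
Proof.
rewrite /pcoef /X1 /X2 -polyC_exp coefCM coefXn.
case: eqP => _; last by rewrite mulr0 coef0 andbF.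
by rewrite mulr1 coefXn andbT.
Qed.
Lemma pcoefX1 p a b : pcoef (X1 * p) a b = if a is a'.+1 then pcoef p a' b else 0.
Proof. by rewrite /pcoef /X1 coefCM coefXM; case: a. Qed.
Lemma pcoefX2 p a b : pcoef (X2 * p) a b = if b is b'.+1 then pcoef p a b' else 0.
Proof. by rewrite /pcoef /X2 coefXM; case: b => //=; rewrite coef0. Qed.
Lemma pcoef_inj p q : (forall a b, pcoef p a b = pcoef q a b) -> p = q.
Proof. by move=> h; apply/polyP => b; apply/polyP => a; exact: h. Qed.
Lemma pcoef_pder0 p a b : pcoef (pder ord0 p) a b = a.+1%:R * pcoef p a.+1 b.
Proof. by rewrite /pcoef /pder eqxx coef_map_id0 ?deriv0// coef_deriv mulr_natl. Qed.
Lemma pcoef_pder1 p a b : pcoef (pder ord_max p) a b = b.+1%:R * pcoef p a b.+1.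
Proof. by rewrite /pcoef /pder /= coef_deriv coefMn mulr_natl. Qed.

Lemma pcoef_eq0 p : exists N, forall a b, (N <= a)%N || (N <= b)%N -> pcoef p a b = 0.
Proof.
exists (maxn (size p) (\max_(b < size p) size (p`_b)%R))%N => a b hab.
have [hb|hb] := leqP (size p) b; first by rewrite /pcoef (nth_default _ hb) coef0.
have ha : (size (p`_b)%R <= a)%N.
  case/orP: hab; rewrite geq_max => /andP[h1 h2].
    by apply: leq_trans h2; exact: (leq_bigmax (Ordinal hb)).
  by rewrite leqNgt hb in h1.
by rewrite /pcoef nth_default.
Qed.

(** The linear functional with value [f a b] at [X1 ^+ a * X2 ^+ b]. Evaluation, both Fischer
    pairings, the isotropic value [cev] and the moment integrals are all of this form, so that their
    identities can be checked on monomials by [poly2_lin_ind]. *)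
Definition psum p (f : nat -> nat -> R) : R :=
  \sum_(b < size p) \sum_(a < size p`_b) pcoef p a b * f a b.

(** The ragged ranges of [psum] are those of [papply0]; additivity in [p] becomes accessible once
    two polynomials are summed over a common square. *)
Lemma psum_widen p f N : (forall a b, (N <= a)%N || (N <= b)%N -> pcoef p a b = 0) ->
  psum p f = \sum_(b < N) \sum_(a < N) pcoef p a b * f a b.
Proof.
move=> hN.
have inner b : \sum_(a < size p`_b) pcoef p a b * f a b = \sum_(a < N) pcoef p a b * f a b.
  set F := fun a => pcoef p a b * f a b.
  have w M : (forall a, (M <= a)%N -> F a = 0) -> forall K, (M <= K)%N ->
      \sum_(a < M) F a = \sum_(a < K) F a.
    move=> h K hK; rewrite -!(big_mkord xpredT F) (big_cat_nat (leq0n M) hK) //=.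
    by rewrite [X in _ + X]big_nat [X in _ + X]big1 ?addr0 // => i /andP[/h].
  have h1 a : (size (p`_b)%R <= a)%N -> F a = 0 by move=> h; rewrite /F /pcoef nth_default ?mul0r.
  have h2 a : (N <= a)%N -> F a = 0 by move=> h; rewrite /F hN ?h ?mul0r.
  by rewrite (w _ h1 (maxn N (size p`_b))) ?leq_maxr// (w _ h2 (maxn N (size p`_b))) ?leq_maxl.
rewrite /psum; under eq_bigr do rewrite inner.
set F := fun b => \sum_(a < N) pcoef p a b * f a b.
have w M : (forall a, (M <= a)%N -> F a = 0) -> forall K, (M <= K)%N ->
    \sum_(a < M) F a = \sum_(a < K) F a.
  move=> h K hK; rewrite -!(big_mkord xpredT F) (big_cat_nat (leq0n M) hK) //=.
  by rewrite [X in _ + X]big_nat [X in _ + X]big1 ?addr0 // => i /andP[/h].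
have h1 a : (size p <= a)%N -> F a = 0.
  by move=> h; rewrite /F big1 // => i _; rewrite /pcoef [p`_a]nth_default// coef0 mul0r.
have h2 a : (N <= a)%N -> F a = 0.
  by move=> h; rewrite /F big1 // => i _; rewrite hN ?h ?orbT ?mul0r.
by rewrite (w _ h1 (maxn N (size p))) ?leq_maxr// (w _ h2 (maxn N (size p))) ?leq_maxl.
Qed.

Lemma psumD p q f : psum (p + q) f = psum p f + psum q f.
Proof.
have [N hN] := pcoef_eq0 p; have [M hM] := pcoef_eq0 q.
set K := maxn N M.
have hp a b : (K <= a)%N || (K <= b)%N -> pcoef p a b = 0.
  by rewrite !geq_max => /orP[]/andP[h _]; apply: hN; rewrite h ?orbT.
have hq a b : (K <= a)%N || (K <= b)%N -> pcoef q a b = 0.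
  by rewrite !geq_max => /orP[]/andP[_ h]; apply: hM; rewrite h ?orbT.
rewrite (psum_widen _ hp) (psum_widen _ hq) (@psum_widen _ _ K); last first.
  by move=> a b h; rewrite pcoefD hp// hq// addr0.
rewrite -big_split; apply: eq_bigr => b _; rewrite -big_split; apply: eq_bigr => a _ /=.
by rewrite pcoefD mulrDl.
Qed.
Lemma psumZ c p f : psum (CC c * p) f = c * psum p f.
Proof.
have [N hN] := pcoef_eq0 p.
rewrite (psum_widen _ hN) (@psum_widen _ _ N); last by move=> a b /hN h; rewrite pcoefZ h mulr0.
rewrite mulr_sumr; apply: eq_bigr => b _; rewrite mulr_sumr; apply: eq_bigr => a _.
by rewrite pcoefZ mulrA.
Qed.
Lemma psum0 f : psum 0 f = 0.
Proof. by rewrite /psum size_poly0 big_ord0. Qed.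
Lemma psum_sum (I : Type) (r : seq I) (P : pred I) (F : I -> P2) f :
  psum (\sum_(i <- r | P i) F i) f = \sum_(i <- r | P i) psum (F i) f.
Proof. by elim/big_rec2: _ => [|i u v _ <-]; rewrite ?psum0 ?psumD. Qed.
Lemma eq_psum p f g : (forall a b, pcoef p a b != 0 -> f a b = g a b) -> psum p f = psum p g.
Proof.
move=> h; apply: eq_bigr => b _; apply: eq_bigr => a _.
by have [->|/h ->] := eqVneq (pcoef p a b) 0; rewrite ?mul0r.
Qed.
Lemma psum_fD p f g : psum p (fun a b => f a b + g a b) = psum p f + psum p g.
Proof.
rewrite -big_split; apply: eq_bigr => b _; rewrite -big_split; apply: eq_bigr => a _ /=.
by rewrite mulrDr.
Qed.
Lemma psum_fZ p c f : psum p (fun a b => c * f a b) = c * psum p f.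
Proof.
rewrite mulr_sumr; apply: eq_bigr => b _; rewrite mulr_sumr; apply: eq_bigr => a _ /=.
by rewrite mulrCA.
Qed.
Lemma psum_fsum (I : Type) (r : seq I) (P : pred I) p (F : I -> nat -> nat -> R) :
  psum p (fun a b => \sum_(i <- r | P i) F i a b) = \sum_(i <- r | P i) psum p (F i).
Proof.
elim: r => [|i r IH].
  rewrite big_nil /psum big1 // => b _; rewrite big1 // => a _.
  by rewrite big_nil mulr0.
rewrite big_cons; case: ifP => hi.
  by rewrite -IH -psum_fD; apply: eq_psum => a b _; rewrite big_cons hi.
by rewrite -IH; apply: eq_psum => a b _; rewrite big_cons hi.
Qed.
Lemma psum_mono a b f : psum (X1 ^+ a * X2 ^+ b) f = f a b.
Proof.
rewrite (@psum_widen _ _ (maxn a b).+1); last first.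
  move=> a' b' h; rewrite pcoef_mono; case: eqP => //= e1; case: eqP => //= e2.
  by move: h; rewrite e1 e2 !ltnNge leq_maxl leq_maxr.
have hb : (b < (maxn a b).+1)%N by rewrite ltnS leq_maxr.
have ha : (a < (maxn a b).+1)%N by rewrite ltnS leq_maxl.
rewrite (bigD1 (Ordinal hb)) //= (bigD1 (Ordinal ha)) //=.
rewrite pcoef_mono !eqxx mul1r big1 ?addr0; last first.
  by move=> i; rewrite -val_eqE /= pcoef_mono => /negbTE ->; rewrite mul0r.
rewrite big1 ?addr0 // => i; rewrite -val_eqE /= => /negbTE hi.
by rewrite big1 // => j _; rewrite pcoef_mono hi andbF mul0r.
Qed.

Lemma poly2_mono p : exists N, p = \sum_(b < N) \sum_(a < N) CC (pcoef p a b) * (X1 ^+ a * X2 ^+ b).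
Proof.
have [N hN] := pcoef_eq0 p; exists N; apply: pcoef_inj => a b.
rewrite pcoef_sum; under eq_bigr do rewrite pcoef_sum.
have [ha|ha] := ltnP a N; last first.
  rewrite hN ?ha// big1 // => j _; rewrite big1 // => i _; rewrite pcoefZ pcoef_mono.
  by rewrite gtn_eqF ?mulr0 //; apply: leq_trans ha.
have [hb|hb] := ltnP b N; last first.
  rewrite hN ?hb ?orbT// big1 // => j _; rewrite big1 // => i _; rewrite pcoefZ pcoef_mono.
  by rewrite [b == j]gtn_eqF ?andbF ?mulr0 //; apply: leq_trans hb.
rewrite (bigD1 (Ordinal hb)) //= (bigD1 (Ordinal ha)) //=.
rewrite pcoefZ pcoef_mono !eqxx mulr1 big1 ?addr0; last first.
  by move=> i; rewrite -val_eqE /= pcoefZ pcoef_mono eq_sym => /negbTE ->; rewrite mulr0.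
rewrite big1 ?addr0 // => i; rewrite -val_eqE /= eq_sym => /negbTE hi.
by rewrite big1 // => j _; rewrite pcoefZ pcoef_mono hi andbF mulr0.
Qed.

Lemma poly2_lin_ind (P : P2 -> Prop) :
  (forall p q, P p -> P q -> P (p + q)) -> (forall c p, P p -> P (CC c * p)) ->
  (forall a b, P (X1 ^+ a * X2 ^+ b)) -> forall p, P p.
Proof.
move=> hD hZ hm p; have [N ->] := poly2_mono p.
have h0 : P 0 by rewrite -(mul0r (X1 ^+ 0 * X2 ^+ 0)) -CC0; exact: hZ.
elim/big_rec: _ => // i q _ hq; apply: (hD) hq.
by elim/big_rec: _ => // j r _ hr; apply: (hD) hr; exact: hZ.
Qed.

Lemma psumX1 p f : psum (X1 * p) f = psum p (fun a b => f a.+1 b).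
Proof.
elim/poly2_lin_ind: p => [p q hp hq|c p hp|a b].
- by rewrite mulrDr !psumD hp hq.
- by rewrite mulrCA !psumZ hp.
- by rewrite mulrA -exprS !psum_mono.
Qed.
Lemma psumX2 p f : psum (X2 * p) f = psum p (fun a b => f a b.+1).
Proof.
elim/poly2_lin_ind: p => [p q hp hq|c p hp|a b].
- by rewrite mulrDr !psumD hp hq.
- by rewrite mulrCA !psumZ hp.
- by rewrite mulrCA -exprS !psum_mono.
Qed.
Lemma peval_psum p x : peval p x = psum p (fun a b => x.1 ^+ a * x.2 ^+ b).
Proof.
elim/poly2_lin_ind: p => [p q hp hq|c p hp|a b].
- by rewrite pevalD psumD hp hq.
- by rewrite pevalM pevalC psumZ hp.
- by rewrite psum_mono !pevalE.
Qed.

(** The Fischer product [(p(d) q)(0)] in coefficient form, where symmetry and positivity are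
    visible; [fpair_pder] gives the differential form. *)
Definition fpair p q : R := psum p (fun a b => a`!%:R * b`!%:R * pcoef q a b).

(** A sum of squares with the positive weights [a! b!]. This definiteness is what finally turns
    equal pairings into equal polynomials. *)
Lemma fpair_def p : fpair p p = 0 -> p = 0.
Proof.
have [N hN] := pcoef_eq0 p; rewrite /fpair (psum_widen _ hN) => h.
have pos a b : 0 <= pcoef p a b * (a`!%:R * b`!%:R * pcoef p a b).
  rewrite mulrCA; apply: mulr_ge0; first by rewrite mulr_ge0.
  by rewrite -expr2 sqr_ge0.
apply: pcoef_inj => a b; rewrite pcoef0.
have [hab|hab] := boolP ((N <= a)%N || (N <= b)%N); first exact: hN.
move: hab; rewrite negb_or -!ltnNge => /andP[ha hb].
move/eqP: h; rewrite psumr_eq0; last by move=> j _; apply: sumr_ge0.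
move=> /allP /(_ (Ordinal hb) (mem_index_enum _)) /=.
rewrite psumr_eq0 // => /allP /(_ (Ordinal ha) (mem_index_enum _)) /=.
rewrite mulf_eq0 => /orP[/eqP//|]; rewrite mulf_eq0 => /orP[|/eqP//].
by rewrite mulf_eq0 !pnatr_eq0 !gtn_eqF ?fact_gt0.
Qed.
Lemma fpairC p q : fpair p q = fpair q p.
Proof.
have [N hN] := pcoef_eq0 p; have [M hM] := pcoef_eq0 q.
set K := maxn N M.
have hp a b : (K <= a)%N || (K <= b)%N -> pcoef p a b = 0.
  by rewrite !geq_max => /orP[]/andP[h _]; apply: hN; rewrite h ?orbT.
have hq a b : (K <= a)%N || (K <= b)%N -> pcoef q a b = 0.
  by rewrite !geq_max => /orP[]/andP[_ h]; apply: hM; rewrite h ?orbT.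
rewrite /fpair (psum_widen _ hp) (psum_widen _ hq).
by apply: eq_bigr => b _; apply: eq_bigr => a _; ring.
Qed.
Lemma fpairDl p q r : fpair (p + q) r = fpair p r + fpair q r.
Proof. exact: psumD. Qed.
Lemma fpairZl c p r : fpair (CC c * p) r = c * fpair p r.
Proof. exact: psumZ. Qed.
Lemma fpairDr p q r : fpair r (p + q) = fpair r p + fpair r q.
Proof. by rewrite !(fpairC r) fpairDl. Qed.
Lemma fpairZr c p r : fpair r (CC c * p) = c * fpair r p.
Proof. by rewrite !(fpairC r) fpairZl. Qed.
Lemma fpair0r r : fpair r 0 = 0.
Proof. by rewrite fpairC /fpair psum0. Qed.
Lemma fpair_sumr (I : Type) (s : seq I) (P : pred I) (F : I -> P2) r :
  fpair r (\sum_(i <- s | P i) F i) = \sum_(i <- s | P i) fpair r (F i).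
Proof. by elim/big_rec2: _ => [|i u v _ <-]; rewrite ?fpair0r ?fpairDr. Qed.

Lemma fpair_pder p q : fpair p q =
  psum p (fun a b => peval (iter a (pder ord0) (iter b (pder ord_max) q)) (0, 0)).
Proof.
have h00 (r : P2) : peval r (0, 0) = pcoef r 0 0.
  by rewrite /peval /pcoef !horner_coef0.
apply: eq_psum => a b _; rewrite h00.
have h1 c (r : P2) : pcoef (iter b (pder ord_max) r) c 0 = b`!%:R * pcoef r c b.
  elim: b c r => [|b IH] c r; first by rewrite fact0 mul1r.
  by rewrite iterSr IH pcoef_pder1 factS natrM; ring.
have h2 (r : P2) : pcoef (iter a (pder ord0) r) 0 0 = a`!%:R * pcoef r a 0.
  elim: a r => [|a IH] r; first by rewrite fact0 mul1r.
  by rewrite iterSr IH pcoef_pder0 factS natrM; ring.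
by rewrite h2 h1 mulrA.
Qed.

Lemma homogP n p : homog n p <-> forall t x, peval p (t * x.1, t * x.2) = t ^+ n * peval p x.
Proof.
split=> [h t x|h a b hab].
  rewrite !peval_psum -psum_fZ; apply: eq_psum => a b hab /=.
  have /eqP <- : (a + b == n)%N by apply: contraNT hab => /h ->.
  by rewrite !exprMn exprD; ring.
have h' c : c ^+ (a + b) * pcoef p a b = c ^+ n * pcoef p a b.
  have [P [hP1 hP2]] : exists P : P2, (forall x, peval P x = peval p (c * x.1, c * x.2)) /\
      forall a b, pcoef P a b = c ^+ (a + b) * pcoef p a b.
    elim/poly2_lin_ind: (p) => [q r [Q [h1 h2]] [S [h3 h4]]|d q [Q [h1 h2]]|a' b'].
    - exists (Q + S); split=> [x|i j]; first by rewrite !pevalD h1 h3.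
      by rewrite !pcoefD h2 h4 mulrDr.
    - exists (CC d * Q); split=> [x|i j]; first by rewrite !pevalE h1.
      by rewrite !pcoefZ h2 mulrCA.
    - exists (CC (c ^+ (a' + b')) * (X1 ^+ a' * X2 ^+ b')); split=> [x|i j].
        by rewrite !pevalE !exprMn exprD; ring.
      rewrite pcoefZ pcoef_mono; case: eqP => [->|_]; case: eqP => [->|_] //=; by rewrite !mulr0.
  rewrite -hP2 -pcoefZ; congr pcoef; apply: peval_inj => x.
  by rewrite hP1 h !pevalE.
apply/eqP; apply: contraT => hp.
(* A single dilation suffices: by 2, whose powers are distinct. *)
have /(mulIf hp) /eqP := h' 2.
by rewrite -!natrX eqr_nat eqn_exp2l // (negbTE hab).
Qed.
End BivariatePolynomials.

(** * Substitution of polynomials for the two variables, and the chain rule *)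

Section LinearSubstitution.
Variable R : realType.
Local Notation P2 := {poly {poly R}}.
Implicit Types (p q : P2) (x : R * R).

Definition lcomp (A B p : P2) : P2 :=
  \sum_(b < size p) \sum_(a < size p`_b) CC (pcoef p a b) * (A ^+ a * B ^+ b).

Lemma peval_lcomp A B p x : peval (lcomp A B p) x = peval p (peval A x, peval B x).
Proof.
rewrite /lcomp peval_sum [RHS]peval_psum; apply: eq_bigr => b _.
by rewrite peval_sum; apply: eq_bigr => a _; rewrite !pevalE.
Qed.
Lemma lcompC A B c : lcomp A B (CC c) = CC c.
Proof. by apply: peval_inj => x; rewrite peval_lcomp !pevalE. Qed.
Lemma lcompD A B p q : lcomp A B (p + q) = lcomp A B p + lcomp A B q.
Proof. by apply: peval_inj => x; rewrite !(peval_lcomp, pevalE). Qed.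
Lemma lcompM A B p q : lcomp A B (p * q) = lcomp A B p * lcomp A B q.
Proof. by apply: peval_inj => x; rewrite !(peval_lcomp, pevalE). Qed.
Lemma lcompX1 A B : lcomp A B (@X1 R) = A.
Proof. by apply: peval_inj => x; rewrite !(peval_lcomp, pevalE). Qed.
Lemma lcompX2 A B : lcomp A B (@X2 R) = B.
Proof. by apply: peval_inj => x; rewrite !(peval_lcomp, pevalE). Qed.
Lemma pder_lcomp i A B p : pder i (lcomp A B p) =
  lcomp A B (pder ord0 p) * pder i A + lcomp A B (pder ord_max p) * pder i B.
Proof.
elim/poly2_ind: p => [c|||p q hp hq|p q hp hq].
- by rewrite lcompC !pderC -CC0 lcompC CC0 !mul0r addr0.
- by rewrite lcompX1 !pder_X1 !lcompC CC1 CC0 mul1r mul0r addr0.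
- by rewrite lcompX2 !pder_X2 !lcompC CC1 CC0 mul1r mul0r add0r.
- by rewrite !(lcompD, pderD) hp hq; ring.
- by rewrite !(lcompM, lcompD, pderD, pderM) hp hq; ring.
Qed.
End LinearSubstitution.

(** * The dihedral reflections and Dunkl operators on polynomials *)

Section Reflections.
Variables (R : realType) (k : nat).
Hypothesis k0 : (0 < k)%N.
Local Notation P2 := {poly {poly R}}.
Implicit Types (p q f : P2) (x : R * R).
Local Notation ra j := (@rootI R k j).
Local Notation rf j := (@reflI R k j).

Let kR : (k%:R : R) != 0. Proof. by rewrite pnatr_eq0 -lt0n. Qed.

Lemma cos_ang_half j : cos (ang R k j) = 1 - 2 * (ra j).1 ^+ 2.
Proof.
have {1}-> : ang R k j = ang R k j / 2 + ang R k j / 2 by field.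
by rewrite cosD /=; have := cos2Dsin2 (ang R k j / 2); lra.
Qed.
Lemma cos_ang_half' j : cos (ang R k j) = 2 * (ra j).2 ^+ 2 - 1.
Proof.
by rewrite cos_ang_half /=; have := cos2Dsin2 (ang R k j / 2); lra.
Qed.
Lemma sin_ang_half j : sin (ang R k j) = - 2 * (ra j).1 * (ra j).2.
Proof.
have {1}-> : ang R k j = ang R k j / 2 + ang R k j / 2 by field.
by rewrite sinD /=; ring.
Qed.
Lemma rootI_unit j : dotp (ra j) (ra j) = 1.
Proof. by rewrite /dotp /= -[RHS](cos2Dsin2 (ang R k j / 2)); ring. Qed.
Lemma rootI_unit' j : (ra j).1 ^+ 2 + (ra j).2 ^+ 2 = 1.
Proof. by rewrite -(rootI_unit j) /dotp; ring. Qed.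
Lemma reflIE j x : rf j x = (x.1 - 2 * dotp (ra j) x * (ra j).1, x.2 - 2 * dotp (ra j) x * (ra j).2).
Proof.
rewrite {1}/reflI {1}cos_ang_half cos_ang_half' sin_ang_half /dotp; congr pair; first by ring.
by have := rootI_unit' j; set a := (ra j).1; set b := (ra j).2 => h; ring: h.
Qed.
Lemma reflIK j x : rf j (rf j x) = x.
Proof.
have h := cos2Dsin2 (ang R k j); case: x => a b; rewrite /reflI /=.
by congr pair; rewrite -[RHS]mulr1 -h; ring.
Qed.

Lemma ang_add2k j : ang R k (j + 2 * k) = ang R k j + pi *+ 2.
Proof. by rewrite /ang natrD natrM mulr2n; field. Qed.
Lemma reflI_add2k j x : rf (j + 2 * k)%N x = rf j x.
Proof. by rewrite /reflI ang_add2k sinD2pi cosD2pi. Qed.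
(** Indices of reflections are read modulo [2 k]. Over a full period the root changes sign, which a
    Dunkl term does not see because it contains the root in the numerator and in the denominator. *)
Lemma rootI_add2k j : ra (j + 2 * k)%N = (- (ra j).1, - (ra j).2).
Proof.
rewrite /rootI ang_add2k mulrDl (_ : pi *+ 2 / 2 = pi); last by rewrite mulr2n; field.
by rewrite sinDpi cosDpi opprK.
Qed.
Lemma reflI_dotp m x y : dotp (rf m x) y = dotp x (rf m y).
Proof. by rewrite /dotp /reflI /=; ring. Qed.
(** Conjugation by the reflection [m] takes the reflection [j] to the one of index [2 m - j]; the
    added [2 k] keeps the subtraction of naturals from being truncated and leaves the parity of the
    index unchanged. *)
Lemma ang_reidx m j : (j <= 2 * m + 2 * k)%N ->
  ang R k (2 * m + 2 * k - j) = ang R k m + ang R k m + pi *+ 2 - ang R k j.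
Proof. by move=> h; rewrite /ang natrB // (natrD _ (2 * m)) !(natrM _ 2) mulr2n; field. Qed.
Lemma rootI_reidx m j : (j <= 2 * m + 2 * k)%N -> ra (2 * m + 2 * k - j)%N = rf m (ra j).
Proof.
move=> h; rewrite /rootI /reflI /= ang_reidx //.
have -> : (ang R k m + ang R k m + pi *+ 2 - ang R k j) / 2 = ang R k m - ang R k j / 2 + pi.
  by rewrite mulr2n; field.
by rewrite sinDpi cosDpi opprK cosB sinB; congr pair; ring.
Qed.
Lemma reflI_reidx m j x : (j <= 2 * m + 2 * k)%N ->
  rf (2 * m + 2 * k - j)%N (rf m x) = rf m (rf j x).
Proof.
move=> h; rewrite /reflI /= ang_reidx //.
set A := ang R k m; set B := ang R k j.
have -> : A + A + pi *+ 2 - B = (A - B) + A + pi *+ 2 by ring.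
rewrite sinD2pi cosD2pi (cosD (A - B)) (sinD (A - B)) cosB sinB.
have hA := cos2Dsin2 A; case: x => a b /=.
by congr pair; rewrite -[RHS]mul1r -hA; ring.
Qed.
Lemma sum_reidx m (G : nat -> R) : (m < 2 * k)%N -> (forall j, G (j + 2 * k)%N = G j) ->
  \sum_(j < 2 * k) G j = \sum_(j < 2 * k) G (2 * m + 2 * k - j)%N.
Proof.
move=> hm hG; set n := (2 * k)%N in hm hG *.
have n0 : (0 < n)%N by rewrite muln_gt0.
have Gmod j : G (j %% n)%N = G j.
  rewrite [in RHS](divn_eq j n) addnC; elim: (j %/ n)%N => [|q IH]; first by rewrite mul0n addn0.
  by rewrite mulSn addnCA addnC hG.
pose f (j : 'I_n) := Ordinal (ltn_pmod (2 * m + n - j) n0).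
have finj : injective f.
  move=> i j /(congr1 val) /= h; apply: val_inj => /=.
  have : ((2 * m + n - i) + (i + j) = (2 * m + n - j) + (i + j) %[mod n])%N.
    by rewrite -modnDml h modnDml.
  have le (a : 'I_n) : (a <= 2 * m + n)%N by apply: leq_trans (ltnW (ltn_ord a)) (leq_addl _ _).
  rewrite addnA subnK // (addnC i) addnA subnK //.
  move/eqP; rewrite eqn_modDl !modn_small // => /eqP //.
rewrite (reindex_inj finj) /=; apply: eq_bigr => j _; exact: Gmod.
Qed.

Definition reflP j p : P2 :=
  lcomp (CC (cos (ang R k j)) * X1 R + CC (sin (ang R k j)) * X2 R)
        (CC (sin (ang R k j)) * X1 R - CC (cos (ang R k j)) * X2 R) p.
Lemma peval_reflP j p x : peval (reflP j p) x = peval p (rf j x).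
Proof.
rewrite /reflP peval_lcomp !pevalE /reflI; congr peval; congr pair; ring.
Qed.

Definition offm x := forall j, (j < 2 * k)%N -> dotp (ra j) x != 0.

(** Multiplication by the product [L] of all root forms makes both sides vanish on the mirrors. [L]
    is not zero, each factor having value 1 at its own root, and can be cancelled. *)
Lemma peval_inj_offm p q : (forall x, offm x -> peval p x = peval q x) -> p = q.
Proof.
move=> h; set L : P2 := \prod_(j < 2 * k) (CC (ra j).1 * X1 R + CC (ra j).2 * X2 R).
have hL x : peval L x = \prod_(j < 2 * k) dotp (ra j) x.
  by rewrite peval_prod; apply: eq_bigr => j _; rewrite !pevalE.
have L0 : L != 0.
  apply/prodf_neq0 => j _; apply/eqP => e.
  have := congr1 (fun p => peval p (ra j)) e; rewrite /= !pevalE => e'.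
  by have := rootI_unit j; rewrite /dotp e' => /eqP; rewrite eq_sym oner_eq0.
apply: (mulfI L0); apply: peval_inj => x; rewrite !pevalM hL.
have [/prodf_neq0 hx|/negPn/eqP ->] := boolP (\prod_(j < 2 * k) dotp (ra j) x != 0).
  by rewrite h // => j hj; exact: (hx (Ordinal hj)).
by rewrite !mul0r.
Qed.

Lemma offm_all x : offm x -> forall j, dotp (ra j) x != 0.
Proof.
move=> hx j; rewrite (divn_eq j (2 * k)) addnC; elim: (j %/ _)%N => [|q IH].
  by rewrite mul0n addn0; apply: hx; rewrite ltn_pmod // muln_gt0.
rewrite mulSn addnCA addnC rootI_add2k; move: IH; set u := ra _; rewrite /dotp /= !mulNr -opprD.
by rewrite oppr_eq0.
Qed.
Lemma offm_reflI m x : (m < 2 * k)%N -> offm x -> offm (rf m x).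
Proof.
move=> hm hx j hj; rewrite -reflI_dotp -rootI_reidx; first exact: offm_all.
by apply: leq_trans (ltnW hj) (leq_addl _ _).
Qed.

Lemma reflPC j c : reflP j (CC c) = CC c. Proof. exact: lcompC. Qed.
Lemma reflPD j p q : reflP j (p + q) = reflP j p + reflP j q. Proof. exact: lcompD. Qed.
Lemma reflPM j p q : reflP j (p * q) = reflP j p * reflP j q. Proof. exact: lcompM. Qed.

Definition rmx j (l i : 'I_2) : R :=
  if l == ord0 then (if i == ord0 then cos (ang R k j) else sin (ang R k j))
  else (if i == ord0 then sin (ang R k j) else - cos (ang R k j)).
Lemma pder_reflP i j p : pder i (reflP j p) =
  CC (rmx j ord0 i) * reflP j (pder ord0 p) + CC (rmx j ord_max i) * reflP j (pder ord_max p).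
Proof.
rewrite /reflP pder_lcomp pderB pderD !pderZ !pder_X1 !pder_X2 -!CCM -CCN -!CCD.
rewrite !(mulrC (lcomp _ _ _)) /rmx /=; case: (i == ord0) => /=;
by rewrite !(mulr1, mulr0, addr0, add0r, subr0, sub0r).
Qed.

Definition cmp (i : 'I_2) (x : R * R) : R := if i == ord0 then x.1 else x.2.
Definition Xc (i : 'I_2) : P2 := if i == ord0 then X1 R else X2 R.
Lemma dotp_evec a i : dotp a (evec R i) = cmp i a.
Proof. by rewrite /dotp /evec /cmp; case: ifP => _ /=; rewrite !(mulr1, mulr0, addr0, add0r). Qed.
Lemma peval_Xc i x : peval (Xc i) x = cmp i x.
Proof. by rewrite /Xc /cmp; case: ifP; rewrite ?pevalX1 ?pevalX2. Qed.
Lemma I2P (i : 'I_2) : i = ord0 \/ i = ord_max.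
Proof. by case: i => [[|[|//]] h]; [left|right]; apply: val_inj. Qed.
Lemma pder_Xc i l : pder l (Xc i) = CC (l == i)%:R.
Proof.
by rewrite /Xc; case: (I2P i) => -> /=; rewrite ?pder_X1 ?pder_X2 //; case: (I2P l) => ->.
Qed.
Lemma cmp_reflI j i x : cmp i (rf j x) = cmp i x - 2 * dotp (ra j) x * cmp i (ra j).
Proof. by rewrite reflIE /cmp; case: ifP. Qed.
Lemma rmx_root j i : rmx j i ord0 * (ra j).1 + rmx j i ord_max * (ra j).2 = - cmp i (ra j).
Proof.
have h := rootI_unit' j; have e1 := cos_ang_half j; have e2 := cos_ang_half' j.
have e3 := sin_ang_half j; rewrite /rmx /cmp.
move: h e1 e2 e3; set a := (ra j).1; set b := (ra j).2 => h e1 e2 e3.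
case: (I2P i) => -> /=; rewrite e3.
  transitivity (a - 2 * a * (a ^+ 2 + b ^+ 2)); first by rewrite e1; ring.
  by rewrite h; ring.
transitivity (b - 2 * b * (a ^+ 2 + b ^+ 2)); first by rewrite e2; ring.
by rewrite h; ring.
Qed.

Section DunklPolynomial.
Variables (al be : R) (T : 'I_2 -> P2 -> P2).
Hypothesis HT : forall i f x, offm x -> peval (T i f) x = dunkl k al be i f x.
Local Notation ka j := (kappa al be j).

Lemma kappa_add2k j : ka (j + 2 * k)%N = ka j.
Proof. by rewrite /kappa oddD oddM andFb addbF. Qed.
Lemma kappa_reidx m j : (j <= 2 * m + 2 * k)%N -> ka (2 * m + 2 * k - j)%N = ka j.
Proof. by move=> h; rewrite /kappa oddB // oddD !oddM /= . Qed.

Lemma dunklE i f x : dunkl k al be i f x = peval (pder i f) x +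
  \sum_(j < 2 * k) ka j * cmp i (ra j) * (peval f x - peval f (rf j x)) / dotp (ra j) x.
Proof. by rewrite /dunkl; congr (_ + _); apply: eq_bigr => j _; rewrite dotp_evec. Qed.

Lemma T_D i f g : T i (f + g) = T i f + T i g.
Proof.
apply: peval_inj_offm => x hx; rewrite pevalD !HT // !dunklE pderD pevalD addrACA -big_split /=.
by congr (_ + _); apply: eq_bigr => j _; rewrite !pevalD; ring.
Qed.
Lemma T_Z i c f : T i (CC c * f) = CC c * T i f.
Proof.
apply: peval_inj_offm => x hx; rewrite pevalM pevalC !HT // !dunklE pderZ mulrDr mulr_sumr.
by rewrite !pevalE; congr (_ + _); apply: eq_bigr => j _; rewrite !pevalE; ring.
Qed.
Lemma T_0 i : T i 0 = 0.
Proof. by have := T_Z i 0 0; rewrite CC0 !mul0r. Qed.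
Lemma T_sum i (I : Type) (r : seq I) (P : pred I) (F : I -> P2) :
  T i (\sum_(j <- r | P j) F j) = \sum_(j <- r | P j) T i (F j).
Proof. by apply: (big_morph (T i) (T_D i) (T_0 i)). Qed.

(** The reflection [m] permutes the difference terms through [j -> 2 m - j]. As the parity of [j] is
    kept, so is the multiplicity [kappa], and the operators transform like the coordinates of a
    vector. *)
Lemma T_reflP m i f : (m < 2 * k)%N -> T i (reflP m f) =
  CC (rmx m ord0 i) * reflP m (T ord0 f) + CC (rmx m ord_max i) * reflP m (T ord_max f).
Proof.
move=> hm; apply: peval_inj_offm => x hx; have hx' := offm_reflI hm hx.
rewrite HT // !pevalE !peval_reflP !HT // !dunklE pder_reflP !pevalE !peval_reflP.
rewrite !mulrDr addrACA; congr (_ + _).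
rewrite !mulr_sumr -big_split /=.
pose G j := rmx m ord0 i * (ka j * cmp ord0 (ra j) * (peval f (rf m x) - peval f (rf j (rf m x))) / dotp (ra j) (rf m x)) +
  rmx m ord_max i * (ka j * cmp ord_max (ra j) * (peval f (rf m x) - peval f (rf j (rf m x))) / dotp (ra j) (rf m x)).
rewrite [RHS](sum_reidx (G := G) hm); last first.
  move=> j; rewrite /G kappa_add2k reflI_add2k rootI_add2k.
  have h0 : dotp (ra j) (rf m x) != 0 by exact: offm_all.
  have -> : dotp (- (ra j).1, - (ra j).2) (rf m x) = - dotp (ra j) (rf m x) by rewrite /dotp /=; ring.
  by rewrite /cmp /=; field.
apply: eq_bigr => j _.
have hj : (j <= 2 * m + 2 * k)%N by apply: leq_trans (ltnW (ltn_ord j)) (leq_addl _ _).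
rewrite /G kappa_reidx // reflI_reidx // rootI_reidx // reflI_dotp reflIK !peval_reflP /rmx /cmp /reflI /=.
have h0 : dotp (ra j) x != 0 by exact: offm_all.
have h1 := cos2Dsin2 (ang R k m).
set c := cos (ang R k m) in h1 *; set s := sin (ang R k m) in h1 *; set a := ra j in h0 *.
case: (i == ord0).
  by rewrite -[LHS]mul1r -h1; field.
by rewrite -[LHS]mul1r -h1; field.
Qed.

(** The extra reflection terms come from [(s x)_i = x_i - 2 <a, x> a_i]: its factor [<a, x>] cancels
    the denominator of the difference quotient. *)
Lemma T_Xc l i f : T l (Xc i * f) = Xc i * T l f + CC (l == i)%:R * f +
  \sum_(j < 2 * k) CC (2 * ka j * cmp l (ra j) * cmp i (ra j)) * reflP j f.
Proof.
apply: peval_inj_offm => x hx; rewrite HT // !pevalE HT // !dunklE pderM pder_Xc peval_sum !pevalE.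
set S1 := (X in _ + X = _); set S2 := (X in _ * (_ + X)); set S3 := (X in _ = _ + X).
have -> : S1 = peval (Xc i) x * S2 + S3; last by ring.
rewrite /S2 mulr_sumr -big_split /=; apply: eq_bigr => j _.
rewrite !pevalE peval_reflP !peval_Xc cmp_reflI.
have h0 : dotp (ra j) x != 0 by exact: offm_all.
by field.
Qed.

(** The factor one half makes the commutator with [x_i] equal to [T_i] itself. *)
Definition Hop f : P2 := CC 2^-1 * (T ord0 (T ord0 f) + T ord_max (T ord_max f)).

Lemma Hop_D f g : Hop (f + g) = Hop f + Hop g.
Proof. by rewrite /Hop !T_D; ring. Qed.
Lemma Hop_Z c f : Hop (CC c * f) = CC c * Hop f.
Proof. by rewrite /Hop !T_Z; ring. Qed.

(* [\sum_l a_l T_l] anticommutes with the reflection of root [a], so the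
   reflection terms of [T_l x_i] cancel in the commutator with the Laplacian. *)
Lemma Hop_Xc i f : Hop (Xc i * f) = Xc i * Hop f + T i f.
Proof.
have key (l : 'I_2) : T l (T l (Xc i * f)) = Xc i * T l (T l f) + 2 * (CC (l == i)%:R * T l f) +
    \sum_(j < 2 * k) CC (2 * ka j * cmp i (ra j)) *
      (CC (cmp l (ra j)) * (reflP j (T l f) + T l (reflP j f))).
  rewrite T_Xc !T_D T_Xc T_Z T_sum.
  set S1 := \sum_(j < _) _; set S2 := \sum_(j < _) _; set S3 := \sum_(j < _) _.
  have -> : S3 = S1 + S2; last by ring.
  rewrite -big_split /=; apply: eq_bigr => j _; rewrite T_Z !CCM; ring.
rewrite /Hop !key; set S1 := \sum_(j < _) _; set S2 := \sum_(j < _) _.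
have e : S1 + S2 = 0.
  rewrite -big_split /= big1 // => j _; rewrite -mulrDr !T_reflP // ?ltn_ord //.
  have h l : CC (rmx j l ord0) * CC (ra j).1 + CC (rmx j l ord_max) * CC (ra j).2 = - CC (cmp l (ra j)).
    by rewrite -!CCM -CCD -CCN rmx_root.
  have -> : CC (cmp ord0 (ra j)) = CC (ra j).1 by [].
  have -> : CC (cmp ord_max (ra j)) = CC (ra j).2 by [].
  have := h ord0; have := h ord_max; rewrite /cmp /=.
  set u := CC (ra j).1; set v := CC (ra j).2 => h1 h0.
  set A := reflP j (T ord0 f); set B := reflP j (T ord_max f).
  apply/eqP; rewrite mulf_eq0; apply/orP; right; apply/eqP.
  transitivity ((CC (rmx j ord0 ord0) * u + CC (rmx j ord0 ord_max) * v + u) * A +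
    (CC (rmx j ord_max ord0) * u + CC (rmx j ord_max ord_max) * v + v) * B); first by ring.
  by rewrite h1 h0; ring.
have -> : T i f = CC (ord0 == i)%:R * T ord0 f + CC (ord_max == i)%:R * T ord_max f.
  by case: (I2P i) => -> /=; rewrite CC1 CC0 !(mul1r, mul0r, addr0, add0r).
have e2 : CC 2^-1 * 2 = 1 :> P2 by rewrite -(CCnat R 2) -CCM mulVf ?CC1 // pnatr_eq0.
transitivity (Xc i * (CC 2^-1 * (T ord0 (T ord0 f) + T ord_max (T ord_max f))) +
  (CC 2^-1 * 2) * (CC (ord0 == i)%:R * T ord0 f + CC (ord_max == i)%:R * T ord_max f) +
  CC 2^-1 * (S1 + S2)); first by ring.
by rewrite e e2; ring.
Qed.

Definition dinv f := forall j, (j < 2 * k)%N -> forall x, peval f (rf j x) = peval f x.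

Lemma T_dinv i f : dinv f -> T i f = pder i f.
Proof.
move=> hf; apply: peval_inj_offm => x hx; rewrite HT // dunklE big1 ?addr0 // => j _.
by rewrite hf // subrr mulr0 mul0r.
Qed.
(** The gradient of an invariant is equivariant rather than invariant: under the reflection of root
    [a] it changes by [2 <a, grad f> a]. The second Dunkl operator therefore leaves a first-order
    term and no difference quotient. *)
Lemma Hop_dinv f x : dinv f -> offm x -> peval (Hop f) x =
  2^-1 * (peval (pder ord0 (pder ord0 f)) x + peval (pder ord_max (pder ord_max f)) x) +
  \sum_(j < 2 * k) ka j * ((ra j).1 * peval (pder ord0 f) x + (ra j).2 * peval (pder ord_max f) x)
     / dotp (ra j) x.
Proof.
move=> hf hx; rewrite /Hop !(T_dinv _ hf) !pevalE !HT // !dunklE.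
have hr i j : (j < 2 * k)%N -> peval (pder i f) (rf j x) = rmx j ord0 i * peval (pder ord0 f) x
    + rmx j ord_max i * peval (pder ord_max f) x.
  move=> hj; have e : reflP j f = f by apply: peval_inj => y; rewrite peval_reflP hf.
  rewrite -[in LHS]e pder_reflP !pevalE !peval_reflP reflIK //.
rewrite addrACA mulrDr -big_split mulr_sumr; congr (_ + _); apply: eq_bigr => j _ /=.
have hj := ltn_ord j; rewrite !hr // /rmx /cmp /=.
have h0 : dotp (ra j) x != 0 by exact: offm_all.
have h := rootI_unit' j; rewrite sin_ang_half cos_ang_half'.
move: h h0; rewrite /=; set a := - sin _; set b := cos (_ / 2) => h h0.
have ha : a ^+ 2 = 1 - b ^+ 2 by rewrite -h addrK.
set F := peval _ x; set G := peval _ x; set d := dotp _ _ in h0 *.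
set K := ka j.
transitivity (K * ((a * 2 - 2 * a * b ^+ 2 + 2 * a * b ^+2) * F + 2 * b * G) / (2 * d)).
  transitivity (K * ((2 * a - 2 * a * b ^+ 2 + 2 * a * b ^+2) * F + (2 * a ^+ 2 * b + 2 * b - 2 * b * (1 - b ^+2)) * G) / (2 * d)).
    by rewrite /=; field.
  by rewrite ha; field.
by field.
Qed.
End DunklPolynomial.
End Reflections.

(** * The intertwiner, and the pairing computed by iterated commutators *)

Section Intertwiner.
Variables (R : realType) (k : nat) (al be : R).
Hypothesis k0 : (0 < k)%N.
Local Notation P2 := {poly {poly R}}.
Implicit Types (p q f : P2) (x : R * R).
Variables (V g : P2 -> P2).
Hypothesis VP : dunkl_intertwiner k al be V.
Hypotheses (VK : cancel V g) (gK : cancel g V).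

(** The intertwining relation makes [V d_i V^-1] agree with the Dunkl operator off the mirrors.
    Defined in this way, the operators take polynomials to polynomials and commute with each other
    because derivatives do. *)
Definition Top (i : 'I_2) f : P2 := V (pder i (g f)).

Lemma Top_dunkl i f x : offm k x -> peval (Top i f) x = dunkl k al be i f x.
Proof.
by move=> hx; case: VP => _ _ _ _ h; rewrite /Top -h // gK.
Qed.
Lemma V_D p q : V (p + q) = V p + V q.
Proof. by case: VP => h _ _ _ _; have := h 1 p q; rewrite !mul1r. Qed.
Lemma V_0 : V 0 = 0.
Proof. by apply: (addrI (V 0)); rewrite -V_D !addr0. Qed.
Lemma V_Z c p : V (CC c * p) = CC c * V p.
Proof. by case: VP => h _ _ _ _; have := h c p 0; rewrite V_0 !addr0. Qed.
Lemma V_C c : V (CC c) = CC c.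
Proof. by rewrite -[CC c]mulr1 V_Z; case: VP => _ _ -> _ _. Qed.

Lemma homog_mono a b : homog (a + b) (X1 R ^+ a * X2 R ^+ b).
Proof. by apply/homogP => t x; rewrite !pevalE /= !exprMn exprD; ring. Qed.

(** [V] fixes constants and keeps degrees, and homogeneous polynomials of positive degree vanish at
    the origin. *)
Lemma V_at0 p : peval (V p) (0, 0) = peval p (0, 0).
Proof.
elim/poly2_lin_ind: p => [p q hp hq|c p hp|a b].
- by rewrite V_D !pevalD hp hq.
- by rewrite V_Z !pevalM hp !pevalC.
have [e|ne] := eqVneq (a + b)%N 0%N.
  have /andP[/eqP-> /eqP->] : (a == 0%N) && (b == 0%N) by rewrite -addn_eq0 e.
  by rewrite !expr0 mulr1 -CC1 V_C.
have h q : homog (a + b) q -> peval q (0, 0) = 0.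
  by move/homogP => /(_ 0 (0, 0)); rewrite /= !mul0r expr0n (negbTE ne) mul0r.
case: VP => _ _ _ hV _; rewrite !h //; first exact: homog_mono.
by apply: hV; exact: homog_mono.
Qed.

Lemma pder_eq0 p : (forall i, pder i p = 0) -> exists c, p = CC c.
Proof.
move=> h; exists (pcoef p 0 0); apply: pcoef_inj => a b.
have -> : CC (pcoef p 0 0) = CC (pcoef p 0 0) * (X1 R ^+ 0 * X2 R ^+ 0) by rewrite !expr0 !mulr1.
rewrite pcoefZ pcoef_mono; case: a => [|a] /=; last first.
  have := pcoef_pder0 p a b; rewrite h pcoef0 mulr0 => /esym/eqP.
  by rewrite mulf_eq0 pnatr_eq0 => /eqP.
case: b => [|b] /=; first by rewrite mulr1.
have := pcoef_pder1 p 0 b; rewrite h pcoef0 mulr0 => /esym/eqP.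
by rewrite mulf_eq0 pnatr_eq0 => /eqP.
Qed.

Lemma Top_eq0 f : (forall i, Top i f = 0) -> exists c, f = CC c.
Proof.
move=> h; have [c hc] : exists c, g f = CC c.
  by apply: pder_eq0 => i; apply: (can_inj VK); rewrite V_0; exact: h.
by exists c; rewrite -V_C -hc gK.
Qed.
Lemma Top_V i p : Top i (V p) = V (pder i p).
Proof. by rewrite /Top VK. Qed.
Lemma Top_comm i j f : Top i (Top j f) = Top j (Top i f).
Proof. by rewrite /Top !VK pderC_comm. Qed.

Local Notation TD := (T_D Top_dunkl).
Local Notation TZ := (T_Z Top_dunkl).
Local Notation H := (Hop Top).
Local Notation HD := (Hop_D Top_dunkl).
Local Notation HZ := (Hop_Z Top_dunkl).

(** By induction on the degree both sides have the same images under [T_1] and [T_2], so they differ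
    by a constant, which is read off at the origin. The consequence needed later is that [V^-1] maps
    invariants to invariants. *)
Lemma V_reflP m p : (m < 2 * k)%N -> V (reflP k m p) = reflP k m (V p).
Proof.
move=> hm; elim/poly2_lin_ind: p => [p q hp hq|c p hp|a b].
- by rewrite !(reflPD, V_D) hp hq.
- by rewrite reflPM reflPC !V_Z reflPM reflPC hp.
have [n] := ubnP (a + b); elim: n a b => // n IH a b hab.
set p := X1 R ^+ a * X2 R ^+ b.
have IHp i : V (reflP k m (pder i p)) = reflP k m (V (pder i p)).
  rewrite /p; case: (I2P i) => ->; rewrite pderM !pderXn pder_X1 pder_X2 /= CC1 CC0 !(mulr0, mulr1, mul0r, addr0, add0r).
    case: a hab {p} => [|a] hab; first by rewrite !mul0r -CC0 !(reflPC, V_C).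
    by rewrite /= -mulrA -(CCnat R a.+1) reflPM reflPC !V_Z [in RHS]reflPM reflPC IH.
  case: b hab {p} => [|b] hab; first by rewrite mul0r mulr0 -CC0 !(reflPC, V_C).
  by rewrite /= mulrCA -(CCnat R b.+1) reflPM reflPC !V_Z [in RHS]reflPM reflPC IH // -ltnS -addnS.
have TB i f h : Top i (f - h) = Top i f - Top i h.
  have {1}-> : - h = CC (-1) * h by rewrite CCN CC1 mulN1r.
  by rewrite TD TZ CCN CC1 mulN1r.
have [|c hc] := @Top_eq0 (V (reflP k m p) - reflP k m (V p)).
  move=> i; rewrite TB Top_V pder_reflP V_D !V_Z !IHp (T_reflP k0 Top_dunkl) //.
  by rewrite !Top_V subrr.
have : c = 0.
  rewrite -(pevalC c (0, 0)) -hc pevalB V_at0 !peval_reflP.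
  have -> : reflI k m (0, 0) = (0 : R, 0 : R) by rewrite /reflI /= !mul0r subrr addr0.
  by rewrite V_at0 subrr.
by move=> c0; move: hc; rewrite c0 CC0 => /eqP; rewrite subr_eq0 => /eqP.
Qed.

Lemma dinvP f : dinv k f <-> (forall j, (j < 2 * k)%N -> reflP k j f = f).
Proof.
split=> h j hj; first by apply: peval_inj => x; rewrite peval_reflP h.
by move=> x; rewrite -peval_reflP h.
Qed.
Lemma g_dinv p : dinv k p -> dinv k (g p).
Proof. by rewrite !dinvP => h j hj; apply: (can_inj VK); rewrite V_reflP // gK h. Qed.

Definition tpair q f : R :=
  psum q (fun a b => peval (iter a (Top ord0) (iter b (Top ord_max) f)) (0, 0)).
Lemma tpair_V q p : tpair q (V p) = fpair q p.
Proof.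
rewrite fpair_pder; apply: eq_psum => a b _; rewrite -[RHS]V_at0; congr peval.
have h i n r : iter n (Top i) (V r) = V (iter n (pder i) r).
  by elim: n => //= n ->; rewrite Top_V.
by rewrite h h.
Qed.

Lemma Hop_Top i f : H (Top i f) = Top i (H f).
Proof.
by rewrite /Hop TZ TD (Top_comm ord0 i) (Top_comm _ i (Top ord0 f)) (Top_comm ord_max i) (Top_comm _ i (Top ord_max f)).
Qed.
Lemma Top_0 i : Top i 0 = 0.
Proof. exact: (T_0 Top_dunkl i). Qed.
Lemma Hop_0 : H 0 = 0.
Proof. by rewrite /Hop !Top_0 addr0 mulr0. Qed.
Lemma Hop_B f h : H (f - h) = H f - H h.
Proof.
have {1}-> : - h = CC (-1) * h by rewrite CCN CC1 mulN1r.
by rewrite HD HZ CCN CC1 mulN1r.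
Qed.
Lemma iter_Hop_D n f h : iter n H (f + h) = iter n H f + iter n H h.
Proof. by elim: n => //= n ->; rewrite HD. Qed.
Lemma iter_Hop_Z n c f : iter n H (CC c * f) = CC c * iter n H f.
Proof. by elim: n => //= n ->; rewrite HZ. Qed.
Lemma iter_Hop_0 n : iter n H 0 = 0.
Proof. by elim: n => //= n ->; rewrite Hop_0. Qed.
Lemma iter_Hop_B n f h : iter n H (f - h) = iter n H f - iter n H h.
Proof. by elim: n => //= n ->; rewrite Hop_B. Qed.
Lemma iter_Hop_sum n (I : Type) (r : seq I) (P : pred I) (F : I -> P2) :
  iter n H (\sum_(i <- r | P i) F i) = \sum_(i <- r | P i) iter n H (F i).
Proof. exact: (big_morph _ (iter_Hop_D n) (iter_Hop_0 n)). Qed.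

(** The operator [ad(H)^n O], where [ad(H) O = H O - O H]. *)
Fixpoint adn n (O : P2 -> P2) : P2 -> P2 :=
  if n is n'.+1 then fun f => H (adn n' O f) - adn n' O (H f) else O.
Lemma eq_adn n O O' : (forall f, O f = O' f) -> forall f, adn n O f = adn n O' f.
Proof. by move=> h; elim: n => //= n IH f; rewrite !IH. Qed.
Lemma adn_D n O O' f : adn n (fun f => O f + O' f) f = adn n O f + adn n O' f.
Proof. by elim: n f => //= n IH f; rewrite !IH HD; ring. Qed.
Lemma adn_Z n c O f : adn n (fun f => CC c * O f) f = CC c * adn n O f.
Proof. by elim: n f => //= n IH f; rewrite !IH HZ; ring. Qed.
(** Leibniz rule for [ad(H)^n], where only two terms remain: [ad(H)] takes [x_i] to [T_i], and [T_i]
    to 0 since [H] commutes with it. *)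
Lemma adn_Xc n i O f : adn n (fun f => Xc R i * O f) f =
  Xc R i * adn n O f + n%:R * Top i (adn n.-1 O f).
Proof.
elim: n f => [|n IH] f /=; first by rewrite mul0r addr0.
rewrite !IH HD (Hop_Xc k0 Top_dunkl) -!CCnat HZ Hop_Top.
case: n IH => [|n] IH /=; first by rewrite CC0 CC1; ring.
have -> : adn n O (H f) = H (adn n O f) - adn n.+1 O f by rewrite /=; ring.
have TB h h' : Top i (h - h') = Top i h - Top i h'.
  have {1}-> : - h' = CC (-1) * h' by rewrite CCN CC1 mulN1r.
  by rewrite TD TZ CCN CC1 mulN1r.
rewrite TB /= !CCnat -[n.+2%:R]natr1; ring.
Qed.
(** [ad(H)] is a derivation that turns each factor [x_i] into [T_i] once and then kills it. On a
    product of [n] coordinates, [n] applications leave [n!] times the product of the [T_i]. The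
    vanishing at the next order is carried along because the induction uses it. *)
Lemma adn_mono a b f :
  adn (a + b) (fun h => X1 R ^+ a * X2 R ^+ b * h) f =
     (a + b)`!%:R * iter a (Top ord0) (iter b (Top ord_max) f)
  /\ adn (a + b).+1 (fun h => X1 R ^+ a * X2 R ^+ b * h) f = 0.
Proof.
have hs i n O P : (forall f, adn n O f = n`!%:R * P f /\ adn n.+1 O f = 0) ->
   forall f, adn n.+1 (fun h => Xc R i * O h) f = n.+1`!%:R * Top i (P f)
     /\ adn n.+2 (fun h => Xc R i * O h) f = 0.
  move=> h {}f; have h0 : adn n.+2 O f = 0.
    by rewrite -[LHS]/(H (adn n.+1 O f) - adn n.+1 O (H f)) !(proj2 (h _)) Hop_0 subrr.
  split; rewrite adn_Xc.
    rewrite (proj2 (h f)) mulr0 add0r /= (proj1 (h f)) -(CCnat R n`!) TZ CCnat factS natrM.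
    by rewrite mulrA.
  by rewrite h0 (proj2 (h f)) Top_0 !mulr0 addr0.
have hb : forall f, adn b (fun h => X2 R ^+ b * h) f = b`!%:R * iter b (Top ord_max) f
     /\ adn b.+1 (fun h => X2 R ^+ b * h) f = 0.
  elim: b => [|b IH] {}f /=.
    by rewrite mul1r !mul1r subrr.
  have [h1 h2] := hs ord_max b _ _ IH f; split.
    by rewrite -h1; apply: (@eq_adn (b.+1)) => h; rewrite exprS mulrA.
  by rewrite -h2; apply: (@eq_adn (b.+2)) => h; rewrite exprS mulrA.
elim: a f => [|a IH] f /=.
  have [h1 h2] := hb f; split; rewrite add0n.
    by rewrite -h1; apply: eq_adn => h; rewrite mul1r.
  by rewrite -h2; apply: (@eq_adn (b.+1)) => h; rewrite mul1r.
have [h1 h2] := hs ord0 (a + b)%N _ _ IH f; split.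
  by rewrite addSn -h1; apply: (@eq_adn ((a + b).+1)) => h; rewrite exprS !mulrA.
by rewrite -h2; apply: (@eq_adn ((a + b).+2)) => h; rewrite exprS !mulrA.
Qed.

Lemma adn_tpair n q f : homog n q -> peval (adn n (fun h => q * h) f) (0, 0) = n`!%:R * tpair q f.
Proof.
move=> hq; transitivity (psum q (fun a b => peval (adn n (fun h => X1 R ^+ a * X2 R ^+ b * h) f) (0, 0))).
  elim/poly2_lin_ind: q {hq} => [p q hp hq|c p hp|a b].
  - rewrite psumD -hp -hq -pevalD -adn_D; congr peval.
    by apply: eq_adn => h; rewrite mulrDl.
  - rewrite psumZ -hp -{2}(pevalC c (0, 0)) -pevalM -adn_Z; congr peval.
    by apply: eq_adn => h; rewrite mulrA.
  - by rewrite psum_mono.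
rewrite /tpair -psum_fZ; apply: eq_psum => a b hab.
have e : (a + b)%N = n by apply/eqP; apply: contraNT hab => /hq ->.
by rewrite -e (proj1 (adn_mono a b f)) pevalM peval_nat.
Qed.

(** [ad(H)^n O] expands into the terms [H^(n - i) O H^i] with signed binomial coefficients; the
    hypothesis says that at the origin all terms with [i > 0] vanish. *)
Lemma adn_lead n O f m :
  (forall i, (0 < i <= n)%N -> peval (iter (m + n - i) H (O (iter i H f))) (0, 0) = 0) ->
  peval (iter m H (adn n O f)) (0, 0) = peval (iter (m + n) H (O f)) (0, 0).
Proof.
elim: n m f => [|n IH] m f h /=; first by rewrite addn0.
rewrite iter_Hop_B pevalB -iterSr !IH.
- have := h 1%N isT; rewrite addnS subn1 /= => ->.
  by rewrite subr0.
- move=> i /andP[i0 i1]; have := h i.+1; rewrite addnS subSS -iterSr; apply.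
  by rewrite /= ltnS.
- move=> i /andP[i0 i1]; have := h i; rewrite addnS addSn; apply.
  by rewrite i0 leqW.
Qed.
(** The way pairings are computed below: single operators [T_i] leave the invariants, whereas [H]
    and multiplication by an invariant [q] do not. *)
Lemma tpair_lead n q f : homog n q ->
  (forall i, (0 < i <= n)%N -> peval (iter (n - i) H (q * iter i H f)) (0, 0) = 0) ->
  n`!%:R * tpair q f = peval (iter n H (q * f)) (0, 0).
Proof.
by move=> hq h; rewrite -adn_tpair //; apply: (@adn_lead n (fun h => q * h) f 0%N).
Qed.
End Intertwiner.

(** * Points of the unit circle and the factorization of [X^k - Y^k] *)

Section RootsOfUnity.
Variable R : realType.
Implicit Types (t : R) (X Y : R[i]).

Definition cis t : R[i] := Complex (cos t) (sin t).
Lemma cis0 : cis 0 = 1. Proof. by rewrite /cis cos0 sin0. Qed.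
Lemma cisD a b : cis (a + b) = cis a * cis b.
Proof.
rewrite /cis cosD sinD; apply/eqP; rewrite eq_complex /=.
by apply/andP; split=> //; rewrite addrC [X in _ + X]mulrC [cos b * _]mulrC addrC.
Qed.
Lemma cisX t n : cis t ^+ n = cis (n%:R * t).
Proof.
elim: n => [|n IH]; first by rewrite mul0r cis0.
by rewrite exprS IH -cisD -natr1 mulrDl mul1r addrC.
Qed.
Lemma cisV t : cis t * cis (- t) = 1.
Proof. by rewrite -cisD subrr cis0. Qed.
Lemma cisDpi t : cis (t + pi) = - cis t.
Proof. by rewrite /cis cosDpi sinDpi; apply/eqP; rewrite eq_complex /= !eqxx. Qed.
Lemma cis_npi n : cis (n%:R * pi) = (-1) ^+ n.
Proof.
elim: n => [|n IH]; first by rewrite mul0r cis0.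
by rewrite -natr1 mulrDl mul1r cisDpi IH exprS mulN1r.
Qed.
Lemma cis_eq1 t : 0 < t -> t < pi *+ 2 -> cis t <> 1.
Proof.
move=> t0 t1 /eqP; rewrite eq_complex /= => /andP[/eqP hc _].
have hs : 0 < sin (t / 2).
  by apply: sin_gt0_pi; rewrite divr_gt0 //= ltr_pdivrMr // mulr_natr.
have := cosD (t / 2) (t / 2); have -> : t / 2 + t / 2 = t by field.
rewrite hc; have := cos2Dsin2 (t / 2); nra.
Qed.

Lemma prod_cis k X Y : (0 < k)%N ->
  \prod_(m < k) (X - Y * cis (m%:R * (pi *+ 2 / k%:R))) = X ^+ k - Y ^+ k.
Proof.
move=> k0; have kR : (k%:R : R) != 0 by rewrite pnatr_eq0 -lt0n.
have pi2 : 0 < pi *+ 2 :> R by rewrite -mulr_natl mulr_gt0 ?ltr0n ?pi_gt0.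
pose w := cis (pi *+ 2 / k%:R).
have hw : k.-primitive_root w.
  apply/andP; split=> //; apply/forallP => i; rewrite unity_rootE /w cisX.
  have [e|ne] := eqVneq i.+1 k.
    rewrite e mulrC divfK // -mulr_natl cis_npi //.
    by rewrite sqrrN expr1n !eqxx.
  have lt : (i.+1 < k)%N by rewrite ltn_neqAle ne ltn_ord.
  apply/eqP; apply/negbTE/eqP; apply: cis_eq1.
    by rewrite mulr_gt0 ?ltr0n // divr_gt0 ?ltr0n.
  rewrite mulrCA gtr_pMr //.
  by rewrite ltr_pdivrMr ?ltr0n // mul1r ltr_nat.
have [->|Y0] := eqVneq Y 0.
  under eq_bigr do rewrite mul0r subr0.
  by rewrite prodr_const card_ord expr0n gtn_eqF // subr0.
have := congr1 (fun p => p.[X / Y]) (factor_Xn_sub_1 hw).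
rewrite /= hornerD hornerN hornerXn hornerC horner_prod big_mkord => h.
transitivity (Y ^+ k * ((X / Y) ^+ k - 1)); last by rewrite mulrBr mulr1 -exprMn mulrC divfK.
rewrite -h -[in Y ^+ k](card_ord k) -prodr_const -big_split /=; apply: eq_bigr => m _.
by rewrite hornerXsubC mulrBr [Y * (X / Y)]mulrC divfK // /w cisX.
Qed.
End RootsOfUnity.

(** * Real and imaginary parts of [(x1 + i x2)^n] as polynomials *)

Section PlanePowers.
Variable R : realType.
Local Notation P2 := {poly {poly R}}.
Implicit Types (p q f : P2) (x : R * R).
Local Notation X1 := (X1 R).
Local Notation X2 := (X2 R).

Fixpoint zpow (n : nat) : P2 * P2 :=
  if n is n'.+1 then (X1 * (zpow n').1 - X2 * (zpow n').2, X1 * (zpow n').2 + X2 * (zpow n').1)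
  else (1, 0).
Definition zre n := (zpow n).1.
Definition zim n := (zpow n).2.
Definition rho : P2 := X1 ^+ 2 + X2 ^+ 2.

Lemma zreS n : zre n.+1 = X1 * zre n - X2 * zim n. Proof. by []. Qed.
Lemma zimS n : zim n.+1 = X1 * zim n + X2 * zre n. Proof. by []. Qed.
Lemma zre_zim n : zre n ^+ 2 + zim n ^+ 2 = rho ^+ n.
Proof.
elim: n => [|n IH]; first by rewrite /zre /zim /= expr1n expr0n addr0.
by rewrite zreS zimS [in RHS]exprS -IH /rho; ring.
Qed.
Lemma zpow_complex n x :
  Complex (peval (zre n) x) (peval (zim n) x) = Complex x.1 x.2 ^+ n.
Proof.
elim: n => [|n IH]; first by rewrite /zre /zim /= peval1 peval0.
rewrite exprS -IH zreS zimS; apply/eqP; rewrite eq_complex /= !pevalE eqxx /=.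
by apply/eqP; ring.
Qed.
Lemma pder_zpow n :
  [/\ pder ord0 (zre n.+1) = n.+1%:R * zre n, pder ord0 (zim n.+1) = n.+1%:R * zim n,
      pder ord_max (zre n.+1) = - (n.+1%:R * zim n) & pder ord_max (zim n.+1) = n.+1%:R * zre n].
Proof.
elim: n => [|n [h1 h2 h3 h4]].
  rewrite zreS zimS /zre /zim /= !mulr0 !mulr1 subr0 add0r !pder_X1 !pder_X2 /=.
  by split; rewrite ?CC1 ?CC0 ?oppr0 ?mulr0.
rewrite (zreS n.+1) (zimS n.+1).
split; rewrite ?pderB ?pderD !pderM ?h1 ?h2 ?h3 ?h4 ?pder_X1 ?pder_X2 /= ?CC0 ?CC1
 (zreS n) (zimS n) -[n.+2%:R]natr1; ring.
Qed.
Lemma peval_rho x : peval rho x = x.1 ^+ 2 + x.2 ^+ 2.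
Proof. by rewrite !pevalE. Qed.
Lemma zpow_polar n r t :
  peval (zre n) (r * cos t, r * sin t) = r ^+ n * cos (n%:R * t) /\
  peval (zim n) (r * cos t, r * sin t) = r ^+ n * sin (n%:R * t).
Proof.
have := zpow_complex n (r * cos t, r * sin t) => /=.
have -> : Complex (r * cos t) (r * sin t) = Complex r 0 * cis t.
  by apply/eqP; rewrite eq_complex /= !mul0r subr0 addr0 !eqxx.
have hr : Complex r 0 ^+ n = Complex (r ^+ n) 0.
  elim: n => [//|n IH]; rewrite exprS IH; apply/eqP; rewrite eq_complex /= exprS.
  by rewrite !mul0r !mulr0 subr0 addr0 !eqxx.
rewrite exprMn hr cisX => /eqP; rewrite eq_complex /= !mul0r subr0 addr0.
by case/andP=> /eqP -> /eqP ->.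
Qed.
Lemma homog_zpow n : homog n (zre n) /\ homog n (zim n).
Proof.
suff h t x : peval (zre n) (t * x.1, t * x.2) = t ^+ n * peval (zre n) x /\
     peval (zim n) (t * x.1, t * x.2) = t ^+ n * peval (zim n) x.
  by split; apply/homogP => t x; case: (h t x).
elim: n => [|n [IH1 IH2]]; first by rewrite /zre /zim /= !pevalE !mul1r.
by rewrite zreS zimS !pevalE IH1 IH2 /= !exprS; split; ring.
Qed.
Lemma homog_rho : homog 2 rho.
Proof. by apply/homogP => t x; rewrite !peval_rho /=; ring. Qed.
Lemma homogM n m p q : homog n p -> homog m q -> homog (n + m) (p * q).
Proof. by move=> /homogP h1 /homogP h2; apply/homogP => t x; rewrite !pevalM h1 h2 exprD; ring. Qed.
Lemma homogXn n m p : homog n p -> homog (n * m) (p ^+ m).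
Proof. by move=> /homogP h1; apply/homogP => t x; rewrite !pevalXn h1 exprMn exprM. Qed.
Lemma homogD n p q : homog n p -> homog n q -> homog n (p + q).
Proof. by move=> /homogP h1 /homogP h2; apply/homogP => t x; rewrite !pevalD h1 h2 mulrDr. Qed.
Lemma homogZ n c p : homog n p -> homog n (CC c * p).
Proof. by move=> /homogP h1; apply/homogP => t x; rewrite !pevalM !pevalC h1 mulrCA. Qed.
Lemma homog0 n : homog n (0 : P2).
Proof. by move=> a b _; rewrite pcoef0. Qed.
Lemma homog_sum n (I : Type) (r : seq I) (P : pred I) (F : I -> P2) :
  (forall i, P i -> homog n (F i)) -> homog n (\sum_(i <- r | P i) F i).
Proof. by move=> h; elim/big_rec: _ => [|i q Pi hq]; [exact: homog0 | apply: homogD => //; exact: h]. Qed.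
End PlanePowers.

(** * The two classes of mirrors as zero sets *)

Section Mirrors.
Variables (R : realType) (k : nat).
Hypothesis k0 : (0 < k)%N.
Local Notation P2 := {poly {poly R}}.
Local Notation ra j := (@rootI R k j).
Implicit Types (x : R * R).
Let kR : (k%:R : R) != 0. Proof. by rewrite pnatr_eq0 -lt0n. Qed.

(** The boolean is the parity of a reflection index: the mirror of index [j] has angle
    [j pi / (2 k)], so [Im z^k] vanishes on the mirrors with [j] even and [Re z^k] on those with [j]
    odd. *)
Definition zpar (d : bool) : P2 := if d then zre R k else zim R k.

(** The linear form of a root with mirror angle [h] is [Im (z e^(-i h))], that is
    [e^(-i h) (z - conj z e^(2 i h)) / (2 i)]. Over one class the [e^(2 i h)] run through [k]
    equally spaced points of the circle, and the product is [z^k - conj z^k] or [z^k + conj z^k] up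
    to a factor. Existence of the constant is enough, as only logarithmic derivatives are taken. *)
Lemma prod_mirrors (d : bool) : exists c : R,
  \prod_(m < k) (CC (ra (2 * m + d)).1 * X1 R + CC (ra (2 * m + d)).2 * X2 R) = CC c * zpar d.
Proof.
pose h (m : nat) : R := ang R k (2 * m + d) / 2.
pose C : R[i] := (\prod_(m < k) cis (- h m)) / (Complex 0 2) ^+ k * (if d then 2 else Complex 0 2).
have i2 : (Complex 0 2 : R[i]) != 0 by rewrite eq_complex /= negb_and pnatr_eq0 orbT.
have key x : Complex (\prod_(m < k) dotp (ra (2 * m + d)) x) 0 = C * Complex (peval (zpar d) x) 0.
  have RC (u v : R) : Complex u 0 * Complex v 0 = Complex (u * v) 0.
    by apply/eqP; rewrite eq_complex /= !mul0r !mulr0 subr0 addr0 !eqxx.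
  have -> : Complex (\prod_(m < k) dotp (ra (2 * m + d)) x) 0 = \prod_(m < k) Complex (dotp (ra (2 * m + d)) x) 0.
    elim/big_rec2: _ => [//|m u v _ <-]; by rewrite RC.
  pose z : R[i] := Complex x.1 x.2; pose zb : R[i] := Complex x.1 (- x.2).
  pose Y : R[i] := zb * cis (d%:R * (pi / k%:R)).
  have hl m : Complex (dotp (ra (2 * m + d)) x) 0 = cis (- h m) / Complex 0 2 *
      (z - Y * cis (m%:R * (pi *+ 2 / k%:R))).
    rewrite mulrAC; apply: (mulIf i2); rewrite divfK // mulrBr.
    have -> : Y * cis (m%:R * (pi *+ 2 / k%:R)) = zb * (cis (h m) * cis (h m)).
      rewrite /Y -mulrA -!cisD; congr (_ * cis _); rewrite /h /ang natrD natrM mulr2n; field.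
      exact: kR.
    have -> : cis (- h m) * (zb * (cis (h m) * cis (h m))) = zb * cis (h m).
      rewrite mulrCA; congr (_ * _); rewrite mulrA [cis (- _) * _]mulrC cisV mul1r //.
    rewrite /z /zb /cis cosN sinN /dotp /rootI -/(h m).
    by apply/eqP; rewrite eq_complex /= -/(h m); apply/andP; split; apply/eqP; ring.
  under eq_bigr do rewrite hl.
  rewrite big_split /= prod_cis // big_split /= prodr_const card_ord.
  rewrite /C exprVn -!mulrA; congr (_ * (_ * _)).
  rewrite /Y exprMn cisX.
  have -> : k%:R * (d%:R * (pi / k%:R)) = d%:R * pi :> R by field.
  rewrite cis_npi.
  have hz : z ^+ k = Complex (peval (zre R k) x) (peval (zim R k) x) by rewrite zpow_complex.
  have hzb : zb ^+ k = Complex (peval (zre R k) x) (- peval (zim R k) x).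
    have cj (u v : R[i]) : (Complex (Cre u) (- Cim u)) * (Complex (Cre v) (- Cim v)) =
       Complex (Cre (u * v)) (- Cim (u * v)).
      by case: u => a b; case: v => c e; apply/eqP; rewrite eq_complex /=; apply/andP; split; apply/eqP; ring.
    have -> : Complex (peval (zre R k) x) (- peval (zim R k) x) = Complex (Cre (z ^+ k)) (- Cim (z ^+ k)).
      by rewrite hz.
    elim: k => [|n IH]; first by apply/eqP; rewrite eq_complex /= oppr0 !eqxx.
    by rewrite exprS IH exprS -cj.
  rewrite hz hzb /zpar; case: d {C hl Y h} => /=; apply/eqP.
    by rewrite expr1 eq_complex /=; apply/andP; split; apply/eqP; ring.
  by rewrite expr0 eq_complex /=; apply/andP; split; apply/eqP; ring.
exists (Cre C); apply: peval_inj => x; rewrite peval_prod pevalM pevalC.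
move/eqP: (key x); rewrite eq_complex; case: C {key} => c1 c2 /= /andP[/eqP h1 _].
by move: h1; rewrite mulr0 subr0 => <-; apply: eq_bigr => m _; rewrite !pevalE.
Qed.

Lemma sum_even_odd (F : nat -> R) n :
  \sum_(j < 2 * n) F j = \sum_(m < n) F (2 * m + false)%N + \sum_(m < n) F (2 * m + true)%N.
Proof.
elim: n => [|n IH]; first by rewrite !big_ord0 addr0.
rewrite mulnS !big_ord_recr /= IH addn0 addn1; ring.
Qed.

(** Logarithmic derivative of [prod_mirrors]. It sums the first-order terms of the Dunkl Laplacian
    over a whole class of mirrors. *)
Lemma mirrors_logder (d : bool) x : (forall j, dotp (ra j) x != 0) ->
  peval (zpar d) x != 0 /\ forall i,
  \sum_(m < k) cmp i (ra (2 * m + d)) / dotp (ra (2 * m + d)) x = peval (pder i (zpar d)) x / peval (zpar d) x.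
Proof.
move=> hx; have [c hc] := prod_mirrors d.
have ev := congr1 (fun p => peval p x) hc; rewrite /= peval_prod pevalM pevalC in ev.
have hl m : peval (CC (ra (2 * m + d)).1 * X1 R + CC (ra (2 * m + d)).2 * X2 R) x = dotp (ra (2 * m + d)) x.
  by rewrite !pevalE.
have pn : \prod_(m < k) dotp (ra (2 * m + d)) x != 0 by apply/prodf_neq0 => m _.
have ev' : \prod_(m < k) dotp (ra (2 * m + d)) x = c * peval (zpar d) x.
  by rewrite -ev; apply: eq_bigr => m _; rewrite hl.
have cn : c != 0 by apply: contraNneq pn => c00; rewrite ev' c00 mul0r.
have zn : peval (zpar d) x != 0 by apply: contraNneq pn => z00; rewrite ev' z00 mulr0.
split=> // i.
have der (s : seq nat) : peval (pder i (\prod_(m <- s) (CC (ra (2 * m + d)).1 * X1 R + CC (ra (2 * m + d)).2 * X2 R))) x =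
    \prod_(m <- s) dotp (ra (2 * m + d)) x * \sum_(m <- s) cmp i (ra (2 * m + d)) / dotp (ra (2 * m + d)) x.
  elim: s => [|m s IH]; first by rewrite !big_nil pder1 peval0 mulr0.
  rewrite !big_cons pderM pevalD !pevalM IH hl peval_prod.
  under [\prod_(i0 <- s) peval _ _]eq_bigr do rewrite hl.
  rewrite pderD !pderZ pder_X1 pder_X2 !pevalE /cmp.
  have := hx (2 * m + d)%N; case: (I2P i) => -> /= h; field; exact: h.
have := congr1 (fun p => peval (pder i p) x) hc; rewrite /= pderZ pevalM pevalC.
have bp (S : pzSemiRingType) (F : nat -> S) : \prod_(m < k) F m = \prod_(m <- iota 0 k) F m.
  by rewrite -(big_mkord xpredT F) /index_iota subn0.
have bs (F : nat -> R) : \sum_(m < k) F m = \sum_(m <- iota 0 k) F m.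
  by rewrite -(big_mkord xpredT F) /index_iota subn0.
rewrite (bp _ (fun m => CC (ra (2 * m + d)).1 * X1 R + CC (ra (2 * m + d)).2 * X2 R)) der.
rewrite -(bp _ (fun m => dotp (ra (2 * m + d)) x)) ev' => e.
rewrite (bs (fun m => cmp i (ra (2 * m + d)) / dotp (ra (2 * m + d)) x)).
apply: (mulfI cn); rewrite mulrA -e; field; exact: zn.
Qed.
End Mirrors.

(** * The Dunkl Laplacian on dihedral invariants *)

Section RadialLaplacian.
Variables (R : realType) (k : nat) (al be : R).
Hypothesis k0 : (0 < k)%N.
Local Notation P2 := {poly {poly R}}.
Local Notation ra j := (@rootI R k j).
Local Notation rf j := (@reflI R k j).
Implicit Types (p q f h : P2) (x : R * R).
Local Notation rho := (rho R).
Local Notation la := (al + be).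

Definition ivar (d : bool) : P2 := zpar R k d ^+ 2.
(** These monomials are linearly dependent, as [ivar true + ivar false = rho ^+ k]. The redundancy
    is kept because the Laplacian then acts through three monomial terms. *)
Definition omega (s i l : nat) : P2 := rho ^+ s * ivar true ^+ i * ivar false ^+ l.

Lemma ivar_sum : ivar true + ivar false = rho ^+ k.
Proof. exact: zre_zim. Qed.

(** The reflection takes [z^k] to [(-1)^j conj (z^k)], so that its real and imaginary parts change
    at most by a sign. *)
Lemma zpar_refl (d : bool) j x : peval (zpar R k d) (rf j x) ^+ 2 = peval (zpar R k d) x ^+ 2.
Proof.
have kR : (k%:R : R) != 0 by rewrite pnatr_eq0 -lt0n.
have cj (u v : R[i]) : (Complex (Cre u) (- Cim u)) * (Complex (Cre v) (- Cim v)) =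
   Complex (Cre (u * v)) (- Cim (u * v)).
  by case: u => a b; case: v => c e; apply/eqP; rewrite eq_complex /=; apply/andP; split; apply/eqP; ring.
have cjX (u : R[i]) n : (Complex (Cre u) (- Cim u)) ^+ n = Complex (Cre (u ^+ n)) (- Cim (u ^+ n)).
  elim: n => [|n IH]; first by rewrite !expr0 /= oppr0.
  by rewrite exprS IH cj exprS.
have := zpow_complex k (rf j x).
have -> : Complex (rf j x).1 (rf j x).2 = Complex x.1 (- x.2) * cis (ang R k j).
  by apply/eqP; rewrite eq_complex /=; apply/andP; split; apply/eqP; ring.
have := cjX (Complex x.1 x.2) k; rewrite /= -zpow_complex /= exprMn => ->.
rewrite cisX /ang (_ : k%:R * (j%:R * pi / k%:R) = j%:R * pi); last by field.
rewrite cis_npi -signr_odd => /eqP.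
by rewrite eq_complex /zpar; case: (odd j) => /=; rewrite ?expr1 ?expr0 /=;
  case/andP=> /eqP h1 /eqP h2; case: d; rewrite ?h1 ?h2; ring.
Qed.
Lemma rho_refl j x : peval rho (rf j x) = peval rho x.
Proof.
rewrite !peval_rho /reflI /=; have := cos2Dsin2 (ang R k j).
set c := cos _; set s := sin _ => h; rewrite -[RHS]mul1r -h; ring.
Qed.
Lemma omega_dinv s i l : dinv k (omega s i l).
Proof. by move=> j hj x; rewrite !pevalM !pevalXn rho_refl !zpar_refl. Qed.
Lemma dinv_D f h : dinv k f -> dinv k h -> dinv k (f + h).
Proof. by move=> hf hh j hj x; rewrite !pevalD hf // hh. Qed.
Lemma dinv_Z c f : dinv k f -> dinv k (CC c * f).
Proof. by move=> hf j hj x; rewrite !pevalM hf // !pevalC. Qed.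
Lemma dinv_sum (I : Type) (r : seq I) (P : pred I) (F : I -> P2) :
  (forall i, P i -> dinv k (F i)) -> dinv k (\sum_(i <- r | P i) F i).
Proof.
move=> h; elim/big_rec: _ => [|i q Pi hq]; last by apply: dinv_D => //; exact: h.
by move=> j hj x; rewrite !peval0.
Qed.
Lemma homog_ivar d : homog (2 * k) (ivar d).
Proof.
rewrite mulnC; apply: homogXn; rewrite /zpar; case: (homog_zpow R k) => h1 h2.
by case: d.
Qed.
Lemma homog_omega s i l : homog (2 * (s + k * (i + l))) (omega s i l).
Proof.
have -> : (2 * (s + k * (i + l)) = 2 * s + 2 * k * i + 2 * k * l)%N by ring.
apply: homogM; last by apply: homogXn; exact: homog_ivar.
by apply: homogM; apply: homogXn; [exact: homog_rho | exact: homog_ivar].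
Qed.
Lemma euler n f x : homog n f -> x.1 * peval (pder ord0 f) x + x.2 * peval (pder ord_max f) x = n%:R * peval f x.
Proof.
move=> hf.
suff -> : n%:R * peval f x = psum f (fun a b => (a + b)%:R * (x.1 ^+ a * x.2 ^+ b)).
  elim/poly2_lin_ind: {hf} f => [p q hp hq|c p hp|a b].
  - by rewrite psumD -hp -hq !pderD !pevalD; ring.
  - by rewrite psumZ -hp !pderZ !pevalM !pevalC; ring.
  - rewrite psum_mono !pderM !pderXn !pder_X1 !pder_X2 /= !pevalE; case: a => [|a]; case: b => [|b] /=;
    by rewrite ?addn0 ?add0n ?exprS ?expr0 ?natrD -?natr1; ring.
rewrite peval_psum -psum_fZ; apply: eq_psum => a b hab.
by have /eqP -> : (a + b == n)%N by apply: contraNT hab => /hf ->.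
Qed.

Section AtPoint.
Variable x : R * R.
Hypothesis hx : offm k x.
Local Notation e f := (peval f x).
Local Notation X := (zpar R k true).
Local Notation Y := (zpar R k false).

(** The product of gradients measures the failure of the second-order operator [Lp] to be a
    derivation ([Lp_M]); hence [Lp] on all [omega] follows from its values on the three generators
    and their mutual [Gam]. [Lp] is the form that [H] takes at [x] on invariants. *)
Definition Gam f h := e (pder ord0 f) * e (pder ord0 h) + e (pder ord_max f) * e (pder ord_max h).
Definition Lp f := 2^-1 * (e (pder ord0 (pder ord0 f)) + e (pder ord_max (pder ord_max f)))
  + al * Gam Y f / e Y + be * Gam X f / e X.

Let hX : e X != 0. Proof. by case: (mirrors_logder k0 true (offm_all k0 hx)). Qed.
Let hY : e Y != 0. Proof. by case: (mirrors_logder k0 false (offm_all k0 hx)). Qed.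

Lemma GamC f h : Gam f h = Gam h f. Proof. by rewrite /Gam; ring. Qed.
Lemma Gam_M f h h' : Gam f (h * h') = e h * Gam f h' + e h' * Gam f h.
Proof. by rewrite /Gam !pderM !pevalD !pevalM; ring. Qed.
Lemma Gam_Xn f h n : Gam f (h ^+ n) = n%:R * e h ^+ n.-1 * Gam f h.
Proof. by rewrite /Gam !pderXn !pevalM !pevalXn peval_nat; ring. Qed.
Lemma Lp_M f h : Lp (f * h) = e f * Lp h + e h * Lp f + Gam f h.
Proof.
rewrite /Lp !Gam_M !pderM !pderD !pderM !pevalD !pevalM /Gam; field.
by rewrite hX hY.
Qed.
Lemma Lp_1 : Lp 1 = 0.
Proof. by rewrite /Lp /Gam !pder1 !(pder0, peval0) !(mulr0, addr0, mul0r). Qed.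

(** The squared modulus of the derivative of [z^k], that is the common squared length of the
    gradients of its real and imaginary parts. *)
Let G := k%:R ^+ 2 * e rho ^+ k.-1.

Let zder : [/\ pder ord0 X = k%:R * zre R k.-1, pder ord0 Y = k%:R * zim R k.-1,
  pder ord_max X = - (k%:R * zim R k.-1) & pder ord_max Y = k%:R * zre R k.-1].
Proof. by case: k k0 => // n _; exact: pder_zpow. Qed.
Let zsum : e (zre R k.-1) ^+ 2 + e (zim R k.-1) ^+ 2 = e rho ^+ k.-1.
Proof. by rewrite -!pevalXn -pevalD zre_zim. Qed.

Lemma Gam_XX : Gam X X = G.
Proof. by case: zder => h1 h2 h3 h4; rewrite /Gam h1 h3 !pevalE /G -zsum; ring. Qed.
Lemma Gam_YY : Gam Y Y = G.
Proof. by case: zder => h1 h2 h3 h4; rewrite /Gam h2 h4 !pevalE /G -zsum; ring. Qed.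
Lemma Gam_XY : Gam X Y = 0.
Proof. by case: zder => h1 h2 h3 h4; rewrite /Gam h1 h2 h3 h4 !pevalE; ring. Qed.
Lemma harm_XY : e (pder ord0 (pder ord0 X)) + e (pder ord_max (pder ord_max X)) = 0 /\
   e (pder ord0 (pder ord0 Y)) + e (pder ord_max (pder ord_max Y)) = 0.
Proof.
case: zder => -> -> -> ->; rewrite pderN -!CCnat !pderZ.
suff gen c n : e (CC c * pder ord0 (zre R n)) + e (- (CC c * pder ord_max (zim R n))) = 0 /\
  e (CC c * pder ord0 (zim R n)) + e (CC c * pder ord_max (zre R n)) = 0 by exact: gen.
case: n => [|n].
  by rewrite /zre /zim /= !(pder1, pder0) !mulr0 oppr0 !peval0 !addr0.
by have [-> -> -> ->] := pder_zpow R n; rewrite !pevalE; split; ring.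
Qed.
Lemma Gam_rho n f : homog n f -> Gam rho f = 2 * n%:R * e f.
Proof.
move=> hf; have := euler x hf; rewrite /Gam /rho !pderD !pderXn !pder_X1 !pder_X2 !pevalE /=.
by move=> h; rewrite -[RHS]mulrA -h; ring.
Qed.
Lemma Lp_rho : Lp rho = 2 * (1 + k%:R * la).
Proof.
have [hz1 hz2] := homog_zpow R k.
rewrite /Lp !(GamC _ rho) (Gam_rho (n := k)) // (Gam_rho (n := k)) // /rho.
rewrite !pderD !pderXn !pder_X1 !pder_X2 /= !pderM !pder_X1 !pder_X2 /= -!CCnat !pderC !pevalE /=.
by field; rewrite hX hY.
Qed.
Lemma Lp_a : Lp (ivar true) = G * (1 + 2 * be).
Proof.
have [hz1 hz2] := harm_XY.
rewrite /ivar expr2 Lp_M Gam_XX {1 2}/Lp hz1 (GamC Y) Gam_XY Gam_XX.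
by field; rewrite hX hY.
Qed.
Lemma Lp_b : Lp (ivar false) = G * (1 + 2 * al).
Proof.
have [hz1 hz2] := harm_XY.
rewrite /ivar expr2 Lp_M Gam_YY {1 2}/Lp hz2 Gam_XY Gam_YY.
by field; rewrite hX hY.
Qed.
Lemma Gam_ivar d d' : Gam (ivar d) (ivar d') = if d == d' then 4 * e (ivar d) * G else 0.
Proof.
rewrite /ivar !Gam_Xn !(GamC (_ ^+ 2)) !Gam_Xn pevalXn.
by case: d; case: d' => /=; rewrite ?Gam_XX ?Gam_YY ?[Gam Y X]GamC ?Gam_XY ?mulr0 //; ring.
Qed.
Lemma pown (t : R) n : n%:R * t ^+ n.-1 * t = n%:R * t ^+ n.
Proof. by case: n => [|n] /=; rewrite ?mul0r // exprSr mulrA. Qed.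
Lemma Lp_ivar d n : Lp (ivar d ^+ n) = 2 * n%:R * (n%:R - 2^-1 + (if d then be else al)) * G * e (ivar d) ^+ n.-1.
Proof.
elim: n => [|n IH]; first by rewrite expr0 Lp_1 !(mulr0, mul0r).
rewrite exprS Lp_M IH Gam_Xn Gam_ivar eqxx pevalXn.
have -> : Lp (ivar d) = G * (1 + 2 * (if d then be else al)) by case: d {IH}; rewrite ?Lp_a ?Lp_b.
set c := if d then be else al; set t := e (ivar d); rewrite -[n.+1%:R]natr1 [n.+1.-1]/=.
have h := pown t n.
transitivity (2 * (n%:R * t ^+ n.-1 * t) * (n%:R - 2^-1 + c) * G + t ^+ n * (G * (1 + 2 * c)) + 4 * (n%:R * t ^+ n.-1 * t) * G); first by ring.
by rewrite h; field.
Qed.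
Lemma Lp_rhoXn n f s : homog n f -> Lp (rho ^+ s * f) =
  e rho ^+ s * Lp f + 2 * s%:R * (s%:R + n%:R + k%:R * la) * e rho ^+ s.-1 * e f.
Proof.
move=> hf; elim: s => [|s IH]; first by rewrite !expr0 !mul1r !(mulr0, mul0r) addr0.
have hs : homog (2 * s + n) (rho ^+ s * f) by apply: homogM => //; apply: homogXn; exact: homog_rho.
rewrite exprS -mulrA Lp_M IH (Gam_rho hs) Lp_rho !pevalM !pevalXn natrD natrM -[s.+1%:R]natr1 [s.+1.-1]/= exprS.
have h := pown (e rho) s.
set t := e rho in h *; set F := e f.
transitivity (t * t ^+ s * Lp f + 2 * (s%:R * t ^+ s.-1 * t) * (s%:R + n%:R + k%:R * la) * F
  + t ^+ s * F * (2 * (1 + k%:R * la)) + 2 * (2 * s%:R + n%:R) * (t ^+ s * F)); first by ring.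
by rewrite h; ring.
Qed.
Lemma Lp_omega s i l : Lp (omega s i l) = e (
  CC (2 * s%:R * (s%:R + 2 * k%:R * (i + l)%:R + k%:R * la)) * omega s.-1 i l +
  CC (2 * k%:R ^+ 2 * i%:R * (i%:R - 2^-1 + be)) * omega (s + k.-1) i.-1 l +
  CC (2 * k%:R ^+ 2 * l%:R * (l%:R - 2^-1 + al)) * omega (s + k.-1) i l.-1).
Proof.
have ho s' i' l' : e (omega s' i' l') = e rho ^+ s' * e (ivar true) ^+ i' * e (ivar false) ^+ l'.
  by rewrite /omega !pevalM !pevalXn.
rewrite pevalD pevalD !(pevalM (CC _)) !pevalC !ho.
rewrite {1}/omega -mulrA (Lp_rhoXn (n := (2 * k * (i + l))%N)); last first.
  by rewrite mulnDr; apply: homogM; apply: homogXn; exact: homog_ivar.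
rewrite Lp_M !Lp_ivar Gam_Xn GamC Gam_Xn Gam_ivar /= (pevalM (ivar true ^+ i)) !(pevalXn (ivar _)) /G.
rewrite [(2 * k * _)%:R]natrM [(2 * k)%:R]natrM !exprD; set r := e rho; set a := e (ivar true); set b := e (ivar false).
ring.
Qed.

Lemma dinv_Lp (T : 'I_2 -> P2 -> P2) f :
  (forall i f x, offm k x -> peval (T i f) x = dunkl k al be i f x) ->
  dinv k f -> e (Hop T f) = Lp f.
Proof.
move=> HT hf; rewrite (Hop_dinv k0 HT hf hx) /Lp -addrA; congr (_ + _).
rewrite (sum_even_odd (fun j => kappa al be j * ((ra j).1 * e (pder ord0 f) + (ra j).2 * e (pder ord_max f)) / dotp (ra j) x)).
have hl (d : bool) : \sum_(m < k) kappa al be (2 * m + d) *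
   ((ra (2 * m + d)).1 * e (pder ord0 f) + (ra (2 * m + d)).2 * e (pder ord_max f)) / dotp (ra (2 * m + d)) x
   = (if d then be else al) * Gam (zpar R k d) f / e (zpar R k d).
  have [hz hd] := mirrors_logder k0 d (offm_all k0 hx).
  have h0 := hd ord0; have h1 := hd ord_max; rewrite /cmp /= in h0 h1.
  transitivity ((if d then be else al) * (e (pder ord0 f) * (e (pder ord0 (zpar R k d)) / e (zpar R k d)) +
      e (pder ord_max f) * (e (pder ord_max (zpar R k d)) / e (zpar R k d)))); last by rewrite /Gam; field.
  rewrite -h0 -h1 !mulr_sumr -big_split mulr_sumr; apply: eq_bigr => m _ /=.
  rewrite /kappa oddD oddM /= oddb; have := offm_all k0 hx (2 * m + d); set D := dotp _ _ => hD.
  by field.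
by rewrite !hl.
Qed.
End AtPoint.

(** Each of the three terms has degree lower by 2. A predecessor of 0 is harmless, since its
    coefficient contains the exponent as a factor. *)
Lemma Hop_omega (T : 'I_2 -> P2 -> P2) s i l :
  (forall i f x, offm k x -> peval (T i f) x = dunkl k al be i f x) ->
  Hop T (omega s i l) =
  CC (2 * s%:R * (s%:R + 2 * k%:R * (i + l)%:R + k%:R * la)) * omega s.-1 i l +
  CC (2 * k%:R ^+ 2 * i%:R * (i%:R - 2^-1 + be)) * omega (s + k.-1) i.-1 l +
  CC (2 * k%:R ^+ 2 * l%:R * (l%:R - 2^-1 + al)) * omega (s + k.-1) i l.-1.
Proof.
move=> HT; apply: (peval_inj_offm (k := k)) => x hx.
by rewrite (dinv_Lp hx HT) ?Lp_omega //; exact: omega_dinv.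
Qed.
End RadialLaplacian.

(** * Pochhammer symbols and a finite difference *)

Section Pochhammer.
Variable R : realType.
Implicit Types (a b : R).

Lemma poch0 a : poch a 0 = 1. Proof. by rewrite /poch big_ord0. Qed.
Lemma pochS a n : poch a n.+1 = poch a n * (a + n%:R).
Proof. by rewrite /poch big_ord_recr. Qed.
Lemma pochSl a n : poch a n.+1 = a * poch (a + 1) n.
Proof.
rewrite /poch big_ord_recl addr0; congr (_ * _); apply: eq_bigr => i _.
by rewrite /= /bump leq0n add1n -natr1; ring.
Qed.
Lemma pochD a n m : poch a (n + m) = poch a n * poch (a + n%:R) m.
Proof.
elim: m => [|m IH]; first by rewrite addn0 poch0 mulr1.
by rewrite addnS !pochS IH natrD; ring.
Qed.
Lemma poch_gt0 a n : 0 < a -> 0 < poch a n.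
Proof. by move=> a0; apply: prodr_gt0 => i _; rewrite ltr_wpDr. Qed.
Lemma poch_neq0 a n : 0 < a -> poch a n != 0.
Proof. by move=> /(poch_gt0 n) h; rewrite gt_eqF. Qed.

(** [1 / j!] times the [j]-th finite difference, in the variable [i], of the product
    [(b + i)_p (a + j - i)_q]. *)
Definition dsum (j p q : nat) (b a : R) : R :=
  \sum_(i < j.+1) (-1) ^+ (j - i) / (i`!%:R * (j - i)`!%:R) * poch (b + i%:R) p * poch (a + (j - i)%:R) q.

Let fac0 n : (n`!%:R : R) != 0. Proof. by rewrite pnatr_eq0 -lt0n fact_gt0. Qed.

Lemma dsum00 j b a : dsum j 0 0 b a = (j == 0)%:R.
Proof.
rewrite /dsum; under eq_bigr do rewrite !poch0 !mulr1.
case: j => [|j]; first by rewrite big_ord_recl big_ord0 /= fact0; field.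
have := exprDn (1 : R) (-1) j.+1; rewrite subrr expr0n /= => h.
have h2 : \sum_(i < j.+2) (-1) ^+ (j.+1 - i) / (i`!%:R * (j.+1 - i)`!%:R) = (j.+1`!%:R)^-1 * (\sum_(i < j.+2) 1 ^+ (j.+1 - i) * (-1) ^+ i *+ 'C(j.+1, i)) :> R; last by rewrite h2 -h mulr0.
rewrite mulr_sumr (reindex_inj rev_ord_inj) /=; apply: eq_bigr => i _.
have le : (i <= j.+1)%N by rewrite -ltnS.
rewrite subSS subKn // expr1n mul1r -mulr_natr.
have := bin_fact le => /(congr1 (fun n => n%:R : R)); rewrite !natrM => <-.
have : ('C(j.+1, i)%:R : R) != 0 by rewrite pnatr_eq0 -lt0n bin_gt0.
by have := fac0 i; have := fac0 (j.+1 - i)%N => ? ? ?; field; apply/and3P; split.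
Qed.
Lemma dsum_p j p q b a : dsum j.+1 p.+1 q b a = b * dsum j.+1 p q (b + 1) a + dsum j p q (b + 1 + 1) a.
Proof.
transitivity (b * dsum j.+1 p q (b + 1) a + \sum_(i < j.+2) i%:R * ((-1) ^+ (j.+1 - i) / (i`!%:R * (j.+1 - i)`!%:R) * poch (b + 1 + i%:R) p * poch (a + (j.+1 - i)%:R) q)).
  rewrite /dsum mulr_sumr -big_split /=; apply: eq_bigr => i _; rewrite pochSl.
  by rewrite (addrAC b _ 1); ring.
congr (_ + _); rewrite big_ord_recl mul0r add0r /dsum; apply: eq_bigr => i _.
rewrite /= /bump leq0n add1n subSS factS natrM -(natr1 i) -(addrA (b + 1)) (addrC 1 i%:R).
have h1 := fac0 i; have h2 := fac0 (j - i)%N.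
have h3 : (i%:R + 1 : R) != 0 by rewrite natr1 pnatr_eq0.
by field; rewrite h1 h2 h3.
Qed.
Lemma dsum_q j p q b a : dsum j.+1 p q.+1 b a = a * dsum j.+1 p q b (a + 1) - dsum j p q b (a + 1 + 1).
Proof.
transitivity (a * dsum j.+1 p q b (a + 1) + \sum_(i < j.+2) (j.+1 - i)%:R * ((-1) ^+ (j.+1 - i) / (i`!%:R * (j.+1 - i)`!%:R) * poch (b + i%:R) p * poch (a + 1 + (j.+1 - i)%:R) q)).
  rewrite /dsum mulr_sumr -big_split /=; apply: eq_bigr => i _; rewrite pochSl.
  by rewrite (addrAC a _ 1); ring.
congr (_ + _); rewrite big_ord_recr /= subnn mul0r addr0 /dsum -sumrN; apply: eq_bigr => i _.
have le : (i <= j)%N by rewrite -ltnS.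
rewrite subSn // exprS factS natrM -(natr1 (j - i)) -(addrA (a + 1)) (addrC 1 (j - i)%:R).
have h1 := fac0 i; have h2 := fac0 (j - i)%N.
have h3 : ((j - i)%:R + 1 : R) != 0 by rewrite natr1 pnatr_eq0.
by field; rewrite h1 h2 h3.
Qed.
(** The differenced function is a polynomial in [i] of degree [p + q] with leading coefficient
    [(-1)^q]. The proof removes one Pochhammer factor at a time instead of using degrees. *)
Lemma dsumE j p q b a : (p + q <= j)%N -> dsum j p q b a = if (p + q == j)%N then (-1) ^+ q else 0.
Proof.
elim: q p j b a => [|q IHq] p.
  elim: p => [|p IHp] j b a.
    by rewrite dsum00 eq_sym; case: eqP.
  case: j => // j; rewrite addSn ltnS => h; rewrite dsum_p !IHp ?leqW //.
  by rewrite [(p + 0)%N == j.+1]ltn_eqF ?ltnS // mulr0 add0r eqSS.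
case=> [|j] b a; rewrite addnS // ltnS => h; rewrite dsum_q !IHq ?leqW //.
rewrite [(p + q)%N == j.+1]ltn_eqF ?ltnS // mulr0 sub0r eqSS.
by case: eqP => _; rewrite ?exprS ?mulN1r ?oppr0.
Qed.
End Pochhammer.

(** * Linear spans *)

Section Span.
Variable R : realType.
Local Notation P2 := {poly {poly R}}.

Lemma CCz (c : R) (f : P2) : c = 0 -> CC c * f = 0.
Proof. by move=> ->; rewrite CC0 mul0r. Qed.

(** The impredicative form makes membership itself the induction principle for properties stable
    under linear combinations. *)
Definition lspan (B : P2 -> Prop) (f : P2) : Prop := forall P : P2 -> Prop,
  P 0 -> (forall c q r, P q -> P r -> P (CC c * q + r)) -> (forall b, B b -> P b) -> P f.
Lemma lspan0 B : lspan B 0. Proof. by move=> P. Qed.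
Lemma lspanZD B c q r : lspan B q -> lspan B r -> lspan B (CC c * q + r).
Proof. by move=> hq hr P h0 hD hB; apply: (hD); [exact: hq | exact: hr]. Qed.
Lemma lspan_in (B : P2 -> Prop) b : B b -> lspan B b. Proof. by move=> hb P _ _; apply. Qed.
Lemma lspanZ B c q : lspan B q -> lspan B (CC c * q).
Proof. by move=> hq; rewrite -[CC c * q]addr0; apply: lspanZD => //; exact: lspan0. Qed.
Lemma lspanD B q r : lspan B q -> lspan B r -> lspan B (q + r).
Proof. by move=> hq hr; rewrite -[q]mul1r -CC1; apply: lspanZD. Qed.
Lemma lspan_sum B (I : Type) (s : seq I) (Q : pred I) (F : I -> P2) :
  (forall i, Q i -> lspan B (F i)) -> lspan B (\sum_(i <- s | Q i) F i).
Proof. by move=> h; elim/big_rec: _ => [|i q Qi hq]; [exact: lspan0 | apply: lspanD => //; exact: h]. Qed.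
End Span.

(** * Pairings of invariants and the reproducing kernel *)

Section Reproducing.
Variables (R : realType) (k : nat) (al be : R).
Hypotheses (k0 : (0 < k)%N) (al0 : 0 < al) (be0 : 0 < be).
Local Notation P2 := {poly {poly R}}.
Implicit Types (p q f h : P2) (x w : R * R).
Variables (V g : P2 -> P2).
Hypothesis VP : dunkl_intertwiner k al be V.
Hypotheses (VK : cancel V g) (gK : cancel g V).
Local Notation la := (al + be).
Local Notation rho := (rho R).
Local Notation om := (omega R k).
Local Notation T := (Top V g).
Local Notation H := (Hop T).
Local Notation tp := (tpair V g).
Let HT := Top_dunkl VP gK.

(** The mean of [cos^(2 i) sin^(2 l)] over the circle for the weight [|cos|^(2 be) |sin|^(2 al)];
    [cst N] below is the value of [H^N (rho ^+ N)]. *)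
Definition wgt (i l : nat) : R := poch (be + 2^-1) i * poch (al + 2^-1) l / poch (la + 1) (i + l).
Definition cst (N : nat) : R := \prod_(r < N) (2 * r.+1%:R * (r.+1%:R + k%:R * la)).
Let la0 : 0 < la. Proof. by rewrite addr_gt0. Qed.
Let la1 : 0 < la + 1. Proof. by rewrite addr_gt0. Qed.
Let be2 : 0 < be + 2^-1. Proof. by rewrite addr_gt0 // invr_gt0. Qed.
Let al2 : 0 < al + 2^-1. Proof. by rewrite addr_gt0 // invr_gt0. Qed.

Lemma wgt_i i l : (i.+1%:R - 2^-1 + be) * wgt i l = (la + (i.+1 + l)%:R) * wgt i.+1 l.
Proof.
rewrite /wgt addSn !pochS -natr1 -(natr1 (i + l)).
have h1 := poch_neq0 (i + l) la1.
have h2 : la + 1 + (i + l)%:R != 0 by rewrite gt_eqF // ltr_wpDr.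
have -> : la + ((i + l)%:R + 1) = la + 1 + (i + l)%:R by ring.
by move: h1 h2; move: (la + 1 + _) (poch (la + 1) _) => D P h1 h2; field; rewrite h1 h2.
Qed.
Lemma wgt_l i l : (l.+1%:R - 2^-1 + al) * wgt i l = (la + (i + l.+1)%:R) * wgt i l.+1.
Proof.
rewrite /wgt addnS !pochS -natr1 -(natr1 (i + l)).
have h1 := poch_neq0 (i + l) la1.
have h2 : la + 1 + (i + l)%:R != 0 by rewrite gt_eqF // ltr_wpDr.
have -> : la + ((i + l)%:R + 1) = la + 1 + (i + l)%:R by ring.
by move: h1 h2; move: (la + 1 + _) (poch (la + 1) _) => D P h1 h2; field; rewrite h1 h2.
Qed.

Lemma homog_at0 n p : homog n p -> (0 < n)%N -> peval p (0, 0) = 0.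
Proof.
by move=> /homogP /(_ 0 (0, 0)) /= h n0; move: h; rewrite !mul0r expr0n gtn_eqF // mul0r.
Qed.

(** With [N = s + k (i + l)], the relations [wgt_i] and [wgt_l] make the three terms of [Hop_omega]
    add up to the factor [2 N (N + k la)], the last factor of [cst N]. *)
Lemma iter_Hop_omega M s i l : peval (iter M H (om s i l)) (0, 0) =
  if (M == s + k * (i + l))%N then cst M * wgt i l else 0.
Proof.
elim: M s i l => [|M IH] s i l.
  rewrite [iter 0 _ _]/=; case: eqP => [/esym/eqP|/eqP e].
    rewrite addn_eq0 muln_eq0 addn_eq0 (gtn_eqF k0) => /and3P[/eqP -> /eqP -> /eqP ->].
    by rewrite /omega !expr0 !mulr1 peval1 /cst big_ord0 /wgt !poch0 divr1 !mulr1.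
  apply: homog_at0; first exact: homog_omega.
  by rewrite muln_gt0 /= lt0n eq_sym.
rewrite iterSr (Hop_omega k0 s i l HT) !(iter_Hop_D VP gK) !(iter_Hop_Z VP gK) !pevalD !(pevalM (CC _)) !pevalC !IH.
have A (s' : nat) c : (if (M == s'.-1 + k * (i + l))%N then cst M * wgt i l else 0) * (s'%:R * c) =
   if (M.+1 == s' + k * (i + l))%N then s'%:R * c * (cst M * wgt i l) else 0.
  case: s' => [|s'] /=; first by rewrite mul0r mulr0; case: ifP; rewrite ?mul0r.
  by rewrite addSn eqSS; case: ifP; rewrite ?mul0r // mulrC.
have kk : k = (k.-1).+1 by rewrite prednK.
have B : (if (M == s + k.-1 + k * (i.-1 + l))%N then cst M * wgt i.-1 l else 0) * (i%:R * (i%:R - 2^-1 + be)) =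
   if (M.+1 == s + k * (i + l))%N then i%:R * (la + (i + l)%:R) * (cst M * wgt i l) else 0.
  case: (i) => [|i'] /=; first by rewrite !mul0r mulr0; case: ifP; rewrite ?mul0r.
  rewrite addSn mulnS {3}kk addSn addnS eqSS addnA; case: ifP => _; last by rewrite mul0r.
  transitivity (i'.+1%:R * cst M * ((i'.+1%:R - 2^-1 + be) * wgt i' l)); first by ring.
  by rewrite wgt_i addSn; ring.
have C : (if (M == s + k.-1 + k * (i + l.-1))%N then cst M * wgt i l.-1 else 0) * (l%:R * (l%:R - 2^-1 + al)) =
   if (M.+1 == s + k * (i + l))%N then l%:R * (la + (i + l)%:R) * (cst M * wgt i l) else 0.
  case: (l) => [|l'] /=; first by rewrite !mul0r mulr0; case: ifP; rewrite ?mul0r.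
  rewrite addnS mulnS {3}kk addSn addnS eqSS addnA; case: ifP => _; last by rewrite mul0r.
  transitivity (l'.+1%:R * cst M * ((l'.+1%:R - 2^-1 + al) * wgt i l')); first by ring.
  by rewrite wgt_l addnS; ring.
move: (A s (2 * (s%:R + 2 * k%:R * (i + l)%:R + k%:R * la))) B C.
set u := (if M == (s.-1 + _)%N then _ else _).
set v := (if M == (s + k.-1 + k * (i.-1 + l))%N then _ else _).
set t := (if M == (s + k.-1 + k * (i + l.-1))%N then _ else _) => hA hB hC.
transitivity (u * (s%:R * (2 * (s%:R + 2 * k%:R * (i + l)%:R + k%:R * la))) + 2 * k%:R ^+ 2 * (v * (i%:R * (i%:R - 2^-1 + be)))
  + 2 * k%:R ^+ 2 * (t * (l%:R * (l%:R - 2^-1 + al)))); first by ring.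
rewrite hA hB hC; case: eqP => [e|_]; last by rewrite !mulr0 !addr0.
rewrite /cst big_ord_recr /= -/(cst M) e !natrD natrM natrD; ring.
Qed.

(** The Pochhammer factors cancel part of [wgt], through [poch a (i + i') = poch a i * poch (a + i)
    i']; what remains of the sum over [i] is then [dsum]. *)
Definition ycoef (j i : nat) : R := (i`!%:R * (j - i)`!%:R * (poch (be + 2^-1) i * poch (al + 2^-1) (j - i)))^-1.
(* The signs turn the pairing of [Yh j] with [om s i l] into the finite difference
   [dsum], which vanishes for i + l < j. *)
Definition Yh (j : nat) : P2 := \sum_(i < j.+1) CC ((-1) ^+ (j - i) * ycoef j i) * om 0 i (j - i).

Lemma omM s i l s' i' l' : om s i l * om s' i' l' = om (s + s') (i + i') (l + l').
Proof. by rewrite /omega !exprD; ring. Qed.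

Lemma homog_Yh j : homog (2 * (k * j)) (Yh j).
Proof.
apply: homog_sum => i _; apply: homogZ; have := @homog_omega R k 0 i (j - i).
by rewrite add0n subnKC // -ltnS.
Qed.

Lemma iter_Hop_Yh_omega M j s i' l' : (i' + l' <= j)%N ->
  peval (iter M H (Yh j * om s i' l')) (0, 0) =
  if (M == s + k * (j + (i' + l')))%N && (i' + l' == j)%N
  then cst M / poch (la + 1) (j + j) * (-1) ^+ l' else 0.
Proof.
move=> hj; rewrite /Yh mulr_suml (iter_Hop_sum VP gK) peval_sum.
under eq_bigr => i _.
  rewrite -mulrA omM (iter_Hop_Z VP gK) pevalM pevalC iter_Hop_omega add0n.
  have -> : ((i + i') + (j - i + l') = j + (i' + l'))%N.
    by rewrite addnACA subnKC // -ltnS.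
  over.
case: eqP => [e|_] /=; last by rewrite big1 // => i _; rewrite mulr0.
transitivity (cst M / poch (la + 1) (j + (i' + l')) * dsum j i' l' (be + 2^-1) (al + 2^-1)).
  rewrite /dsum mulr_sumr; apply: eq_bigr => i _.
  have le : (i <= j)%N by rewrite -ltnS.
  rewrite /wgt /ycoef addnACA subnKC // (pochD (be + 2^-1)) (pochD (al + 2^-1)).
  have f1 : (i`!%:R : R) != 0 by rewrite pnatr_eq0 -lt0n fact_gt0.
  have f2 : ((j - i)`!%:R : R) != 0 by rewrite pnatr_eq0 -lt0n fact_gt0.
  have f3 := poch_neq0 i be2; have f4 := poch_neq0 (j - i) al2; have f5 := poch_neq0 (j + (i' + l')) la1.
  by field; rewrite f1 f2 f3 f4 f5.
by rewrite dsumE //; case: eqP => [->|_] //; rewrite mulr0.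
Qed.

Definition omset (N : nat) : P2 -> Prop := fun f => exists s i l, (s + k * (i + l) = N)%N /\ f = om s i l.
Lemma Hop_lspan N f : lspan (omset N) f -> lspan (omset N.-1) (H f).
Proof.
move=> hf; apply: (hf (fun f => lspan (omset N.-1) (H f))) => [|c q r hq hr|_ [s [i [l [e ->]]]]].
- rewrite (Hop_0 VP gK); exact: lspan0.
- by rewrite (Hop_D (Top_dunkl VP gK)) (Hop_Z (Top_dunkl VP gK)); apply: lspanZD.
rewrite (Hop_omega k0 s i l HT).
have kk : k = (k.-1).+1 by rewrite prednK.
apply: lspanD; first apply: lspanD.
- case: s e => [|s] e; first by rewrite mulr0 mul0r CC0 mul0r; exact: lspan0.
  by apply: lspanZ; apply: lspan_in; exists s, i, l; rewrite -e.
- case: i e => [|i] e; first by rewrite mulr0 mul0r CC0 mul0r; exact: lspan0.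
  apply: lspanZ; apply: lspan_in; exists (s + k.-1)%N, i, l; split=> //; rewrite -e /= addSn mulnS {3}kk addSn addnS.
  by rewrite addnA.
- case: l e => [|l] e; first by rewrite mulr0 mul0r CC0 mul0r; exact: lspan0.
  apply: lspanZ; apply: lspan_in; exists (s + k.-1)%N, i, l; split=> //; rewrite -e /= addnS mulnS {3}kk addSn addnS.
  by rewrite addnA.
Qed.
Lemma iter_Hop_lspan n N f : lspan (omset N) f -> lspan (omset (N - n)) (iter n H f).
Proof.
move=> hf; elim: n => [|n IH] /=; first by rewrite subn0.
by rewrite subnS; exact: Hop_lspan.
Qed.

(** Only the leading term of the iterated commutator survives. If the two degrees differ, all values
    at 0 vanish by homogeneity; if they agree, [H^i] with [i > 0] brings the second argument below
    the degree of [Yh j], where [low] applies because there the difference [dsum] vanishes. *)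
Lemma tpair_Yh j s i l : tp (Yh j) (om s i l) =
  if (s == 0)%N && (i + l == j)%N then (2 * (k * j))`!%:R^-1 * (cst (2 * (k * j)) / poch (la + 1) (j + j) * (-1) ^+ l) else 0.
Proof.
set n := (2 * (k * j))%N; set N := (s + k * (i + l))%N.
have fn : (n`!%:R : R) != 0 by rewrite pnatr_eq0 -lt0n fact_gt0.
have omN : lspan (omset N) (om s i l) by apply: lspan_in; exists s, i, l.
have low N' M f : lspan (omset N') f -> (N' < k * j)%N || (M != N' + k * j)%N -> peval (iter M H (Yh j * f)) (0, 0) = 0.
  move=> hf hM; apply: (hf (fun f => peval (iter M H (Yh j * f)) (0, 0) = 0)) => [|c q r hq hr|_ [s' [i' [l' [e ->]]]]].
  - by rewrite mulr0 (iter_Hop_0 VP gK) peval0.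
  - by rewrite mulrDr mulrCA (iter_Hop_D VP gK) (iter_Hop_Z VP gK) pevalD pevalM hq hr mulr0 addr0.
  have [hle|hgt] := leqP (i' + l') j.
    rewrite iter_Hop_Yh_omega //; case: ifP => // /andP[/eqP hM' /eqP hj]; exfalso; move: hM.
    by rewrite -e hM' hj mulnDr; set K := (k * j)%N; lia.
  rewrite /Yh mulr_suml (iter_Hop_sum VP gK) peval_sum big1 // => i0 _.
  rewrite -mulrA omM (iter_Hop_Z VP gK) pevalM pevalC iter_Hop_omega add0n addnACA subnKC -1?ltnS //.
  case: eqP => [hM'|]; last by rewrite mulr0.
  exfalso; have : (k * j <= k * (i' + l'))%N by rewrite leq_mul2l ltnW // orbT.
  by move: hM; rewrite -e hM' mulnDr; set K := (k * j)%N; set L := (k * (i' + l'))%N; lia.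
have mul : n`!%:R * tp (Yh j) (om s i l) = peval (iter n H (Yh j * om s i l)) (0, 0).
  apply: (tpair_lead k0 VP VK gK (@homog_Yh j)) => i0 /andP[i00 i0n].
  have hl := @iter_Hop_lspan i0 _ _ omN.
  (* Beyond the degree, [H^i0] gives 0; the truncated subtraction in [iter_Hop_lspan] does not
     record this. *)
  have [hi|hi] := leqP i0 N; last first.
    rewrite -(subnK hi) iterD.
    have -> : iter N.+1 H (om s i l) = 0; last by rewrite (iter_Hop_0 VP gK) mulr0 (iter_Hop_0 VP gK) peval0.
    have := @iter_Hop_lspan N _ _ omN; rewrite subnn => h0; rewrite iterS.
    apply: (h0 (fun f => H f = 0)) => [|c q r hq hr|_ [s' [i' [l' [e ->]]]]].
    - exact: (Hop_0 VP gK).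
    - by rewrite (Hop_D (Top_dunkl VP gK)) (Hop_Z (Top_dunkl VP gK)) hq hr mulr0 addr0.
    move/eqP: e; rewrite addn_eq0 muln_eq0 addn_eq0 (gtn_eqF k0) => /and3P[/eqP -> /eqP -> /eqP ->].
    by rewrite (Hop_omega k0 0 0 0 HT) !CCz ?addr0 //; rewrite mulr0 mul0r.
  apply: low hl _; move: hi i00 i0n; rewrite /n; set K := (k * j)%N; clearbody N; lia.
apply: (mulfI fn); rewrite mul; case: ifP => hc; last first.
  rewrite mulr0; have [hle|hgt] := leqP (i + l) j.
    rewrite iter_Hop_Yh_omega //; case: ifP => // /andP[/eqP e1 /eqP e2]; move: hc.
    by rewrite e2 eqxx andbT => /eqP; case; move: e1; rewrite /n e2 mulnDr; lia.
  apply: low omN _; apply/orP; right; apply/eqP; rewrite /n /N => e.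
  have : (k * j.+1 <= k * (i + l))%N by rewrite leq_mul2l hgt orbT.
  by rewrite mulnS; move: e; lia.
case/andP: hc => /eqP s0 /eqP ij; rewrite iter_Hop_Yh_omega ?ij // eqxx andbT s0 /n.
have -> : (2 * (k * j) == 0 + k * (j + j))%N by rewrite add0n mulnDr; lia.
by rewrite mulrA divff // mul1r.
Qed.

Lemma tp_D q f h : tp q (f + h) = tp q f + tp q h.
Proof.
have it n i u v : iter n (T i) (u + v) = iter n (T i) u + iter n (T i) v.
  by elim: n => //= n ->; rewrite (T_D HT).
by rewrite /tpair -psum_fD; apply: eq_psum => a b _; rewrite !it pevalD.
Qed.
Lemma tp_Z q c f : tp q (CC c * f) = c * tp q f.
Proof.
have it n i u : iter n (T i) (CC c * u) = CC c * iter n (T i) u.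
  by elim: n => //= n ->; rewrite (T_Z HT).
by rewrite /tpair -psum_fZ; apply: eq_psum => a b _; rewrite !it pevalM pevalC.
Qed.
Lemma tp_0 q : tp q 0 = 0.
Proof. by rewrite -[0](mul0r 0) -CC0 tp_Z mul0r. Qed.
Lemma tp_sum q (I : Type) (r : seq I) (P : pred I) (F : I -> P2) :
  tp q (\sum_(i <- r | P i) F i) = \sum_(i <- r | P i) tp q (F i).
Proof. exact: (big_morph _ (tp_D q) (tp_0 q)). Qed.
(** [rho] evaluated at the commuting operators is [T_1^2 + T_2^2 = 2 H]. *)
Lemma tp_rho q f : tp (rho * q) f = tp q (2 * H f).
Proof.
have ic n i l u : iter n (T i) (T l u) = T l (iter n (T i) u).
  by elim: n => //= n ->; rewrite (Top_comm VK).
have e2 : 2 * H f = T ord0 (T ord0 f) + T ord_max (T ord_max f).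
  rewrite /Hop mulrA -(CCnat R 2) -CCM divff ?pnatr_eq0 // CC1 mul1r //.
rewrite e2 tp_D /rho mulrDl !expr2 -!mulrA /tpair psumD !psumX1 !psumX2.
by congr (_ + _); apply: eq_psum => a b _; rewrite -?iterS ?iterSr ?ic.
Qed.

Section Kernel.
Variable d : nat -> nat -> R.
Hypothesis d_rec : forall N m, (k * m <= N)%N -> d N m =
  4 * (N.+1%:R - k%:R * m%:R) * (N.+1%:R + k%:R * m%:R + k%:R * la) * d N.+1 m + 4 * k%:R ^+ 2 * d N.+1 m.+1.
Hypothesis d_out : forall N m, (N < k * m)%N -> d N m = 0.
Hypothesis d_top : forall j, d (k * j) j = poch la (2 * j) / (2 ^+ (2 * (k * j)) * poch (k%:R * la) (2 * (k * j))).

(** The sum of [Yh] without signs, and with a second point [w]. Here the two lowering terms of [H]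
    add up instead of cancelling and produce the factor [rho(w)^k]; this makes combinations such as
    [Kh], the part of degree [2 N] of the kernel at [w], stable under [H]. *)
Definition Sh (m : nat) w : P2 := \sum_(i < m.+1)
  CC (ycoef m i * peval (ivar R k true) w ^+ i * peval (ivar R k false) w ^+ (m - i)) * om 0 i (m - i).
Definition Kh (N : nat) w : P2 := \sum_(m < N.+1)
  CC (d N m * peval rho w ^+ (N - k * m)) * (rho ^+ (N - k * m) * Sh m w).

Lemma Hop_rhoSh s m w : H (rho ^+ s * Sh m w) =
  CC (2 * s%:R * (s%:R + 2 * k%:R * m%:R + k%:R * la)) * (rho ^+ s.-1 * Sh m w) +
  CC (2 * k%:R ^+ 2 * peval rho w ^+ k) * (if m is m'.+1 then rho ^+ (s + k.-1) * Sh m' w else 0).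
Proof.
have rom s' i l : rho ^+ s' * om 0 i l = om s' i l by rewrite /omega expr0 mul1r mulrA.
have HS (F : nat -> R) (D : nat -> P2) n : H (\sum_(i < n) CC (F i) * D i) = \sum_(i < n) CC (F i) * H (D i).
  have := iter_Hop_sum VP gK 1 (index_enum 'I_n) xpredT (fun i => CC (F i) * D i).
  by rewrite /= => ->; apply: eq_bigr => i _; rewrite (Hop_Z HT).
set a := peval (ivar R k true) w; set b := peval (ivar R k false) w.
have rS s' m' : rho ^+ s' * Sh m' w = \sum_(i < m'.+1) CC (ycoef m' i * a ^+ i * b ^+ (m' - i)) * om s' i (m' - i).
  by rewrite /Sh mulr_sumr; apply: eq_bigr => i _; rewrite mulrCA rom.
have hM (c u v t : P2) : c * (u + v + t) = c * u + c * v + c * t by ring.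
rewrite rS (HS (fun i => ycoef m i * a ^+ i * b ^+ (m - i)) (fun i => om s i (m - i))).
under eq_bigr => i _.
  rewrite (Hop_omega k0 _ _ _ HT) hM.
  have -> : (i + (m - i) = m)%N by rewrite subnKC // -ltnS.
  over.
rewrite !big_split /= -addrA; congr (_ + _).
  by rewrite rS mulr_sumr; apply: eq_bigr => i _; ring.
have -> : peval rho w ^+ k = a + b by rewrite /a /b -pevalD ivar_sum pevalXn.
case: m => [|m].
  by rewrite !big_ord_recl !big_ord0 /= !(mulr0, mul0r, CC0) !addr0.
rewrite rS mulr_sumr.
have fz n : (n`!%:R : R) != 0 by rewrite pnatr_eq0 -lt0n fact_gt0.
have -> : \sum_(i < m.+2) CC (ycoef m.+1 i * a ^+ i * b ^+ (m.+1 - i)) *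
    (CC (2 * k%:R ^+ 2 * i%:R * (i%:R - 2^-1 + be)) * om (s + k.-1) i.-1 (m.+1 - i)) =
  \sum_(i < m.+1) CC (2 * k%:R ^+ 2 * a) * (CC (ycoef m i * a ^+ i * b ^+ (m - i)) * om (s + k.-1) i (m - i)).
  rewrite big_ord_recl [X in X + _](_ : _ = 0) ?add0r; last first.
    by rewrite [X in _ * X]CCz ?mulr0 //= mul0r.
  apply: eq_bigr => i _; rewrite !lift0 subSS [i.+1.-1]/= mulrA [RHS]mulrA -!CCM; congr (CC _ * _).
  have le : (i <= m)%N by rewrite -ltnS.
  rewrite /ycoef subSS factS natrM pochS exprS -(natr1 i).
  have h1 : (i%:R + 1 : R) != 0 by rewrite natr1 pnatr_eq0.
  have h2 : be + 2^-1 + i%:R != 0 by rewrite gt_eqF // ltr_wpDr.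
  have -> : i%:R + 1 - 2^-1 + be = be + 2^-1 + i%:R by field.
  have := poch_neq0 i be2; have := poch_neq0 (m - i) al2; have := fz i; have := fz (m - i)%N.
  move: (be + 2^-1 + i%:R) (i%:R + 1) h1 h2 => u v u0 v0 g1 g2 g3 g4; field.
  by rewrite g1 g2 g3 g4 u0 v0.
have -> : \sum_(i < m.+2) CC (ycoef m.+1 i * a ^+ i * b ^+ (m.+1 - i)) *
    (CC (2 * k%:R ^+ 2 * (m.+1 - i)%:R * ((m.+1 - i)%:R - 2^-1 + al)) * om (s + k.-1) i (m.+1 - i).-1) =
  \sum_(i < m.+1) CC (2 * k%:R ^+ 2 * b) * (CC (ycoef m i * a ^+ i * b ^+ (m - i)) * om (s + k.-1) i (m - i)).
  rewrite big_ord_recr /= subnn (@CCz _ (2 * k%:R ^+ 2 * 0%:R * _)); last by rewrite mulr0 mul0r.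
  rewrite mulr0 addr0; apply: eq_bigr => i _.
  have le : (i <= m)%N by rewrite -ltnS.
  rewrite subSn // [_.+1.-1]/= mulrA [RHS]mulrA -!CCM; congr (CC _ * _).
  rewrite /ycoef subSn // factS natrM pochS exprS -(natr1 (m - i)%N).
  set n := (m - i)%N.
  have h1 : (n%:R + 1 : R) != 0 by rewrite natr1 pnatr_eq0.
  have h2 : al + 2^-1 + n%:R != 0 by rewrite gt_eqF // ltr_wpDr.
  have -> : n%:R + 1 - 2^-1 + al = al + 2^-1 + n%:R by field.
  have := poch_neq0 i be2; have := poch_neq0 n al2; have := fz i; have := fz n.
  move: (al + 2^-1 + n%:R) (n%:R + 1) h1 h2 => u v u0 v0 g1 g2 g3 g4; field.
  by rewrite g1 g2 g3 g4 u0 v0.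
by rewrite -big_split /=; apply: eq_bigr => i _; rewrite -mulrDl -CCD -mulrDr.
Qed.

(** The recursion [d_rec] says exactly this: [2 H], the adjoint of [rho], must act on a reproducing
    kernel as multiplication by [rho(w)]. *)
Lemma Hop_Kh N w : 2 * H (Kh N w) = if N is N'.+1 then CC (peval rho w) * Kh N' w else 0.
Proof.
set r := peval rho w.
have HK M : H (Kh M w) = \sum_(m < M.+1) CC (d M m * r ^+ (M - k * m)) * H (rho ^+ (M - k * m) * Sh m w).
  have := iter_Hop_sum VP gK 1 (index_enum 'I_M.+1) xpredT (fun m : 'I_M.+1 => CC (d M m * r ^+ (M - k * m)) * (rho ^+ (M - k * m) * Sh m w)).
  by rewrite /= => ->; apply: eq_bigr => m _; rewrite (Hop_Z HT).
rewrite HK; under eq_bigr => m _ do rewrite Hop_rhoSh mulrDr.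
rewrite big_split /=.
case: N => [|N].
  by rewrite !big_ord_recl !big_ord0 /= muln0 subnn !(mulr0, mul0r, CC0, addr0).
set S1 := \sum_(_ < _) _; set S2 := \sum_(_ < _) _.
have -> : S1 = \sum_(m < N.+1) CC (d N.+1 m * (2 * (N.+1%:R - k%:R * m%:R) * (N.+1%:R + k%:R * m%:R + k%:R * la)) *
     (if (k * m <= N)%N then r * r ^+ (N - k * m) else 0)) * (rho ^+ (N - k * m) * Sh m w).
  rewrite /S1 big_ord_recr /= [X in _ + X](_ : _ = 0) ?addr0; last first.
    have -> : (N.+1 - k * N.+1 = 0)%N by apply/eqP; rewrite subn_eq0 leq_pmull.
    by rewrite [2 * 0]mulr0 mul0r CC0 mul0r mulr0.
  apply: eq_bigr => m _; case: leqP => h.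
    rewrite subSn // exprS /= mulrA -CCM; congr (CC _ * _).
    rewrite -(natr1 (N - k * m)%N) natrB // natrM -(natr1 N); ring.
  rewrite mulr0 CC0 mul0r; have -> : (N.+1 - k * m = 0)%N by apply/eqP; rewrite subn_eq0.
  by rewrite [2 * 0]mulr0 mul0r CC0 mul0r mulr0.
have -> : S2 = \sum_(m < N.+1) CC (d N.+1 m.+1 * (2 * k%:R ^+ 2) * (if (k * m <= N)%N then r * r ^+ (N - k * m) else 0)) * (rho ^+ (N - k * m) * Sh m w).
  rewrite /S2 big_ord_recl !mulr0 add0r; apply: eq_bigr => m _.
  rewrite /= /bump leq0n add1n.
  have [h|h] := leqP (k * m.+1) N.+1; last first.
    by rewrite d_out // [LHS]CCz ?[RHS]CCz ?mul0r.
  have h' : (k * m <= N)%N.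
    by have := h; rewrite mulnS; move: k0; set K := (k * m)%N; lia.
  rewrite h' mulrA -CCM.
  have -> : (N.+1 - k * m.+1 + k.-1 = N - k * m)%N.
    by move: h; rewrite mulnS; move: k0; set K := (k * m)%N; lia.
  congr (CC _ * _).
  transitivity (d N.+1 m.+1 * (2 * k%:R ^+ 2) * (r ^+ (N.+1 - k * m.+1) * r ^+ k)); first by ring.
  rewrite -exprD -exprS; congr (_ * _ ^+ _).
  by move: h; rewrite mulnS; move: k0; set K := (k * m)%N; lia.
rewrite -big_split mulr_sumr /Kh mulr_sumr /=; apply: eq_bigr => m _.
rewrite -mulrDl -CCD !mulrA -(CCnat R 2) -!CCM; congr (CC _ * _ * _).
case: leqP => h; last by rewrite !mulr0 addr0 mulr0 d_out // mul0r mulr0.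
by rewrite (d_rec h); ring.
Qed.

(** By [tpair_Yh] the only surviving term has [m = j] and no factor [rho], which forces [N = k j];
    [d_out] removes the terms where [N - k m] is 0 only by truncation. [d_top] is the normalization
    that makes the remaining constant equal to 1. *)
Lemma tp_Yh_Kh j N w : tp (Yh j) (Kh N w) = if N == (k * j)%N then peval (Yh j) w else 0.
Proof.
rewrite /Kh tp_sum.
under eq_bigr => m _.
  rewrite tp_Z /Sh [rho ^+ _ * _]mulr_sumr tp_sum.
  under eq_bigr => i _.
    have -> : rho ^+ (N - k * m) * (CC (ycoef m i * peval (ivar R k true) w ^+ i * peval (ivar R k false) w ^+ (m - i)) * om 0 i (m - i)) =
       CC (ycoef m i * peval (ivar R k true) w ^+ i * peval (ivar R k false) w ^+ (m - i)) * om (N - k * m) i (m - i).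
      by rewrite /omega expr0 mul1r; ring.
    rewrite tp_Z tpair_Yh.
    have -> : (i + (m - i) = m)%N by rewrite subnKC // -ltnS.
    over.
  over.
case: eqP => [->|ne]; last first.
  rewrite big1 // => m _; case: (boolP ((N - k * m == 0)%N && (m == j :> nat))) => [|_].
    case/andP => h /eqP hm; rewrite d_out ?mul0r // hm ltn_neqAle; apply/andP; split; first by apply/eqP.
    by rewrite -subn_eq0 -hm.
  by rewrite big1 ?mulr0 // => i _; rewrite mulr0.
have hj : (j < (k * j).+1)%N by rewrite ltnS leq_pmull.
rewrite (bigD1 (Ordinal hj)) //= [X in _ + X]big1 ?addr0; last first.
  move=> m; rewrite -val_eqE /= => /negbTE hm; rewrite hm andbF.
  by rewrite big1 ?mulr0 // => i _; rewrite mulr0.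
rewrite subnn eqxx /= expr0 mulr1 d_top /Yh peval_sum mulr_sumr; apply: eq_bigr => i _.
rewrite pevalM pevalC /omega expr0 mul1r pevalM !pevalXn.
set A := peval (ivar R k true) w ^+ i; set B := peval (ivar R k false) w ^+ (j - i).
set n := (2 * (k * j))%N.
have cn : cst n = n`!%:R * 2 ^+ n * poch (k%:R * la + 1) n.
  rewrite /cst /poch; elim: (n) => [|N' IH]; first by rewrite !big_ord0 fact0 !mulr1.
  by rewrite !big_ord_recr /= IH factS natrM exprS -(natr1 N'); ring.
have kla : 0 < k%:R * la by rewrite mulr_gt0 // ltr0n.
have sh (a : R) M : a != 0 -> poch (a + 1) M = poch a M * (a + M%:R) / a.
  by move=> a0; rewrite -pochS pochSl; field.
have -> : (j + j = 2 * j)%N by rewrite mul2n addnn.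
have kln : k%:R * la != 0 by rewrite gt_eqF.
have ln : la != 0 by rewrite gt_eqF.
rewrite eqxx cn (sh _ _ kln) (sh _ _ ln).
have fn : (n`!%:R : R) != 0 by rewrite pnatr_eq0 -lt0n fact_gt0.
have p1 := poch_neq0 (2 * j) la0; have p2 := poch_neq0 n kla.
have p3 : (2 : R) ^+ n != 0 by rewrite expf_neq0 // pnatr_eq0.
have p4 : la + (2 * j)%:R != 0 by rewrite gt_eqF // ltr_wpDr.
have kn : (k%:R : R) != 0 by rewrite pnatr_eq0 -lt0n.
have e : k%:R * la + n%:R = k%:R * (la + (2 * j)%:R) by rewrite /n mulnCA natrM; ring.
rewrite e.
move: (la + (2 * j)%:R) (poch la (2 * j)) (poch (k%:R * la) n) (2 ^+ n) p1 p2 p3 p4 => u v t x v0 t0 x0 u0.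
move: (la) ln => l0 ln; field.
by rewrite kn fn u0 v0 t0 x0 ln.
Qed.

Lemma tp_rhoYh_Kh s j N w : tp (rho ^+ s * Yh j) (Kh N w) =
  if N == (s + k * j)%N then peval (rho ^+ s * Yh j) w else 0.
Proof.
elim: s N => [|s IH] N; first by rewrite expr0 mul1r tp_Yh_Kh add0n.
rewrite exprS -mulrA tp_rho Hop_Kh; case: N => [|N]; first by rewrite tp_0.
by rewrite tp_Z IH addSn eqSS (pevalM rho); case: eqP => _ //; rewrite mulr0.
Qed.
End Kernel.
End Reproducing.

(** * Divisibility by [rho], tested at an isotropic point *)

Section IsotropicValue.
Variable R : realType.
Local Notation P2 := {poly {poly R}}.
Implicit Types (p q f h : P2) (x w : R * R).
Local Notation X1 := (X1 R).
Local Notation X2 := (X2 R).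
Local Notation rho := (rho R).

(* [cev p] is the value of [p] at the isotropic point [(1, i)], where [rho] vanishes. *)
Definition ipow (b : nat) : R[i] := Complex 0 1 ^+ b.
Definition cev p : R[i] := Complex (psum p (fun _ b => Cre (ipow b))) (psum p (fun _ b => Cim (ipow b))).
Definition cjg (z : R[i]) : R[i] := Complex (Cre z) (- Cim z).

Lemma cjgM z z' : cjg (z * z') = cjg z * cjg z'.
Proof.
by case: z => a b; case: z' => c e; apply/eqP; rewrite eq_complex /=; apply/andP; split; apply/eqP; ring.
Qed.
Lemma cevD p q : cev (p + q) = cev p + cev q.
Proof. by rewrite /cev !psumD; apply/eqP; rewrite eq_complex /= !eqxx. Qed.
Lemma cevZ c p : cev (CC c * p) = Complex c 0 * cev p.
Proof.
by rewrite /cev !psumZ; apply/eqP; rewrite eq_complex /=; apply/andP; split; apply/eqP; ring.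
Qed.
Lemma cevX1 p : cev (X1 * p) = cev p.
Proof. by rewrite /cev !psumX1. Qed.
Lemma cevX2 p : cev (X2 * p) = Complex 0 1 * cev p.
Proof.
rewrite /cev !psumX2; apply/eqP; rewrite eq_complex /=.
have e (b : nat) : Cre (ipow b.+1) = - Cim (ipow b) /\ Cim (ipow b.+1) = Cre (ipow b).
  by rewrite /ipow exprS; case: (_ ^+ b) => u v /=; split; ring.
have Nf (f : nat -> nat -> R) : psum p (fun a b => - f a b) = - psum p f.
  by rewrite -mulN1r -psum_fZ; apply: eq_psum => a b _; rewrite mulN1r.
apply/andP; split; apply/eqP.
  rewrite mul0r mul1r sub0r -Nf; apply: eq_psum => a b _; by case: (e b).
by rewrite mul0r mul1r add0r; apply: eq_psum => a b _; case: (e b).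
Qed.
Lemma cev_mono a b : cev (X1 ^+ a * X2 ^+ b) = ipow b.
Proof. by rewrite /cev !psum_mono; case: (ipow b). Qed.
Lemma cevM p q : cev (p * q) = cev p * cev q.
Proof.
elim/poly2_lin_ind: p => [p r hp hr|c p hp|a b].
- by rewrite mulrDl !cevD hp hr mulrDl.
- by rewrite -mulrA !cevZ hp mulrA.
rewrite cev_mono -mulrA; elim: a => [|a IH]; last by rewrite exprS -mulrA cevX1 IH.
rewrite expr0 mul1r; elim: b => [|b IH]; first by rewrite expr0 !mul1r.
by rewrite exprS -mulrA cevX2 IH mulrA -exprS.
Qed.
Lemma cev1 : cev 1 = 1.
Proof. by have := cev_mono 0 0; rewrite !expr0 mulr1. Qed.
Lemma cevXn p n : cev (p ^+ n) = cev p ^+ n.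
Proof. by elim: n => [|n IH]; rewrite ?expr0 ?cev1 // !exprS cevM IH. Qed.
Lemma cev_X1 : cev X1 = 1.
Proof. by have := cev_mono 1 0; rewrite expr0 mulr1. Qed.
Lemma cev_X2 : cev X2 = Complex 0 1.
Proof. by have := cev_mono 0 1; rewrite expr0 mul1r. Qed.
Lemma cevC c : cev (CC c) = Complex c 0.
Proof. by rewrite -[CC c]mulr1 cevZ cev1 mulr1. Qed.
Lemma cev0 : cev 0 = 0.
Proof. by rewrite -CC0 cevC. Qed.
Lemma cev_sum (I : Type) (r : seq I) (P : pred I) (F : I -> P2) :
  cev (\sum_(i <- r | P i) F i) = \sum_(i <- r | P i) cev (F i).
Proof. exact: (big_morph _ cevD cev0). Qed.
Lemma cev_rho : cev rho = 0.
Proof.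
rewrite /rho cevD !cevXn cev_X1 cev_X2; apply/eqP; rewrite eq_complex /=.
by apply/andP; split; apply/eqP; ring.
Qed.
Lemma cevB p q : cev (p - q) = cev p - cev q.
Proof. by have -> : - q = CC (-1) * q by [rewrite CCN CC1 mulN1r]; rewrite cevD cevZ; apply/eqP; rewrite eq_complex /=; apply/andP; split; apply/eqP; ring. Qed.
Lemma cev_zpow n : cev (zre R n.+1) = Complex (2 ^+ n) 0 /\ cev (zim R n.+1) = Complex 0 (2 ^+ n).
Proof.
elim: n => [|n [IH1 IH2]].
  by rewrite zreS zimS /zre /zim /= !mulr0 !mulr1 subr0 add0r cev_X1 cev_X2 expr0.
rewrite zreS zimS cevB cevD !cevM cev_X1 cev_X2 IH1 IH2 exprS.
by split; apply/eqP; rewrite eq_complex /=; apply/andP; split; apply/eqP; ring.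
Qed.

(** Reduction modulo [rho] by [X2^2 = rho - X1^2], which lowers the exponent of [X2] two by two down
    to 0 or 1. *)
Lemma isotropic_red a b : exists q c d, homog (a + b - 2) q /\
  X1 ^+ a * X2 ^+ b = rho * q + CC c * X1 ^+ (a + b) + CC d * (X1 ^+ (a + b).-1 * X2) /\ ((a + b)%N = 0%N -> d = 0).
Proof.
have [n] := ubnP b; elim: n a b => // n IH a [|[|b]] hb.
- exists 0, 1, 0; split; first exact: homog0; split=> //.
  by rewrite expr0 CC1 CC0 addn0 mulr0 mul0r addr0 add0r mulr1 mul1r.
- exists 0, 0, 1; split; first exact: homog0; split; last by rewrite addn1.
  by rewrite addn1 /= CC1 CC0 !(mulr0, mul0r) !add0r mul1r expr1.
have hb' : (b < n)%N by move: hb; lia.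
have [q [c [d [hq [e hd]]]]] := IH a.+2 b hb'.
exists (X1 ^+ a * X2 ^+ b - q), (- c), (- d); split.
  have -> : (a + b.+2 - 2 = a + b)%N by rewrite !addnS subn2.
  rewrite !addSn subn2 /= in hq; apply: homogD; first exact: homog_mono.
  have -> : - q = CC (-1) * q by rewrite CCN CC1 mulN1r.
  exact: homogZ.
split; last by rewrite !addnS.
have -> : (a + b.+2 = a.+2 + b)%N by rewrite !addnS !addSn.
have -> : X1 ^+ a * X2 ^+ b.+2 = rho * (X1 ^+ a * X2 ^+ b) - X1 ^+ a.+2 * X2 ^+ b.
  by rewrite /rho !exprS; ring.
by rewrite e !CCN; ring.
Qed.

Definition hcomp n p : P2 := \sum_(a < n.+1) CC (pcoef p a (n - a)) * (X1 ^+ a * X2 ^+ (n - a)).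
Lemma pcoef_hcomp n p a b : pcoef (hcomp n p) a b = if (a + b == n)%N then pcoef p a b else 0.
Proof.
rewrite /hcomp pcoef_sum.
have [e|ne] := eqVneq (a + b)%N n.
  have ha : (a < n.+1)%N by rewrite ltnS -e leq_addr.
  have hb : (n - a)%N = b by rewrite -e addKn.
  rewrite (bigD1 (Ordinal ha)) //= pcoefZ pcoef_mono hb !eqxx mulr1 big1 ?addr0 // => i.
  by rewrite -val_eqE /= eq_sym => /negbTE hi; rewrite pcoefZ pcoef_mono hi mulr0.
rewrite big1 // => i _; rewrite pcoefZ pcoef_mono.
case: eqP => [ea|_]; last by rewrite mulr0.
case: eqP => [eb|_]; last by rewrite mulr0.
by move: ne; rewrite ea eb subnKC ?eqxx // -ltnS.
Qed.
Lemma homog_hcomp n p : homog n (hcomp n p).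
Proof. by move=> a b /negbTE h; rewrite pcoef_hcomp h. Qed.
Lemma hcomp_id n p : homog n p -> hcomp n p = p.
Proof. by move=> hp; apply: pcoef_inj => a b; rewrite pcoef_hcomp; case: ifP => // /negbT /hp ->. Qed.
Lemma hcomp_sum p : exists M, p = \sum_(n < M) hcomp n p.
Proof.
have [N hN] := pcoef_eq0 p; exists (N + N)%N; apply: pcoef_inj => a b; rewrite pcoef_sum.
have [h|h] := ltnP (a + b) (N + N).
  rewrite (bigD1 (Ordinal h)) //= pcoef_hcomp eqxx big1 ?addr0 // => i.
  by rewrite -val_eqE /= pcoef_hcomp eq_sym => /negbTE ->.
rewrite hN; last first.
  case: (leqP N a) => //= ha; rewrite leqNgt; apply/negP => hb.
  by move: h; rewrite leqNgt => /negP; apply; rewrite -addSn leq_add // ltnW.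
by rewrite big1 // => i _; rewrite pcoef_hcomp gtn_eqF // (leq_trans (ltn_ord i)).
Qed.

Lemma homog_isotropic n p : homog n p -> exists q c d, homog (n - 2) q /\
  p = rho * q + CC c * X1 ^+ n + CC d * (X1 ^+ n.-1 * X2) /\ (n = 0%N -> d = 0).
Proof.
move=> /hcomp_id <-; rewrite /hcomp; elim/big_rec: _ => [|i f _ [q [c [d [hq [-> hd]]]]]].
  exists 0, 0, 0; split; first exact: homog0; split=> //; by rewrite CC0 !(mulr0, mul0r) !addr0.
have le : (i <= n)%N by rewrite -ltnS.
have [q' [c' [d' [hq' [-> hd']]]]] := isotropic_red i (n - i).
rewrite subnKC // in hq' hd' *; set e := pcoef p i (n - i).
exists (CC e * q' + q), (e * c' + c), (e * d' + d); split.
  by apply: homogD => //; exact: homogZ.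
split; last by move=> n0; rewrite hd' // hd // mulr0 addr0.
by rewrite !CCD !CCM; ring.
Qed.

(** The remainder [c X1^n + d X1^(n - 1) X2] has isotropic value [c + i d], so that it is 0 as soon
    as this value is. *)
Lemma rho_dvd n p : homog n p -> cev p = 0 -> exists q, homog (n - 2) q /\ p = rho * q.
Proof.
move=> hp h; have [q [c [d [hq [e hd]]]]] := homog_isotropic hp; exists q; split=> //.
move: h; rewrite e !cevD !cevZ !cevM !cevXn cev_rho cev_X1 cev_X2 !expr1n !mul1r mul0r add0r => /eqP.
rewrite eq_complex /= !(mulr0, mul0r, mulr1, subr0, addr0, add0r) => /andP[/eqP -> /eqP ->].
by rewrite CC0 !mul0r !addr0.
Qed.

(** The reflection takes [(1, i)] to [e^(i t) (1, -i)], with [t] its angle, and a real polynomial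
    has conjugate values at [(1, i)] and [(1, -i)]. *)
Lemma cev_reflP k j n p : homog n p -> cev (reflP k j p) = cis (n%:R * ang R k j) * cjg (cev p).
Proof.
move=> hp; set t := ang R k j.
have cjD z z' : cjg (z + z') = cjg z + cjg z'.
  by case: z => a b; case: z' => c e; apply/eqP; rewrite eq_complex /=; apply/andP; split; apply/eqP; ring.
rewrite -[in LHS](hcomp_id hp) -[in RHS](hcomp_id hp) /hcomp.
have r0 : reflP k j 0 = 0 :> P2 by rewrite -CC0 reflPC.
have c0 : cjg 0 = 0 by rewrite /cjg /= oppr0.
rewrite (big_morph _ (reflPD k j) r0) !cev_sum (big_morph _ cjD c0) mulr_sumr.
apply: eq_bigr => i _; rewrite reflPM reflPC !cevZ cev_mono.
have -> : cjg (Complex (pcoef p i (n - i)) 0 * ipow (n - i)) = Complex (pcoef p i (n - i)) 0 * cjg (ipow (n - i)).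
  by rewrite cjgM /cjg /= oppr0.
rewrite mulrCA; congr (_ * _).
have -> : reflP k j (X1 ^+ i * X2 ^+ (n - i)) =
   (CC (cos t) * X1 + CC (sin t) * X2) ^+ i * (CC (sin t) * X1 - CC (cos t) * X2) ^+ (n - i).
  apply: peval_inj => x; rewrite peval_reflP !pevalE /reflI /= -/t.
  by rewrite ![_ * cos t]mulrC ![_ * sin t]mulrC.
rewrite cevM !cevXn cevB cevD !cevZ cev_X1 cev_X2.
have -> : Complex (cos t) 0 * 1 + Complex (sin t) 0 * Complex 0 1 = cis t.
  by apply/eqP; rewrite eq_complex /=; apply/andP; split; apply/eqP; ring.
have -> : Complex (sin t) 0 * 1 - Complex (cos t) 0 * Complex 0 1 = cis t * Complex 0 (-1).
  by apply/eqP; rewrite eq_complex /=; apply/andP; split; apply/eqP; ring.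
rewrite exprMn mulrA -exprD subnKC -1?ltnS // cisX; congr (_ * _).
rewrite /ipow; elim: (n - i)%N => [|m IHm]; first by rewrite !expr0 /cjg /= oppr0.
by rewrite !exprS cjgM IHm; congr (_ * _); rewrite /cjg.
Qed.
End IsotropicValue.

(** * The invariants as a span, and [V] on invariants *)

Section InvariantSpan.
Variables (R : realType) (k : nat) (al be : R).
Hypotheses (k0 : (0 < k)%N) (al0 : 0 < al) (be0 : 0 < be).
Local Notation P2 := {poly {poly R}}.
Implicit Types (p q f h : P2) (x w : R * R).
Local Notation rho := (rho R).
Local Notation om := (omega R k).
Local Notation Yh := (Yh k al be).

Lemma cev_om i l : cev (om 0 i l) = Complex ((-1) ^+ l * 4 ^+ (k.-1 * (i + l))) 0.
Proof.
rewrite /omega expr0 mul1r cevM !cevXn.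
have := cev_zpow R k.-1; rewrite prednK // /zpar => -[-> ->].
have h1 : Complex (2 ^+ k.-1) 0 ^+ 2 = Complex (4 ^+ k.-1) 0 :> R[i].
  have -> : (4 : R) = 2 * 2 by ring.
  by rewrite exprMn; apply/eqP; rewrite eq_complex /=; apply/andP; split; apply/eqP; ring.
have h2 : Complex 0 (2 ^+ k.-1) ^+ 2 = Complex (- 4 ^+ k.-1) 0 :> R[i].
  have -> : (4 : R) = 2 * 2 by ring.
  by rewrite exprMn; apply/eqP; rewrite eq_complex /=; apply/andP; split; apply/eqP; ring.
have hX (c : R) n : Complex c 0 ^+ n = Complex (c ^+ n) 0.
  elim: n => [//|n IH]; rewrite exprS IH exprS; apply/eqP; rewrite eq_complex /=.
  by apply/andP; split; apply/eqP; ring.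
rewrite h1 h2 !hX mulnDr exprD !exprM (exprNn (4 ^+ k.-1)).
by apply/eqP; rewrite eq_complex /=; apply/andP; split; apply/eqP; ring.
Qed.
(** The value of [(Im z^k)^2] at the isotropic point is negative; the resulting sign [(-1)^l]
    cancels the one in [Yh], and all terms of the sum are positive. *)
Lemma cev_Yh j : exists2 c : R, c != 0 & cev (Yh j) = Complex c 0.
Proof.
exists (\sum_(i < j.+1) ycoef al be j i * 4 ^+ (k.-1 * j)).
  rewrite gt_eqF // big_ord_recl ltr_pwDl //.
    rewrite mulr_gt0 ?exprn_gt0 // /ycoef invr_gt0 !mulr_gt0 ?ltr0n ?fact_gt0 //;
    by apply: poch_gt0; rewrite addr_gt0 // invr_gt0.
  apply: sumr_ge0 => i _; rewrite mulr_ge0 ?exprn_ge0 // /ycoef invr_ge0 !mulr_ge0 //;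
  by apply: ltW; apply: poch_gt0; rewrite addr_gt0 // invr_gt0.
rewrite /Yh cev_sum.
have hs (F : 'I_j.+1 -> R) : \sum_(i < j.+1) Complex (F i) 0 = Complex (\sum_(i < j.+1) F i) 0.
  by elim/big_rec2: _ => [//|i u v _ ->]; apply/eqP; rewrite eq_complex /= addr0 !eqxx.
rewrite -hs; apply: eq_bigr => i _; rewrite cevZ cev_om subnKC -1?ltnS //.
have := sqrr_sign R (odd (j - i)); rewrite signr_odd => h.
apply/eqP; rewrite eq_complex /=; apply/andP; split; apply/eqP; last by ring.
transitivity ((-1) ^+ (j - i) ^+ 2 * (ycoef al be j i * 4 ^+ (k.-1 * j))); first by ring.
by rewrite h mul1r.
Qed.
Lemma Yh_dinv j : dinv k (Yh j).
Proof. by apply: dinv_sum => i _; apply: dinv_Z; exact: omega_dinv. Qed.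

Definition invset : P2 -> Prop := fun f => exists s j, f = rho ^+ s * Yh j.

Lemma rho_neq0 : rho != 0.
Proof.
apply/eqP => /(congr1 (fun p => peval p (1, 0))); rewrite peval_rho /= peval0 expr1n expr0n addr0.
by move/eqP; rewrite oner_eq0.
Qed.
(** Induction on the degree of a homogeneous invariant. The reflection of index 0 forces its
    isotropic value to be real and, if the value is not 0, the reflection of index 1 forces the
    degree to be a multiple of [2 k]. Then a multiple of [Yh j] can be subtracted to make the value
    0, and the rest is [rho] times an invariant. *)
Lemma dinv_span p : dinv k p -> lspan invset p.
Proof.
move=> hp.
have hom n q : homog n q -> dinv k q -> lspan invset q.
  have [N] := ubnP n; elim: N n q => // N IH n q hN hq hd.
  have rq j : (j < 2 * k)%N -> reflP k j q = q.
    by move=> hj; apply: peval_inj => x; rewrite peval_reflP hd.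
  have step r : homog n r -> dinv k r -> cev r = 0 -> lspan invset r.
    move=> hr hdr hc; have [f [hf e]] := rho_dvd hr hc; rewrite e.
    have hdf : dinv k f.
      have h j : (j < 2 * k)%N -> reflP k j f = f.
        move=> hj; apply: (mulfI rho_neq0); rewrite -e.
        have <- : reflP k j r = r by apply: peval_inj => x; rewrite peval_reflP hdr.
        rewrite e reflPM; congr (_ * _).
        by apply: peval_inj => x; rewrite peval_reflP rho_refl.
      by move=> j hj x; rewrite -peval_reflP h.
    have hl : lspan invset f.
      (* Below degree 2 the truncated [n - 2] gives no descent; there a multiple of [rho] that is
         homogeneous of degree [n] must be 0. *)
      have [n2|n2] := ltnP n 2; last by apply: (IH (n - 2)%N) => //; move: hN n2; lia.
      have : f = 0.
        have h2 := homogM (@homog_rho R) hf; rewrite -e in h2.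
        suff r0 : r = 0 by apply: (mulfI rho_neq0); rewrite mulr0 -e.
        apply: pcoef_inj => a b; rewrite pcoef0.
        have [hab|/h2 //] := eqVneq (a + b)%N (2 + (n - 2))%N.
        by apply: hr; rewrite hab; move: n2; case: (n) => [|[|]].
      by move=> ->; exact: lspan0.
    apply: (hl (fun f => lspan invset (rho * f))) => [|c u v hu hv|_ [s [j ->]]].
    - by rewrite mulr0; exact: lspan0.
    - by rewrite mulrDr mulrCA; exact: lspanZD.
    - by apply: lspan_in; exists s.+1, j; rewrite exprS mulrA.
  have h2k : (0 < 2 * k)%N by rewrite muln_gt0.
  have h2k1 : (1 < 2 * k)%N by rewrite mul2n -addnn; case: (k) k0 => // m _; rewrite addnS.
  have im0 : Cim (cev q) = 0.
    have := cev_reflP k 0 hq; rewrite rq // /ang !mul0r mulr0 cis0 mul1r.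
    case: (cev q) => u v /eqP; rewrite eq_complex /= => /andP[_ /eqP h].
    by rewrite /=; move: h => /=; lra.
  have cq : cjg (cev q) = cev q.
    by move: im0; case: (cev q) => u v /= ->; rewrite /cjg /= oppr0.
  have := cev_reflP k 1 hq; rewrite rq // cq.
  have [z0 _|z0 h] := eqVneq (cev q) 0; first exact: step.
  have kR : (k%:R : R) != 0 by rewrite pnatr_eq0 -lt0n.
  have h1 : cis (n%:R * ang R k 1) = 1 by apply: (mulIf z0); rewrite mul1r -h.
  have hn : n = (2 * k * (n %/ (2 * k)))%N.
    rewrite mulnC {1}(divn_eq n (2 * k)); set r := (n %% (2 * k))%N.
    suff -> : r = 0%N by rewrite addn0.
    apply/eqP; apply: contraT; rewrite -lt0n => r0.
    have hr : cis (r%:R * ang R k 1) = 1.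
      rewrite -h1 [in RHS](divn_eq n (2 * k)) natrD mulrDl cisD.
      have -> : (n %/ (2 * k) * (2 * k))%:R * ang R k 1 = (2 * (n %/ (2 * k)))%:R * pi.
        by rewrite /ang !natrM; field.
      by rewrite cis_npi exprM sqrrN !expr1n mul1r.
    have lt : (r < 2 * k)%N by rewrite ltn_pmod.
    have p0 := pi_gt0 R.
    exfalso; apply: (cis_eq1 _ _ hr).
      by rewrite /ang mul1r mulr_gt0 ?ltr0n // divr_gt0 // ltr0n.
    rewrite /ang mul1r mulrA ltr_pdivrMr ?ltr0n // -mulr_natl.
    have : r%:R * pi < (2 * k%:R) * pi :> R by rewrite ltr_pM2r // -natrM ltr_nat.
    lra.
  set j := (n %/ (2 * k))%N in hn; have [c c0 hc] := cev_Yh j.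
  have hY : homog n (Yh j) by rewrite hn -mulnA; exact: homog_Yh.
  pose a := Cre (cev q) / c.
  have e : q = CC a * Yh j + (q - CC a * Yh j) by ring.
  have NZ : - (CC a * Yh j) = CC (- a) * Yh j by rewrite CCN mulNr.
  rewrite e; apply: lspanZD; first by apply: lspan_in; exists 0%N, j; rewrite expr0 mul1r.
  rewrite NZ; apply: step.
  - by apply: homogD => //; exact: homogZ.
  - by apply: dinv_D => //; apply: dinv_Z; exact: Yh_dinv.
  rewrite cevD cevZ hc /a; move: im0; case: (cev q) => u v /= ->.
  by apply/eqP; rewrite eq_complex /=; apply/andP; split; apply/eqP; field.
(* Reflections preserve degrees, so the homogeneous components of an invariant are invariant. *)
have [M e] := hcomp_sum p; rewrite e; apply: lspan_sum => n _; apply: (hom n).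
  exact: homog_hcomp.
move=> j hj x.
suff h (i : 'I_M) : reflP k j (hcomp i p) = hcomp i p by rewrite -peval_reflP h.
have homr m f : homog m f -> homog m (reflP k j f).
  move=> /homogP hf; apply/homogP => t y; rewrite !peval_reflP -hf; congr peval.
  by rewrite /reflI /=; congr pair; ring.
have er : reflP k j p = p by apply: peval_inj => y; rewrite peval_reflP hp.
have es : \sum_(m < M) reflP k j (hcomp m p) = \sum_(m < M) hcomp m p.
  rewrite -e -[in RHS]er [in RHS]e.
  have r0 : reflP k j 0 = 0 :> P2 by rewrite -CC0 reflPC.
  by rewrite (big_morph _ (reflPD k j) r0).
apply: pcoef_inj => a b; have hs := congr1 (fun f => pcoef f a b) es; rewrite /= !pcoef_sum in hs.
have [hab|hab] := eqVneq (a + b)%N i; last first.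
  by rewrite (homr _ _ (@homog_hcomp R i p) a b hab) (@homog_hcomp R i p a b hab).
move: hs; rewrite (bigD1 i) //= [in RHS](bigD1 i) //= big1 ?addr0; last first.
  move=> m hm; apply: (homr _ _ (@homog_hcomp R m p)); rewrite hab; apply: contra hm => /eqP hm.
  by apply/eqP/val_inj.
rewrite big1 ?addr0 // => m hm; apply: (@homog_hcomp R m p); rewrite hab.
by apply: contra hm => /eqP hm; apply/eqP/val_inj.
Qed.

Variables (V : P2 -> P2).
Hypothesis VP : dunkl_intertwiner k al be V.
Variable d : nat -> nat -> R.
Local Notation la := (al + be).
Hypothesis d_rec : forall N m, (k * m <= N)%N -> d N m =
  4 * (N.+1%:R - k%:R * m%:R) * (N.+1%:R + k%:R * m%:R + k%:R * la) * d N.+1 m + 4 * k%:R ^+ 2 * d N.+1 m.+1.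
Hypothesis d_out : forall N m, (N < k * m)%N -> d N m = 0.
Hypothesis d_top : forall j, d (k * j) j = poch la (2 * j) / (2 ^+ (2 * (k * j)) * poch (k%:R * la) (2 * (k * j))).

(** The kernel truncated at degree [2 M], with the ordinary Fischer product against [p] taken in one
    of its two points. *)
Definition Wh (M : nat) p : P2 := \sum_(N < M) \sum_(m < N.+1) \sum_(i < m.+1)
  CC (d N m * ycoef al be m i * fpair p (om (N - k * m) i (m - i))) * om (N - k * m) i (m - i).

Lemma V_dihedral p M : dinv k p -> (forall a b, (2 * M <= a + b)%N -> pcoef p a b = 0) -> V p = Wh M p.
Proof.
move=> hp hM.
have [g VK gK] : bijective V by case: VP.
have tpl f f' q : tpair V g (f + f') q = tpair V g f q + tpair V g f' q by exact: psumD.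
have key q : lspan invset q -> tpair V g q (Wh M p) = fpair q p.
  move=> hq; apply: (hq (fun q => tpair V g q (Wh M p) = fpair q p)) => [|c u v hu hv|_ [s [j ->]]].
  - by rewrite fpairC fpair0r /tpair psum0.
  - by rewrite tpl fpairDl fpairZl -hu -hv /tpair psumZ.
  set q0 := rho ^+ s * Yh j.
  (* By symmetry of the kernel, [q0] can be paired first: [Q] is [q0] as reproduced by the truncated
     kernel. It equals [q0], or 0 when the degree of [q0] is at least [2 M], where [p] has no
     coefficients. *)
  pose Q : P2 := \sum_(N < M) \sum_(m < N.+1) \sum_(i < m.+1)
    CC (d N m * ycoef al be m i * tpair V g q0 (om (N - k * m) i (m - i))) * om (N - k * m) i (m - i).
  have -> : tpair V g q0 (Wh M p) = fpair p Q.
    rewrite /Wh /Q (tp_sum VP gK) fpair_sumr; apply: eq_bigr => N _.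
    rewrite (tp_sum VP gK) fpair_sumr; apply: eq_bigr => m _.
    rewrite (tp_sum VP gK) fpair_sumr; apply: eq_bigr => i _.
    by rewrite (tp_Z VP gK) fpairZr; ring.
  have hQ : Q = if (s + k * j < M)%N then q0 else 0.
    apply: peval_inj => w.
    have -> : peval Q w = \sum_(N < M) tpair V g q0 (Kh k al be d N w).
      rewrite /Q peval_sum; apply: eq_bigr => N _; rewrite peval_sum /Kh (tp_sum VP gK); apply: eq_bigr => m _.
      rewrite peval_sum (tp_Z VP gK) /Sh [_ ^+ _ * _]mulr_sumr (tp_sum VP gK) mulr_sumr; apply: eq_bigr => i _.
      rewrite [rho ^+ _ * (_ * _)]mulrCA (tp_Z VP gK) pevalM pevalC.
      have -> : rho ^+ (N - k * m) * om 0 i (m - i) = om (N - k * m) i (m - i) by rewrite /omega expr0 mul1r mulrA.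
      by rewrite {2}/omega !pevalM !pevalXn; ring.
    under eq_bigr do rewrite (tp_rhoYh_Kh k0 al0 be0 VP VK gK d_rec d_out d_top).
    case: ltnP => h.
      rewrite (bigD1 (Ordinal h)) //= eqxx big1 ?addr0 // => N.
      by rewrite -val_eqE /= => /negbTE ->.
    rewrite peval0 big1 // => N _; rewrite ltn_eqF //.
    by apply: leq_trans h.
  rewrite hQ fpairC; case: ltnP => h //.
  rewrite fpairC fpair0r fpairC /fpair /psum big1 // => b _; rewrite big1 // => a _.
  have [hab|hab] := leqP (2 * M) (a + b); first by rewrite hM // mul0r.
  have hq0 : homog (2 * s + 2 * (k * j)) q0.
    by apply: homogM; [apply: homogXn; exact: homog_rho | exact: homog_Yh].
  rewrite hq0 ?mulr0 // -mulnDr ltn_eqF //; apply: leq_trans hab _.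
  by rewrite leq_mul2l h orbT.
have dW : dinv k (Wh M p).
  by do 3! (apply: dinv_sum => ? _); apply: dinv_Z; exact: omega_dinv.
have dg := g_dinv k0 VP VK gK dW.
(* [g0] is itself invariant, so it may serve as the test polynomial in [key]; this gives its Fischer
   square. *)
pose g0 := p - g (Wh M p).
have g0E : g0 = p + CC (-1) * g (Wh M p) by rewrite CCN CC1 mulN1r.
have d0 : dinv k g0 by rewrite g0E; apply: dinv_D => //; exact: dinv_Z.
have : fpair g0 g0 = 0.
  rewrite {2}g0E fpairDr fpairZr -(key _ (dinv_span d0)) -[in tpair _ _ _ _](gK (Wh M p)).
  by rewrite (tpair_V VP VK); ring.
move/fpair_def/eqP; rewrite subr_eq0 => /eqP e.
by rewrite {1}e gK.
Qed.
End InvariantSpan.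

(** * The power [- la] of the cosine product and its differential equation *)

Section GeneratingFunction.
Variables (R : realType) (k : nat) (la : R).
Hypotheses (k0 : (0 < k)%N) (la0 : 0 < la).
Local Notation P2 := {poly {poly R}}.
Implicit Types (p q f h : P2).
Local Notation X1 := (X1 R).
Local Notation X2 := (X2 R).
Local Notation dx := (@pder R ord0).

(* In this section the outer variable [X2] is the expansion variable s and the
   inner variable [X1] is the Gegenbauer variable xi. *)
Definition th p : P2 := X2 * pder ord_max p.
Definition sg : P2 := 1 - X2 ^+ 2.

(* With r+- = (1 +- sqrt (1 - s^2)) / 2: chA n = r+^n + r-^n and
   chB n = (r+^n - r-^n) / sqrt (1 - s^2), so that at xi = cos q, [Qk] below is
   the product over i < k of 1 - s cos ((q - 2 pi i) / k). *)
Fixpoint chAB (n : nat) : P2 * P2 :=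
  if n is n'.+1 then let: (A, B) := chAB n' in (CC 2^-1 * (A + sg * B), CC 2^-1 * (A + B))
  else (CC 2, 0).
Definition chA n := (chAB n).1.
Definition chB n := (chAB n).2.
Definition chE n : P2 := CC (2 * 2^-1 ^+ n) * X2 ^+ n.

Lemma chAS n : chA n.+1 = CC 2^-1 * (chA n + sg * chB n).
Proof. by rewrite /chA /chB /=; case: (chAB n). Qed.
Lemma chBS n : chB n.+1 = CC 2^-1 * (chA n + chB n).
Proof. by rewrite /chA /chB /=; case: (chAB n). Qed.

Let half2 : CC 2^-1 * 2 = 1 :> P2.
Proof. by rewrite -(CCnat R 2) -CCM mulVf ?CC1 // pnatr_eq0. Qed.

(** In terms of [r+] and [r-] both sides are [4 (r+ r-)^n], and [r+ r- = s^2 / 4]. *)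
Lemma chAB_sqr n : chA n ^+ 2 - sg * chB n ^+ 2 = chE n ^+ 2.
Proof.
elim: n => [|n IH]; first by rewrite /chA /chB /chE /= !expr0 !mulr1 expr0n mulr0 subr0.
rewrite chAS chBS.
have -> : chE n.+1 = CC 2^-1 * X2 * chE n by rewrite /chE !exprS !CCM; ring.
rewrite [RHS]exprMn -IH /sg; ring.
Qed.
Lemma thD p q : th (p + q) = th p + th q. Proof. by rewrite /th pderD mulrDr. Qed.
Lemma thB p q : th (p - q) = th p - th q. Proof. by rewrite /th pderB mulrBr. Qed.
Lemma thM p q : th (p * q) = th p * q + p * th q. Proof. by rewrite /th pderM; ring. Qed.
Lemma thC c : th (CC c) = 0. Proof. by rewrite /th pderC mulr0. Qed.
Lemma thZ c p : th (CC c * p) = CC c * th p. Proof. by rewrite thM thC mul0r add0r. Qed.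
Lemma th1 : th 1 = 0. Proof. by rewrite -CC1 thC. Qed.
Lemma thX1 : th X1 = 0. Proof. by rewrite /th pder_X1 /= CC0 mulr0. Qed.
Lemma thX2n n : th (X2 ^+ n) = n%:R * X2 ^+ n.
Proof.
rewrite /th pderXn pder_X2 /= CC1 mulr1; case: n => [|n]; first by rewrite !mul0r mulr0.
by rewrite exprS mulrCA.
Qed.
Lemma th_sg : th sg = 2 * (sg - 1).
Proof. by rewrite /sg thB th1 thX2n; ring. Qed.
Lemma th_chE n : th (chE n) = n%:R * chE n.
Proof. by rewrite /chE thZ thX2n mulrCA. Qed.
(** The derivative of [chB] is multiplied by [sg] because the square root of [1 - s^2] brings [sg]
    into its denominator. *)
Lemma th_chAB n : th (chA n) = n%:R * (chA n - chB n) /\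
  sg * th (chB n) = n%:R * (sg * chB n) - n%:R * chA n - (sg - 1) * chB n.
Proof.
elim: n => [|n [IH1 IH2]].
  by rewrite /chA /chB /= thC -CC0 thC CC0 !mul0r !mulr0 !subr0.
rewrite chAS chBS !thZ !thD thM th_sg IH1 IH2 -[n.+1%:R]natr1.
split; first by ring.
rewrite mulrCA mulrDr IH2; ring.
Qed.
Lemma dx_chAB n : dx (chA n) = 0 /\ dx (chB n) = 0.
Proof.
elim: n => [|n [IH1 IH2]]; first by rewrite /chA /chB /= pderC pder0.
rewrite chAS chBS !pderZ !pderD pderM IH1 IH2 /sg pderB pder1 pderXn pder_X2 /= CC0.
by split; ring.
Qed.
Lemma dx_chE n : dx (chE n) = 0.
Proof. by rewrite /chE pderZ pderXn pder_X2 /= CC0 !mulr0. Qed.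

Definition Qk : P2 := chA k - X1 * chE k.
Definition cL (L : nat) : R := poch la L / L`!%:R.
(** The binomial series of [Qk ^ (- la)] in powers of [1 - Qk], cut at order [M]. As [1 - Qk] is
    divisible by [s], the cut changes coefficients of [s^n] only for [n > M]. *)
Definition Uk (M : nat) : P2 := \sum_(L < M.+1) CC (cL L) * (1 - Qk) ^+ L.

Definition van (M : nat) p := exists r, p = X2 ^+ M * r.
Lemma vanD M p q : van M p -> van M q -> van M (p + q).
Proof. by case=> r -> [r' ->]; exists (r + r'); rewrite mulrDr. Qed.
Lemma vanM M p q : van M p -> van M (q * p).
Proof. by case=> r ->; exists (q * r); rewrite mulrCA. Qed.
Lemma vanN M p : van M p -> van M (- p).
Proof. by case=> r ->; exists (- r); rewrite mulrN. Qed.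
Lemma vanB M p q : van M p -> van M q -> van M (p - q).
Proof. by move=> hp hq; apply: vanD => //; exact: vanN. Qed.
Lemma van0 M : van M 0. Proof. by exists 0; rewrite mulr0. Qed.
Lemma vanW M N p : (N <= M)%N -> van M p -> van N p.
Proof. by move=> h [r ->]; exists (X2 ^+ (M - N) * r); rewrite mulrA -exprD subnKC. Qed.
Lemma van_th M p : van M p -> van M (th p).
Proof. by case=> r ->; exists (M%:R * r + th r); rewrite thM thX2n; ring. Qed.
Lemma van_dx M p : van M p -> van M (dx p).
Proof. by case=> r ->; exists (dx r); rewrite pderM pderXn pder_X2 /= CC0 mulr0 mul0r add0r. Qed.
Lemma van_exp p M : van 1 p -> van M (p ^+ M).
Proof. by case=> r ->; exists (r ^+ M); rewrite expr1 exprMn. Qed.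
(** [q] is invertible modulo [X2 ^+ M], the inverse being a geometric sum in [1 - q]. *)
Lemma van_cancel M q p : van 1 (1 - q) -> van M (q * p) -> van M p.
Proof.
move=> hq hp.
have -> : p = (\sum_(i < M) (1 - q) ^+ i) * (q * p) + p * (1 - q) ^+ M.
  have h := subrX1 (1 - q) M.
  have -> : (1 - q) ^+ M = 1 - q * \sum_(i < M) (1 - q) ^+ i.
    by rewrite -[LHS](subrK 1) h; ring.
  by ring.
by apply: vanD; apply: vanM => //; exact: van_exp.
Qed.
Lemma pcoef_van M p a b : van M p -> (b < M)%N -> pcoef p a b = 0.
Proof.
case=> r ->; elim: M b => // M IH [|b] hb; rewrite exprS -mulrA pcoefX2 //.
exact: IH.
Qed.

(** Each [xi] comes with [k] powers of [s], and the rest is a power of [s^2] with exponent at least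
    [r]. Level 0 describes the support of the coefficients, level 1 separates everything below the
    leading ones. *)
Definition gr (r : nat) : P2 -> Prop :=
  lspan (fun f => exists a t, (r <= t)%N /\ f = X1 ^+ a * X2 ^+ (k * a + 2 * t)).
Lemma grW r r' p : (r <= r')%N -> gr r' p -> gr r p.
Proof.
move=> h hp; apply: (hp (gr r)) => [|c u v hu hv|_ [a [t [ht ->]]]].
- exact: lspan0.
- exact: lspanZD.
- by apply: lspan_in; exists a, t; split=> //; apply: leq_trans ht.
Qed.
Lemma grM r r' p q : gr r p -> gr r' q -> gr (r + r') (p * q).
Proof.
move=> hp hq; apply: (hp (fun p => gr (r + r') (p * q))) => [|c u v hu hv|_ [a [t [ht ->]]]].
- rewrite mul0r; exact: lspan0.
- by rewrite mulrDl -mulrA; exact: lspanZD.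
apply: (hq (fun q => gr (r + r') (_ * q))) => [|c u v hu hv|_ [a' [t' [ht' ->]]]].
- rewrite mulr0; exact: lspan0.
- by rewrite mulrDr mulrCA; exact: lspanZD.
apply: lspan_in; exists (a + a')%N, (t + t')%N; split; first exact: leq_add.
by rewrite !mulnDr !exprD; ring.
Qed.
Lemma gr1 : gr 0 1.
Proof. by apply: lspan_in; exists 0%N, 0%N; rewrite !muln0 !expr0 mulr1. Qed.
Lemma grXn p n : gr 0 p -> gr 0 (p ^+ n).
Proof. by move=> hp; elim: n => [|n IH]; [exact: gr1 | rewrite exprS; exact: (grM hp IH)]. Qed.
Lemma gr_s2 : gr 1 (X2 ^+ 2).
Proof. by apply: lspan_in; exists 0%N, 1%N; rewrite muln0 expr0 mul1r. Qed.
Lemma gr_sub r p q : gr r p -> gr r q -> gr r (p - q).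
Proof.
move=> hp hq; have -> : p - q = CC (-1) * q + p by rewrite CCN CC1 mulN1r addrC.
exact: lspanZD.
Qed.
Lemma gr_chAB n : gr 1 (1 - chA n.+1) /\ gr 1 (1 - chB n.+1).
Proof.
elim: n => [|n [IH1 IH2]].
  rewrite chAS chBS /chA /chB /= !mulr0 !addr0 -CCM mulVf ?pnatr_eq0 // CC1 subrr.
  by split; exact: lspan0.
have hB : gr 0 (chB n.+1).
  have -> : chB n.+1 = 1 - (1 - chB n.+1) by ring.
  by apply: gr_sub; [exact: gr1 | exact: grW IH2].
move: IH1 IH2 hB; rewrite [chA n.+2]chAS [chB n.+2]chBS; set A := chA _; set B := chB _ => IH1 IH2 hB; split.
  have -> : 1 - CC 2^-1 * (A + sg * B) =
     CC 2^-1 * (1 - A) + (CC 2^-1 * (1 - B) + CC 2^-1 * (X2 ^+ 2 * B)).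
    by rewrite /sg -{1}half2; ring.
  apply: lspanZD => //; apply: lspanZD => //; apply: lspanZ; exact: (grM gr_s2 hB).
have -> : 1 - CC 2^-1 * (A + B) = CC 2^-1 * (1 - A) + CC 2^-1 * (1 - B).
  by rewrite -{1}half2; ring.
by apply: lspanZD => //; exact: lspanZ.
Qed.
Lemma gr_van p : gr 1 p -> van 1 p.
Proof.
move=> hp; apply: (hp (van 1)) => [|c u v hu hv|_ [a [t [ht ->]]]].
- exact: van0.
- by apply: vanD => //; exact: vanM.
exists (X1 ^+ a * X2 ^+ (k * a + 2 * t).-1); rewrite mulrCA -exprD add1n prednK //.
by move: ht; generalize (k * a)%N; lia.
Qed.
Lemma pcoef_gr r p a b : gr r p -> pcoef p a b != 0 -> exists2 t, (r <= t)%N & b = (k * a + 2 * t)%N.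
Proof.
move=> hp; apply: (hp (fun p => pcoef p a b != 0 -> exists2 t, (r <= t)%N & b = (k * a + 2 * t)%N)) => [|c u v hu hv|_ [a' [t [ht ->]]]].
- by rewrite pcoef0 eqxx.
- rewrite pcoefD pcoefZ; have [e|/hu //] := eqVneq (pcoef u a b) 0.
  by rewrite e mulr0 add0r => /hv.
rewrite pcoef_mono; have [->|_] := eqVneq a a'; last by rewrite eqxx.
have [->|_] /= := eqVneq b (k * a' + 2 * t)%N; last by rewrite eqxx.
by exists t.
Qed.

Lemma gr_chA : gr 1 (1 - chA k).
Proof. by case: k k0 => // n _; case: (gr_chAB n). Qed.
Lemma gr_xE : gr 0 (X1 * chE k).
Proof.
rewrite /chE mulrCA; apply: lspanZ; apply: lspan_in; exists 1%N, 0%N.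
by rewrite muln1 muln0 addn0 expr1.
Qed.
Lemma Qk_split : 1 - Qk = (1 - chA k) + X1 * chE k.
Proof. by rewrite /Qk; ring. Qed.
Lemma van_Qk : van 1 (1 - Qk).
Proof.
rewrite Qk_split; apply: vanD; first by apply: gr_van; exact: gr_chA.
apply: vanM; rewrite /chE; apply: vanM; apply: (vanW k0); by exists 1; rewrite mulr1.
Qed.
Lemma gr_Uk M : gr 0 (Uk M).
Proof.
apply: lspan_sum => L _; apply: lspanZ; apply: grXn; rewrite Qk_split.
by apply: lspanD; [exact: (grW _ gr_chA) | exact: gr_xE].
Qed.

Lemma cLS L : L.+1%:R * cL L.+1 = (la + L%:R) * cL L.
Proof.
rewrite /cL pochS factS natrM.
have h1 : (L.+1%:R : R) != 0 by rewrite pnatr_eq0.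
have h2 : (L`!%:R : R) != 0 by rewrite pnatr_eq0 -lt0n fact_gt0.
by move: (L.+1%:R : R) (L`!%:R : R) h1 h2 => x y h1 h2; field; rewrite h1 h2.
Qed.
(** The equation [(1 - b) F' = la F] of [F = (1 - b)^(- la)], with the error term left by cutting
    the series. *)
Lemma tele (b : P2) M : (1 - b) * \sum_(L < M.+1) (L%:R * CC (cL L) * b ^+ L.-1) =
  CC la * \sum_(L < M.+1) CC (cL L) * b ^+ L - CC ((la + M%:R) * cL M) * b ^+ M.
Proof.
elim: M => [|M IH].
  by rewrite !big_ord_recl !big_ord0 /= !mul0r !addr0 mulr0 expr0 CCM; ring.
rewrite big_ord_recr [in RHS]big_ord_recr /= mulrDr IH -(CCnat R M.+1) -CCM cLS mulrDr.
have -> : CC ((la + M.+1%:R) * cL M.+1) = CC la * CC (cL M.+1) + CC ((la + M%:R) * cL M).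
  by rewrite mulrDl cLS CCD CCM.
by rewrite exprS; ring.
Qed.
(** Logarithmic derivative of [Qk ^ (- la)] without division; the error is a multiple of
    [(1 - Qk)^M]. A general derivation is taken so that it serves for [s] and for [xi]. *)
Lemma Uk_der (D : P2 -> P2) M : (forall p q, D (p + q) = D p + D q) ->
  (forall p q, D (p * q) = D p * q + p * D q) -> (forall c, D (CC c) = 0) ->
  van M (Qk * D (Uk M) + CC la * (D Qk * Uk M)).
Proof.
move=> hD hM hC.
have DX p n : D (p ^+ n) = n%:R * p ^+ n.-1 * D p.
  elim: n => [|n IH]; first by rewrite expr0 -CC1 hC !mul0r.
  rewrite exprS hM IH /= -[in RHS]natr1; case: n {IH} => [|n] /=; first by rewrite !expr0; ring.
  by rewrite exprS; ring.
have D0 : D 0 = 0 by rewrite -CC0 hC.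
have DB : D (1 - Qk) = - D Qk.
  have : D (1 - Qk + Qk) = 0 by rewrite subrK -CC1 hC.
  by rewrite hD => /eqP; rewrite addr_eq0 => /eqP.
have e : D (Uk M) = - D Qk * \sum_(L < M.+1) (L%:R * CC (cL L) * (1 - Qk) ^+ L.-1).
  rewrite /Uk (big_morph D hD D0) mulr_sumr; apply: eq_bigr => L _.
  by rewrite hM hC mul0r add0r DX DB; ring.
have -> : Qk * D (Uk M) + CC la * (D Qk * Uk M) = D Qk * (CC ((la + M%:R) * cL M) * (1 - Qk) ^+ M).
  have t := tele (1 - Qk) M; rewrite subKr in t.
  rewrite e mulrCA t /Uk; ring.
by apply: vanM; apply: vanM; apply: van_exp; exact: van_Qk.
Qed.

(** A power of [Qk] satisfies a second-order equation if [Qk] satisfies a quadratic one. Multiplied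
    by [Qk^2], the expression is a combination of the first-order residues [r1], [r2], their
    derivatives [r3], [r4], and [U] times a bracket in [Qk] and its derivatives. *)
Lemma Uk_pde M (U := Uk M) : van M (
  th (th U) + CC (2 * k%:R * la) * th U
  + CC (k%:R ^+ 2) * ((1 - X1 ^+ 2) * dx (dx U) - CC (2 * la + 1) * (X1 * dx U))
  - X2 ^+ 2 * (th (th U) + CC (2 * k%:R * la + 1) * th U + CC (k%:R * la * (k%:R * la + 1)) * U)).
Proof.
have h1 : van M (Qk * th U + CC la * (th Qk * U)) by apply: Uk_der; [exact: thD | exact: thM | exact: thC].
have h2 : van M (Qk * dx U + CC la * (dx Qk * U)) by apply: Uk_der; [exact: pderD | exact: pderM | exact: pderC].
have h3 := van_th h1; have h4 := van_dx h2.
apply: (van_cancel van_Qk); apply: (van_cancel van_Qk).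
have [tA tB] := th_chAB k; have [dA dB] := dx_chAB k.
have tQ : th Qk = k%:R * (chA k - chB k) - k%:R * (X1 * chE k).
  by rewrite /Qk thB thM thX1 th_chE tA; ring.
have ttQ : sg * th (th Qk) = k%:R * (k%:R * (sg * (chA k - chB k)) - (k%:R * (sg * chB k) - k%:R * chA k - (sg - 1) * chB k))
   - k%:R ^+ 2 * (X1 * chE k * sg).
  rewrite tQ -!CCnat thB !thZ thB thM thX1 th_chE tA !CCnat mulrBr mulrCA mulrBr [sg * (_ * (_ - _))]mulrCA tB.
  by ring.
have dQ : dx Qk = - chE k.
  by rewrite /Qk pderB pderM dA pder_X1 /= CC1 dx_chE; ring.
have ddQ : dx (dx Qk) = 0 by rewrite dQ pderN dx_chE oppr0.
have sE : X2 ^+ 2 = 1 - sg by rewrite /sg; ring.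
have rel := chAB_sqr k.
rewrite thD thZ (thM Qk) (thM (th Qk)) in h3; rewrite pderD pderZ (pderM _ Qk) (pderM _ (dx Qk)) ddQ in h4.
move: h1 h2 h3 h4.
set tU := th U; set ttU := th tU; set dU := dx U; set ddU := dx dU.
set l := CC la; set K := (k%:R : P2).
move=> h1 h2 h3 h4.
set r1 := Qk * tU + _ in h1 *; set r2 := Qk * dU + _ in h2 *.
set r3 := (X in van _ X) in h3; set r4 := (X in van _ X) in h4.
set tt := th (th Qk) in ttQ r3 h3 *.
have CK1 : CC (2 * k%:R * la) = 2 * K * l by rewrite !CCM !CCnat.
have CK2 : CC (2 * k%:R * la + 1) = 2 * K * l + 1 by rewrite CCD CC1 CK1.
have CK3 : CC (k%:R * la * (k%:R * la + 1)) = K * l * (K * l + 1) by rewrite CCM CCD CC1 !CCM !CCnat.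
have CK4 : CC (k%:R ^+ 2) = K ^+ 2 by rewrite CCXn CCnat.
have CK5 : CC (2 * la + 1) = 2 * l + 1 by rewrite CCD CC1 CCM !CCnat.
rewrite CK1 CK2 CK3 CK4 CK5 sE.
set F := (X in van _ X).
have -> : F =
  (sg * Qk * r3 - sg * (1 + l) * th Qk * r1)
  + (2 * K * l - (1 - sg) * (2 * K * l + 1)) * Qk * r1
  + K ^+ 2 * (1 - X1 ^+ 2) * (Qk * r4 - (1 + l) * dx Qk * r2) - K ^+ 2 * (2 * l + 1) * X1 * Qk * r2
  + U * l * ((1 + l) * (sg * th Qk ^+ 2) - Qk * (sg * tt) - (2 * K * l - (1 - sg) * (2 * K * l + 1)) * Qk * th Qk
   - (1 - sg) * K * (K * l + 1) * Qk ^+ 2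
   + K ^+ 2 * ((1 - X1 ^+ 2) * (1 + l) * dx Qk ^+ 2 + (2 * l + 1) * X1 * Qk * dx Qk)).
  by rewrite /F /r1 /r2 /r3 /r4; ring.
(* The quadratic equation of [Qk]: after substitution of the derivatives it reduces to
   [chAB_sqr]. *)
set br := (X in U * l * X).
have -> : br = 0.
  transitivity ((1 + l) * K ^+ 2 * (chE k ^+ 2 - (chA k ^+ 2 - sg * chB k ^+ 2))); last by rewrite rel subrr mulr0.
  by rewrite /br ttQ tQ dQ /K /Qk; ring.
rewrite mulr0 addr0.
apply: vanB; last by apply: vanM.
apply: vanD; last first.
  by apply: vanM; apply: vanB; apply: vanM.
by apply: vanD; [apply: vanB; apply: vanM | apply: vanM].
Qed.

(* The coefficient of s^n xi^m in [Qk ^ (- la)]. *)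
Definition un (n m : nat) : R := pcoef (Uk n) m n.
Lemma pcoef_Uk M n m : (n <= M)%N -> pcoef (Uk M) m n = un n m.
Proof.
move=> h; rewrite /un -(subnKC h); elim: (M - n)%N => [|d IH]; first by rewrite addn0.
rewrite addnS -IH /Uk big_ord_recr /= pcoefD [X in _ + X](pcoef_van (M := (n + d).+1)) ?addr0 //.
  by apply: vanM; apply: van_exp; exact: van_Qk.
by rewrite ltnS leq_addr.
Qed.
Lemma un_out n m : (forall t, n <> (k * m + 2 * t)%N) -> un n m = 0.
Proof.
move=> h; apply/eqP; apply: contraT => hu.
by have [t _ e] := pcoef_gr (gr_Uk n) hu; case: (h t).
Qed.
Lemma un_top m : un (k * m) m = cL m * (2 * 2^-1 ^+ k) ^+ m.
Proof.
set M := (k * m)%N.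
have hc : gr 1 (Uk M - \sum_(L < M.+1) CC (cL L) * (X1 * chE k) ^+ L).
  rewrite /Uk -sumrB; apply: lspan_sum => L _; rewrite -mulrBr; apply: lspanZ.
  elim: (L : nat) => [|n IH]; first by rewrite !expr0 subrr; exact: lspan0.
  rewrite !exprS.
  have -> : (1 - Qk) * (1 - Qk) ^+ n - X1 * chE k * (X1 * chE k) ^+ n =
    X1 * chE k * ((1 - Qk) ^+ n - (X1 * chE k) ^+ n) + (1 - chA k) * (1 - Qk) ^+ n.
    by rewrite Qk_split; ring.
  apply: lspanD; first by have := grM gr_xE IH; rewrite add0n.
  have g0 : gr 0 ((1 - Qk) ^+ n).
    apply: grXn; rewrite Qk_split; apply: lspanD; last exact: gr_xE.
    exact: (grW _ gr_chA).
  by have := grM gr_chA g0.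
have h0 : pcoef (Uk M - \sum_(L < M.+1) CC (cL L) * (X1 * chE k) ^+ L) m M = 0.
  apply/eqP; apply: contraT => hu; have [t ht /eqP e] := pcoef_gr hc hu.
  by move: e; rewrite /M -[X in X == _]addn0 eqn_add2l eq_sym muln_eq0 /= -leqn0 leqNgt ht.
move/eqP: h0; rewrite pcoefD pcoefN subr_eq0 => /eqP; rewrite /un => ->.
have hL (L : nat) : CC (cL L) * (X1 * chE k) ^+ L = CC (cL L * (2 * 2^-1 ^+ k) ^+ L) * (X1 ^+ L * X2 ^+ (k * L)).
  by rewrite /chE mulrCA exprMn exprMn -CCXn CCM -mulrA -exprM; ring.
have hm : (m < M.+1)%N by rewrite ltnS leq_pmull.
rewrite pcoef_sum (bigD1 (Ordinal hm)) //= hL pcoefZ pcoef_mono !eqxx mulr1 big1 ?addr0 // => L.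
by rewrite -val_eqE /= hL pcoefZ pcoef_mono eq_sym => /negbTE ->; rewrite mulr0.
Qed.

Lemma pcoef_th p a b : pcoef (th p) a b = b%:R * pcoef p a b.
Proof. by rewrite /th pcoefX2; case: b => [|b]; rewrite ?mul0r // pcoef_pder1. Qed.
Lemma pcoef_X1dx p a b : pcoef (X1 * dx p) a b = a%:R * pcoef p a b.
Proof. by rewrite pcoefX1; case: a => [|a]; rewrite ?mul0r // pcoef_pder0. Qed.
(** The coefficient of [s^(n + 2) xi^m] in [Uk_pde]; the order [n + 3] is high enough for this
    coefficient to vanish. *)
Lemma un_rec n m :
  (k%:R * la + n%:R) * (k%:R * la + n%:R + 1) * un n m =
  (n.+2%:R - k%:R * m%:R) * (n.+2%:R + k%:R * m%:R + 2 * k%:R * la) * un n.+2 m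
  + k%:R ^+ 2 * (m.+2%:R * m.+1%:R) * un n.+2 m.+2.
Proof.
have h := pcoef_van m (Uk_pde n.+3) (leqnn n.+3); move: h.
have X22 (f : P2) : pcoef (X2 ^+ 2 * f) m n.+2 = pcoef f m n by rewrite expr2 -mulrA !pcoefX2.
rewrite 3!pcoefD pcoefN X22 !pcoefD !pcoefZ !pcoef_th mulrBl mul1r !pcoefD !pcoefN pcoefZ pcoef_X1dx.
have -> : pcoef (X1 ^+ 2 * dx (dx (Uk n.+3))) m n.+2 = m%:R * (m%:R - 1) * pcoef (Uk n.+3) m n.+2.
  rewrite expr2 -mulrA !pcoefX1; clear X22; case: m => [|[|m]]; rewrite ?mul0r ?subrr ?mulr0 ?mul0r //.
  - by rewrite pcoefX1.
  - by rewrite pcoefX1 !pcoef_pder0 -[in RHS]natr1 addrK; ring.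
rewrite !pcoef_pder0 !(pcoef_Uk _ (leqnSn n.+2)) (@pcoef_Uk n.+3 n); last by lia.
move=> h.
apply/eqP; rewrite -subr_eq0; apply/eqP/oppr_inj; rewrite oppr0 -[RHS]h.
by rewrite -[m.+2%:R]natr1 -[m.+1%:R]natr1 -[n.+2%:R]natr1 -[n.+1%:R]natr1; ring.
Qed.
End GeneratingFunction.

(** * The kernel coefficients *)

Section KernelCoefficients.
Variables (R : realType) (k : nat) (la : R).
Hypotheses (k0 : (0 < k)%N) (la0 : 0 < la).

(** The division by [poch (k la) (2 N)] is that of the Humbert series; the factor [(2 m)! / 4^m] is
    what the moments of the measures [nu] contribute in [mom_ycoef]. *)
Definition dco (N m : nat) : R :=
  un k la (2 * N) (2 * m) / poch (k%:R * la) (2 * N) * ((2 * m)`!%:R / 4 ^+ m).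

Let kla : 0 < k%:R * la. Proof. by rewrite mulr_gt0 // ltr0n. Qed.

Lemma dco_out N m : (N < k * m)%N -> dco N m = 0.
Proof.
move=> h; rewrite /dco un_out ?mul0r // => t; move: h; set K := (k * m)%N.
by rewrite mulnCA -/K; lia.
Qed.
Lemma dco_top j : dco (k * j) j = poch la (2 * j) / (2 ^+ (2 * (k * j)) * poch (k%:R * la) (2 * (k * j))).
Proof.
have -> : (2 * (k * j) = k * (2 * j))%N by rewrite mulnCA.
rewrite /dco mulnCA un_top // /cL.
have h1 : ((2 * j)`!%:R : R) != 0 by rewrite pnatr_eq0 -lt0n fact_gt0.
have h2 := poch_neq0 (k * (2 * j)) kla.
have h3 : (2 : R) ^+ (k * (2 * j)) != 0 by rewrite expf_neq0 // pnatr_eq0.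
have h4 : (4 : R) ^+ j != 0 by rewrite expf_neq0 // pnatr_eq0.
have -> : (2 * 2^-1 ^+ k : R) ^+ (2 * j) = 4 ^+ j / 2 ^+ (k * (2 * j)).
  by rewrite exprMn -exprM exprVn exprM; congr (_ ^+ _ / _); rewrite expr2 -natrM.
by field; rewrite h1 h2 h3 h4.
Qed.
Lemma dco_rec N m : (k * m <= N)%N -> dco N m =
  4 * (N.+1%:R - k%:R * m%:R) * (N.+1%:R + k%:R * m%:R + k%:R * la) * dco N.+1 m + 4 * k%:R ^+ 2 * dco N.+1 m.+1.
Proof.
move=> _; rewrite /dco !mulnS !add2n; have := un_rec k0 la0 (2 * N) (2 * m).
rewrite !factS !natrM !pochS [4 ^+ m.+1]exprS.
set u := un _ _ _ _; set v := un _ _ _ _; set w := un _ _ _ _ => h.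
have p0 := poch_neq0 (2 * N) kla.
have n2 : (2%:R * N%:R : R) >= 0 by rewrite mulr_ge0.
have p1 : k%:R * la + 2%:R * N%:R != 0 by rewrite gt_eqF // ltr_wpDr.
have p2 : k%:R * la + 2%:R * N%:R + 1 != 0 by rewrite gt_eqF // ltr_wpDl // ltW // ltr_wpDr.
have p3 : (4 : R) ^+ m != 0 by rewrite expf_neq0 // pnatr_eq0.
have -> : u = ((2 * N).+2%:R - k%:R * (2%:R * m%:R)) * ((2 * N).+2%:R + k%:R * (2%:R * m%:R) + 2 * k%:R * la) /
     ((k%:R * la + 2%:R * N%:R) * (k%:R * la + 2%:R * N%:R + 1)) * v
   + k%:R ^+ 2 * ((2 * m).+2%:R * (2 * m).+1%:R) / ((k%:R * la + 2%:R * N%:R) * (k%:R * la + 2%:R * N%:R + 1)) * w.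
  apply: (mulfI p1); apply: (mulfI p2); rewrite !mulrA [X in X * u]mulrC h.
  by field; rewrite p1 p2.
rewrite -[(2 * N).+2%:R]natr1 -[(2 * N).+1%:R]natr1 -[(2 * m).+2%:R]natr1 -[(2 * m).+1%:R]natr1 -[N.+1%:R]natr1 !natrM.
have p4 : k%:R * la + (2%:R * N%:R + 1) != 0 by rewrite addrA.
by field; rewrite p0 p1 p4 p3.
Qed.
End KernelCoefficients.

(** * Coefficientwise majorants of polynomials *)

Section Majorants.
Variable R : realType.
Implicit Types (p q P Q : {poly R}).

(** A majorant has nonnegative coefficients, so its value at one positive point bounds every
    coefficient of [p] ([pmaj_eval]): Cauchy estimates compatible with sums and products. *)
Definition pmaj p P := forall n, `|p`_n| <= P`_n.
Lemma pmaj_ge0 p P : pmaj p P -> forall n, 0 <= P`_n.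
Proof. by move=> h n; apply: le_trans (h n). Qed.
Lemma pmaj_self p P : pmaj p P -> pmaj P P.
Proof. by move=> h n; rewrite ger0_norm // (pmaj_ge0 h). Qed.
Lemma pmajD p q P Q : pmaj p P -> pmaj q Q -> pmaj (p + q) (P + Q).
Proof. by move=> hp hq n; rewrite !coefD (le_trans (ler_normD _ _)) // lerD. Qed.
Lemma pmajN p P : pmaj p P -> pmaj (- p) P.
Proof. by move=> h n; rewrite coefN normrN. Qed.
Lemma pmajM p q P Q : pmaj p P -> pmaj q Q -> pmaj (p * q) (P * Q).
Proof.
move=> hp hq n; rewrite !coefM (le_trans (ler_norm_sum _ _ _)) //.
by apply: ler_sum => i _; rewrite normrM ler_pM.
Qed.
Lemma pmajC c : pmaj c%:P `|c|%:P.
Proof. by move=> n; rewrite !coefC; case: ifP => //; rewrite normr0. Qed.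
Lemma pmajX : pmaj 'X 'X.
Proof. by move=> n; rewrite coefX normr_nat. Qed.
Lemma pmaj0 : pmaj 0 0. Proof. by move=> n; rewrite coef0 normr0. Qed.
Lemma pmaj1 : pmaj 1 1. Proof. by move=> n; rewrite coef1 normr_nat. Qed.
Lemma pmaj_prod (I : Type) (r : seq I) (F G : I -> {poly R}) :
  (forall i, pmaj (F i) (G i)) -> pmaj (\prod_(i <- r) F i) (\prod_(i <- r) G i).
Proof. by move=> h; elim/big_rec2: _ => [|i P p _ hp]; [exact: pmaj1 | exact: pmajM]. Qed.
Lemma pmaj_eval p P n r : pmaj p P -> 0 <= r -> `|p`_n| * r ^+ n <= P.[r].
Proof.
move=> h r0; have P0 := pmaj_ge0 h.
apply: (@le_trans _ _ (P`_n * r ^+ n)); first by rewrite ler_wpM2r // exprn_ge0.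
have ge0 i : 0 <= P`_i * r ^+ i by rewrite mulr_ge0 ?exprn_ge0.
rewrite horner_coef; have [hn|hn] := ltnP n (size P).
  by rewrite (bigD1 (Ordinal hn)) //= lerDl sumr_ge0.
by rewrite (nth_default _ hn) mul0r sumr_ge0.
Qed.

Local Notation P2 := {poly {poly R}}.
Definition maj (p P : P2) := forall b, pmaj p`_b P`_b.
Lemma majD (p q P Q : P2) : maj p P -> maj q Q -> maj (p + q) (P + Q).
Proof. by move=> hp hq b; rewrite !coefD; exact: pmajD. Qed.
Lemma majM (p q P Q : P2) : maj p P -> maj q Q -> maj (p * q) (P * Q).
Proof.
move=> hp hq b; rewrite !coefM; elim/big_rec2: _ => [|i u v _ h]; first exact: pmaj0.
by apply: pmajD => //; exact: pmajM.
Qed.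
Lemma majC c d : `|c| <= d -> maj (CC c) (CC d).
Proof.
by move=> h b n; rewrite /CC !coefC; case: ifP => _; rewrite ?coef0 ?normr0 // !coefC; case: ifP; rewrite ?normr0.
Qed.
Lemma majX1 : maj (X1 R) (X1 R).
Proof. by move=> b; rewrite /X1 coefC; case: ifP => _; [exact: pmajX | exact: pmaj0]. Qed.
Lemma majX2 : maj (X2 R) (X2 R).
Proof. by move=> b; rewrite /X2 coefX; case: eqP => _; [exact: pmaj1 | exact: pmaj0]. Qed.
Lemma majXn (p P : P2) n : maj p P -> maj (p ^+ n) (P ^+ n).
Proof.
move=> h; elim: n => [|n IH]; last by rewrite !exprS; exact: majM.
by rewrite !expr0 -CC1; apply: majC; rewrite normr1.
Qed.
Lemma maj_sum (I : Type) (r : seq I) (F G : I -> P2) :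
  (forall i, maj (F i) (G i)) -> maj (\sum_(i <- r) F i) (\sum_(i <- r) G i).
Proof.
move=> h; elim/big_rec2: _ => [|i P p _ hp]; last exact: majD.
by move=> b; rewrite coef0; exact: pmaj0.
Qed.
Lemma maj_ex (p : P2) : exists P : P2, maj p P.
Proof.
elim/poly2_ind: p => [c|||p q [P hP] [Q hQ]|p q [P hP] [Q hQ]].
- by exists (CC `|c|); exact: majC.
- by exists (X1 R); exact: majX1.
- by exists (X2 R); exact: majX2.
- by exists (P + Q); exact: majD.
- by exists (P * Q); exact: majM.
Qed.
Lemma maj_pcoef (p P : P2) a b : maj p P -> `|pcoef p a b| <= pcoef P a b.
Proof. by move=> h; exact: h. Qed.
Lemma maj_self (p P : P2) : maj p P -> maj P P.
Proof. by move=> h b; apply: pmaj_self (h b). Qed.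
Lemma maj_row (p P : P2) x : maj p P -> 0 <= x -> pmaj p.[x%:P] P.[x%:P].
Proof.
move=> h x0; have hh n : pmaj (p`_n * x%:P ^+ n) (P`_n * x%:P ^+ n).
  apply: pmajM => //; rewrite -polyC_exp -{2}(ger0_norm (exprn_ge0 n x0)); exact: pmajC.
rewrite (horner_coef_wide _ (leq_maxl (size p) (size P))) (horner_coef_wide _ (leq_maxr (size p) (size P))).
elim/big_rec2: _ => [|i u v _ h']; first exact: pmaj0.
exact: pmajD.
Qed.
Lemma maj_eval (p P : P2) a b x y : maj p P -> 0 <= x -> 0 <= y ->
  `|pcoef p a b| * x ^+ a * y ^+ b <= peval P (x, y).
Proof.
move=> h x0 y0; rewrite /peval.
have hp := pmaj_self (maj_row h y0).
apply: (le_trans _ (pmaj_eval a hp x0)) => /=.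
rewrite mulrAC ler_wpM2r ?exprn_ge0 //.
have P0 n : 0 <= (P`_n * y%:P ^+ n)`_a.
  by rewrite -polyC_exp coefMC mulr_ge0 ?exprn_ge0 // (pmaj_ge0 (h n)).
rewrite horner_coef coef_sum [leRHS]ger0_norm ?sumr_ge0 //.
have [hn|hn] := ltnP b (size P).
  rewrite (bigD1 (Ordinal hn)) //= -[leLHS]addr0 lerD ?sumr_ge0 //.
  by rewrite -polyC_exp coefMC ler_wpM2r ?exprn_ge0 //; exact: h.
have := h b a; rewrite (nth_default _ hn) coef0 normr_le0 => /eqP e.
by rewrite /pcoef e normr0 mul0r sumr_ge0.
Qed.
Lemma peval_monotone (P : P2) x y y' : maj P P -> 0 <= x -> 0 <= y -> y <= y' ->
  peval P (x, y) <= peval P (x, y').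
Proof.
move=> h x0 y0 yy; rewrite !peval_psum; apply: ler_sum => b _; apply: ler_sum => a _ /=.
rewrite ler_wpM2l ?(pmaj_ge0 (h b)) // ler_wpM2l ?exprn_ge0 // lerXn2r // nnegrE //.
exact: le_trans yy.
Qed.
End Majorants.

(** * Humbert functions at cosines as power series *)

Section HumbertSeries.
Variables (R : realType) (k : nat) (la : R).
Hypotheses (k0 : (0 < k)%N) (la0 : 0 < la).
Implicit Types (f g F G H : {poly R}).

Definition tp F : {poly R} := 'X * F^`().
Lemma coef_tp F n : (tp F)`_n = n%:R * F`_n.
Proof. by rewrite /tp coefXM coef_deriv; case: n => [|n]; rewrite ?mul0r //= mulr_natl. Qed.
Lemma tpM F G : tp (F * G) = tp F * G + F * tp G.
Proof. by rewrite /tp derivM; ring. Qed.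
Lemma tpB F G : tp (F - G) = tp F - tp G.
Proof. by rewrite /tp derivB mulrBr. Qed.

Definition low N F := forall n, (n < N)%N -> F`_n = 0.
Lemma lowM N F G : low N F -> low N (G * F).
Proof.
move=> h n hn; rewrite coefM big1 // => i _.
by rewrite h ?mulr0 // (leq_ltn_trans (leq_subr _ _)).
Qed.
Lemma lowD N F G : low N F -> low N G -> low N (F + G).
Proof. by move=> hF hG n hn; rewrite coefD hF ?hG ?addr0. Qed.
Lemma lowB N F G : low N F -> low N G -> low N (F - G).
Proof. by move=> hF hG n hn; rewrite coefB hF ?hG ?subr0. Qed.

(* [ode N f F]: F is f^(-la) modulo s^N, up to a constant factor. *)
Definition ode N f F := low N (f * tp F + la%:P * (tp f * F)).
Lemma ode_mul N f g F G : ode N f F -> ode N g G -> ode N (f * g) (F * G).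
Proof.
move=> hF hG; rewrite /ode !tpM.
have -> : f * g * (tp F * G + F * tp G) + la%:P * ((tp f * g + f * tp g) * (F * G)) =
  g * G * (f * tp F + la%:P * (tp f * F)) + f * F * (g * tp G + la%:P * (tp g * G)) by ring.
by apply: lowD; exact: lowM.
Qed.
(** Since [f] has constant term 1, the coefficient of [s^n] in the equation expresses [n F_n]
    through lower coefficients. *)
Lemma ode_uniq N f F G : f`_0 = 1 -> ode N f F -> ode N f G -> F`_0 = G`_0 ->
  forall n, (n < N)%N -> F`_n = G`_n.
Proof.
move=> f0 hF hG e n hn; apply/eqP; rewrite -subr_eq0 -coefB; apply/eqP.
set H := F - G.
have hH : ode N f H.
  rewrite /ode /H tpB.
  have -> : f * (tp F - tp G) + la%:P * (tp f * (F - G)) =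
    f * tp F + la%:P * (tp f * F) - (f * tp G + la%:P * (tp f * G)) by ring.
  exact: lowB.
elim/ltn_ind: n hn => -[|n] IH hn; first by rewrite coefB e subrr.
have := hH _ hn; rewrite coefD coefCM !coefM [X in X + _]big_ord_recl [X in _ + la * X]big_ord_recl /= !subn0 !coef_tp f0 mul1r !mul0r add0r.
rewrite !big1 ?mulr0 ?addr0; last 2 first.
- by move=> i _; rewrite IH ?mulr0 //= /bump /= ?add1n; move: (ltn_ord i) hn; lia.
- by move=> i _; rewrite coef_tp IH ?mulr0 //= /bump /= ?add1n; move: (ltn_ord i) hn; lia.
by move/eqP; rewrite mulf_eq0 pnatr_eq0 /= => /eqP.
Qed.
Lemma ode_prod N (I : Type) (r : seq I) (f F : I -> {poly R}) :
  (forall i, ode N (f i) (F i)) -> ode N (\prod_(i <- r) f i) (\prod_(i <- r) F i).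
Proof.
move=> h; elim/big_rec2: _ => [|i g G _]; last exact: ode_mul.
by move=> n _; rewrite mul1r /tp derivC mulr0 mul0r mulr0 addr0 coef0.
Qed.

Definition geo N y : {poly R} := \poly_(j < N) (cL la j * y ^+ j).
Lemma ode_geo N y : ode N (1 - y%:P * 'X) (geo N y).
Proof.
move=> n hn.
have -> : (1 - y%:P * 'X) * tp (geo N y) + la%:P * (tp (1 - y%:P * 'X) * geo N y) =
  tp (geo N y) - y%:P * ('X * (tp (geo N y) + la%:P * geo N y)).
  by rewrite /tp derivB derivM !derivC derivX; ring.
rewrite coefB coef_tp coefCM coefXM; case: n hn => [|n] hn; first by rewrite mul0r mulr0 subr0.
rewrite /= coefD coef_tp coefCM !coef_poly hn (ltnW hn) mulrA cLS exprS; ring.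
Qed.
Lemma geo0 N y : (geo N.+1 y)`_0 = 1.
Proof. by rewrite coef_poly /= /cL poch0 fact0 expr0 divr1 mulr1. Qed.

Local Notation ev xi := (map_poly (horner_eval xi)).
Lemma ev_coef xi (p : {poly {poly R}}) n : (ev xi p)`_n = (p`_n).[xi].
Proof. by rewrite coef_map. Qed.
Lemma ev_van M xi (p : {poly {poly R}}) : van M p -> low M (ev xi p).
Proof.
by case=> r -> n hn; rewrite ev_coef /X2 coefXnM hn horner0.
Qed.
Lemma ode_Uk N xi : ode N (ev xi (Qk R k)) (ev xi (Uk k la N)).
Proof.
have h := Uk_der k0 la0 N (@pderD R ord_max) (@pderM R ord_max) (@pderC R ord_max).
have {}h := ev_van xi h.
have {}h := lowM 'X h.
rewrite /ode; suff -> : ev xi (Qk R k) * tp (ev xi (Uk k la N)) + la%:P * (tp (ev xi (Qk R k)) * ev xi (Uk k la N)) =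
  'X * ev xi (Qk R k * pder ord_max (Uk k la N) + CC la * (pder ord_max (Qk R k) * Uk k la N)) by [].
have evM a b : ev xi (a * b) = ev xi a * ev xi b by exact: rmorphM.
have evD a b : ev xi (a + b) = ev xi a + ev xi b by exact: rmorphD.
rewrite (evD (Qk R k * _)) (evM (Qk R k)) (evM (CC la)) (evM (pder ord_max _)) /tp !deriv_map /pder /= /CC map_polyC /= /horner_eval hornerC; ring.
Qed.

(** The coefficient of [s^n] in [Qk ^ (- la)] as a polynomial in [xi]; this is the dependence on
    [cos q] which the Humbert arguments hide. *)
Definition hn n xi : R := \sum_(m < n.+1) un k la n m * xi ^+ m.
Lemma ev_Uk N n xi : (n <= N)%N -> (ev xi (Uk k la N))`_n = hn n xi.
Proof.
move=> h; rewrite ev_coef (@horner_coef_wide _ n.+1).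
  by apply: eq_bigr => m _; rewrite -(pcoef_Uk k0 la0 m h).
apply/leq_sizeP => m hm; rewrite -/(pcoef _ m n) (pcoef_Uk k0 la0) // un_out // => t.
have : (m <= k * m)%N by rewrite leq_pmull.
by move: hm; generalize (k * m)%N; lia.
Qed.

(** The substitution makes the square root rational: [c^2 = 1 - s^2], [r+ = 1 / (1 + t^2)] and
    [r- = t^2 / (1 + t^2)]. *)
Lemma peval_chAB n t (s := 2 * t / (1 + t ^+ 2)) (c := (1 - t ^+ 2) / (1 + t ^+ 2)) xi :
  peval (chA R n) (xi, s) = (1 + t ^+ (2 * n)) / (1 + t ^+ 2) ^+ n /\
  c * peval (chB R n) (xi, s) = (1 - t ^+ (2 * n)) / (1 + t ^+ 2) ^+ n.
Proof.
have t1 : 1 + t ^+ 2 != 0 by rewrite gt_eqF // ltr_wpDr ?sqr_ge0.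
have hs : peval (sg R) (xi, s) = c * c.
  by rewrite /sg !pevalE /= /c /s; field.
elim: n => [|n [IH1 IH2]].
  by rewrite /chA /chB /= !pevalE /= !muln0 !expr0; split; field.
have tn : (1 + t ^+ 2) ^+ n != 0 by rewrite expf_neq0.
rewrite chAS chBS; split.
  rewrite pevalM pevalC pevalD pevalM hs IH1 -mulrA IH2 /c mulnS exprD (exprS (1 + t ^+ 2)).
  by move: (t ^+ (2 * n)) ((1 + t ^+ 2) ^+ n) tn => x y tn; field; rewrite t1 tn.
rewrite pevalM pevalC pevalD mulrCA mulrDr IH2 IH1 /c mulnS exprD (exprS (1 + t ^+ 2)).
by move: (t ^+ (2 * n)) ((1 + t ^+ 2) ^+ n) tn => x y tn; field; rewrite t1 tn.
Qed.

Definition nsq (z : R[i]) : R := complex.Re z ^+ 2 + complex.Im z ^+ 2.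
Lemma nsqM z w : nsq (z * w) = nsq z * nsq w.
Proof. by case: z w => [a b] [c d]; rewrite /nsq /=; ring. Qed.
(** Squared modulus of the factorization [prod_cis] at [X = 1] and [Y = t e^(- i q / k)]. *)
Lemma prod_cos (q t : R) :
  \prod_(m < k) (1 + t ^+ 2 - 2 * t * cos ((q - 2 * (m : nat)%:R * pi) / k%:R)) =
  1 + t ^+ (2 * k) - 2 * t ^+ k * cos q.
Proof.
have kn : k%:R != 0 :> R by rewrite pnatr_eq0 -lt0n.
have cs (x : R) : cos x ^+ 2 + sin x ^+ 2 = 1 by exact: cos2Dsin2.
have Cr (x y : R) : Complex (x * y) 0 = Complex x 0 * Complex y 0 :> R[i].
  by apply/eqP; rewrite eq_complex /= !mulr0 !mul0r subr0 addr0 !eqxx.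
have CX (x : R) n : Complex x 0 ^+ n = Complex (x ^+ n) 0 :> R[i].
  by elim: n => [|n IH]; rewrite ?expr0 // !exprS IH Cr.
have key x y : nsq (1 - Complex y 0 * cis x) = 1 + y ^+ 2 - 2 * y * cos x.
  rewrite (_ : 1 + y ^+ 2 - 2 * y * cos x = 1 + y ^+ 2 * (cos x ^+ 2 + sin x ^+ 2) - 2 * y * cos x).
    by rewrite /nsq /cis /=; ring.
  by rewrite cs mulr1.
have := prod_cis 1 (Complex t 0 * cis (- (q / k%:R))) k0.
move/(congr1 nsq); rewrite (big_morph nsq nsqM (_ : nsq 1 = 1)); last by rewrite /nsq /=; ring.
rewrite expr1n exprMn cisX CX mulrN mulrCA divff // mulr1 key cosN -exprM mulnC => <-.
apply: eq_bigr => m _; rewrite -[_ * cis _ * cis _]mulrA -cisD key -cosN; congr (_ - _ * cos _).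
by field.
Qed.

Lemma prod_Qk q : \prod_(m < k) (1 - (cos ((q - 2 * (m : nat)%:R * pi) / k%:R))%:P * 'X) = ev (cos q) (Qk R k).
Proof.
set p1 := LHS; set p2 := RHS.
apply/eqP; rewrite -subr_eq0; apply/eqP.
(* Enough points [2 t / (1 + t^2)] to identify two polynomials in [s]. Equal values at [t] and [t']
   force [t = t'] or [t t' = 1], and starting from [t = 2] excludes the latter. *)
pose s (i : nat) : R := 2 * i.+2%:R / (1 + i.+2%:R ^+ 2).
have t1 i : 1 + i.+2%:R ^+ 2 != 0 :> R by rewrite gt_eqF // ltr_wpDr ?sqr_ge0.
apply: (@roots_geq_poly_eq0 _ _ [seq s i | i <- iota 0 (size (p1 - p2))]); last by rewrite size_map size_iota.
  apply/allP => _ /mapP[i _ ->]; rewrite rootE hornerD hornerN subr_eq0; apply/eqP.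
  have tk : (1 + i.+2%:R ^+ 2) ^+ k != 0 :> R by rewrite expf_neq0.
  have [hA _] := peval_chAB k i.+2%:R (cos q).
  have -> : p2.[s i] = peval (Qk R k) (cos q, s i).
    by rewrite /peval /= -[RHS]/(horner_eval (cos q) _) -horner_map /= /horner_eval hornerC.
  rewrite /Qk pevalB pevalM hA pevalX1 /chE pevalM pevalC pevalXn pevalX2 /=.
  transitivity ((1 + i.+2%:R ^+ (2 * k) - 2 * i.+2%:R ^+ k * cos q) / (1 + i.+2%:R ^+ 2) ^+ k); last first.
    rewrite /s exprMn exprMn [2^-1 ^+ k]exprVn exprVn.
    have tk2 : 2 ^+ k != 0 :> R by rewrite expf_neq0 // pnatr_eq0.
    by field; rewrite tk tk2.
  have -> : (1 + i.+2%:R ^+ 2) ^+ k = \prod_(m < k) (1 + i.+2%:R ^+ 2) :> R by rewrite prodr_const card_ord.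
  rewrite -prod_cos /p1 horner_prod -prodf_div.
  apply: eq_bigr => m _; rewrite hornerD hornerN hornerM !hornerC hornerX /s.
  by move: (cos _) (i.+2%:R : R) (t1 i) => c x hx; field.
rewrite map_inj_uniq ?iota_uniq // => i j.
rewrite /s => e.
have : (i.+2%:R - j.+2%:R) * (i.+2%:R * j.+2%:R - 1) = 0 :> R.
  have : (2 * i.+2%:R / (1 + i.+2%:R ^+ 2) - 2 * j.+2%:R / (1 + j.+2%:R ^+ 2)) *
     ((1 + i.+2%:R ^+ 2) * (1 + j.+2%:R ^+ 2) / -2) = 0 :> R by rewrite e subrr mul0r.
  by move=> <-; move: (i.+2%:R : R) (j.+2%:R : R) (t1 i) (t1 j) => x y hx hy; field; rewrite hx hy.
move/eqP; rewrite mulf_eq0 !subr_eq0 eqr_nat -natrM pnatr_eq1 muln_eq1 /= orbF => /eqP.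
by case.
Qed.
Let kla : 0 < k%:R * la. Proof. by rewrite mulr_gt0 // ltr0n. Qed.

(** The ratio [(n + 1) / (mu + n)] is at most 2 for [n >= 1]; the constant [1 + mu^-1] pays for
    [n = 0]. *)
Lemma poch_lb (mu : R) n : 0 < mu -> n`!%:R <= (1 + mu^-1) * 2 ^+ n * poch mu n.
Proof.
move=> m0; have i0 : 0 < mu^-1 by rewrite invr_gt0.
have c0 : 0 <= 1 + mu^-1 by rewrite addr_ge0 // ltW.
elim: n => [|n IH]; first by rewrite poch0 fact0 expr0 !mulr1 lerDl ltW.
rewrite pochS factS natrM exprS.
have hn : n.+1%:R * n`!%:R <= n.+1%:R * ((1 + mu^-1) * 2 ^+ n * poch mu n) by rewrite ler_wpM2l.
case: n IH hn => [|n] IH hn.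
  rewrite poch0 fact0 expr0 !mulr1 mul1r addr0 mulrAC mulrDl mulVf ?gt_eqF // mul1r.
  by rewrite mulrDl mul1r; apply: (@le_trans _ _ 2); rewrite ?lerDr ?mulr_ge0 ?ltW // ler1n.
apply: (le_trans hn).
rewrite [leRHS](_ : _ = 2 * (mu + n.+1%:R) * ((1 + mu^-1) * 2 ^+ n.+1 * poch mu n.+1)); last by ring.
apply: ler_wpM2r; first by rewrite mulr_ge0 ?mulr_ge0 ?exprn_ge0 // ltW // poch_gt0.
rewrite -natr1; have : (1 : R) <= n.+1%:R by rewrite ler1n.
by move: (n.+1%:R : R) => x hx; lra.
Qed.
Lemma inv_poch (mu : R) n : 0 < mu -> (poch mu n)^-1 <= (1 + mu^-1) * 2 ^+ n / n`!%:R.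
Proof.
move=> m0; have p0 := poch_gt0 n m0.
have f0 : (0 : R) < n`!%:R by rewrite ltr0n fact_gt0.
rewrite ler_pdivlMr // mulrC ler_pdivrMr //; exact: poch_lb.
Qed.
Lemma cL_ge0 n : 0 <= cL la n.
Proof. by rewrite /cL divr_ge0 // ltW // poch_gt0. Qed.
Lemma cL_le n : cL la n <= (1 + la) ^+ n.
Proof.
elim: n => [|n IH]; first by rewrite /cL poch0 fact0 divr1.
have n0 : (0 : R) < n.+1%:R by rewrite ltr0n.
have c0 := cL_ge0 n; rewrite -(ler_pM2l n0) cLS exprS [leRHS]mulrA.
apply: (@le_trans _ _ (n.+1%:R * (1 + la) * cL la n)); last by rewrite ler_wpM2l // mulr_ge0 // addr_ge0 // ltW.
rewrite ler_wpM2r // -natr1; have : (0 : R) <= n%:R by [].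
by move: (n%:R : R) => x hx; have := mulr_ge0 (ltW la0) hx; lra.
Qed.

Definition geoabs N : {poly R} := \poly_(j < N) (1 + la) ^+ j.
Lemma pmaj_geo N y : `|y| <= 1 -> pmaj (geo N y) (geoabs N).
Proof.
move=> hy n; rewrite !coef_poly; case: ifP => _; last by rewrite normr0.
rewrite normrM (ger0_norm (cL_ge0 n)) normrX -[leRHS]mulr1.
by apply: ler_pM; rewrite ?exprn_ge0 ?cL_ge0 ?cL_le // exprn_ile1.
Qed.
Lemma sum_half N : \sum_(j < N) (2^-1 : R) ^+ j <= 2.
Proof.
suff -> : \sum_(j < N) (2^-1 : R) ^+ j = 2 - 2 * 2^-1 ^+ N by rewrite gerBl mulr_ge0 // exprn_ge0.
elim: N => [|N IH]; first by rewrite big_ord0 expr0 mulr1 subrr.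
by rewrite big_ord_recr /= IH exprS; field.
Qed.
(** At the point [1 / Bg] the majorant [geoabs] is geometric of ratio one half, so each of the [k]
    factors has value at most 2. *)
Definition Bg : R := 2 * (1 + la).
Lemma Bg_gt0 : 0 < Bg. Proof. by rewrite /Bg mulr_gt0 // addr_gt0. Qed.
Lemma prod_geo_le (y : 'I_k -> R) N n : (forall i, `|y i| <= 1) ->
  `|(\prod_i geo N (y i))`_n| <= 2 ^+ k * Bg ^+ n.
Proof.
move=> hy; have B0 := Bg_gt0.
have h := pmaj_eval n (pmaj_prod (index_enum 'I_k) (fun i => pmaj_geo N (hy i))) (ltW (eqbRL (invr_gt0 Bg) B0)).
rewrite -ler_pdivrMr ?exprn_gt0 // -exprVn (le_trans h) // horner_prod.
have -> : 2 ^+ k = \prod_(i < k) (2 : R) by rewrite prodr_const card_ord.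
apply: ler_prod => i _; rewrite /geoabs horner_poly.
have -> : \sum_(i0 < N) (1 + la) ^+ i0 * Bg^-1 ^+ i0 = \sum_(i0 < N) (2^-1 : R) ^+ i0.
  apply: eq_bigr => j _; rewrite -exprMn; congr (_ ^+ _); rewrite /Bg invfM mulrCA divff ?mulr1 //.
  by rewrite gt_eqF // addr_gt0.
by rewrite sum_half sumr_ge0 // => j _; rewrite exprn_ge0.
Qed.
(** By [prod_Qk] both sides are cut series of the same power [- la]: they satisfy the same
    first-order equation in [s] with the same constant term. *)
Lemma prod_geo_hn q N n : (n < N)%N ->
  (\prod_(i < k) geo N (cos ((q - 2 * (i : nat)%:R * pi) / k%:R)))`_n = hn n (cos q).
Proof.
move=> hN; rewrite -(ev_Uk _ (ltnW hN)).
have h1 : ode N (ev (cos q) (Qk R k)) (\prod_(i < k) geo N (cos ((q - 2 * (i : nat)%:R * pi) / k%:R))).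
  by rewrite -prod_Qk; apply: ode_prod => i; exact: ode_geo.
have h2 := @ode_Uk N (cos q).
apply: (ode_uniq _ h1 h2) => //.
  rewrite -prod_Qk -horner_coef0 horner_prod big1 // => i _.
  by rewrite hornerD hornerN hornerM hornerX hornerC mulr0 subr0.
case: N hN h1 h2 => // N _ _ _; rewrite (ev_Uk _ (leq0n _)) /hn big_ord1 expr0 mulr1.
have := un_top la k0 0; rewrite muln0 /cL poch0 fact0 expr0 divr1 mulr1 => ->.
rewrite -horner_coef0 horner_prod big1 // => i _; by rewrite horner_coef0 geo0.
Qed.

Definition wn (b : R) n : R := b ^+ n / poch (k%:R * la) n.
(** The box sum grouped by total degree: [(la)_j / j!] is the coefficient in [geo], and the common
    Pochhammer symbol and the power of [b] go into [wn]. Because of the cut, degrees run up to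
    [k N]. *)
Lemma humbert_partE (y : 'I_k -> R) b N :
  humbert_part (fun _ : 'I_k => la) (k%:R * la) (fun i => b * y i) N =
  \sum_(n < (k * N).+1) (\prod_i geo N (y i))`_n * wn b n.
Proof.
have -> : \prod_i geo N (y i) = \sum_(f : {ffun 'I_k -> 'I_N})
    (\prod_i (cL la (f i) * y i ^+ f i)) *: 'X^(\sum_i (f i : nat)).
  under eq_bigr do rewrite /geo poly_def.
  rewrite bigA_distr_bigA; apply: eq_bigr => f _.
  by rewrite scaler_prod prodrXr.
under [RHS]eq_bigr do rewrite coef_sum mulr_suml.
rewrite exchange_big; apply: eq_bigr => f _ /=.
have hf : (\sum_i (f i : nat) < (k * N).+1)%N.
  rewrite ltnS -[k in (k * N)%N]card_ord -sum_nat_const; apply: leq_sum => i _; exact: ltnW.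
rewrite [RHS](bigD1 (Ordinal hf)) //= coefZ coefXn eqxx mulr1 [X in _ = _ + X]big1 ?addr0; last first.
  by move=> i; rewrite -val_eqE /= coefZ coefXn => /negbTE ->; rewrite mulr0 mul0r.
have -> : \prod_i (cL la (f i) * y i ^+ f i) =
   (\prod_i poch la (f i)) * \prod_i (y i ^+ f i / (f i)`!%:R).
  by rewrite -big_split; apply: eq_bigr => i _ /=; rewrite /cL mulrAC mulrA.
have -> : \prod_i ((b * y i) ^+ f i / (f i)`!%:R) = b ^+ (\sum_i (f i : nat)) * \prod_i (y i ^+ f i / (f i)`!%:R).
  by rewrite -prodrXr -big_split; apply: eq_bigr => i _ /=; rewrite exprMn mulrA.
by rewrite /wn; ring.
Qed.

Lemma wn_le b n : `|wn b n| <= (1 + (k%:R * la)^-1) * ((2 * `|b|) ^+ n / n`!%:R).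
Proof.
rewrite /wn normrM normrX [`|_^-1|]ger0_norm; last by rewrite invr_ge0 ltW // poch_gt0.
apply: le_trans (ler_wpM2l (exprn_ge0 n (normr_ge0 b)) (inv_poch n kla)) _.
by rewrite exprMn le_eqVlt; apply/orP; left; apply/eqP; ring.
Qed.
Definition Dn : R := 2 ^+ k * (1 + (k%:R * la)^-1).
Lemma prod_geo_wn (y : 'I_k -> R) b N n : (forall i, `|y i| <= 1) ->
  `|(\prod_i geo N (y i))`_n * wn b n| <= Dn * exp_coeff (2 * Bg * `|b|) n.
Proof.
move=> hy; rewrite normrM; apply: le_trans (ler_pM _ _ (prod_geo_le N n hy) (wn_le b n)) _ => //.
by rewrite /exp_coeff /= /Dn !exprMn le_eqVlt; apply/orP; left; apply/eqP; ring.
Qed.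

Lemma cos_le1' (x : R) : `|cos x| <= 1.
Proof. by rewrite ler_norml cos_geN1 cos_le1. Qed.

(** Below degree [N] the box sum has the true coefficients [hn]; its part between [N] and [k N] is
    dominated by a stretch of a convergent exponential series. *)
Lemma humbert_cvg q b :
  (fun N => \sum_(n < N) hn n (cos q) * wn b n) @ \oo -->
  humbert (fun _ : 'I_k => la) (k%:R * la) (fun j => b * cos ((q - 2 * (j : nat)%:R * pi) / k%:R)).
Proof.
set y := fun j : 'I_k => cos ((q - 2 * (j : nat)%:R * pi) / k%:R).
have hy i : `|y i| <= 1 by exact: cos_le1'.
set E := exp_coeff (2 * Bg * `|b|).
have cE : cvgn (series E) by exact: is_cvg_series_exp_coeff.
pose e n := hn n (cos q) * wn b n.
have he n : `|e n| <= Dn * E n.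
  by rewrite /e -(@prod_geo_hn q n.+1) //; exact: (prod_geo_wn b n.+1 n hy).
have cS : cvgn (series e).
  apply: normed_cvg; apply: (@series_le_cvg _ _ (fun n => Dn * E n)) => //.
  - by move=> n /=; exact: normr_ge0.
  - by move=> n; apply: le_trans (he n); exact: normr_ge0.
  - exact: is_cvg_seriesZ.
have eS : (fun N => \sum_(n < N) hn n (cos q) * wn b n) = series e.
  by apply/funext => N; rewrite /series /= big_mkord.
rewrite eS /humbert; set h := humbert_part _ _ _.
suff hh : h @ \oo --> limn (series e) by rewrite (cvg_lim _ hh).
have -> : h = (fun N => series e N + (h N - series e N)) by apply/funext => N; rewrite addrC subrK.
rewrite -[limn _]addr0; apply: cvgD => //.
apply/norm_cvg0P.
have tail : (fun N => Dn * (series E (k * N).+1 - series E N)) @ \oo --> 0.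
  rewrite -(mulr0 Dn) -(subrr (limn (series E))); apply: cvgMr; apply: cvgB => //.
  apply: (cvg_comp _ _ _ cE) => //.
  apply/cvgnyPge => A; near=> N.
  have : (A <= N)%N by near: N; exact: nbhs_infty_ge.
  by move=> hA; rewrite (leq_trans hA) // leqW // leq_pmull.
apply: (squeeze_cvgr _ (cvg_cst 0) tail); near=> N; rewrite normr_ge0 /=.
rewrite /h (humbert_partE y b N).
have hN : (N <= (k * N).+1)%N by rewrite leqW // leq_pmull.
have -> : series E (k * N).+1 - series E N = \sum_(N <= n < (k * N).+1) E n.
  by rewrite sub_series_geq.
have -> : series e N = \sum_(0 <= n < N) (\prod_i geo N (y i))`_n * wn b n.
  by apply: eq_big_nat => n /andP[_ hn]; rewrite /e -(prod_geo_hn q hn).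
rewrite -(big_mkord xpredT (fun n => (\prod_i geo N (y i))`_n * wn b n)) (big_cat_nat (leq0n N) hN) //= addrAC subrr add0r.
rewrite mulr_sumr (le_trans (ler_norm_sum _ _ _)) //; apply: ler_sum => n _.
exact: prod_geo_wn.
Unshelve. all: by end_near. Qed.

Definition gE N xi : R := \sum_(m < N.+1) un k la (2 * N) (2 * m) * xi ^+ (2 * m).
Lemma sum_pairs (f : nat -> R) M : \sum_(m < 2 * M) f m = \sum_(i < M) (f (2 * i)%N + f (2 * i).+1).
Proof.
elim: M => [|M IH]; first by rewrite muln0 !big_ord0.
by rewrite mulnS add2n !big_ord_recr /= IH addrA.
Qed.
Lemma hn_wide n M xi : (n < M)%N -> hn n xi = \sum_(m < M) un k la n m * xi ^+ m.
Proof.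
move=> h; rewrite /hn (big_ord_widen M (fun m => un k la n m * xi ^+ m) h) big_mkcond /=.
apply: eq_bigr => m _; case: ltnP => // hm.
rewrite un_out ?mul0r // => t; have : (m <= k * m)%N by rewrite leq_pmull.
by move: hm; generalize (k * m)%N; lia.
Qed.
Lemma hn_sym_even N xi : hn (2 * N) xi + hn (2 * N) (- xi) = 2 * gE N xi.
Proof.
have h : (2 * N < 2 * N.+1)%N by rewrite mulnS add2n ltnS.
rewrite !(hn_wide _ h) !(sum_pairs (fun m => un k la (2 * N) m * _ ^+ m)) -big_split /gE mulr_sumr; apply: eq_bigr => i _ /=.
by rewrite !exprS !exprM sqrrN; ring.
Qed.
Lemma hn_sym_odd N xi : hn (2 * N).+1 xi + hn (2 * N).+1 (- xi) = 0.
Proof.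
have h : ((2 * N).+1 < 2 * N.+1)%N by rewrite mulnS add2n.
rewrite !(hn_wide _ h) !(sum_pairs (fun m => un k la (2 * N).+1 m * _ ^+ m)) -big_split big1 // => i _ /=.
rewrite un_out //; last by move=> t; rewrite mulnCA; lia.
by rewrite !exprS !exprM sqrrN; ring.
Qed.
(** The second Humbert function has [pi - q] for [q], hence [- xi] for [xi]. The average keeps the
    even powers of [xi]; as [n - k m] is even in every term, odd degrees [n] disappear as well. *)
Lemma gfun_cvg b xi : -1 <= xi <= 1 ->
  (fun N => \sum_(n < N) gE n xi * wn b (2 * n)) @ \oo --> gfun k la b xi.
Proof.
move=> hxi; have c1 : cos (acos xi) = xi by rewrite acosK // in_itv.
have c2 : cos (pi - acos xi) = - xi.
  by rewrite cosB cospi sinpi mul0r addr0 mulN1r c1.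
have h1 := @humbert_cvg (acos xi) b; have h2 := @humbert_cvg (pi - acos xi) b.
rewrite c1 in h1; rewrite c2 in h2.
have h3 : (fun N : nat => 2^-1 * (\sum_(n < N) hn n xi * wn b n + \sum_(n < N) hn n (- xi) * wn b n)) @ \oo -->
    gfun k la b xi by apply: cvgM; [exact: cvg_cst | exact: cvgD].
have d : (fun N : nat => (2 * N)%N) @ \oo --> \oo.
  by apply/cvgnyPge => A; near=> N; have : (A <= N)%N by [near: N; exact: nbhs_infty_ge]; lia.
have := cvg_comp _ _ d h3; apply: cvg_trans; apply: near_eq_cvg; near=> N => /=.
rewrite -big_split /= (sum_pairs (fun n => hn n xi * wn b n + hn n (- xi) * wn b n)) mulr_sumr.
apply: eq_bigr => n _; rewrite -!mulrDl hn_sym_even hn_sym_odd mul0r addr0.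
by rewrite mulrA mulKf // pnatr_eq0.
Unshelve. all: by end_near. Qed.
End HumbertSeries.

(** * Entire power series in two variables *)

Section EntireSeries.
Variable R : realType.
Implicit Types (c : nat -> nat -> R) (w : R * R) (F : R * R -> R).

(** Coefficients of exponential type. This class is stable under differentiation, and its sums are
    dominated by [exp (M |w.1|) exp (M |w.2|)], which a Gaussian makes integrable. *)
Definition ebnd c := exists C M : R,
  [/\ 0 <= C, 0 <= M & forall a b, `|c a b| <= C * M ^+ (a + b) / (a`!%:R * b`!%:R)].
Definition box c N w := \sum_(a < N) \sum_(b < N) c a b * w.1 ^+ a * w.2 ^+ b.
Definition abox c N w := \sum_(a < N) \sum_(b < N) `|c a b * w.1 ^+ a * w.2 ^+ b|.

Lemma big_box_widen (f : nat -> nat -> R) N M : (N <= M)%N ->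
  \sum_(a < N) \sum_(b < N) f a b = \sum_(a < M) \sum_(b < M) (if (a < N)%N && (b < N)%N then f a b else 0).
Proof.
move=> h; rewrite (big_ord_widen M (fun a => \sum_(b < N) f a b) h) big_mkcond /=.
apply: eq_bigr => a _; case: ifP => ha /=; last by rewrite big1 // => b _; rewrite ha.
by rewrite (big_ord_widen M (f a) h) big_mkcond; apply: eq_bigr => b _.
Qed.
Lemma abox_homo c w : {homo (fun N => abox c N w) : n m / (n <= m)%N >-> n <= m}.
Proof.
move=> n m h; rewrite /abox (big_box_widen (fun a b => `|c a b * w.1 ^+ a * w.2 ^+ b|) h).
by apply: ler_sum => a _; apply: ler_sum => b _; case: ifP.
Qed.
Lemma series_exp_le (x : R) N : 0 <= x -> \sum_(n < N) x ^+ n / n`!%:R <= expR x.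
Proof.
move=> x0; have := @nondecreasing_cvgn_le _ (series (exp_coeff x)) _ (@is_cvg_series_exp_coeff _ x) N.
rewrite /series /= big_mkord; apply => n m h.
by rewrite /series /= (big_cat_nat (leq0n n) h) /= lerDl sumr_ge0 // => i _; rewrite exp_coeff_ge0.
Qed.
Lemma abox_le c C M w N : 0 <= C -> 0 <= M ->
  (forall a b, `|c a b| <= C * M ^+ (a + b) / (a`!%:R * b`!%:R)) ->
  abox c N w <= C * expR (M * `|w.1|) * expR (M * `|w.2|).
Proof.
move=> C0 M0 h.
apply: (@le_trans _ _ (C * (\sum_(a < N) (M * `|w.1|) ^+ a / a`!%:R) * (\sum_(b < N) (M * `|w.2|) ^+ b / b`!%:R))).
  rewrite [C * _]mulr_sumr mulr_suml; apply: ler_sum => a _; rewrite mulr_sumr; apply: ler_sum => b _.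
  rewrite !normrM !normrX.
  apply: (@le_trans _ _ (C * M ^+ (a + b) / (a`!%:R * b`!%:R) * `|w.1| ^+ a * `|w.2| ^+ b)).
    by rewrite !ler_wpM2r ?exprn_ge0.
  by rewrite !exprMn exprD invfM le_eqVlt; apply/orP; left; apply/eqP; ring.
have s0 (x : R) : 0 <= x -> 0 <= \sum_(n < N) x ^+ n / n`!%:R.
  by move=> x0; rewrite sumr_ge0 // => n _; rewrite divr_ge0 ?exprn_ge0.
by rewrite ler_pM ?ler_wpM2l ?series_exp_le ?mulr_ge0 ?s0 ?mulr_ge0.
Qed.
Lemma abox_cvg c w : ebnd c -> cvgn (fun N => abox c N w).
Proof.
case=> C [M [C0 M0 h]]; apply: nondecreasing_is_cvgn; first exact: abox_homo.
by exists (C * expR (M * `|w.1|) * expR (M * `|w.2|)) => _ [N _ <-]; exact: abox_le.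
Qed.
Lemma cvgn_shift_sub (u : nat -> R) (f g : nat -> nat) : cvgn u ->
  f @ \oo --> \oo -> g @ \oo --> \oo -> (fun N => u (f N) - u (g N)) @ \oo --> 0.
Proof.
by move=> cu hf hg; rewrite -(subrr (limn u)); apply: cvgB; apply: (cvg_comp _ _ _ cu).
Qed.
Lemma infty_ge (f : nat -> nat) : (forall n, (n <= f n)%N) -> f @ \oo --> \oo.
Proof.
move=> h; apply/cvgnyPge => A; near=> N; apply: leq_trans (h N); near: N; exact: nbhs_infty_ge.
Unshelve. all: by end_near. Qed.
Lemma partial_box_le c w (P : nat -> nat -> bool) N M : (N <= M)%N ->
  (forall a b, (a < N)%N -> (b < N)%N -> P a b) ->
  `|\sum_(a < M) \sum_(b < M) (if P a b then c a b * w.1 ^+ a * w.2 ^+ b else 0) - box c N w|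
   <= abox c M w - abox c N w.
Proof.
move=> h hP; rewrite /box /abox.
rewrite (big_box_widen (fun a b => c a b * w.1 ^+ a * w.2 ^+ b) h) (big_box_widen (fun a b => `|c a b * w.1 ^+ a * w.2 ^+ b|) h).
rewrite -!sumrB (le_trans (ler_norm_sum _ _ _)) //; apply: ler_sum => a _.
rewrite -!sumrB (le_trans (ler_norm_sum _ _ _)) //; apply: ler_sum => b _.
case: (boolP ((a < N)%N && (b < N)%N)) => [/andP[ha hb]|_]; first by rewrite hP // !subrr normr0.
by rewrite !subr0; case: ifP; rewrite ?normr0.
Qed.
(** Any summation region between the box [n] and the box [f n] gives the same limit, since the
    difference is bounded by a stretch of the absolute sums. It serves for sums by total degree and
    for the shifted ranges of a derivative. *)
Lemma partial_box_cvg c w (P : nat -> nat -> nat -> bool) (f : nat -> nat) (L : R) : ebnd c ->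
  (forall n, (n <= f n)%N) -> (forall n a b, (a < n)%N -> (b < n)%N -> P n a b) ->
  (fun N => \sum_(a < f N) \sum_(b < f N) (if P N a b then c a b * w.1 ^+ a * w.2 ^+ b else 0)) @ \oo --> L
  <-> (fun N => box c N w) @ \oo --> L.
Proof.
move=> hc hf hP.
set S := (X in X @ _ --> _ <-> _).
have d0 : (fun N => S N - box c N w) @ \oo --> 0.
  apply/norm_cvg0P; have t := cvgn_shift_sub (@abox_cvg _ w hc) (infty_ge hf) (infty_ge leqnn).
  apply: (squeeze_cvgr _ (cvg_cst 0) t); near=> N; rewrite normr_ge0 /=.
  by apply: partial_box_le => //; exact: hP.
split=> h.
  have -> : (fun N => box c N w) = (fun N => S N - (S N - box c N w)) by apply/funext => N; rewrite opprB addrC subrK.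
  by rewrite -[L]subr0; exact: cvgB.
have -> : S = (fun N => (S N - box c N w) + box c N w) by apply/funext => N; rewrite subrK.
by rewrite -[L]add0r; exact: cvgD.
Unshelve. all: by end_near. Qed.
(** The terms of [box + abox] are nonnegative, so its partial sums are nondecreasing and at most
    twice the limit of [abox]. *)
Lemma box_is_cvg c w : ebnd c -> cvgn (fun N => box c N w).
Proof.
move=> hc; have ca := @abox_cvg _ w hc.
have -> : (fun N => box c N w) = (fun N => (box c N w + abox c N w) - abox c N w) by apply/funext => N; rewrite addrK.
apply: is_cvgB => //; apply: nondecreasing_is_cvgn.
  move=> n m h; rewrite /box /abox -!big_split /=.
  under eq_bigr do rewrite -big_split /=; under [leRHS]eq_bigr do rewrite -big_split /=.
  rewrite (big_box_widen (fun a b => c a b * w.1 ^+ a * w.2 ^+ b + `|c a b * w.1 ^+ a * w.2 ^+ b|) h).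
  apply: ler_sum => a _; apply: ler_sum => b _; case: ifP => // _.
  by move: (_ * _ * _) => X; have := ler_norm (- X); rewrite normrN; lra.
exists (2 * limn (fun N => abox c N w)) => _ [N _ <-].
have h := nondecreasing_cvgn_le (@abox_homo c w) ca N.
apply: (@le_trans _ _ (abox c N w + abox c N w)); last by rewrite mulr_natl mulr2n lerD.
rewrite lerD2r /box /abox; apply: ler_sum => a _; apply: ler_sum => b _; exact: ler_norm.
Qed.

Definition ent c F := ebnd c /\ forall w, (fun N => box c N w) @ \oo --> F w.
Lemma ent0 c F : ent c F -> F (0, 0) = c 0 0.
Proof.
case=> hc /(_ (0, 0)) h; apply: (cvg_unique _ h) => //.
apply: cvg_near_cst; near=> N.
have N0 : (0 < N)%N by near: N; exact: nbhs_infty_ge.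
rewrite -(prednK N0) /box big_ord_recl /= big_ord_recl /= !expr0 !mulr1.
rewrite !big1 ?addr0 // => [a _|b _]; last by rewrite exprS mul0r mulr0.
by apply: big1 => b _; rewrite exprS mul0r mulr0 mul0r.
Unshelve. all: by end_near. Qed.

(** The bound in powers of [|x| + 1], rather than with a factor [a^2], is chosen so that the
    remainders of all monomials sum up to [abox] at [|x| + 1]. *)
Lemma pow_remainder (x h : R) a : `|h| <= 1 ->
  `|(x + h) ^+ a - x ^+ a| <= `|h| * (`|x| + 1) ^+ a /\
  `|(x + h) ^+ a - x ^+ a - h * (a%:R * x ^+ a.-1)| <= h ^+ 2 * (`|x| + 1) ^+ a.
Proof.
move=> h1; have xh n : `|(x + h) ^+ n| <= (`|x| + 1) ^+ n.
  by rewrite normrX lerXn2r // ?nnegrE ?addr_ge0 // (le_trans (ler_normD _ _)) // lerD2l.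
elim: a => [|a [IH1 IH2]].
  by rewrite !expr0 subrr !mul0r mulr0 subrr normr0 !mulr1 sqr_ge0 normr_ge0.
have e1 : (x + h) ^+ a.+1 - x ^+ a.+1 = x * ((x + h) ^+ a - x ^+ a) + h * (x + h) ^+ a.
  by rewrite !exprS; ring.
have e2 : (x + h) ^+ a.+1 - x ^+ a.+1 - h * (a.+1%:R * x ^+ a.+1.-1) =
   x * ((x + h) ^+ a - x ^+ a - h * (a%:R * x ^+ a.-1)) + h * ((x + h) ^+ a - x ^+ a).
  rewrite -[a.+1%:R]natr1 /=; case: a {IH1 IH2 e1} => [|a] /=; first by rewrite !expr0 expr1; ring.
  by rewrite !exprS; ring.
split.
  rewrite e1 (le_trans (ler_normD _ _)) // !normrM exprS.
  rewrite (_ : `|h| * _ = `|x| * (`|h| * (`|x| + 1) ^+ a) + `|h| * (`|x| + 1) ^+ a); last by ring.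
  by rewrite lerD // ler_wpM2l.
rewrite e2 (le_trans (ler_normD _ _)) // !normrM exprS.
rewrite (_ : h ^+ 2 * _ = `|x| * (h ^+ 2 * (`|x| + 1) ^+ a) + `|h| * (`|h| * (`|x| + 1) ^+ a)).
  by rewrite lerD // ler_wpM2l.
have hh : h ^+ 2 = `|h| * `|h| by rewrite -normrM -expr2 ger0_norm ?sqr_ge0.
by rewrite hh exprS; ring.
Qed.
Lemma derive1_quad (f : R -> R) x l K : 0 <= K ->
  (forall h, `|h| <= 1 -> `|f (x + h) - f x - h * l| <= h ^+ 2 * K) -> f^`() x = l.
Proof.
move=> K0 hf; rewrite /derive1; apply: cvg_lim => //.
suff e0 : (fun h => h^-1 *: (f (h + x) - f x) - l) @ 0^' --> 0.
  have -> : (fun h => h^-1 *: (f (h + x) - f x)) = (fun h => (h^-1 *: (f (h + x) - f x) - l) + l).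
    by apply/funext => h; rewrite subrK.
  by rewrite -[X in _ --> X]add0r; apply: cvgD => //; exact: cvg_cst.
apply/norm_cvg0P.
have t : (fun h : R => `|h| * K) @ 0^' --> 0.
  suff : (fun h : R => `|h| * K) @ 0^' --> `|0 : R| * K by rewrite normr0 mul0r.
  apply: cvgM; last exact: cvg_cst.
  by apply: cvg_norm; apply: cvg_within.
apply: (squeeze_cvgr _ (cvg_cst 0) t); near=> h; rewrite normr_ge0 /=.
have h0 : h != 0 by near: h; exact: nbhs_dnbhs_neq.
have h1 : `|h| <= 1 by near: h; apply: dnbhs0_le.
have hh := hf _ h1.
rewrite -(ler_pM2l (_ : 0 < `|h|)) ?normr_gt0 // -normrM mulrBr /GRing.scale /= mulrA divff // mul1r.
rewrite [h + x]addrC mulrA -normrM -expr2 [`|h ^+ 2|]ger0_norm ?sqr_ge0.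
Unshelve. all: by end_near. Qed.

Lemma ebnd_shift1 c : ebnd c -> ebnd (fun a b => a.+1%:R * c a.+1 b).
Proof.
case=> C [M [C0 M0 h]]; exists (C * M), M; split=> [||a b] //; first exact: mulr_ge0.
rewrite normrM normr_nat; apply: le_trans (ler_wpM2l (ler0n R a.+1) (h a.+1 b)) _.
have fa : (a`!%:R : R) != 0 by rewrite pnatr_eq0 -lt0n fact_gt0.
have fb : (b`!%:R : R) != 0 by rewrite pnatr_eq0 -lt0n fact_gt0.
have an : (a.+1%:R : R) != 0 by rewrite pnatr_eq0.
rewrite factS natrM addSn exprS le_eqVlt; apply/orP; left; apply/eqP.
by move: (a.+1%:R : R) (a`!%:R : R) (b`!%:R : R) fa fb an => x y z fa fb an; field; rewrite fa fb an.
Qed.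
Lemma ebnd_swap c : ebnd c -> ebnd (fun a b => c b a).
Proof.
by case=> C [M [C0 M0 h]]; exists C, M; split=> // a b; rewrite addnC mulrC [_ * b`!%:R]mulrC mulrC.
Qed.
Lemma box_swap c N w : box (fun a b => c b a) N w = box c N (w.2, w.1).
Proof. by rewrite /box exchange_big; apply: eq_bigr => a _; apply: eq_bigr => b _; rewrite mulrAC. Qed.
Lemma ent_swap c F : ent c F -> ent (fun a b => c b a) (fun w => F (w.2, w.1)).
Proof.
case=> hc h; split; first exact: ebnd_swap.
by move=> w; have -> : (fun N => box (fun a b => c b a) N w) = (fun N => box c N (w.2, w.1)) by apply/funext => N; rewrite box_swap.
Qed.

(** The quadratic remainders of the monomials are summed by [abox] at [|w.1| + 1]; in the limit [F]
    itself has a quadratic remainder with respect to the differentiated series, which is then its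
    derivative. *)
Lemma ent_d1 c F : ent c F -> ent (fun a b => a.+1%:R * c a.+1 b) (d1 F).
Proof.
case=> hc hF; have hc' := ebnd_shift1 hc; split=> // w.
pose c' a b := a.+1%:R * c a.+1 b; suff -> : d1 F w = limn (fun N => box c' N w) by exact: box_is_cvg.
have [C [M [C0 M0 hb]]] := hc.
pose K := C * expR (M * `|(`|w.1| + 1)|) * expR (M * `|w.2|).
apply: (@derive1_quad _ _ _ K); first by rewrite !mulr_ge0 ?expR_ge0.
move=> h h1.
(* The derivative of the box sum of size [N.+1] contains only exponents [a < N], so its partial sums
   are not square. *)
have l' : (fun N => \sum_(a < N.+1) \sum_(b < N.+1) (if (a < N)%N then c' a b * w.1 ^+ a * w.2 ^+ b else 0)) @ \oo --> limn (fun N => box c' N w).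
  apply/(@partial_box_cvg c' w (fun N a b => (a < N)%N) (fun N => N.+1)) => //.
  exact: box_is_cvg.
have sh : (fun N : nat => N.+1) @ \oo --> \oo by exact: infty_ge.
have l1 := cvg_comp _ _ sh (hF (w.1 + h, w.2)).
have l2 := cvg_comp _ _ sh (hF (w.1, w.2)).
have l3 : (fun N => `|box c N.+1 (w.1 + h, w.2) - box c N.+1 (w.1, w.2) -
   h * \sum_(a < N.+1) \sum_(b < N.+1) (if (a < N)%N then c' a b * w.1 ^+ a * w.2 ^+ b else 0)|) @ \oo -->
   `|F (w.1 + h, w.2) - F (w.1, w.2) - h * limn (fun N => box c' N w)|.
  by apply: cvg_norm; apply: cvgB; [exact: cvgB | apply: cvgM => //; exact: cvg_cst].
rewrite -(cvg_lim _ l3) //; apply: limr_le; first by apply/cvg_ex; eexists; exact: l3.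
near=> N.
have -> : \sum_(a < N.+1) \sum_(b < N.+1) (if (a < N)%N then c' a b * w.1 ^+ a * w.2 ^+ b else 0) =
   \sum_(a < N.+1) \sum_(b < N.+1) c a b * (a%:R * w.1 ^+ a.-1) * w.2 ^+ b.
  rewrite [LHS]big_ord_recr [RHS]big_ord_recl /= ltnn [X in _ + X = _]big1 // addr0.
  rewrite [X in _ = X + _]big1 ?add0r; last by move=> b _; rewrite !mul0r mulr0 mul0r.
  apply: eq_bigr => a _; apply: eq_bigr => b _; rewrite ltn_ord /c' /bump /= add1n; ring.
apply: (@le_trans _ _ (h ^+ 2 * abox c N.+1 (`|w.1| + 1, w.2))); last first.
  by rewrite ler_wpM2l ?sqr_ge0 //; exact: (abox_le (`|w.1| + 1, w.2) N.+1 C0 M0 hb).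
rewrite mulr_sumr /box -!sumrB (le_trans (ler_norm_sum _ _ _)) // mulr_sumr; apply: ler_sum => a _.
rewrite !mulr_sumr -!sumrB (le_trans (ler_norm_sum _ _ _)) //; apply: ler_sum => b _ /=.
have -> : c a b * (w.1 + h) ^+ a * w.2 ^+ b - c a b * w.1 ^+ a * w.2 ^+ b - h * (c a b * (a%:R * w.1 ^+ a.-1) * w.2 ^+ b) =
  c a b * w.2 ^+ b * ((w.1 + h) ^+ a - w.1 ^+ a - h * (a%:R * w.1 ^+ a.-1)) by ring.
rewrite !normrM [`|(_ + 1) ^+ a|]ger0_norm ?exprn_ge0 ?addr_ge0 //.
have [_ hp] := pow_remainder w.1 a h1.
rewrite (_ : h ^+ 2 * _ = `|c a b| * `|w.2 ^+ b| * (h ^+ 2 * (`|w.1| + 1) ^+ a)); last by ring.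
by rewrite ler_wpM2l // mulr_ge0.
Unshelve. all: by end_near. Qed.
Lemma ent_d2 c F : ent c F -> ent (fun a b => b.+1%:R * c a b.+1) (d2 F).
Proof. by move=> h; have := ent_swap (ent_d1 (ent_swap h)). Qed.
Lemma ent_iter c F a b : ent c F -> iter a (@d1 R) (iter b (@d2 R) F) (0, 0) = a`!%:R * b`!%:R * c a b.
Proof.
elim: b c F => [|b IH] c F h; last first.
  by rewrite iterSr (IH _ _ (ent_d2 h)) factS natrM; ring.
rewrite /= fact0 mulr1; elim: a c F h => [|a IH] c F h; first by rewrite /= (ent0 h) fact0 mul1r.
by rewrite iterSr (IH _ _ (ent_d1 h)) factS natrM; ring.
Qed.
Lemma ent_papply0 c F p : ent c F -> papply0 p F = psum p (fun a b => a`!%:R * b`!%:R * c a b).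
Proof.
move=> h; rewrite /papply0 /psum; apply: eq_bigr => b _; apply: eq_bigr => a _.
by rewrite (ent_iter _ _ h).
Qed.

(** Regrouping by total degree, with [P n] the part of degree [2 n]: the triangle [a + b < 2 N]
    contains the box [N] and lies in the box [2 N]. *)
Lemma ent_poly c F (P : nat -> {poly {poly R}}) : ebnd c ->
  (forall a b, odd (a + b) -> c a b = 0) ->
  (forall N a b, pcoef (P N) a b = if (a + b == 2 * N)%N then c a b else 0) ->
  (forall w, (fun N => \sum_(n < N) peval (P n) w) @ \oo --> F w) -> ent c F.
Proof.
move=> hc hodd hP hF; split=> // w.
apply/(@partial_box_cvg c w (fun N a b => (a + b < 2 * N)%N) (fun N => (2 * N)%N)) => //.
- by move=> n; rewrite leq_pmull.
- by move=> n a b ha hb /=; rewrite mul2n -addnn; lia.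
suff -> : (fun N => \sum_(a < 2 * N) \sum_(b < 2 * N) (if (a + b < 2 * N)%N then c a b * w.1 ^+ a * w.2 ^+ b else 0)) =
   (fun N => \sum_(n < N) peval (P n) w) by exact: hF.
apply/funext => N; rewrite -peval_sum peval_psum.
have hS a b : pcoef (\sum_(i < N) P i) a b = if (a + b < 2 * N)%N then c a b else 0.
  rewrite pcoef_sum; under eq_bigr do rewrite hP.
  case: ltnP => h; last first.
    by apply: big1 => i _; case: eqP => // e; move: h (ltn_ord i); lia.
  have [ho|he] := boolP (odd (a + b)).
    by rewrite hodd // big1 // => i _; rewrite if_same.
  have hi : ((a + b)./2 < N)%N by lia.
  rewrite (bigD1 (Ordinal hi)) //= big1 ?addr0; first by case: eqP => //; lia.
  by move=> i; rewrite -val_eqE /= => hne; case: eqP => // e'; lia.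
rewrite (@psum_widen _ _ _ (2 * N)) => [|a b h]; last by rewrite hS; case: ltnP => //; lia.
rewrite exchange_big; apply: eq_bigr => b _; apply: eq_bigr => a _ /=.
by rewrite hS; case: ifP; rewrite ?mul0r ?mulrA.
Qed.
End EntireSeries.

(** * [J] as a power series in [w] *)

Section KernelSeries.
Variables (R : realType) (k : nat) (al be : R).
Hypotheses (k0 : (0 < k)%N) (al0 : 0 < al) (be0 : 0 < be).
Local Notation P2 := {poly {poly R}}.
Local Notation X1 := (X1 R).
Local Notation X2 := (X2 R).
Local Notation la := (al + be).
Local Notation un := (un k la).

Let la0 : 0 < la. Proof. exact: addr_gt0. Qed.
Let kla : 0 < k%:R * la. Proof. by rewrite mulr_gt0 // ltr0n. Qed.

Lemma un_even_out N m : (N < k * m)%N -> un (2 * N) (2 * m) = 0.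
Proof. by move=> h; apply: un_out => // t; rewrite mulnCA; move: h; generalize (k * m)%N; lia. Qed.
(** A Cauchy estimate at [xi = 2] and [s = 1 / B]. Since [1 - Qk] is divisible by [s], the binomial
    series is there dominated by a geometric one. The factor [2 ^+ m] is reserved for the sum of two
    terms raised to the power [2 m] in [JP]. *)
Lemma un_bound : exists2 B : R, 0 < B & forall n m, `|un n m| * 2 ^+ m <= 2 * B ^+ n.
Proof.
have [r hr] := van_Qk k0 la0; have [Q hQ] := maj_ex r.
set A := peval Q (2, 1).
have A0 : 0 <= A.
  by have := maj_eval 0 0 hQ (ler0n R 2) ler01; rewrite !expr0 !mulr1; apply: le_trans.
have l1 : 0 < 1 + la by rewrite addr_gt0.
(* Large enough for [(1 + la) * A / B] to be at most one half, and at least 1 so that [1 / B] stays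
   in the range where [Q] is bounded by [A]. *)
set B := 2 * (1 + la) * (1 + A).
have B1 : 1 <= B.
  have h1 : 0 <= al * A by rewrite mulr_ge0 // ltW.
  have h2 : 0 <= be * A by rewrite mulr_ge0 // ltW.
  by rewrite /B; move: al0 be0; nra.
have B0 : 0 < B by apply: lt_le_trans B1.
exists B => // n m; set q := B^-1.
have q0 : 0 <= q by rewrite invr_ge0 ltW.
have q1 : q <= 1 by rewrite invf_le1.
pose P : P2 := \sum_(L < n.+1) CC ((1 + la) ^+ L) * (X2 * Q) ^+ L.
have hP : maj (Uk k la n) P.
  rewrite /Uk hr expr1; apply: maj_sum => L; apply: majM.
    by apply: majC; rewrite ger0_norm ?cL_ge0 ?cL_le.
  by apply: majXn; apply: majM => //; exact: majX2.
have := maj_eval m n hP (ler0n R 2) q0; rewrite (pcoef_Uk k0 la0 m (leqnn n)) => h.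
rewrite -ler_pdivrMr ?exprn_gt0 // -exprVn; apply: (le_trans h).
rewrite /P peval_sum.
apply: (@le_trans _ _ (\sum_(L < n.+1) (2^-1 : R) ^+ L)); last exact: sum_half.
apply: ler_sum => L _; rewrite !pevalE /= -exprMn lerXn2r ?nnegrE //.
  rewrite !mulr_ge0 // ?(ltW l1) //.
  have := maj_eval 0 0 (maj_self hQ) (ler0n R 2) q0; rewrite !expr0 !mulr1; exact: le_trans.
apply: (@le_trans _ _ ((1 + la) * (q * A))).
  rewrite ler_wpM2l ?(ltW l1) // ler_wpM2l //; exact: (peval_monotone (maj_self hQ)).
rewrite /q mulrCA ler_pdivrMl // /B; have : 0 <= (1 + la) by exact: ltW.
by move=> ?; nra.
Qed.

(** Powers of [X1 + X2] are common majorants of [zre], [zim] and [rho], with coefficients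
    [n! / (a! b!)], the shape that [ebnd] asks for. *)
Definition lin2 : P2 := X1 + X2.
Lemma pcoef_lin2 n a b : pcoef (lin2 ^+ n) a b = if (a + b == n)%N then n`!%:R / (a`!%:R * b`!%:R) else 0.
Proof.
rewrite /lin2 exprDn pcoef_sum.
have e (i : 'I_n.+1) : pcoef (X1 ^+ (n - i) * X2 ^+ i *+ 'C(n, i)) a b = if (a == n - i)%N && (b == i) then 'C(n, i)%:R else 0.
  rewrite -[_ *+ _]mulr_natl -CCnat pcoefZ pcoef_mono; case: ifP => _; by rewrite ?mulr1 ?mulr0.
under eq_bigr do rewrite e.
case: eqP => h.
  have hb : (b < n.+1)%N by lia.
  rewrite (bigD1 (Ordinal hb)) //= big1 ?addr0; last first.
    by move=> i; rewrite -val_eqE /= => hi; case: ifP => // /andP[_ /eqP hh]; move: hi; rewrite hh eqxx.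
  rewrite eqxx andbT (_ : (a == n - b)%N); last by apply/eqP; lia.
  have hbn : (b <= n)%N by lia.
  have <- : ('C(n, b) * (b`! * (n - b)`!))%:R = n`!%:R :> R by rewrite bin_fact.
  have -> : (n - b = a)%N by lia.
  have fa : (a`!%:R : R) != 0 by rewrite pnatr_eq0 -lt0n fact_gt0.
  have fb : (b`!%:R : R) != 0 by rewrite pnatr_eq0 -lt0n fact_gt0.
  rewrite !natrM; field; by rewrite fa fb.
by rewrite big1 // => i _; case: ifP => // /andP[/eqP h1 /eqP h2]; move: (ltn_ord i); lia.
Qed.
Lemma maj_zpow n : maj (zre R n) (lin2 ^+ n) /\ maj (zim R n) (lin2 ^+ n).
Proof.
elim: n => [|n [IH1 IH2]].
  rewrite expr0 /zre /zim /= -CC1 -CC0; split; first by apply: majC; rewrite normr1.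
  by apply: majC; rewrite normr0.
rewrite zreS zimS exprS /lin2 mulrDl; split; last by apply: majD; apply: majM; (exact: majX1 || exact: majX2 || done).
apply: majD; first by apply: majM => //; exact: majX1.
by move=> b; rewrite coefN; apply: pmajN; apply: majM => //; exact: majX2.
Qed.

Local Notation zre := (zre R k).
Local Notation zim := (zim R k).
Local Notation rho := (rho R).
Section Point.
Variables (u v : R) (z : R * R).
Hypotheses (hu : -1 <= u <= 1) (hv : -1 <= v <= 1).

(* The part of degree 2N in w of J_{u,v}(z, w). *)
Definition JP N : P2 := \sum_(m < N.+1)
  CC (un (2 * N) (2 * m) / poch (k%:R * la) (2 * N)) * (CC (z.1 ^+ 2 + z.2 ^+ 2) * rho) ^+ (N - k * m) *
  (CC (v * peval zre z) * zre + CC (u * peval zim z) * zim) ^+ (2 * m).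

Lemma polar (x : R * R) : x.1 = nrm x * cos (argp x) /\ x.2 = nrm x * sin (argp x).
Proof.
have n2 : nrm x ^+ 2 = x.1 ^+ 2 + x.2 ^+ 2 by rewrite sqr_sqrtr // addr_ge0 ?sqr_ge0.
have n0 : 0 <= nrm x by exact: sqrtr_ge0.
have [e|ne] := eqVneq (nrm x) 0.
  move: n2; rewrite e expr0n /= !mul0r => /eqP; rewrite eq_sym paddr_eq0 ?sqr_ge0 // !sqrf_eq0.
  by case/andP => /eqP -> /eqP ->.
have np : 0 < nrm x by rewrite lt_neqAle eq_sym ne.
have hq : (x.1 / nrm x) ^+ 2 <= 1.
  by rewrite expr_div_n ler_pdivrMr ?exprn_gt0 // mul1r n2 lerDl sqr_ge0.
have hb : -1 <= x.1 / nrm x <= 1.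
  by rewrite -ler_norml -(@ler_pXn2r _ 2) ?nnegrE // expr1n real_normK ?num_real.
have hc : cos (acos (x.1 / nrm x)) = x.1 / nrm x by rewrite acosK // in_itv.
have hs : nrm x * sin (acos (x.1 / nrm x)) = `|x.2|.
  rewrite sin_acos //; set y := x.1 / nrm x.
  have -> : nrm x * Num.sqrt (1 - y ^+ 2) = Num.sqrt (nrm x ^+ 2 * (1 - y ^+ 2)).
    by rewrite sqrtrM ?sqr_ge0 // sqrtr_sqr ger0_norm.
  rewrite mulrBr mulr1 /y expr_div_n mulrCA divff ?mulr1 ?expf_neq0 // n2 addrC addrA addNr add0r.
  exact: sqrtr_sqr.
rewrite /argp; case: ifP => h; rewrite ?cosN ?sinN hc.
  by rewrite hs ger0_norm // mulrCA divff // mulr1.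
rewrite mulrN hs ler0_norm ?opprK; last by rewrite ltW // ltNge h.
by rewrite mulrCA divff // mulr1.
Qed.
Lemma peval_zpow_polar (x : R * R) : peval zre x = nrm x ^+ k * cos (k%:R * argp x) /\
  peval zim x = nrm x ^+ k * sin (k%:R * argp x).
Proof.
have [h1 h2] := polar x; have [h3 h4] := zpow_polar k (nrm x) (argp x).
by rewrite -h1 -h2 -surjective_pairing in h3 h4.
Qed.
(** Cauchy-Schwarz for two unit vectors. It puts [xi] in the domain on which [acos] inverts
    [cos]. *)
Lemma xi_bound t1 t2 : -1 <= xi_uv u v t1 t2 <= 1.
Proof.
have cs (x : R) : cos x ^+ 2 + sin x ^+ 2 = 1 by exact: cos2Dsin2.
rewrite -ler_norml /xi_uv (le_trans (ler_normD _ _)) // !normrM.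
have hu' : `|u| <= 1 by rewrite ler_norml.
have hv' : `|v| <= 1 by rewrite ler_norml.
apply: (@le_trans _ _ (`|cos t1| * `|cos t2| + `|sin t1| * `|sin t2|)).
  by rewrite lerD // -[leRHS]mul1r -mulrA ler_wpM2r // mulr_ge0.
have c1 := cs t1; have c2 := cs t2; rewrite -!(real_normK (num_real (cos _))) -!(real_normK (num_real (sin _))) in c1 c2.
have s1 := sqr_ge0 (`|cos t1| - `|cos t2|); have s2 := sqr_ge0 (`|sin t1| - `|sin t2|).
move: s1 s2; rewrite !sqrrB; lra.
Qed.

(** Why polar coordinates disappear: [|z|^k |w|^k xi] is bilinear in the real and imaginary parts of
    [z^k] and [w^k], and next to [xi^(2 m)] the remaining power of [|z| |w|] has the even exponent
    [2 (N - k m)]. *)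
Lemma JP_eval w N : peval (JP N) w =
  gE k la N (xi_uv u v (k%:R * argp z) (k%:R * argp w)) * wn k la (nrm z * nrm w) (2 * N).
Proof.
have n2 (x : R * R) : nrm x ^+ 2 = x.1 ^+ 2 + x.2 ^+ 2 by rewrite sqr_sqrtr // addr_ge0 ?sqr_ge0.
rewrite /JP peval_sum /gE mulr_suml; apply: eq_bigr => m _.
have [h|h] := leqP (k * m) N; last first.
  by rewrite un_even_out ?mul0r ?CC0 ?mul0r ?peval0.
rewrite 2!pevalM pevalC 2!pevalXn pevalM peval_rho pevalC pevalD !pevalM !pevalC -!n2.
have [zx zy] := peval_zpow_polar z; have [wx wy] := peval_zpow_polar w.
rewrite zx zy wx wy /wn.
set xi := xi_uv _ _ _ _.
have -> : v * (nrm z ^+ k * cos (k%:R * argp z)) * (nrm w ^+ k * cos (k%:R * argp w)) +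
   u * (nrm z ^+ k * sin (k%:R * argp z)) * (nrm w ^+ k * sin (k%:R * argp w)) = (nrm z * nrm w) ^+ k * xi.
  by rewrite exprMn /xi /xi_uv; ring.
have e : (2 * N = 2 * (N - k * m) + k * (2 * m))%N by rewrite mulnCA -mulnDr subnK.
set b := nrm z * nrm w.
have -> : b ^+ (2 * N) = (b ^+ 2) ^+ (N - k * m) * (b ^+ k) ^+ (2 * m) by rewrite -!exprM -exprD -e.
by rewrite -[nrm z ^+ 2 * _]exprMn -/b [(b ^+ k * xi) ^+ _]exprMn; ring.
Qed.
Lemma Jfun_cvg w : (fun N => \sum_(n < N) peval (JP n) w) @ \oo --> Jfun k al be u v z w.
Proof.
have h := @gfun_cvg _ _ _ k0 la0 (nrm z * nrm w) _ (xi_bound (k%:R * argp z) (k%:R * argp w)).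
have -> : (fun N => \sum_(n < N) peval (JP n) w) = (fun N => \sum_(n < N)
   gE k la n (xi_uv u v (k%:R * argp z) (k%:R * argp w)) * wn k la (nrm z * nrm w) (2 * n)).
  by apply/funext => N; apply: eq_bigr => n _; exact: JP_eval.
exact: h.
Qed.

Lemma maj_rho : maj rho (lin2 ^+ 2).
Proof.
have m0 (p P : P2) : maj p P -> maj 0 P.
  by move=> h b n; rewrite !coef0 normr0 (pmaj_ge0 (h b)).
have h1 : maj X1 lin2 by rewrite -[X1]addr0 /lin2; apply: majD; [exact: majX1 | apply: (m0 _ _ (majX2 R))].
have h2 : maj X2 lin2 by rewrite -[X2]add0r /lin2; apply: majD; [apply: (m0 _ _ (majX1 R)) | exact: majX2].
rewrite (_ : rho = X1 ^+ 2 + X2 ^+ 2) // !expr2 [X in maj _ X]mulrDl; apply: majD; apply: majM => //; [exact: majX1 | exact: majX2].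
Qed.
Lemma JP_bound : exists C M : R, [/\ 0 <= C, 0 <= M & forall N a b,
  `|pcoef (JP N) a b| <= if (a + b == 2 * N)%N then C * M ^+ (2 * N) / (a`!%:R * b`!%:R) else 0].
Proof.
have [B B0 hB] := un_bound; set r := nrm z.
have r0 : 0 <= r by exact: sqrtr_ge0.
have r2 : z.1 ^+ 2 + z.2 ^+ 2 = r ^+ 2 by rewrite sqr_sqrtr // addr_ge0 ?sqr_ge0.
have i0 : 0 <= 1 + (k%:R * la)^-1 by rewrite addr_ge0 // invr_ge0 ltW.
(* In the 4, one factor 2 comes from [inv_poch], and the other absorbs the [N.+1] terms of the
   sum. *)
exists (2 * (1 + (k%:R * la)^-1)), (4 * B * r); split=> [||N a b].
- exact: mulr_ge0.
- by rewrite !mulr_ge0 // ltW.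
pose s m := `|un (2 * N) (2 * m)| * 2 ^+ (2 * m) / poch (k%:R * la) (2 * N) * r ^+ (2 * N).
have [zx zy] := peval_zpow_polar z.
have hu' : `|u| <= 1 by rewrite ler_norml.
have hv' : `|v| <= 1 by rewrite ler_norml.
have p0 : 0 < poch (k%:R * la) (2 * N) by exact: poch_gt0.
have hJ : maj (JP N) (CC (\sum_(m < N.+1) s m) * lin2 ^+ (2 * N)).
  rewrite /JP CC_sum mulr_suml; apply: maj_sum => m.
  have [h|h] := leqP (k * m) N; last first.
    have e0 := un_even_out h.
    rewrite /s e0 normr0 !mul0r ?CC0 ?mul0r; by move=> b' n; rewrite !coef0 normr0.
  have e : (2 * N = 2 * (N - k * m) + k * (2 * m))%N by rewrite mulnCA -mulnDr subnK.
  have -> : CC (s m) * lin2 ^+ (2 * N) = CC (`|un (2 * N) (2 * m) / poch (k%:R * la) (2 * N)|) *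
     (CC (r ^+ 2) * lin2 ^+ 2) ^+ (N - k * m) *
     (CC (r ^+ k) * lin2 ^+ k + CC (r ^+ k) * lin2 ^+ k) ^+ (2 * m).
    have -> : (CC (r ^+ 2) * lin2 ^+ 2) ^+ (N - k * m) = CC ((r ^+ 2) ^+ (N - k * m)) * lin2 ^+ (2 * (N - k * m)).
      by rewrite exprMn -CCXn -[(lin2 ^+ _) ^+ _]exprM.
    have -> : (CC (r ^+ k) * lin2 ^+ k + CC (r ^+ k) * lin2 ^+ k) ^+ (2 * m) =
        CC ((2 * r ^+ k) ^+ (2 * m)) * lin2 ^+ (k * (2 * m)).
      rewrite -mulrDl -CCD exprMn -CCXn -[(lin2 ^+ _) ^+ _]exprM; congr (CC (_ ^+ _) * _); ring.
    have -> : lin2 ^+ (2 * N) = lin2 ^+ (2 * (N - k * m)) * lin2 ^+ (k * (2 * m)) by rewrite -exprD -e.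
    have -> : s m = `|un (2 * N) (2 * m) / poch (k%:R * la) (2 * N)| * (r ^+ 2) ^+ (N - k * m) * (2 * r ^+ k) ^+ (2 * m).
      have -> : s m = `|un (2 * N) (2 * m)| * 2 ^+ (2 * m) / poch (k%:R * la) (2 * N) * ((r ^+ 2) ^+ (N - k * m) * (r ^+ k) ^+ (2 * m)).
        by rewrite /s -!exprM -exprD -e.
      rewrite normrM [`|_^-1|]ger0_norm ?invr_ge0 ?(ltW p0) // [(2 * _) ^+ _]exprMn.
      by move: ((r ^+ 2) ^+ _) ((r ^+ k) ^+ _) (2 ^+ (2 * m)) => x y t; ring.
    by rewrite !CCM; ring.
  apply: majM; first apply: majM; first exact: majC.
    by rewrite r2; apply: majXn; apply: majM; [apply: majC; rewrite ger0_norm ?sqr_ge0 | exact: maj_rho].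
  have [m1 m2] := maj_zpow k.
  have rk : 0 <= r ^+ k by rewrite exprn_ge0.
  have cs_le (x : R) : `|cos x| <= 1 by exact: cos_le1'.
  have sn_le (x : R) : `|sin x| <= 1 by rewrite ler_norml sin_geN1 sin_le1.
  have bnd (x y : R) : `|x| <= 1 -> `|y| <= 1 -> `|x * (r ^+ k * y)| <= r ^+ k.
    move=> hx hy; rewrite !normrM [`|r ^+ k|]ger0_norm // -[leRHS]mul1r ler_pM ?mulr_ge0 //.
    by rewrite -[leRHS]mulr1 ler_wpM2l.
  apply: majXn; apply: majD; apply: majM => //; apply: majC; rewrite ?zx ?zy; exact: bnd.
apply: (le_trans (maj_pcoef a b hJ)); rewrite pcoefZ pcoef_lin2; case: eqP => // eab; last by rewrite mulr0.
have fab : 0 < a`!%:R * b`!%:R :> R by rewrite mulr_gt0 // ltr0n fact_gt0.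
rewrite mulrA ler_wpM2r ?invr_ge0 ?(ltW fab) //.
have f0 : 0 < (2 * N)`!%:R :> R by rewrite ltr0n fact_gt0.
apply: (@le_trans _ _ ((\sum_(m < N.+1) 2 * B ^+ (2 * N) * ((1 + (k%:R * la)^-1) * 2 ^+ (2 * N) / (2 * N)`!%:R) * r ^+ (2 * N)) * (2 * N)`!%:R)).
  rewrite ler_wpM2r // ?(ltW f0) //; apply: ler_sum => m _; rewrite /s ler_wpM2r ?exprn_ge0 //.
  by rewrite ler_pM ?mulr_ge0 ?exprn_ge0 ?invr_ge0 ?(ltW p0) ?hB ?inv_poch.
rewrite sumr_const card_ord -[_ *+ N.+1]mulr_natr.
have hN : (N.+1%:R : R) <= 2 ^+ (2 * N).
  rewrite -natrX ler_nat; apply: leq_trans (ltn_expl N (ltnSn 1)) _.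
  by rewrite leq_exp2l // leq_pmull.
have X0 : 0 <= 2 * (1 + (k%:R * la)^-1) * (B ^+ (2 * N) * 2 ^+ (2 * N) * r ^+ (2 * N)).
  by rewrite !mulr_ge0 ?exprn_ge0 // ltW.
rewrite [leLHS](_ : _ = 2 * (1 + (k%:R * la)^-1) * (B ^+ (2 * N) * 2 ^+ (2 * N) * r ^+ (2 * N)) * N.+1%:R).
  apply: le_trans (ler_wpM2l X0 hN) _; rewrite le_eqVlt; apply/orP; left; apply/eqP.
  rewrite !exprMn (_ : (4 : R) = 2 * 2) ?exprMn; last by rewrite -natrM.
  by move: (2 ^+ (2 * N)) (B ^+ _) (r ^+ _) => x y t; ring.
move: (2 ^+ (2 * N)) (B ^+ _) (r ^+ _) (_`!%:R : R) f0 ((k%:R * la)^-1) => x y t f f0 i; field.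
by rewrite gt_eqF.
Qed.

Definition cJ a b : R := if odd (a + b) then 0 else pcoef (JP (a + b)./2) a b.
Lemma pcoef_JP N a b : pcoef (JP N) a b = if (a + b == 2 * N)%N then cJ a b else 0.
Proof.
have [C [M [_ _ h]]] := JP_bound; case: eqP => e.
  by rewrite /cJ e mul2n odd_double doubleK.
by apply/eqP; rewrite -normr_le0; have := h N a b; case: eqP.
Qed.
Lemma ebnd_cJ : ebnd cJ.
Proof.
have [C [M [C0 M0 h]]] := JP_bound; exists C, M; split=> // a b; rewrite /cJ; case: ifP => o.
  by rewrite normr0 divr_ge0 ?mulr_ge0 ?exprn_ge0.
by have := h (a + b)./2 a b; rewrite mul2n even_halfK ?o // eqxx.
Qed.
Lemma ent_J : ent cJ (Jfun k al be u v z).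
Proof.
apply: (ent_poly ebnd_cJ) Jfun_cvg; first by move=> a b o; rewrite /cJ o.
exact: pcoef_JP.
Qed.
Lemma p_uv_cJ p : p_uv k al be p u v z = psum p (fun a b => a`!%:R * b`!%:R * cJ a b).
Proof. exact: ent_papply0 ent_J. Qed.
Lemma p_uv_JP p M : (forall a b, (2 * M <= a + b)%N -> pcoef p a b = 0) ->
  p_uv k al be p u v z = \sum_(N < M) fpair p (JP N).
Proof.
move=> hp; rewrite p_uv_cJ /fpair -psum_fsum; apply: eq_psum => a b hab.
have hM : (a + b < 2 * M)%N by rewrite ltnNge; apply/negP => h; move: hab; rewrite hp ?eqxx.
rewrite -mulr_sumr; congr (_ * _).
under eq_bigr do rewrite pcoef_JP.
have [ho|ho] := boolP (odd (a + b)).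
  by rewrite big1 /cJ ?ho // => N _; rewrite if_same.
have hi : ((a + b)./2 < M)%N by lia.
rewrite (bigD1 (Ordinal hi)) //= big1 ?addr0; first by rewrite mul2n even_halfK // eqxx.
by move=> i; rewrite -val_eqE /= => hne; case: eqP => // e'; lia.
Qed.
End Point.
End KernelSeries.

(** * Affine changes of variable on the line *)

Section AffineChange.
Local Open Scope ereal_scope.
Context {R : realType}.
Notation mu := (@lebesgue_measure R).
Implicit Types (c d : R) (f : R -> \bar R).

Definition affR c d (x : R) : measurableTypeR R := (c * x + d)%R.
Lemma measurable_affR c d : measurable_fun [set: measurableTypeR R] (affR c d).
Proof. by apply: measurable_funD => //; exact: measurable_funM. Qed.
Lemma lebesgue_affR c d (c0 : (0 < c)%R) (A : set R) : measurable A ->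
  pushforward (mscale (NngNum (ltW c0)) mu) (affR c d) A = mu A.
Proof.
move=> mA; have mphi := measurable_affR c d.
apply/esym/lebesgue_measure_unique => //= _ [[a b]] _ <-.
rewrite /mscale /= /pushforward.
have -> : affR c d @^-1` `]a, b]%classic = `]((a - d) / c)%R, ((b - d) / c)%R]%classic.
  by apply/seteqP; split=> x /=; rewrite /affR !in_itv /= ltr_pdivrMr // ler_pdivlMr // ltrBlDr lerBrDr [(x * c)%R]mulrC.
rewrite !lebesgue_measure_itv /= !lte_fin ltr_pM2r ?invr_gt0 // ltrD2r.
case: ifP => _; last by rewrite mule0.
by rewrite -!EFinB -EFinM; congr (_%:E); field; rewrite gt_eqF.
Qed.
Lemma ge0_integral_affR c d f : (0 < c)%R -> measurable_fun [set: R] f -> (forall x, 0 <= f x) ->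
  \int[mu]_x f x = c%:E * \int[mu]_x f (c * x + d)%R.
Proof.
move=> c0 mf f0; have mphi := measurable_affR c d.
transitivity (\int[pushforward (mscale (NngNum (ltW c0)) mu) (affR c d)]_x f x).
  by apply: eq_measure_integral => //= A mA _; rewrite lebesgue_affR.
rewrite ge0_integral_pushforward // preimage_setT ge0_integral_mscale //=.
exact: measurableT_comp.
Qed.
Lemma ge0_integral_shift d f : measurable_fun [set: R] f -> (forall x, 0 <= f x) ->
  \int[mu]_x f x = \int[mu]_x f (x + d)%R.
Proof.
move=> mf f0; rewrite (@ge0_integral_affR 1 d) // mul1e.
by apply: eq_integral => x _; rewrite mul1r.
Qed.
Lemma ge0_integral_scale c f : (0 < c)%R -> measurable_fun [set: R] f -> (forall x, 0 <= f x) ->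
  \int[mu]_x f x = c%:E * \int[mu]_x f (c * x)%R.
Proof.
move=> c0 mf f0; rewrite (@ge0_integral_affR c 0) //; congr (_ * _).
by apply: eq_integral => x _; rewrite addr0.
Qed.
Lemma ge0_integral_reflect f : measurable_fun [set: R] f -> (forall x, 0 <= f x) ->
  \int[mu]_x f x = \int[mu]_x f (- x)%R.
Proof.
move=> mf f0; transitivity (\int[pushforward mu (-%R : _ -> measurableTypeR R)]_x f x).
  by apply: eq_measure_integral => //= A mA _; exact/esym/lebesgue_measureN.
by rewrite ge0_integral_pushforward.
Qed.
End AffineChange.

(** * Gamma function, beta integrals and the moments of [nu] *)

Section GammaFunction.
Local Open Scope ereal_scope.
Context {R : realType}.
Notation mu := (@lebesgue_measure R).
Implicit Types (s t x r a : R).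

(** Extension by 0 lets all Gamma and beta integrals run over the whole line, so that substitutions
    need not transport domains. *)
Definition hp s t : R := if (0 < t)%R then (t `^ (s - 1))%R else 0%R.
Lemma hp_ge0 s t : (0 <= hp s t)%R.
Proof. by rewrite /hp; case: ifP => // _; exact: powR_ge0. Qed.
Lemma measurable_hp s : measurable_fun [set: R] (hp s).
Proof.
by apply: measurable_fun_ifT => //; exact: measurable_fun_ltr.
Qed.
Definition Gm s : \bar R := \int[mu]_t (hp s t * expR (- t))%:E.

Lemma Gm_ge0 s : 0 <= Gm s.
Proof. by apply: integral_ge0 => t _; rewrite lee_fin mulr_ge0 ?hp_ge0 ?expR_ge0. Qed.
Lemma GammaE s : Gamma s = fine (Gm s).
Proof.
rewrite /Gamma /Rintegral /Gm integral_mkcond; congr fine; apply: eq_integral => t _.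
rewrite patchE /hp; case: ifPn => [/set_mem /= ->|] //.
by rewrite notin_setE /= => /negP/negbTE ->; rewrite mul0r.
Qed.

Lemma integral_exp_tail r : \int[mu]_(t in `[r, +oo[) (expR (- t))%:E = (expR (- r))%:E.
Proof.
have ce : continuous (fun t : R => expR (- t))%R.
  by move=> t; apply: continuous_comp; [exact: continuousN | exact: continuous_expR].
rewrite (@ge0_continuous_FTC2y _ _ (fun x => - expR (- x))%R _ 0%R) //.
- by rewrite EFinN oppeK add0e.
- exact: continuous_subspaceT.
- by rewrite -oppr0; apply: cvgN; exact: cvgr_expR.
- by apply: cvgN; apply: cvg_at_right_filter; exact: ce.
- move=> x _; rewrite derive1E derive_val /GRing.scale /=; ring.
Qed.
Lemma integral_exp_tail_le r : \int[mu]_t (if (r <= t)%R then expR (- t) else 0%R)%:E = (expR (- r))%:E.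
Proof.
rewrite -integral_exp_tail [RHS]integral_mkcond; apply: eq_integral => t _; rewrite patchE.
have -> : (t \in (`[r, +oo[%classic : set R)) = (r <= t)%R by apply/idP/idP; rewrite inE /= in_itv /= andbT.
by case: ifP.
Qed.
Lemma integral_exp_tail_lt r : \int[mu]_t (if (r < t)%R then expR (- t) else 0%R)%:E = (expR (- r))%:E.
Proof.
rewrite -integral_exp_tail -integral_itv_obnd_cbnd; last first.
  apply/measurable_EFinP; apply: measurable_funTS.
  by apply: measurableT_comp => //; exact: measurable_funN.
rewrite [RHS]integral_mkcond; apply: eq_integral => t _; rewrite patchE.
have -> : (t \in (`]r, +oo[%classic : set R)) = (r < t)%R by apply/idP/idP; rewrite inE /= in_itv /= andbT.
by case: ifP.
Qed.

Lemma continuous_powR_pos p x : (0 < x)%R -> {for x, continuous (fun y : R => y `^ p)%R}.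
Proof.
move=> x0; apply: differentiable_continuous; apply/derivable1_diffP; apply: derivable_powR.
by rewrite in_itv /= x0.
Qed.
Lemma integral_powR_itv s a t : (0 < s)%R -> (0 < a)%R -> (a < t)%R ->
  \int[mu]_(r in `[a, t]) (r `^ (s - 1))%R%:E = ((t `^ s - a `^ s) / s)%R%:E.
Proof.
move=> s0 a0 at_; rewrite (@continuous_FTC2 _ _ (fun x => x `^ s * s^-1)%R) //.
- by rewrite mulrBl.
- apply: continuous_in_subspaceT => x; rewrite inE /= in_itv /= => /andP[ax _].
  by apply: continuous_powR_pos; apply: lt_le_trans ax.
- have cc x : (0 < x)%R -> {for x, continuous (fun y : R => y `^ s * s^-1)%R}.
    by move=> x0; apply: cvgM; [exact: continuous_powR_pos | exact: cvg_cst].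
  split.
  + move=> x; rewrite in_itv /= => /andP[ax _]; apply: derivableM => //.
    by apply: derivable_powR; rewrite in_itv /= andbT (lt_trans a0).
  + by apply: cvg_at_right_filter; exact: cc.
  + by apply: cvg_at_left_filter; apply: cc; exact: lt_trans at_.
- move=> x; rewrite in_itv /= => /andP[ax _].
  have x0 : x \in `]0%R, +oo[%R by rewrite in_itv /= andbT (lt_trans a0).
  rewrite derive1Mr; last exact: derivable_powR.
  by rewrite (powR_derive1 _ x0) mulrAC divff ?mul1r // gt_eqF.
Qed.
(** For [s < 1] the integrand is singular at 0; the integral is the monotone limit of those over
    [[t / (n + 2), t]]. *)
Lemma integral_hp_le s t : (0 < s)%R -> (0 < t)%R ->
  \int[mu]_r (if (r <= t)%R then hp s r else 0%R)%:E = (t `^ s / s)%R%:E.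
Proof.
move=> s0 t0.
pose a n : R := (t / n.+2%:R)%R.
have a0 n : (0 < a n)%R by rewrite divr_gt0 // ltr0n.
have at_ n : (a n < t)%R by rewrite /a ltr_pdivrMr ?ltr0n // ltr_pMr // ltr1n.
pose F n : set R := `[a n, t]%classic.
have UF : \bigcup_n F n = `]0%R, t]%classic.
  apply/seteqP; split=> [x [n _]|x /=]; rewrite /F /= !in_itv /=.
    by move=> /andP[h1 h2]; rewrite h2 andbT (lt_le_trans (a0 n)).
  move=> /andP[x0 xt]; exists (Num.truncn (t / x)) => //=; rewrite in_itv /= xt andbT /a.
  rewrite ler_pdivrMr ?ltr0n // mulrC -ler_pdivrMr //.
  apply: le_trans (ltW (truncnS_gt (t / x))) _; by rewrite ler_nat.
transitivity (\int[mu]_(r in \bigcup_n F n) (r `^ (s - 1))%R%:E).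
  rewrite UF [RHS]integral_mkcond; apply: eq_integral => r _; rewrite patchE.
  have -> : (r \in (`]0%R, t]%classic : set R)) = ((0 < r) && (r <= t))%R by apply/idP/idP; rewrite inE /= in_itv.
  by rewrite /hp; case: (0 < r)%R; case: (r <= t)%R.
have mp : measurable_fun [set: R] (fun r => (r `^ (s - 1))%R%:E) by apply/measurable_EFinP; exact: measurable_powR.
have h : \int[mu]_(r in F n) (r `^ (s - 1))%R%:E @[n --> \oo] --> \int[mu]_(r in \bigcup_n F n) (r `^ (s - 1))%R%:E.
  apply: ge0_nondecreasing_set_cvg_integral.
  - move=> n m nm; apply/subsetPset => x; rewrite /F /= !in_itv /= => /andP[h1 ->]; rewrite andbT.
    by apply: le_trans h1; rewrite /a ler_pM2l // lef_pV2 ?posrE ?ltr0n // ler_nat.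
  - by move=> n; exact: measurable_itv.
  - by move=> n; exact: measurable_funTS.
  - by move=> n x _; rewrite lee_fin powR_ge0.
rewrite -(cvg_lim _ h) //; apply/cvg_lim => //.
have e n : \int[mu]_(r in F n) (r `^ (s - 1))%R%:E = ((t `^ s - a n `^ s) / s)%R%:E by exact: integral_powR_itv.
rewrite (_ : (fun n => _) = EFin \o (fun n => (t `^ s - a n `^ s) / s)%R); last by apply/funext.
apply: cvg_EFin; first exact: nearW.
rewrite -[X in _ --> (X / s)%R]subr0.
apply: cvgM; last exact: cvg_cst.
apply: cvgB; first exact: cvg_cst.
have [h1 _] := cvg_at_rightP (fun y : R => y `^ s)%R 0%R 0%R.
apply: (h1 (powR_cvg0 s0)); split => //; rewrite -(mulr0 t).
by apply: cvgM; [exact: cvg_cst | exact: (cvg_comp _ _ (infty_ge leqnSn) cvg_harmonic)].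
Qed.

Lemma tonelli (f : R * R -> \bar R) : measurable_fun setT f -> (forall z, 0 <= f z) ->
  \int[mu]_x \int[mu]_y f (x, y) = \int[mu]_y \int[mu]_x f (x, y).
Proof. by move=> mf f0; exact: fubini_tonelli. Qed.
Lemma Gm_integrand_ge0 s t : 0 <= (hp s t * expR (- t))%:E.
Proof. by rewrite lee_fin mulr_ge0 ?hp_ge0 ?expR_ge0. Qed.
Lemma measurable_expN : measurable_fun [set: R] (fun t => expR (- t))%R.
Proof. by apply: measurableT_comp => //; exact: measurable_funN. Qed.
Lemma hpS s t : hp (s + 1) t = if (0 < t)%R then (t `^ s)%R else 0%R.
Proof. by rewrite /hp addrK. Qed.
(** [t^s] is [s] times the integral of [r^(s - 1)] over [0 < r <= t]. Exchanging the two integrals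
    replaces integration by parts and needs no finiteness. *)
Lemma Gm_rec s : (0 < s)%R -> Gm (s + 1) = s%:E * Gm s.
Proof.
move=> s0.
pose f (z : R * R) := (if (z.2 <= z.1)%R then s * hp s z.2 * expR (- z.1) else 0)%R%:E.
have mf : measurable_fun setT f.
  apply/measurable_EFinP; apply: measurable_fun_ifT => //.
    by apply: measurable_fun_ler; [exact: measurable_snd | exact: measurable_fst].
  apply: measurable_funM; last exact: (measurableT_comp measurable_expN measurable_fst).
  by apply: measurable_funM => //; exact: (measurableT_comp (measurable_hp s) measurable_snd).
have f0 z : 0 <= f z.
  by rewrite /f lee_fin; case: ifP => // _; rewrite !mulr_ge0 ?hp_ge0 ?expR_ge0 // ltW.
transitivity (\int[mu]_t \int[mu]_r f (t, r)).
  apply: eq_integral => t _; rewrite hpS.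
  have [t0|t0] := ltP 0%R t; last first.
    rewrite mul0r integral0_eq // => r _; rewrite /f /=; case: ifP => // rt.
    by rewrite /hp ltNge (le_trans rt t0) /= mulr0 mul0r.
  have -> : (t `^ s * expR (- t))%R%:E = (s * expR (- t))%R%:E * (t `^ s / s)%R%:E.
    by rewrite -EFinM; congr (_%:E); field; rewrite gt_eqF.
  rewrite -integral_hp_le // -ge0_integralZl_EFin //; last 3 first.
  - by move=> r _; rewrite lee_fin; case: ifP => // _; exact: hp_ge0.
  - apply/measurable_EFinP; apply: measurable_fun_ifT => //; last exact: measurable_hp.
    exact: measurable_fun_ler.
  - by rewrite mulr_ge0 ?expR_ge0 // ltW.
  apply: eq_integral => r _; rewrite /f /= -EFinM; congr (_%:E); case: ifP => _; rewrite ?mulr0 //; ring.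
rewrite (tonelli mf f0) /Gm -ge0_integralZl_EFin //; last 3 first.
- by move=> t _; exact: Gm_integrand_ge0.
- apply/measurable_EFinP; apply: measurable_funM; [exact: measurable_hp | exact: measurable_expN].
- exact: ltW.
apply: eq_integral => r _; rewrite -EFinM mulrA EFinM -integral_exp_tail_le -ge0_integralZl_EFin //; last 3 first.
- by move=> t _; rewrite lee_fin; case: ifP => // _; exact: expR_ge0.
- apply/measurable_EFinP; apply: measurable_fun_ifT => //; last exact: measurable_expN.
  exact: measurable_fun_ler.
- by rewrite mulr_ge0 ?hp_ge0 // ltW.
by apply: eq_integral => t _; rewrite /f /= -EFinM; congr (_%:E); case: ifP => _; rewrite ?mulr0.
Qed.
Lemma Gm_1 : Gm 1 = 1.
Proof.
have := integral_exp_tail_lt 0%R; rewrite oppr0 expR0 => <-; apply: eq_integral => t _.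
by rewrite /hp subrr powRr0; case: ifP; rewrite ?mul1r ?mul0r.
Qed.
Lemma Gm_nat n : Gm n.+1%:R < +oo.
Proof.
elim: n => [|n IH]; first by rewrite Gm_1 ltry.
rewrite -natr1 Gm_rec ?ltr0n //; have := Gm_ge0 n.+1%:R.
by case: (Gm _) IH => // r _ _; rewrite -EFinM ltry.
Qed.
Lemma Gm_fin_ge1 s : (1 <= s)%R -> Gm s < +oo.
Proof.
move=> s1; have [n hn] : exists n : nat, (s <= n.+1%:R)%R by exists (Num.truncn s); exact/ltW/truncnS_gt.
have hM : Gm 1 + Gm n.+1%:R < +oo by apply: lte_add_pinfty; [exact: (Gm_nat 0) | exact: Gm_nat].
apply: le_lt_trans hM.
have mG s' : measurable_fun [set: R] (fun t => (hp s' t * expR (- t))%:E).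
  by apply/measurable_EFinP; apply: measurable_funM; [exact: measurable_hp | exact: measurable_expN].
rewrite /Gm -ge0_integralD //; last 4 first.
- by move=> t _; exact: Gm_integrand_ge0.
- exact: mG.
- by move=> t _; exact: Gm_integrand_ge0.
- exact: mG.
apply: ge0_le_integral => //; try exact: mG; try (by move=> t _; rewrite ?adde_ge0 // Gm_integrand_ge0).
  by apply: emeasurable_funD; exact: mG.
move=> t _; rewrite -EFinD lee_fin -mulrDl ler_wpM2r ?expR_ge0 // /hp; case: ifP => [t0|_]; last by rewrite addr0.
rewrite subrr powRr0; have [t1|t1] := leP t 1%R.
  apply: (@le_trans _ _ (1 `^ (s - 1))%R); last by rewrite powR1 lerDl powR_ge0.
  by rewrite ge0_ler_powR // ?nnegrE ?subr_ge0 // ltW.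
rewrite -[leLHS]add0r lerD // ler_powR ?(ltW t1) //.
by rewrite lerD2r.
Qed.
(** The recursion pulls finiteness back from [s + 1], where the exponent is positive and comparison
    with integer arguments applies. *)
Lemma Gm_fin s : (0 < s)%R -> Gm s < +oo.
Proof.
move=> s0; have : Gm (s + 1) < +oo by apply: Gm_fin_ge1; rewrite lerDr ltW.
by rewrite Gm_rec //; have := Gm_ge0 s; case: (Gm s) => [r||] // _; rewrite ?ltry // gt0_muley ?lte_fin.
Qed.
Lemma Gm_gt0 s : (0 < s)%R -> 0 < Gm s.
Proof.
move=> s0; rewrite lt_neqAle Gm_ge0 andbT eq_sym; apply/eqP => e.
have := Gm_rec s0; rewrite e mule0 => e1.
have : (expR (- 1))%:E <= Gm (s + 1).
  rewrite -integral_exp_tail_lt; apply: ge0_le_integral => //.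
  - by move=> t _; rewrite lee_fin; case: ifP => // _; exact: expR_ge0.
  - apply/measurable_EFinP; apply: measurable_fun_ifT => //; last exact: measurable_expN.
    exact: measurable_fun_ltr.
  - by apply/measurable_EFinP; apply: measurable_funM; [exact: measurable_hp | exact: measurable_expN].
  move=> t _; rewrite lee_fin hpS; case: ifP => t1; last first.
    by rewrite mulr_ge0 ?expR_ge0 //; case: ifP => // _; exact: powR_ge0.
  rewrite (lt_trans ltr01 t1) -[leLHS]mul1r ler_wpM2r ?expR_ge0 // -(powRr0 t) ler_powR ?(ltW t1) //.
  exact: ltW.
by rewrite e1 lee_fin leNgt expR_gt0.
Qed.
Lemma GmE s : (0 < s)%R -> Gm s = (Gamma s)%:E.
Proof.
by move=> s0; rewrite GammaE fineK // fin_real // Gm_fin // (lt_le_trans _ (Gm_ge0 s)).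
Qed.
Lemma Gamma_gt0 s : (0 < s)%R -> (0 < Gamma s)%R.
Proof. by move=> s0; have := Gm_gt0 s0; rewrite GmE. Qed.
Lemma Gamma_rec s : (0 < s)%R -> Gamma (s + 1) = (s * Gamma s)%R.
Proof.
move=> s0; have := Gm_rec s0; rewrite !GmE //; last by rewrite addr_gt0.
by rewrite -EFinM => -[].
Qed.
Lemma Gamma_poch s n : (0 < s)%R -> Gamma (s + n%:R) = (poch s n * Gamma s)%R.
Proof.
move=> s0; elim: n => [|n IH]; first by rewrite addr0 poch0 mul1r.
by rewrite -natr1 addrA Gamma_rec ?IH ?pochS ?ltr_wpDr //; ring.
Qed.

Definition Mn n : \bar R := \int[mu]_x (x ^+ (2 * n) * expR (- x ^+ 2))%R%:E.
Definition Bm n a : \bar R := \int[mu]_x (x ^+ (2 * n) * hp a (1 - x ^+ 2))%R%:E.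
Lemma even_pow_ge0 x n : (0 <= x ^+ (2 * n))%R.
Proof. by rewrite exprM exprn_ge0 // sqr_ge0. Qed.
Lemma Bm_ge0 n a : 0 <= Bm n a.
Proof. by apply: integral_ge0 => x _; rewrite lee_fin mulr_ge0 ?even_pow_ge0 ?hp_ge0. Qed.
Lemma measurable_pow n : measurable_fun [set: R] (fun x : R => x ^+ n)%R.
Proof. exact: measurable_funX. Qed.
Lemma measurable_gauss2 : measurable_fun [set: R] (fun x : R => expR (- x ^+ 2))%R.
Proof. exact: (measurableT_comp measurable_expN (measurable_pow 2)). Qed.
Lemma measurable_Bm n a : measurable_fun [set: R] (fun x => (x ^+ (2 * n) * hp a (1 - x ^+ 2))%R%:E).
Proof.
apply/measurable_EFinP; apply: measurable_funM; first exact: measurable_pow.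
by apply: (measurableT_comp (measurable_hp a)); apply: measurable_funB => //; exact: measurable_pow.
Qed.
(* The double integral of x^(2n) t^(a-1) exp(-x^2-t), in the variables (x, t)
   and in the variables (x / sqrt (t + x^2), t + x^2). *)
Lemma Mn_Gm n a : Mn n * Gm a = Bm n a * Gm (a + n%:R + 2^-1).
Proof.
pose f (z : R * R) := (z.1 ^+ (2 * n) * hp a (z.2 - z.1 ^+ 2) * expR (- z.2))%R%:E.
have mf : measurable_fun setT f.
  apply/measurable_EFinP; apply: measurable_funM; last exact: (measurableT_comp measurable_expN measurable_snd).
  apply: measurable_funM; first exact: (measurableT_comp (measurable_pow _) measurable_fst).
  apply: (measurableT_comp (measurable_hp a)); apply: measurable_funB; first exact: measurable_snd.
  exact: (measurableT_comp (measurable_pow _) measurable_fst).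
have f0 z : 0 <= f z by rewrite lee_fin !mulr_ge0 ?even_pow_ge0 ?hp_ge0 ?expR_ge0.
have mG s' : measurable_fun [set: R] (fun t => (hp s' t * expR (- t))%R%:E).
  by apply/measurable_EFinP; apply: measurable_funM; [exact: measurable_hp | exact: measurable_expN].
transitivity (\int[mu]_x \int[mu]_t f (x, t)).
  rewrite muleC /Mn -ge0_integralZl //; last 3 first.
  - apply/measurable_EFinP; apply: measurable_funM; [exact: measurable_pow | exact: measurable_gauss2].
  - by move=> x _; rewrite lee_fin mulr_ge0 ?even_pow_ge0 ?expR_ge0.
  - exact: Gm_ge0.
  apply: eq_integral => x _; rewrite muleC /Gm -ge0_integralZl_EFin //; last 3 first.
  - by move=> t _; exact: Gm_integrand_ge0.
  - exact: mG.
  - by rewrite mulr_ge0 ?even_pow_ge0 ?expR_ge0.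
  rewrite [RHS](@ge0_integral_shift _ (x ^+ 2)) //; last exact: (measurableT_comp mf (pair1_measurable x)).
  apply: eq_integral => t _; rewrite -EFinM /f /=; congr (_%:E).
  by rewrite addrK opprD expRD; ring.
rewrite (tonelli mf f0) [in RHS]/Gm -ge0_integralZl //; last 3 first.
- exact: mG.
- by move=> t _; exact: Gm_integrand_ge0.
- exact: Bm_ge0.
apply: eq_integral => r _; have [r0|r0] := ltP 0%R r; last first.
  rewrite [hp _ r]/hp ltNge r0 /= mul0r mule0 integral0_eq // => x _; rewrite /f /= /hp ltNge.
  by rewrite (_ : (_ <= 0)%R) /= ?mulr0 ?mul0r // subr_le0 (le_trans r0) ?sqr_ge0.
have sr0 : (0 < Num.sqrt r)%R by rewrite sqrtr_gt0.
rewrite (@ge0_integral_scale _ (Num.sqrt r)) //; last exact: (measurableT_comp mf (pair2_measurable r)).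
rewrite [RHS]muleC [in RHS]/Bm -[RHS]ge0_integralZl_EFin //; last 3 first.
- by move=> x _; rewrite lee_fin mulr_ge0 ?even_pow_ge0 ?hp_ge0.
- exact: measurable_Bm.
- by rewrite mulr_ge0 ?hp_ge0 ?expR_ge0.
rewrite -ge0_integralZl_EFin //; last first.
  have m2 := measurableT_comp mf (pair2_measurable r).
  by apply: (measurableT_comp (f := fun x => f (x, r)) m2); exact: measurable_funM.
apply: eq_integral => x _; rewrite /f -!EFinM; congr (_%:E) => /=.
rewrite !exprMn sqr_sqrtr ?(ltW r0) //.
have -> : (r - r * x ^+ 2 = r * (1 - x ^+ 2))%R by rewrite mulrBr mulr1.
have -> : hp a (r * (1 - x ^+ 2)) = (r `^ (a - 1) * hp a (1 - x ^+ 2))%R.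
  rewrite /hp pmulr_rgt0 //; case: ifP => h; last by rewrite mulr0.
  by rewrite powRM // ltW.
have -> : hp (a + n%:R + 2^-1) r = (r ^+ n * r `^ (a - 1) * Num.sqrt r)%R.
  rewrite /hp r0 -powR12_sqrt ?(ltW r0) // -powR_mulrn ?(ltW r0) // -!powRD.
  - by congr (_ `^ _)%R; ring.
  - by rewrite (gt_eqF r0) implybT.
  - by rewrite (gt_eqF r0) implybT.
have -> : (Num.sqrt r ^+ (2 * n) = r ^+ n)%R by rewrite exprM sqr_sqrtr // ltW.
ring.
Qed.
Lemma Bm_1 n : Bm n 1 = (2 / (2 * n).+1%:R)%R%:E.
Proof.
have n0 : ((2 * n).+1%:R : R) != 0%R by rewrite pnatr_eq0.
transitivity (\int[mu]_(x in `[(-1)%R, 1%R]) (x ^+ (2 * n))%R%:E).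
  rewrite (@integral_itv_bndoo _ (- 1) 1 _ true false); last first.
    by apply: measurable_funTS; apply/measurable_EFinP; exact: measurable_pow.
  rewrite [RHS]integral_mkcond; apply: eq_integral => x _; rewrite patchE.
  have -> : (x \in (`](-1)%R, 1%R[%classic : set R)) = (0 < 1 - x ^+ 2)%R.
    rewrite subr_gt0 -[X in _ = (_ < X)%R](expr1n _ 2) -[(x ^+ 2)%R]real_normK ?num_real //.
    rewrite ltr_pXn2r ?nnegrE // ltr_norml.
    by apply/idP/idP; rewrite inE /= in_itv.
  by rewrite /hp subrr powRr0; case: ifP; rewrite ?mulr1 ?mulr0.
have cp m : continuous (fun y : R => y ^+ m)%R by move=> y; exact: exprn_continuous.
rewrite (@continuous_FTC2 _ _ (fun x => x ^+ (2 * n).+1 * (2 * n).+1%:R^-1)%R) //.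
- rewrite expr1n exprS exprM sqrrN expr1n expr1n -EFinB; congr (_%:E).
  by move: ((2 * n).+1%:R : R) n0 => y y0; field.
- exact: continuous_subspaceT.
- split.
  + by move=> x _; apply: derivableM => //; exact: exprn_derivable.
  + by apply: cvg_at_right_filter; apply: cvgM; [exact: cp | exact: cvg_cst].
  + by apply: cvg_at_left_filter; apply: cvgM; [exact: cp | exact: cvg_cst].
- move=> x _; rewrite derive1Mr; last exact: exprn_derivable.
  by rewrite exp_derive1 /GRing.scale /= mulrAC divff // mul1r.
Qed.
Lemma half_gt0 : (0 < 2^-1 :> R)%R. Proof. by rewrite invr_gt0. Qed.
(** [Mn_Gm] at [a = 1], where the beta integral is elementary, evaluates the Gaussian moment. Put
    back into [Mn_Gm], this value gives the beta integral for every [a]. *)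
Lemma Mn_Gamma n : Mn n = (Gamma (2^-1 + n%:R))%:E.
Proof.
have h := Mn_Gm n 1; rewrite Gm_1 mule1 Bm_1 in h.
have hs : (0 < 2^-1 + n%:R :> R)%R by rewrite ltr_wpDr ?half_gt0.
rewrite h (_ : 1 + n%:R + 2^-1 = (2^-1 + n%:R) + 1)%R; last by ring.
rewrite Gm_rec // GmE // -!EFinM; congr (_%:E).
have n0 : ((2 * n).+1%:R : R) != 0%R by rewrite pnatr_eq0.
rewrite mulrA [X in (X * _)%R](_ : _ = 1)%R ?mul1r //.
by rewrite -natr1 natrM in n0 *; field.
Qed.
Lemma Gamma_half : Gamma 2^-1 = Num.sqrt pi :> R.
Proof.
have := Mn_Gamma 0; rewrite addr0 => h.
have : (Gamma 2^-1)%:E = (Num.sqrt pi)%:E :> \bar R.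
  rewrite -h -integralT_gauss; apply: eq_integral => x _.
  by rewrite muln0 expr0 mul1r.
by case.
Qed.
Lemma Bm_Gamma n a : (0 < a)%R ->
  Bm n a = (poch 2^-1 n * Num.sqrt pi * Gamma a / (poch (a + 2^-1) n * Gamma (a + 2^-1)))%R%:E.
Proof.
move=> a0; have ah : (0 < a + 2^-1)%R by rewrite addr_gt0 ?half_gt0.
have := Mn_Gm n a; rewrite Mn_Gamma addrAC Gamma_poch ?half_gt0 // Gamma_half.
rewrite !GmE ?ltr_wpDr // Gamma_poch // -EFinM.
have g0 : (poch (a + 2^-1) n * Gamma (a + 2^-1) != 0)%R.
  by rewrite gt_eqF // mulr_gt0 ?poch_gt0 ?Gamma_gt0.
have := Bm_ge0 n a; case: (Bm n a) => [r _|_|//].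
- by rewrite -EFinM => -[->]; rewrite mulfK.
- by rewrite gt0_mulye // lte_fin mulr_gt0 ?poch_gt0 ?Gamma_gt0.
Qed.

Definition hpow n a x : R := (x ^+ n * hp a (1 - x ^+ 2))%R.
Lemma measurable_hpow n a : measurable_fun [set: R] (hpow n a).
Proof.
apply: measurable_funM; first exact: measurable_pow.
by apply: (measurableT_comp (measurable_hp a)); apply: measurable_funB => //; exact: measurable_pow.
Qed.
Lemma hpow_le n a x : (`|hpow n a x| <= hpow 0 a x)%R.
Proof.
rewrite /hpow expr0 mul1r normrM [`|hp _ _|%R]ger0_norm ?hp_ge0 // normrX.
rewrite /hp; case: ifP => h; last by rewrite mulr0.
rewrite -[leRHS]mul1r ler_wpM2r ?powR_ge0 // exprn_ile1 //.
by rewrite -(@ler_pXn2r _ 2) ?nnegrE // expr1n real_normK ?num_real // -subr_ge0 ltW.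
Qed.
Lemma integrable_hpow n a : (0 < a)%R -> mu.-integrable [set: R] (EFin \o hpow n a).
Proof.
move=> a0; apply/integrableP; split; first by apply/measurable_EFinP; exact: measurable_hpow.
apply: (@le_lt_trans _ _ (Bm 0 a)); last by rewrite Bm_Gamma // ltry.
apply: ge0_le_integral => //.
- apply: measurableT_comp => //; apply/measurable_EFinP; exact: measurable_hpow.
- exact: measurable_Bm.
- by move=> x _; rewrite /= lee_fin hpow_le.
Qed.
Lemma integral_hpow_odd n a : (0 < a)%R -> odd n -> \int[mu]_x (hpow n a x)%:E = 0.
Proof.
move=> a0 on; have hN x : hpow n a (- x) = (- hpow n a x)%R.
  by rewrite /hpow sqrrN exprNn -signr_odd on expr1 mulN1r mulNr.
have i0 := integrable_hpow n a0.
rewrite integralE (_ : \int[mu]_x (fun x => (hpow n a x)%:E)^\- x = \int[mu]_x (fun x => (hpow n a x)%:E)^\+ x).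
  by rewrite subee // integrable_pos_fin_num.
rewrite ge0_integral_reflect //; last by apply: measurable_funeneg; apply/measurable_EFinP; exact: measurable_hpow.
by apply: eq_integral => x _; rewrite funeposE funenegE hN EFinN oppeK.
Qed.

(* The n-th moment of the probability measure nu^a. *)
Definition mom a n : R := if odd n then 0%R else (poch 2^-1 n./2 / poch (a + 2^-1) n./2)%R.
Definition nuC a : R := (Gamma (a + 2^-1) / (Num.sqrt pi * Gamma a))%R.
Lemma integral_hpow n a : (0 < a)%R -> \int[mu]_x (nuC a * hpow n a x)%R%:E = (mom a n)%:E.
Proof.
move=> a0; under eq_integral do rewrite EFinM.
rewrite integralZl //; last exact: integrable_hpow.
rewrite /mom; case: ifPn => on; first by rewrite integral_hpow_odd ?mule0.
have -> : \int[mu]_x (hpow n a x)%:E = Bm n./2 a.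
  by apply: eq_integral => x _; rewrite /hpow mul2n even_halfK.
rewrite Bm_Gamma // -EFinM; congr (_%:E); rewrite /nuC.
have ah : (0 < a + 2^-1)%R by rewrite addr_gt0 ?half_gt0.
have g1 := Gamma_gt0 a0; have g2 := Gamma_gt0 ah; have p0 := poch_gt0 n./2 ah.
have q0 : (0 < Num.sqrt (pi : R))%R by rewrite sqrtr_gt0 pi_gt0.
move: (Gamma a) (Gamma (a + 2^-1)) (poch (a + 2^-1) n./2) (Num.sqrt (pi : R)) (poch 2^-1 n./2) g1 g2 p0 q0.
by move=> x y z w t g1 g2 p0 q0; field; rewrite !gt_eqF.
Qed.

Lemma I11E : @I11 R = `[(-1)%R, 1%R]%classic.
Proof. by apply/seteqP; split=> x; rewrite /I11 /= in_itv. Qed.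
Lemma measurable_I11 : measurable (@I11 R).
Proof. by rewrite I11E; exact: measurable_itv. Qed.
Lemma measurable_nu_dens a : measurable_fun [set: R] (nu_dens a).
Proof.
rewrite /nu_dens; apply: measurable_funM => //.
apply: (measurableT_comp (f := fun y : R => (y `^ (a - 1))%R)); first exact: measurable_powR.
by apply: measurable_funB => //; exact: measurable_pow.
Qed.
Lemma in_oo11 (x : R) : (x \in (`](-1)%R, 1%R[%classic : set R)) = (0 < 1 - x ^+ 2)%R.
Proof.
rewrite subr_gt0 -[X in _ = (_ < X)%R](expr1n _ 2) -[(x ^+ 2)%R]real_normK ?num_real //.
rewrite ltr_pXn2r ?nnegrE // ltr_norml.
by apply/idP/idP; rewrite inE /= in_itv.
Qed.
(** The endpoints are discarded as a null set; on the open interval the conventions of [nu_dens] and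
    [hp] for powers agree. *)
Lemma integral_I11 (F G : R -> R) : measurable_fun [set: R] F ->
  (forall x, G x = if (0 < 1 - x ^+ 2)%R then F x else 0%R) ->
  \int[mu]_(x in @I11 R) (F x)%:E = \int[mu]_x (G x)%:E.
Proof.
move=> mF h; rewrite I11E (@integral_itv_bndoo _ (- 1) 1 _ true false); last first.
  by apply: measurable_funTS; exact/measurable_EFinP.
rewrite [LHS]integral_mkcond; apply: eq_integral => x _; rewrite patchE in_oo11 h.
by case: ifP.
Qed.
Lemma nu_densE n a x : (nuC a * hpow n a x = if 0 < 1 - x ^+ 2 then x ^+ n * nu_dens a x else 0)%R.
Proof. by rewrite /hpow /hp /nu_dens -/(nuC a); case: ifP => _; rewrite ?mulr0 //; ring. Qed.
Lemma measurable_nu_pow n a : measurable_fun [set: R] (fun x => x ^+ n * nu_dens a x)%R.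
Proof. by apply: measurable_funM; [exact: measurable_pow | exact: measurable_nu_dens]. Qed.
Lemma integrable_nu_pow n a : (0 < a)%R ->
  mu.-integrable (@I11 R) (fun x => (x ^+ n * nu_dens a x)%R%:E).
Proof.
move=> a0; apply/integrableP; split.
  by apply: measurable_funTS; apply/measurable_EFinP; exact: measurable_nu_pow.
rewrite (_ : \int[mu]_(x in @I11 R) _ = \int[mu]_x `|nuC a * hpow n a x|%R%:E); last first.
  rewrite -(@integral_I11 (fun x => `|x ^+ n * nu_dens a x|)%R) //.
    by apply: (measurableT_comp (@normr_measurable R setT)) => //; exact: measurable_nu_pow.
  by move=> x; rewrite nu_densE; case: ifP => //; rewrite normr0.
have /integrableP[_] : mu.-integrable [set: R] (fun x => (nuC a)%:E * (hpow n a x)%:E).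
  by apply: integrableZl => //; exact: integrable_hpow.
by apply: le_lt_trans; rewrite le_eqVlt; apply/orP; left; apply/eqP; apply: eq_integral.
Qed.
Lemma integral_nu_pow n a : (0 < a)%R ->
  \int[mu]_(x in @I11 R) (x ^+ n * nu_dens a x)%R%:E = (mom a n)%:E.
Proof.
move=> a0; rewrite -integral_hpow //; apply: integral_I11; first exact: measurable_nu_pow.
by move=> x; rewrite nu_densE.
Qed.

Local Open Scope ring_scope.
Lemma integral_nu_poly a (Q : {poly {poly R}}) (v : R) : 0 < a ->
  mu.-integrable (@I11 R) (fun u => (peval Q (u, v) * nu_dens a u)%:E) /\
  Rintegral mu (@I11 R) (fun u => peval Q (u, v) * nu_dens a u) = psum Q (fun i j => mom a i * v ^+ j).
Proof.
move=> a0; have mI := measurable_I11.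
elim/poly2_lin_ind: Q => [p q [ip hp] [iq hq]|c p [ip hp]|i j].
- have e u : peval (p + q) (u, v) * nu_dens a u = peval p (u, v) * nu_dens a u + peval q (u, v) * nu_dens a u.
    by rewrite pevalD mulrDl.
  under eq_fun do rewrite e EFinD.
  split; first exact: integrableD.
  by under eq_Rintegral do rewrite e; rewrite RintegralD // hp hq psumD.
- have e u : peval (CC c * p) (u, v) * nu_dens a u = c * (peval p (u, v) * nu_dens a u).
    by rewrite pevalM pevalC mulrA.
  under eq_fun do rewrite e EFinM.
  split; first exact: integrableZl.
  by under eq_Rintegral do rewrite e; rewrite RintegralZl // hp psumZ.
have e u : peval (X1 R ^+ i * X2 R ^+ j) (u, v) * nu_dens a u = v ^+ j * (u ^+ i * nu_dens a u).
  by rewrite !pevalE /=; ring.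
have ii := integrable_nu_pow i a0.
under eq_fun do rewrite e EFinM.
split; first exact: integrableZl.
under eq_Rintegral do rewrite e; rewrite RintegralZl // psum_mono mulrC; congr (_ * _).
by rewrite /Rintegral integral_nu_pow.
Qed.
Lemma integral_nu_poly2 a b (Q : {poly {poly R}}) : 0 < a -> 0 < b ->
  Rintegral mu (@I11 R) (fun v => psum Q (fun i j => mom a i * v ^+ j) * nu_dens b v) =
  psum Q (fun i j => mom a i * mom b j).
Proof.
move=> a0 b0; have mI := measurable_I11.
suff : mu.-integrable (@I11 R) (fun v => (psum Q (fun i j => mom a i * v ^+ j) * nu_dens b v)%:E) /\
  Rintegral mu (@I11 R) (fun v => psum Q (fun i j => mom a i * v ^+ j) * nu_dens b v) =
  psum Q (fun i j => mom a i * mom b j) by case.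
elim/poly2_lin_ind: Q => [p q [ip hp] [iq hq]|c p [ip hp]|i j].
- under eq_fun do rewrite psumD mulrDl EFinD.
  split; first exact: integrableD.
  by under eq_Rintegral do rewrite psumD mulrDl; rewrite RintegralD // hp hq psumD.
- under eq_fun do rewrite psumZ -mulrA EFinM.
  split; first exact: integrableZl.
  by under eq_Rintegral do rewrite psumZ -mulrA; rewrite RintegralZl // hp psumZ.
have ii := integrable_nu_pow j b0.
under eq_fun do rewrite psum_mono -mulrA EFinM.
split; first exact: integrableZl.
under eq_Rintegral do rewrite psum_mono -mulrA; rewrite RintegralZl // psum_mono; congr (_ * _).
by rewrite /Rintegral integral_nu_pow.
Qed.
Lemma integrable_tensorT (f g : R -> R) :
  mu.-integrable [set: R] (EFin \o f) -> mu.-integrable [set: R] (EFin \o g) ->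
  (@leb2 R).-integrable setT (fun z => (f z.1 * g z.2)%:E).
Proof.
move=> intf intg.
have /integrableP[/measurable_EFinP mf fy] := intf.
have /integrableP[/measurable_EFinP mg gy] := intg.
apply/integrable12ltyP.
  apply/measurable_EFinP; apply: measurable_funM.
    exact: (measurableT_comp mf measurable_fst).
  exact: (measurableT_comp mg measurable_snd).
have e x : (\int[mu]_y `|(f x * g y)%:E| = `|(f x)%:E| * \int[mu]_y `|(g y)%:E|)%E.
  rewrite -ge0_integralZl_EFin //.
    by apply: eq_integral => y _; rewrite EFinM abseM.
  by apply: measurableT_comp => //; exact/measurable_EFinP.
under eq_integral do rewrite e muleC.
rewrite ge0_integralZl //; last 2 first.
- by apply: measurableT_comp => //; exact/measurable_EFinP.
- exact: integral_ge0.
by apply: lte_mul_pinfty => //; [exact: integral_ge0 | rewrite ge0_fin_numE // integral_ge0].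
Qed.
Lemma integrable_tensor (D E : set R) (f g : R -> R) : measurable D -> measurable E ->
  mu.-integrable D (EFin \o f) -> mu.-integrable E (EFin \o g) ->
  (@leb2 R).-integrable (D `*` E) (fun z => (f z.1 * g z.2)%:E).
Proof.
move=> mD mE iF iG; apply/integrable_mkcond; first exact: measurableX.
have iF' : mu.-integrable [set: R] (EFin \o (f \_ D)).
  have h := (@integrable_mkcond _ (measurableTypeR R) R mu D (EFin \o f) mD).1 iF.
  by apply: eq_integrable h => // x _; rewrite /= !patchE; case: ifP.
have iG' : mu.-integrable [set: R] (EFin \o (g \_ E)).
  have h := (@integrable_mkcond _ (measurableTypeR R) R mu E (EFin \o g) mE).1 iG.
  by apply: eq_integrable h => // x _; rewrite /= !patchE; case: ifP.
apply: eq_integrable (integrable_tensorT iF' iG') => // z _.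
rewrite /= !patchE in_setX; case: (z.1 \in D); case: (z.2 \in E); by rewrite //= ?mulr0 ?mul0r.
Qed.
Lemma integrable2_nu_poly a b (Q : {poly {poly R}}) : 0 < a -> 0 < b ->
  (@leb2 R).-integrable (@I11 R `*` @I11 R)
    (fun uv => (nu_dens a uv.1 * nu_dens b uv.2 * peval Q uv)%:E).
Proof.
move=> a0 b0; have mI := measurable_I11; have mII := measurableX mI mI.
elim/poly2_lin_ind: Q => [p q ip iq|c p ip|i j].
- under eq_fun do rewrite pevalD mulrDr EFinD; exact: integrableD.
- under eq_fun do rewrite pevalM pevalC mulrCA EFinM; exact: integrableZl.
have h := integrable_tensor mI mI (integrable_nu_pow i a0) (integrable_nu_pow j b0).
by apply: eq_integrable h => // z _; congr (_%:E); rewrite !pevalE /=; ring.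
Qed.
End GammaFunction.

Lemma poch_half (R : realType) n : poch (2^-1 : R) n = (2 * n)`!%:R / (4 ^+ n * n`!%:R).
Proof.
elim: n => [|n IH]; first by rewrite poch0 muln0 fact0 expr0 mulr1 divr1.
rewrite pochS IH mulnS add2n !factS !natrM exprS -[(2 * n).+2%:R]natr1 -[(2 * n).+1%:R]natr1 -[n.+1%:R]natr1 natrM.
have h1 : (n`!%:R : R) != 0 by rewrite pnatr_eq0 -lt0n fact_gt0.
have h2 : (4 : R) ^+ n != 0 by rewrite expf_neq0 // pnatr_eq0.
have h3 : (n%:R + 1 : R) != 0 by rewrite natr1 pnatr_eq0.
by move: (n%:R : R) (n`!%:R : R) ((4 : R) ^+ n) ((2 * n)`!%:R : R) h1 h2 h3 => x y t w h1 h2 h3; field; rewrite h1 h2 h3.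
Qed.

(** * Integration of [p_{u,v}] over [u] and [v] *)

Section Moments.
Variables (R : realType) (k : nat) (al be : R).
Hypotheses (k0 : (0 < k)%N) (al0 : 0 < al) (be0 : 0 < be).
Local Notation P2 := {poly {poly R}}.
Local Notation la := (al + be).
Local Notation zre := (zre R k).
Local Notation zim := (zim R k).
Local Notation rho := (rho R).
Variables (p : P2) (M : nat) (z : R * R).
Hypothesis hM : forall a b, (2 * M <= a + b)%N -> pcoef p a b = 0.

(** From [(1/2)_i = (2 i)! / (4^i i!)]: the numerators cancel against the binomial coefficient. This
    is the origin of the factor [(2 m)! / 4^m] in [dco]. *)
Lemma mom_ycoef m i : (i <= m)%N ->
  'C(2 * m, 2 * (m - i))%:R * (mom al (2 * (m - i)) * mom be (2 * i)) = (2 * m)`!%:R / 4 ^+ m * ycoef al be m i.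
Proof.
move=> him; rewrite /mom !mul2n !odd_double !doubleK -!mul2n !poch_half /ycoef.
set j := (m - i)%N; have -> : m = (i + j)%N by rewrite /j subnKC.
have hb := bin_fact (leq_addl (2 * i) (2 * j)); rewrite addnK -mulnDr in hb.
rewrite -hb !natrM exprD.
have ai : 0 < al + 2^-1 by rewrite addr_gt0 // invr_gt0.
have bi : 0 < be + 2^-1 by rewrite addr_gt0 // invr_gt0.
have p1 : poch (al + 2^-1) j != 0 by exact: poch_neq0.
have p2 : poch (be + 2^-1) i != 0 by exact: poch_neq0.
have h1 : (i`!%:R : R) != 0 by rewrite pnatr_eq0 -lt0n fact_gt0.
have h2 : (j`!%:R : R) != 0 by rewrite pnatr_eq0 -lt0n fact_gt0.
have h3 : (4 : R) ^+ i != 0 by rewrite expf_neq0 // pnatr_eq0.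
have h4 : (4 : R) ^+ j != 0 by rewrite expf_neq0 // pnatr_eq0.
move: (poch _ j) (poch _ i) (i`!%:R : R) (j`!%:R : R) ((4 : R) ^+ i) ((4 : R) ^+ j) p1 p2 h1 h2 h3 h4.
move=> a b c d e f p1 p2 h1 h2 h3 h4; field.
by rewrite p1 p2 h1 h2 h3 h4.
Qed.

Definition KQ N m j : R := un k la (2 * N) (2 * m) / poch (k%:R * la) (2 * N) *
  (z.1 ^+ 2 + z.2 ^+ 2) ^+ (N - k * m) * ('C(2 * m, j)%:R * (peval zre z ^+ (2 * m - j) * peval zim z ^+ j)) *
  fpair p (rho ^+ (N - k * m) * (zre ^+ (2 * m - j) * zim ^+ j)).
(** For fixed [z], [p_{u,v}(z)] as a polynomial with [u] as first and [v] as second variable; its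
    integral then depends on moments only. *)
Definition Qz : P2 := \sum_(N < M) \sum_(m < N.+1) \sum_(j < (2 * m).+1)
  CC (KQ N m j) * (X1 R ^+ j * X2 R ^+ (2 * m - j)).

Lemma p_uv_Qz u v : -1 <= u <= 1 -> -1 <= v <= 1 -> p_uv k al be p u v z = peval Qz (u, v).
Proof.
move=> hu hv; rewrite (p_uv_JP k0 al0 be0 z hu hv hM) /Qz peval_sum; apply: eq_bigr => N _.
rewrite /JP fpair_sumr peval_sum; apply: eq_bigr => m _.
rewrite exprDn mulr_sumr fpair_sumr peval_sum; apply: eq_bigr => j _.
set c := _ / _; set e := (N - k * m)%N; set n := (2 * m)%N.
have -> : CC c * (CC (z.1 ^+ 2 + z.2 ^+ 2) * rho) ^+ e * ((CC (v * peval zre z) * zre) ^+ (n - j) *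
    (CC (u * peval zim z) * zim) ^+ j *+ 'C(n, j)) =
  CC (c * (z.1 ^+ 2 + z.2 ^+ 2) ^+ e * ('C(n, j)%:R * ((v * peval zre z) ^+ (n - j) * (u * peval zim z) ^+ j))) *
   (rho ^+ e * (zre ^+ (n - j) * zim ^+ j)).
  rewrite -mulr_natl -(CCnat R) 3!(exprMn _ (CC _)) -!CCXn !(CCM, CCXn, exprMn); ring.
by rewrite fpairZr !pevalE /= /KQ -/c -/e -/n !exprMn; ring.
Qed.

Lemma psum_Qz : psum Qz (fun i j => mom al i * mom be j) = peval (Wh k al be (dco k la) M p) z.
Proof.
rewrite /Qz /Wh psum_sum peval_sum; apply: eq_bigr => N _.
rewrite psum_sum peval_sum; apply: eq_bigr => m _.
rewrite psum_sum peval_sum.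
pose F j := KQ N m j * (mom al j * mom be (2 * m - j)).
have Fodd j : odd j -> F j = 0 by move=> oj; rewrite /F /mom oj !mul0r mulr0.
transitivity (\sum_(j < 2 * m.+1) F j).
  rewrite mulnS add2n [RHS]big_ord_recr /= (Fodd (2 * m).+1) ?addr0; last by rewrite /= mul2n odd_double.
  by apply: eq_bigr => j _; rewrite psumZ psum_mono.
(* Indices are grouped in pairs to drop the odd ones, whose moments vanish, and reversed because [j]
   counts powers of [zim] whereas [i] in [omega] counts those of [zre ^+ 2]. *)
rewrite sum_pairs (reindex_inj rev_ord_inj); apply: eq_bigr => i _ /=.
rewrite subSS (Fodd (2 * (m - i)).+1) ?addr0; last by rewrite /= mul2n odd_double.
have him : (i <= m)%N by rewrite -ltnS.
rewrite /F /KQ -mulnBr (subKn him).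
have eo : rho ^+ (N - k * m) * (zre ^+ (2 * i) * zim ^+ (2 * (m - i))) = omega R k (N - k * m) i (m - i).
  by rewrite /omega /ivar /zpar !exprM mulrA.
rewrite eo pevalM pevalC -[in RHS]eo !pevalM !pevalXn peval_rho /dco.
have hy := mom_ycoef him.
transitivity (un k la (2 * N) (2 * m) / poch (k%:R * la) (2 * N) * (z.1 ^+ 2 + z.2 ^+ 2) ^+ (N - k * m) *
   (peval zre z ^+ (2 * i) * peval zim z ^+ (2 * (m - i))) * fpair p (omega R k (N - k * m) i (m - i)) *
   ('C(2 * m, 2 * (m - i))%:R * (mom al (2 * (m - i)) * mom be (2 * i)))); first by ring.
by rewrite hy -eo; ring.
Qed.
End Moments.

Lemma intertwiner_integral (R : realType) (k : nat) (al be : R) (p : {poly {poly R}})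
    (V : {poly {poly R}} -> {poly {poly R}}) (z : R * R) :
  (0 < k)%N -> 0 < al -> 0 < be -> dihedral_invariant k p -> dunkl_intertwiner k al be V ->
  (@leb2 R).-integrable (@I11 R `*` @I11 R)
     (fun uv => (nu_dens al uv.1 * nu_dens be uv.2 * p_uv k al be p uv.1 uv.2 z)%:E)
  /\ peval (V p) z =
     Rintegral (@lebesgue_measure R) (@I11 R) (fun v =>
       Rintegral (@lebesgue_measure R) (@I11 R) (fun u =>
         p_uv k al be p u v z * nu_dens al u) * nu_dens be v).
Proof.
move=> k0 al0 be0 hp VP.
have [N0 hN0] := pcoef_eq0 p.
have hM a b : (2 * N0 <= a + b)%N -> pcoef p a b = 0.
  by move=> h; apply: hN0; move: h; rewrite mul2n -addnn; lia.
have la0 : 0 < al + be by rewrite addr_gt0.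
have hd : dinv k p by move=> j hj x; have [_ ->] := hp j x hj.
have inI (x : R) : x \in @I11 R -> -1 <= x <= 1 by rewrite inE.
split.
  apply: eq_integrable (integrable2_nu_poly (Qz k al be p N0 z) al0 be0) => //.
    by apply: measurableX; exact: measurable_I11.
  move=> [u v]; rewrite in_setX => /andP[/inI hu /inI hv] /=.
  by rewrite (p_uv_Qz k0 al0 be0 z hM).
rewrite (V_dihedral k0 al0 be0 VP (fun N m => @dco_rec _ _ _ k0 la0 N m) (fun N m => @dco_out _ _ _ k0 la0 N m) (dco_top k0 la0) hd hM).
rewrite -psum_Qz // -integral_nu_poly2 //; apply: eq_Rintegral => v /inI hv.
congr (_ * _); have [_ <-] := integral_nu_poly (Qz k al be p N0 z) v al0.
apply: eq_Rintegral => u /inI hu; by rewrite (p_uv_Qz k0 al0 be0 z hM).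
Qed.

(** * Gaussian integrals and Hermite polynomials *)

Section GaussianMoments.
Context {R : realType}.
Notation mu := (@lebesgue_measure R).
Implicit Types (x y t M : R) (q : {poly R}).

Lemma dominated_Rintegral d (T : measurableType d) (m : {measure set T -> \bar R})
    (f_ : nat -> T -> R) (f g : T -> R) :
  (forall n, measurable_fun setT (f_ n)) -> (forall z, (fun n => f_ n z) @ \oo --> f z) ->
  m.-integrable setT (EFin \o g) -> (forall n z, `|f_ n z| <= g z) ->
  m.-integrable setT (EFin \o f) /\
  (fun n => Rintegral m setT (f_ n)) @ \oo --> Rintegral m setT f.
Proof.
move=> mf hf ig hg.
have mf' n : measurable_fun setT (EFin \o f_ n) by exact/measurable_EFinP.
have hf' z : setT z -> (EFin \o f_ n) z @[n --> \oo] --> (EFin \o f) z.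
  by move=> _; apply: cvg_EFin; [exact: nearW | exact: hf].
have mfl : measurable_fun setT (EFin \o f) by apply: (emeasurable_fun_cvg _ _ mf' hf').
have [||h1 _ h3] := @dominated_convergence _ _ _ m setT measurableT (fun n => EFin \o f_ n) (EFin \o f) (EFin \o g) mf' mfl _ ig.
- exact: aeW.
- by apply: aeW => x n _ /=; rewrite lee_fin.
split=> //; apply: fine_cvg; rewrite /Rintegral fineK //.
by apply: integrable_fin_num.
Qed.

Definition gam x : R := expR (- x ^+ 2 / 2).
Lemma gam_gt0 x : 0 < gam x. Proof. exact: expR_gt0. Qed.
Lemma measurable_gam : measurable_fun [set: R] gam.
Proof.
rewrite /gam; apply: measurableT_comp => //; apply: measurable_funM => //.
by apply: measurable_funN; exact: measurable_pow.
Qed.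
Lemma measurable_eabs M : measurable_fun [set: R] (fun x => expR (M * `|x|)).
Proof.
apply: measurableT_comp => //; apply: measurable_funM => //.
Qed.
Definition egam M x : R := expR (M * `|x|) * gam x.
Lemma egam_ge0 M x : 0 <= egam M x. Proof. by rewrite mulr_ge0 ?expR_ge0. Qed.
Lemma measurable_egam M : measurable_fun [set: R] (egam M).
Proof. by apply: measurable_funM; [exact: measurable_eabs | exact: measurable_gam]. Qed.
(** Completing the square: [M |x| - x^2 / 2 <= M^2 - x^2 / 4]. *)
Lemma egam_le M x : egam M x <= expR (M ^+ 2) * expR (- (x / 2) ^+ 2).
Proof.
rewrite /egam /gam -!expRD ler_expR -subr_ge0.
rewrite (_ : _ - _ = (`|x| / 2 - M) ^+ 2) ?sqr_ge0 //.
have e : x ^+ 2 = `|x| ^+ 2 by rewrite real_normK ?num_real.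
by rewrite expr_div_n e; field.
Qed.
Lemma integrable_egam M : mu.-integrable [set: R] (EFin \o egam M).
Proof.
apply/integrableP; split; first by apply/measurable_EFinP; exact: measurable_egam.
apply: (@le_lt_trans _ _ ((expR (M ^+ 2) * 2)%:E * Mn 0)%E); last first.
  by rewrite Mn_Gamma -EFinM ltry.
have mg : measurable_fun [set: R] (fun x : R => (x ^+ (2 * 0) * expR (- x ^+ 2))%:E).
  by apply/measurable_EFinP; apply: measurable_funM; [exact: measurable_pow | exact: measurable_gauss2].
have mh : measurable_fun [set: R] (fun x : R => (expR (- (x / 2) ^+ 2))%:E).
  apply/measurable_EFinP; apply: (measurableT_comp measurable_gauss2).
  by apply: measurable_funM.
apply: (@le_trans _ _ (\int[mu]_x ((expR (M ^+ 2))%:E * (expR (- (x / 2) ^+ 2))%:E))%E).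
  apply: ge0_le_integral => //.
  - by apply: measurableT_comp => //; apply/measurable_EFinP; exact: measurable_egam.
  - by apply: emeasurable_funM => //; exact: measurable_cst.
  by move=> x _; rewrite -EFinM lee_fin ger0_norm ?egam_ge0 // egam_le.
rewrite ge0_integralZl_EFin ?expR_ge0 //.
rewrite EFinM -muleA lee_pmul2l // ?lte_fin ?expR_gt0 //.
rewrite (@ge0_integral_scale _ 2) //.
rewrite le_eqVlt; apply/orP; left; apply/eqP; congr (_ * _)%E; apply: eq_integral => x _.
by rewrite muln0 expr0 mul1r (mulrC 2) mulfK.
Qed.
Lemma pow_le_exp x a : `|x| ^+ a <= a`!%:R * expR `|x|.
Proof.
have h := @series_exp_le R `|x| a.+1 (normr_ge0 x).
rewrite big_ord_recr /= in h.
have f0 : 0 < a`!%:R :> R by rewrite ltr0n fact_gt0.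
rewrite mulrC -ler_pdivrMr //; apply: le_trans h; rewrite lerDr.
by apply: sumr_ge0 => i _; rewrite divr_ge0 // exprn_ge0.
Qed.
Lemma measurable_horner q : measurable_fun [set: R] (fun x => q.[x]).
Proof.
elim/poly_ind: q => [|q c IH].
  by rewrite (_ : horner 0 = (fun=> 0)) //; apply/funext => x; rewrite horner0.
rewrite (_ : horner _ = fun x => q.[x] * x + c); last by apply/funext => x; rewrite !hornerE.
by apply: measurable_funD => //; apply: measurable_funM.
Qed.
Lemma horner_le q : exists2 C, 0 <= C & forall x, `|q.[x]| <= C * expR `|x|.
Proof.
exists (\sum_(i < size q) `|q`_i| * i`!%:R); first by apply: sumr_ge0 => i _; rewrite mulr_ge0.
move=> x; rewrite horner_coef (le_trans (ler_norm_sum _ _ _)) // mulr_suml.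
by apply: ler_sum => i _; rewrite normrM normrX -mulrA ler_wpM2l // pow_le_exp.
Qed.
Lemma integrable_horner_exp q M : mu.-integrable [set: R] (fun x => (q.[x] * egam M x)%:E).
Proof.
have [C C0 hC] := horner_le q.
apply: (le_integrable _ _ _ (integrableZl _ C (integrable_egam (1 + M)))) => //.
  by apply/measurable_EFinP; apply: measurable_funM; [exact: measurable_horner | exact: measurable_egam].
move=> x _; rewrite [(EFin \o _) x]/= -EFinM lee_fin [`|q.[x] * _|]normrM [`|C * _|]normrM [`|egam _ _|]ger0_norm ?egam_ge0 //.
rewrite [`|C|]ger0_norm // [`|egam _ _|]ger0_norm ?egam_ge0 // /egam mulrDl expRD mul1r !mulrA.
by rewrite ler_wpM2r ?expR_ge0 // ler_wpM2r ?expR_ge0.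
Qed.
Lemma integrable_horner q : mu.-integrable [set: R] (fun x => (q.[x] * gam x)%:E).
Proof.
apply: eq_integrable (integrable_horner_exp q 0) => // x _.
by rewrite /egam mul0r expR0 mul1r.
Qed.

(* The l-th moment of the standard Gaussian law; [gmean] is its expectation. *)
Definition El l : R := if odd l then 0 else 2 ^+ l./2 * poch 2^-1 l./2.
Definition gmean q : R := \sum_(i < size q) q`_i * El i.
Lemma ElS l : El l.+2 = l.+1%:R * El l.
Proof.
rewrite /El /= negbK; case: ifPn => ol; first by rewrite mulr0.
rewrite pochS exprS mulrACA [RHS]mulrC; rewrite [2 * _]mulrC -mulrA [RHS]mulrC.
rewrite (_ : l.+1%:R = 2 * (2^-1 + l./2%:R)); first by ring.
by rewrite -{1}(even_halfK ol) -natr1 -mul2n natrM mulrDr mulfV // addrC.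
Qed.
Lemma gmean_widen q N : (size q <= N)%N -> gmean q = \sum_(i < N) q`_i * El i.
Proof.
move=> h; rewrite /gmean (big_ord_widen N (fun i => q`_i * El i) h) big_mkcond /=.
by apply: eq_bigr => i _; case: ltnP => // hi; rewrite nth_default // mul0r.
Qed.
Lemma gmeanD p q : gmean (p + q) = gmean p + gmean q.
Proof.
rewrite (@gmean_widen _ (maxn (size p) (size q))) ?size_polyD //.
rewrite (@gmean_widen p (maxn (size p) (size q))) ?leq_maxl //.
rewrite (@gmean_widen q (maxn (size p) (size q))) ?leq_maxr // -big_split /=.
by apply: eq_bigr => i _; rewrite coefD mulrDl.
Qed.
Lemma gmeanZ c q : gmean (c *: q) = c * gmean q.
Proof.
rewrite (@gmean_widen _ (size q)) ?size_scale_leq // /gmean mulr_sumr.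
by apply: eq_bigr => i _; rewrite coefZ mulrA.
Qed.
Lemma gmeanX n : gmean 'X^n = El n.
Proof.
rewrite /gmean size_polyXn big_ord_recr /= coefXn eqxx mul1r big1 ?add0r // => i _.
by rewrite coefXn ltn_eqF ?mul0r.
Qed.
Lemma poly_lin_ind (P : {poly R} -> Prop) :
  (forall p q, P p -> P q -> P (p + q)) -> (forall c q, P q -> P (c *: q)) ->
  (forall n, P 'X^n) -> forall q, P q.
Proof.
move=> hD hZ hX q; rewrite -[q]coefK poly_def.
elim/big_ind: _ => [|//|i _]; last exact: hZ.
by rewrite -(scale0r 'X^0); apply: hZ.
Qed.
(** Gaussian integration by parts, here an algebraic consequence of the moment recursion [ElS]. *)
Lemma gmean_stein q : gmean ('X * q) = gmean q^`().
Proof.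
elim/poly_lin_ind: q => [p q hp hq|c q hq|n].
- by rewrite mulrDr derivD !gmeanD hp hq.
- by rewrite -scalerAr derivZ !gmeanZ hq.
rewrite -exprS derivXn -scaler_nat gmeanZ !gmeanX; case: n => [|n]; last by rewrite ElS.
by rewrite mul0r.
Qed.
Definition s2pi : R := Num.sqrt (2 * pi).
Lemma s2pi_gt0 : 0 < s2pi.
Proof. by rewrite sqrtr_gt0 mulr_gt0 // pi_gt0. Qed.
Lemma s2pi_sqr : s2pi * s2pi = 2 * pi.
Proof. by rewrite -expr2 sqr_sqrtr // mulr_ge0 // pi_ge0. Qed.
Lemma integral_gam_even n : (\int[mu]_x (x ^+ (2 * n) * gam x)%:E = (s2pi * (2 ^+ n * poch 2^-1 n))%:E)%E.
Proof.
have r2 : 0 < Num.sqrt 2 :> R by rewrite sqrtr_gt0.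
have s22 : Num.sqrt 2 ^+ 2 = 2 :> R by rewrite sqr_sqrtr.
have mf : measurable_fun [set: R] (fun x : R => (x ^+ (2 * n) * gam x)%:E).
  by apply/measurable_EFinP; apply: measurable_funM; [exact: measurable_pow | exact: measurable_gam].
rewrite (ge0_integral_scale r2) //; last by move=> x; rewrite lee_fin mulr_ge0 ?expR_ge0 ?even_pow_ge0.
rewrite (_ : (\int[mu]_x _)%E = (\int[mu]_x ((2 ^+ n)%:E * (x ^+ (2 * n) * expR (- x ^+ 2))%:E))%E); last first.
  apply: eq_integral => x _; rewrite -EFinM; congr (_%:E).
  have -> : gam (Num.sqrt 2 * x) = expR (- x ^+ 2) by rewrite /gam exprMn s22; congr expR; field.
  by rewrite exprMn exprM s22 mulrA.
rewrite ge0_integralZl_EFin //; last 2 first.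
- by move=> x _; rewrite lee_fin mulr_ge0 ?expR_ge0 ?even_pow_ge0.
- by apply/measurable_EFinP; apply: measurable_funM; [exact: measurable_pow | exact: measurable_gauss2].
rewrite -/(Mn n) Mn_Gamma Gamma_poch ?half_gt0 // Gamma_half -!EFinM; congr (_%:E).
by rewrite /s2pi sqrtrM //; ring.
Qed.
Lemma integral_gam_odd n : odd n -> (\int[mu]_x (x ^+ n * gam x)%:E = 0)%E.
Proof.
move=> on; pose f x : R := x ^+ n * gam x.
have fN x : f (- x) = - f x.
  by rewrite /f /gam sqrrN exprNn -signr_odd on expr1 mulN1r mulNr.
have i0 : mu.-integrable [set: R] (EFin \o f).
  by apply: eq_integrable (integrable_horner 'X^n) => // x _; rewrite hornerXn.
have mf : measurable_fun [set: R] (EFin \o f) by case/integrableP: i0.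
rewrite integralE (_ : (\int[mu]_x (fun x => (f x)%:E)^\- x)%E = (\int[mu]_x (fun x => (f x)%:E)^\+ x)%E).
  by rewrite subee // integrable_pos_fin_num.
rewrite ge0_integral_reflect //; last exact: measurable_funeneg.
by apply: eq_integral => x _; rewrite funeposE funenegE fN EFinN oppeK.
Qed.
Lemma integral_gam q : Rintegral mu [set: R] (fun x => q.[x] * gam x) = s2pi * gmean q.
Proof.
elim/poly_lin_ind: q => [p q hp hq|c q hq|n].
- under eq_Rintegral do rewrite hornerD mulrDl.
  by rewrite RintegralD //; [rewrite hp hq gmeanD mulrDr | exact: integrable_horner | exact: integrable_horner].
- under eq_Rintegral do rewrite hornerZ -mulrA.
  by rewrite RintegralZl //; [rewrite hq gmeanZ mulrCA | exact: integrable_horner].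
rewrite gmeanX /El /Rintegral; under eq_integral do rewrite hornerXn.
case: ifPn => on; first by rewrite integral_gam_odd // mulr0.
by rewrite -{1}(even_halfK on) -mul2n integral_gam_even.
Qed.

(* The Hermite polynomial He_n, paired with He_(n - 1). *)
Fixpoint Hp2 n : {poly R} * {poly R} :=
  if n is m.+1 then let: (a, b) := Hp2 m in ('X * a - m%:R *: b, a) else (1, 0).
Definition Hp n := (Hp2 n).1.
Lemma Hp0 : Hp 0 = 1. Proof. by []. Qed.
Lemma HpS n : Hp n.+1 = 'X * Hp n - n%:R *: Hp n.-1.
Proof.
rewrite /Hp /=; case: n => [|n] /=; first by rewrite !scale0r.
by case: (Hp2 n) => a b /=.
Qed.
Lemma deriv_Hp n : deriv (Hp n) = n%:R *: Hp n.-1.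
Proof.
elim/ltn_ind: n => [[|n]] IH; first by rewrite Hp0 derivC scale0r.
rewrite HpS derivB derivM derivX derivZ mul1r IH //=.
case: n IH => [|n] IH; first by rewrite !scale0r mulr0 addr0 subr0 scale1r.
rewrite IH //= HpS.
have -> : n.+2%:R = 1 + n.+1%:R :> R by rewrite nat1r.
rewrite scalerDl scale1r scalerBr scalerAr !scalerA [_ * n%:R]mulrC; ring.
Qed.
(** [He_(n + 1) q = x He_n q - He_n' q], so Stein's identity moves one derivative onto [q] at each
    step. Orthogonality of the Hermite polynomials follows. *)
Lemma gmean_Hp n q : gmean (Hp n * q) = gmean q^`(n).
Proof.
elim: n q => [|n IH] q; first by rewrite Hp0 mul1r.
have -> : Hp n.+1 * q = 'X * (Hp n * q) - deriv (Hp n) * q by rewrite HpS deriv_Hp; ring.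
rewrite -scaleN1r gmeanD gmean_stein.
rewrite gmeanZ derivM gmeanD mulN1r [X in X - _]addrC addrK IH derivSn //.
Qed.
End GaussianMoments.

(** * One-dimensional Gaussian Fourier integrals *)

Section GaussianPhase.
Context {R : realType}.
Notation mu := (@lebesgue_measure R).
Implicit Types (x y t M : R) (q : {poly R}).

(** The mean of [(X + t)^n] for a standard Gaussian [X]. Its recursion is that of [He_n] with a plus
    sign, hence it dominates [|He_n|]; being a mean, it has an exponential generating sum that is
    easy to bound. *)
Definition ha n t : R := gmean (('X + t%:P) ^+ n).
Lemma ha0 t : ha 0 t = 1.
Proof. by rewrite /ha expr0 -(expr0 'X) gmeanX /El /= expr0 poch0 mul1r. Qed.
Lemma haS n t : ha n.+1 t = t * ha n t + n%:R * ha n.-1 t.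
Proof.
rewrite /ha exprS mulrDl gmeanD gmean_stein mul_polyC gmeanZ addrC; congr (_ + _).
by rewrite deriv_exp derivD derivX derivC addr0 mul1r -scaler_nat gmeanZ.
Qed.
Lemma ha_ge0 n t : 0 <= t -> 0 <= ha n t.
Proof.
move=> t0; elim/ltn_ind: n => [[|n]] IH; first by rewrite ha0.
by rewrite haS addr_ge0 ?mulr_ge0 // IH // ltnS leq_pred.
Qed.
Lemma Hp_le n y : `|(Hp n).[y]| <= ha n `|y|.
Proof.
elim/ltn_ind: n => [[|n]] IH; first by rewrite Hp0 ha0 hornerC normr1.
rewrite HpS haS hornerD hornerN hornerZ hornerM hornerX.
apply: le_trans (ler_normB _ _) _; rewrite !normrM normr_nat.
by rewrite lerD // ler_wpM2l // IH // ltnS leq_pred.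
Qed.
(** The sum is the mean of a truncated [exp (M (X + t))], at most [exp (M t)] times the mean of
    [exp (M |X|)]. *)
Lemma ha_sum M : 0 <= M -> exists2 K, 0 <= K & forall N t, 0 <= t ->
  \sum_(n < N) M ^+ n / n`!%:R * ha n t <= K * expR (M * t).
Proof.
move=> M0; exists (Rintegral mu [set: R] (egam M) / s2pi).
  by rewrite divr_ge0 ?(ltW s2pi_gt0) //; apply: Rintegral_ge0 => x _; exact: egam_ge0.
move=> N t t0; pose q : {poly R} := \sum_(n < N) (M ^+ n / n`!%:R) *: ('X + t%:P) ^+ n.
have gmean0 : gmean 0 = 0 :> R by rewrite -(scale0r (0 : {poly R})) gmeanZ mul0r.
have -> : \sum_(n < N) M ^+ n / n`!%:R * ha n t = gmean q.
  by rewrite (big_morph gmean gmeanD gmean0); apply: eq_bigr => n _; rewrite gmeanZ.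
rewrite mulrAC ler_pdivlMr ?s2pi_gt0 // mulrC -integral_gam mulrC -RintegralZl //; last exact: integrable_egam.
apply: le_Rintegral => //; first exact: integrable_horner.
  by have := integrableZl measurableT (expR (M * t)) (integrable_egam M); apply: eq_integrable.
move=> x _; rewrite /egam mulrA ler_wpM2r ?(ltW (gam_gt0 x)) //.
rewrite horner_sum; apply: (@le_trans _ _ (\sum_(n < N) (M * `|x + t|) ^+ n / n`!%:R)).
  apply: ler_sum => n _; rewrite hornerZ horner_exp hornerD hornerX hornerC exprMn.
  rewrite -!mulrA ler_wpM2l ?exprn_ge0 // [leRHS]mulrC ler_wpM2l ?invr_ge0 //.
  by rewrite -normrX ler_norm.
apply: le_trans (series_exp_le _ _) _; first exact: mulr_ge0.
rewrite -expRD ler_expR -mulrDr ler_wpM2l // addrC.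
by apply: le_trans (ler_normD _ _) _; rewrite (ger0_norm t0) addrC.
Qed.

(** The boolean separates the real ([false]) and imaginary ([true]) parts of [exp (i x)], so that
    only real integrals occur. Multiplication by [i] exchanges the parts with the sign [phsgn]. *)
Definition ph (b : bool) x : R := if b then sin x else cos x.
Definition phsgn (b : bool) : R := if b then 1 else -1.
(* [cs false n] and [cs true n] are the real and imaginary parts of i^n. *)
Definition cs (b : bool) n : R := if b == odd n then (-1) ^+ n./2 else 0.
Lemma csS b n : cs b n.+1 = phsgn b * cs (~~ b) n.
Proof.
rewrite /cs /phsgn /= uphalfE /= uphalf_half; case: b; case on: (odd n) => //=.
- by rewrite mulr0.
- by rewrite add0n mul1r.
- by rewrite exprS.
- by rewrite mulr0.
Qed.
Lemma csSS b n : cs b n.+2 = - cs b n.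
Proof. by rewrite !csS negbK mulrA; case: b; rewrite /phsgn /= ?mulr1 ?mul1r mulN1r. Qed.
Lemma csD b m n : cs b (m + n) =
  if b then cs true m * cs false n + cs false m * cs true n else cs false m * cs false n - cs true m * cs true n.
Proof.
elim/ltn_ind: m b => [[|[|m]]] IH b.
- by rewrite add0n /cs /=; case: b; case: (odd n); rewrite /= ?mul0r ?mul1r ?add0r ?addr0 ?subr0 ?oppr0.
- by rewrite add1n csS /cs /phsgn /=; case: b; case: (odd n); rewrite /= ?mul0r ?mul1r ?mulr0 ?add0r ?addr0 ?subr0 ?mulN1r ?sub0r ?oppr0 ?mul1r ?mul0r ?oppr0.
- by rewrite !addSn !csSS IH //; case: b; ring.
Qed.
Lemma cs_norm b n : `|cs b n| <= 1.
Proof. by rewrite /cs; case: ifP => _; rewrite ?normr0 // normrX normrN1 expr1n. Qed.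
Lemma cs_sqr n : ~~ odd n -> cs false n * cs false n = 1.
Proof. by move=> on; rewrite /cs (negbTE on) eqxx -expr2 sqrr_sign. Qed.
Lemma ph_cvg b x : (fun N => \sum_(n < N) cs b n * x ^+ n / n`!%:R) @ \oo --> ph b x.
Proof.
case: b; rewrite /ph.
  have h : series (sin_coeff x) @ \oo --> sin x by rewrite unlock; exact: is_cvg_series_sin_coeff.
  apply: cvg_trans h; apply: near_eq_cvg; apply: nearW => N.
  rewrite seriesEord; apply: eq_bigr => n _; rewrite /sin_coeff /cs /= eq_sym eqb_id.
  by case on: (odd n); rewrite ?mul1r ?mul0r // -{1}[nat_of_ord n]odd_double_half on /= doubleK.
have h : series (cos_coeff x) @ \oo --> cos x by rewrite unlock; exact: is_cvg_series_cos_coeff.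
apply: cvg_trans h; apply: near_eq_cvg; apply: nearW => N.
rewrite seriesEord; apply: eq_bigr => n _; rewrite /cos_coeff /cs /= eq_sym eqbF_neg.
by case on: (odd n); rewrite ?mul1r ?mul0r.
Qed.

Definition Iph b a y : R := Rintegral mu [set: R] (fun x => x ^+ a * ph b (x * y) * gam x).
Definition Sph b a y N : R := \sum_(j < N) cs b j * y ^+ j / j`!%:R * El (a + j).
Lemma Iph_cvg b a y : mu.-integrable [set: R] (EFin \o (fun x => x ^+ a * ph b (x * y) * gam x)) /\
  (fun N => s2pi * Sph b a y N) @ \oo --> Iph b a y.
Proof.
pose q N : {poly R} := \sum_(j < N) (cs b j * y ^+ j / j`!%:R) *: 'X^(a + j).
have qE N x : (q N).[x] = x ^+ a * \sum_(j < N) cs b j * (x * y) ^+ j / j`!%:R.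
  rewrite horner_sum mulr_sumr; apply: eq_bigr => j _.
  by rewrite hornerZ hornerXn exprMn exprD; ring.
have gmean0 : gmean 0 = 0 :> R by rewrite -(scale0r (0 : {poly R})) gmeanZ mul0r.
have [||||h1 h2] := @dominated_Rintegral R _ _ mu (fun N x => (q N).[x] * gam x)
   (fun x => x ^+ a * ph b (x * y) * gam x) (fun x => a`!%:R * egam (1 + `|y|) x).
- move=> n; apply: measurable_funM; [exact: measurable_horner | exact: measurable_gam].
- move=> x; under eq_fun do rewrite qE.
  apply: cvgM; last exact: cvg_cst.
  by apply: cvgM; [exact: cvg_cst | exact: ph_cvg].
- have := integrableZl measurableT (a`!%:R) (integrable_egam (1 + `|y|)); apply: eq_integrable => //.
- move=> N x; rewrite qE normrM [`|gam x|]ger0_norm ?(ltW (gam_gt0 _)) // /egam mulrA.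
  rewrite ler_wpM2r ?(ltW (gam_gt0 _)) // mulrDl mul1r expRD mulrA normrM normrX.
  apply: ler_pM => //; first exact: pow_le_exp.
  apply: le_trans (ler_norm_sum _ _ _) _.
  apply: le_trans (series_exp_le N _); last exact: mulr_ge0.
  apply: ler_sum => j _; rewrite normrM normfV normr_nat ler_wpM2r ?invr_ge0 //.
  rewrite normrM normrX normrM [`|y| * _]mulrC -[leRHS]mul1r ler_wpM2r ?exprn_ge0 ?mulr_ge0 //.
  exact: cs_norm.
split=> //; apply: cvg_trans h2; apply: near_eq_cvg; apply: nearW => N.
rewrite integral_gam (big_morph gmean gmeanD gmean0); congr (_ * _); apply: eq_bigr => j _.
by rewrite gmeanZ gmeanX.
Qed.
Lemma ElS' n : El n.+1 = n%:R * El n.-1 :> R.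
Proof. by case: n => [|n]; rewrite ?ElS // mul0r. Qed.
(** Integration by parts against the Gaussian, done on partial sums through the moment recursion.
    The second sum is shorter by one term, which disappears in the limit. *)
Lemma Sph_rec b a y N : Sph b a.+1 y N.+1 = a%:R * Sph b a.-1 y N.+1 + phsgn b * y * Sph (~~ b) a y N.
Proof.
rewrite /Sph.
have -> : \sum_(j < N.+1) cs b j * y ^+ j / j`!%:R * El (a.+1 + j) =
  \sum_(j < N.+1) (a%:R * (cs b j * y ^+ j / j`!%:R * El (a.-1 + j))
     + j%:R * (cs b j * y ^+ j / j`!%:R * El (a + j).-1)).
  apply: eq_bigr => j _; rewrite addSn ElS' natrD.
  by case: a => [|a]; rewrite ?mul0r ?addSn /=; ring.
rewrite big_split /= mulr_sumr; congr (_ + _).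
rewrite big_ord_recl /= mul0r add0r mulr_sumr; apply: eq_bigr => j _.
rewrite /bump /= add1n addnS csS exprS factS natrM /=.
have f0 : j`!%:R != 0 :> R by rewrite pnatr_eq0 -lt0n fact_gt0.
by field; rewrite f0 -?natr1 ?natr1 ?pnatr_eq0 //= pnatr_eq0.
Qed.
Lemma Iph_rec b a y : Iph b a.+1 y = a%:R * Iph b a.-1 y + phsgn b * y * Iph (~~ b) a y.
Proof.
have [_ h1] := Iph_cvg b a.+1 y; have [_ h2] := Iph_cvg b a.-1 y; have [_ h3] := Iph_cvg (~~ b) a y.
move: h1 h2; rewrite -cvg_shiftS -[in X in _ -> X -> _]cvg_shiftS => h1 h2.
apply: (cvg_unique _ h1) => //.
rewrite (_ : [sequence _]_n = fun N => a%:R * (s2pi * Sph b a.-1 y N.+1) + phsgn b * y * (s2pi * Sph (~~ b) a y N)).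
  by apply: cvgD; apply: cvgM => //; exact: cvg_cst.
by apply/funext => N /=; rewrite Sph_rec; ring.
Qed.
Lemma fact_double n : (2 * n)`!%:R = 4 ^+ n * n`!%:R * poch 2^-1 n :> R.
Proof.
elim: n => [|n IH]; first by rewrite muln0 expr0 poch0 !mulr1.
rewrite mulnS !factS !natrM IH pochS exprS -!natr1 natrM; by field.
Qed.
(** Odd moments vanish, and [(2 i)! = 4^i i! (1/2)_i] turns the even terms of the cosine series into
    those of [exp (- y^2 / 2)]. *)
Lemma Sph0 b y N : Sph b 0 y (2 * N) = if b then 0 else \sum_(i < N) (- y ^+ 2 / 2) ^+ i / i`!%:R.
Proof.
elim: N => [|N IH]; first by rewrite muln0 /Sph !big_ord0; case: b.
rewrite mulnS /Sph !add2n !big_ord_recr /= -/(Sph b 0 y (2 * N)) IH !add0n /El /cs /=.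
rewrite mul2n odd_double /= mulr0 addr0 doubleK -mul2n; case: b {IH} => /=; first by rewrite !mul0r addr0.
congr (_ + _).
rewrite fact_double (_ : - y ^+ 2 / 2 = (-1) * y ^+ 2 * 2^-1); last by ring.
rewrite exprM (_ : 4 = 2 * 2 :> R); last by rewrite -natrM.
rewrite !exprMn exprVn.
have p0 : poch 2^-1 N != 0 :> R by rewrite gt_eqF // poch_gt0 // half_gt0.
have f0 : N`!%:R != 0 :> R by rewrite pnatr_eq0 -lt0n fact_gt0.
have t0 : 2 ^+ N != 0 :> R by rewrite expf_neq0.
by field; rewrite p0 f0 t0.
Qed.
Lemma Iph0 b y : Iph b 0 y = s2pi * gam y * cs b 0.
Proof.
have [_ h] := Iph_cvg b 0 y.
have h2 : (fun N => s2pi * Sph b 0 y (2 * N)) @ \oo --> Iph b 0 y.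
  apply: cvg_comp h; apply: infty_ge => n; exact: leq_pmull.
apply: (cvg_unique _ h2) => //.
rewrite (_ : (fun N => _) = fun N => s2pi * (if b then 0 else \sum_(i < N) (- y ^+ 2 / 2) ^+ i / i`!%:R)); last by apply/funext => N; rewrite Sph0.
case: b {h h2}; rewrite /cs /= ?mulr0; first exact: cvg_cst.
rewrite mulr1; apply: cvgM; first exact: cvg_cst.
have := @is_cvg_series_exp_coeff R (- y ^+ 2 / 2); rewrite /gam /expR.
move=> hc; apply: cvg_trans hc; apply: near_eq_cvg; apply: nearW => N.
by rewrite seriesEord.
Qed.
Lemma IphE b a y : Iph b a y = s2pi * gam y * (Hp a).[y] * cs b a.
Proof.
elim/ltn_ind: a b => [[|a]] IH b; first by rewrite Iph0 Hp0 hornerC mulr1.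
rewrite Iph_rec !IH //; last by rewrite ltnS leq_pred.
rewrite HpS hornerD hornerN hornerZ hornerM hornerX.
case: a IH => [|a] IH; first by rewrite csS !mul0r; ring.
by rewrite csSS (csS (~~ b)) negbK /=; case: b; rewrite /phsgn /=; ring.
Qed.
End GaussianPhase.

(** * The Fourier formula in the plane *)

Section PlaneFourier.
Context {R : realType}.
Notation mu := (@lebesgue_measure R).
Notation mu2 := (@leb2 R).
Notation P2 := {poly {poly R}}.
Implicit Types (c : nat -> nat -> R) (w z : R * R) (F : R * R -> R) (p : P2).

Lemma Rintegral_tensor (f g : R -> R) :
  mu.-integrable [set: R] (EFin \o f) -> mu.-integrable [set: R] (EFin \o g) ->
  Rintegral mu2 setT (fun z => f z.1 * g z.2) = Rintegral mu [set: R] f * Rintegral mu [set: R] g.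
Proof.
move=> intf intg; rewrite {1}/Rintegral /leb2 -integral12_prod_meas1; last exact: integrable_tensorT.
rewrite (_ : (\int[mu]_x _)%E = (\int[mu]_x (f x * Rintegral mu [set: R] g)%:E)%E).
  exact: RintegralZr.
apply: eq_integral => x _; rewrite /fubini_F /= EFinM /Rintegral fineK; last exact: integrable_fin_num.
rewrite -integralZl //.
Qed.

Definition gam2 z : R := gam z.1 * gam z.2.
Lemma gam2_gt0 z : 0 < gam2 z. Proof. by rewrite mulr_gt0 ?gam_gt0. Qed.
Lemma gam2E z : gam2 z = expR (- nrm z ^+ 2 / 2).
Proof.
rewrite /gam2 /gam /nrm -expRD sqr_sqrtr ?addr_ge0 ?sqr_ge0 //; congr expR; ring.
Qed.
Definition Hp2d a b y : R := (Hp a).[y.1] * (Hp b).[y.2].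

Lemma integral_mono_phase s a b y :
  mu2.-integrable setT (fun x => (x.1 ^+ a * x.2 ^+ b * ph s (dotp x y) * gam2 x)%:E) /\
  Rintegral mu2 setT (fun x => x.1 ^+ a * x.2 ^+ b * ph s (dotp x y) * gam2 x) =
  2 * pi * gam2 y * (cs s (a + b) * Hp2d a b y).
Proof.
pose g s' a' t x : R := x ^+ a' * ph s' (x * t) * gam x.
have ig s' a' t : mu.-integrable [set: R] (EFin \o g s' a' t) by case: (Iph_cvg s' a' t).
have it s1 s2 := integrable_tensorT (ig s1 a y.1) (ig s2 b y.2).
have vt s1 s2 := Rintegral_tensor (ig s1 a y.1) (ig s2 b y.2).
have v s' a' t : Rintegral mu [set: R] (g s' a' t) = s2pi * gam t * (Hp a').[t] * cs s' a' by exact: IphE.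
rewrite csD; case: s.
- have e x : x.1 ^+ a * x.2 ^+ b * ph true (dotp x y) * gam2 x =
      g true a y.1 x.1 * g false b y.2 x.2 + g false a y.1 x.1 * g true b y.2 x.2.
    by rewrite /g /ph /dotp /gam2 sinD; ring.
  under eq_fun do rewrite e EFinD; under eq_Rintegral do rewrite e.
  split; first exact: (integrableD measurableT (it true false) (it false true)).
  rewrite RintegralD //; try exact: it.
  by rewrite !vt !v /gam2 /Hp2d -s2pi_sqr; ring.
- have e x : x.1 ^+ a * x.2 ^+ b * ph false (dotp x y) * gam2 x =
      g false a y.1 x.1 * g false b y.2 x.2 - g true a y.1 x.1 * g true b y.2 x.2.
    by rewrite /g /ph /dotp /gam2 cosD; ring.
  under eq_fun do rewrite e EFinB; under eq_Rintegral do rewrite e.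
  split; first exact: (integrableB measurableT (it false false) (it true true)).
  rewrite RintegralB //; try exact: it.
  by rewrite !vt !v /gam2 /Hp2d -s2pi_sqr; ring.
Qed.

(** Partial sums of the real or imaginary part of the transform after division by [2 pi * gam2 y]:
    each monomial of degree [n] becomes a Hermite product times a part of [i^n]. *)
Definition KN s c N y : R := \sum_(a < N) \sum_(b < N) c a b * (cs s (a + b) * Hp2d a b y).
Lemma ph_norm s t : `|ph s t| <= 1 :> R.
Proof. by rewrite ler_norml; case: s; rewrite /ph ?sin_geN1 ?sin_le1 ?cos_geN1 ?cos_le1. Qed.
Lemma integrable_sum_box (f : nat -> nat -> R * R -> R) N :
  (forall a b, mu2.-integrable setT (EFin \o f a b)) ->
  mu2.-integrable setT (EFin \o (fun x => \sum_(a < N) \sum_(b < N) f a b x)) /\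
  Rintegral mu2 setT (fun x => \sum_(a < N) \sum_(b < N) f a b x) =
  \sum_(a < N) \sum_(b < N) Rintegral mu2 setT (f a b).
Proof.
move=> hf.
have gen (I : Type) (r : seq I) (h : I -> R * R -> R) : (forall i, mu2.-integrable setT (EFin \o h i)) ->
    mu2.-integrable setT (EFin \o (fun x => \sum_(i <- r) h i x)) /\
    Rintegral mu2 setT (fun x => \sum_(i <- r) h i x) = \sum_(i <- r) Rintegral mu2 setT (h i).
  move=> hh; elim: r => [|i r [IH1 IH2]].
    rewrite (_ : (fun x => _) = fun=> 0); last by apply/funext => x; rewrite big_nil.
    split; first exact: integrable0.
    by rewrite big_nil /Rintegral integral0.
  rewrite (_ : (fun x => _) = fun x => h i x + \sum_(i <- r) h i x); last by apply/funext => x; rewrite big_cons.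
  split; first by apply: eq_integrable (integrableD measurableT (hh i) IH1).
  by rewrite RintegralD // big_cons IH2.
have h1 a := gen _ (index_enum 'I_N) (fun b => f a b) (fun b => hf a b).
have [h2 h3] := gen _ (index_enum 'I_N) (fun a x => \sum_(b < N) f a b x) (fun a => (h1 a).1).
by split=> //; rewrite h3; apply: eq_bigr => a _; rewrite (h1 a).2.
Qed.
Lemma ent_phase_integral s c F y : ent c F ->
  mu2.-integrable setT (fun x => (F x * ph s (dotp x y) * gam2 x)%:E) /\
  (fun N => 2 * pi * gam2 y * KN s c N y) @ \oo --> Rintegral mu2 setT (fun x => F x * ph s (dotp x y) * gam2 x).
Proof.
case=> -[C [M [C0 M0 hc]]] hF.
pose m a b x : R := c a b * (x.1 ^+ a * x.2 ^+ b * ph s (dotp x y) * gam2 x).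
have im a b : mu2.-integrable setT (EFin \o m a b).
  have [h _] := integral_mono_phase s a b y.
  by apply: eq_integrable (integrableZl measurableT (c a b) h).
have vm a b : Rintegral mu2 setT (m a b) = 2 * pi * gam2 y * (c a b * (cs s (a + b) * Hp2d a b y)).
  have [h e] := integral_mono_phase s a b y.
  by rewrite /m RintegralZl // e; ring.
have E N x : box c N x * ph s (dotp x y) * gam2 x = \sum_(a < N) \sum_(b < N) m a b x.
  rewrite /box !mulr_suml; apply: eq_bigr => a _; rewrite !mulr_suml; apply: eq_bigr => b _.
  by rewrite /m; ring.
have [||||h1 h2] := @dominated_Rintegral R _ _ mu2 (fun N x => box c N x * ph s (dotp x y) * gam2 x)
   (fun x => F x * ph s (dotp x y) * gam2 x) (fun x => C * (egam M x.1 * egam M x.2)).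
- move=> N; under eq_fun do rewrite E.
  have [h _] := integrable_sum_box N im.
  by case/integrableP: h => /measurable_EFinP.
- move=> x; apply: cvgM; last exact: cvg_cst.
  by apply: cvgM; [exact: hF | exact: cvg_cst].
- have := integrableZl measurableT C (integrable_tensorT (integrable_egam M) (integrable_egam M)).
  by apply: eq_integrable.
- move=> N x; rewrite normrM [`|gam2 x|]ger0_norm ?(ltW (gam2_gt0 _)) //.
  rewrite (_ : C * _ = C * expR (M * `|x.1|) * expR (M * `|x.2|) * gam2 x); last by rewrite /egam /gam2; ring.
  rewrite ler_wpM2r ?(ltW (gam2_gt0 _)) // normrM -[leRHS]mulr1 ler_pM // ?ph_norm //.
  apply: le_trans (abox_le x N C0 M0 hc); apply: le_trans (ler_norm_sum _ _ _) _.
  by apply: ler_sum => a _; exact: ler_norm_sum.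
split=> //; apply: cvg_trans h2; apply: near_eq_cvg; apply: nearW => N.
under eq_Rintegral do rewrite E.
have [_ ->] := integrable_sum_box N im.
rewrite /KN mulr_sumr; apply: eq_bigr => a _; rewrite mulr_sumr; apply: eq_bigr => b _.
by rewrite vm.
Qed.

Definition Kf F y : R := Rintegral mu2 setT (fun x => F x * ph false (dotp x y) * gam2 x) / (2 * pi * gam2 y).
Lemma pg_gt0 y : 0 < 2 * pi * gam2 y.
Proof. by rewrite mulr_gt0 ?gam2_gt0 // mulr_gt0 // pi_gt0. Qed.
Lemma KN_cvg c F y : ent c F -> (fun N => KN false c N y) @ \oo --> Kf F y.
Proof.
move=> h; have [_ h2] := ent_phase_integral false y h.
have h3 : (fun N => 2 * pi * gam2 y * KN false c N y / (2 * pi * gam2 y)) @ \oo --> Kf F y.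
  by apply: cvgM => //; exact: cvg_cst.
apply: cvg_trans h3; apply: near_eq_cvg; apply: nearW => N /=.
by rewrite mulrAC divff ?mul1r // gt_eqF // pg_gt0.
Qed.
Lemma sin_integral c F y : ent c F -> (forall a b, odd (a + b) -> c a b = 0) ->
  Rintegral mu2 setT (fun x => F x * ph true (dotp x y) * gam2 x) = 0.
Proof.
move=> h ho; have [_ h2] := ent_phase_integral true y h.
apply/esym; apply: (cvg_unique _ _ h2) => //.
rewrite (_ : (fun N => _) = fun=> 0); first exact: cvg_cst.
apply/funext => N; rewrite /KN big1 ?mulr0 // => a _; rewrite big1 // => b _.
have [ab|ab] := boolP (odd (a + b)); first by rewrite ho ?mul0r.
by rewrite /cs (negbTE ab) /= mul0r mulr0.
Qed.
Lemma CreM (a b : R[i]) : Cre (a * b) = Cre a * Cre b - Cim a * Cim b.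
Proof. by case: a; case: b. Qed.
Lemma CimM (a b : R[i]) : Cim (a * b) = Cre a * Cim b + Cim a * Cre b.
Proof. by case: a; case: b. Qed.
Lemma CrealM (a b : R) : Creal a * Creal b = Creal (a * b).
Proof. by rewrite /Creal; congr Complex; rewrite /= ?mulr0 ?mul0r ?subr0 ?addr0. Qed.
Lemma fourierE c F y : ent c F -> (forall a b, odd (a + b) -> c a b = 0) ->
  fourier (fun w => expR (- nrm w ^+ 2 / 2) * F w) y = Creal (gam2 y * Kf F y).
Proof.
move=> h ho; rewrite /fourier /Cint.
have -> : Rintegral mu2 setT (fun x => Cre (expmi (dotp x y) * Creal (expR (- nrm x ^+ 2 / 2) * F x))) =
    2 * pi * (gam2 y * Kf F y).
  rewrite /Kf [RHS]mulrA [RHS]mulrC divfK ?gt_eqF ?pg_gt0 //.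
  by apply: eq_Rintegral => x _; rewrite CreM /= -gam2E mulr0 subr0; ring.
have -> : Rintegral mu2 setT (fun x => Cim (expmi (dotp x y) * Creal (expR (- nrm x ^+ 2 / 2) * F x))) = 0.
  rewrite -(mulr0 (-1)) -(sin_integral y h ho) -RintegralZl //; last by case: (ent_phase_integral true y h).
  by apply: eq_Rintegral => x _; rewrite CimM /= -gam2E mulr0 add0r; ring.
rewrite -[Complex _ 0]/(Creal _) CrealM mulrA mulVf ?mul1r // gt_eqF // mulr_gt0 //; exact: pi_gt0.
Qed.

(** Uniform in [N] and of exponential growth in [y]: this is the domination that allows the Hermite
    series of the transform to be integrated term by term against the Gaussian. *)
Lemma KN_bound s c : ebnd c -> exists C M, [/\ 0 <= C, 0 <= M &
  forall N y, `|KN s c N y| <= C * (expR (M * `|y.1|) * expR (M * `|y.2|))].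
Proof.
case=> C [M [C0 M0 hc]]; have [K K0 hK] := @ha_sum R M M0.
exists (C * (K * K)), M; split=> // [|N y]; first by rewrite !mulr_ge0.
pose S t : R := \sum_(n < N) M ^+ n / n`!%:R * ha n t.
apply: (@le_trans _ _ (C * (S `|y.1| * S `|y.2|))); last first.
  have S0 t : 0 <= t -> 0 <= S t by move=> t0; apply: sumr_ge0 => n _; rewrite mulr_ge0 ?ha_ge0 ?divr_ge0 ?exprn_ge0.
  rewrite -mulrA ler_wpM2l // mulrACA ler_pM ?S0 //; exact: hK.
rewrite /S big_distrlr /= mulr_sumr.
apply: le_trans (ler_norm_sum _ _ _) _; apply: ler_sum => a _.
rewrite mulr_sumr; apply: le_trans (ler_norm_sum _ _ _) _; apply: ler_sum => b _.
rewrite normrM [leRHS](_ : _ = C * M ^+ (a + b) / (a`!%:R * b`!%:R) * (ha a `|y.1| * ha b `|y.2|)).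
  apply: ler_pM => //; rewrite normrM -[leRHS]mul1r ler_pM ?cs_norm // /Hp2d normrM ler_pM ?Hp_le //.
by rewrite exprD invfM; ring.
Qed.

Lemma derivn_Hp m n : derivn m (Hp n : {poly R}) = (n ^_ m)%:R *: Hp (n - m).
Proof.
elim: m => [|m IH]; first by rewrite derivn0 ffactn0 scale1r subn0.
rewrite derivnS IH derivZ deriv_Hp scalerA -natrM ffactnSr subnS //.
Qed.
Lemma gmean_Hp_Hp m n : gmean (Hp m * Hp n) = (m == n)%:R * n`!%:R :> R.
Proof.
wlog h : m n / (n <= m)%N.
  move=> W; case: (leqP n m) => h; first exact: W.
  rewrite mulrC W ?(ltnW h) // eq_sym; case: eqP => [->|] //; by rewrite !mul0r.
rewrite gmean_Hp derivn_Hp gmeanZ; move: h; rewrite leq_eqVlt => /orP[/eqP ->|h].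
  by rewrite eqxx ffactnn subnn Hp0 -(expr0 'X) gmeanX /El /= poch0 !mul1r !mulr1.
by rewrite ffact_small // gtn_eqF // !mul0r.
Qed.
Lemma integral_Hp2d a b i j :
  mu2.-integrable setT (fun y => (Hp2d a b y * Hp2d i j y * gam2 y)%:E) /\
  Rintegral mu2 setT (fun y => Hp2d a b y * Hp2d i j y * gam2 y) =
  if (a == i) && (b == j) then 2 * pi * (i`!%:R * j`!%:R) else 0.
Proof.
have h1 := @integrable_horner R (Hp a * Hp i); have h2 := @integrable_horner R (Hp b * Hp j).
have e y : Hp2d a b y * Hp2d i j y * gam2 y = ((Hp a * Hp i).[y.1] * gam y.1) * ((Hp b * Hp j).[y.2] * gam y.2).
  by rewrite /Hp2d /gam2 !hornerM; ring.
under eq_fun do rewrite e; under eq_Rintegral do rewrite e.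
split; first exact: (integrable_tensorT h1 h2).
rewrite (Rintegral_tensor h1 h2) !integral_gam !gmean_Hp_Hp -s2pi_sqr.
by case: eqP => _; case: eqP => _; rewrite /= ?mul1r ?mul0r ?mulr0 ?mul0r //; ring.
Qed.

Lemma sum_delta_box N (f : nat -> nat -> R) i j : (i < N)%N -> (j < N)%N ->
  \sum_(a < N) \sum_(b < N) (if ((a : nat) == i) && ((b : nat) == j) then f a b else 0) = f i j.
Proof.
move=> hi hj; rewrite (bigD1 (Ordinal hi)) //= [X in _ + X]big1 ?addr0; last first.
  move=> a ha; rewrite big1 // => b _; rewrite (_ : (a == i :> nat) = false) //.
  by apply: contraNF ha => /eqP e; apply/eqP/val_inj.
rewrite (bigD1 (Ordinal hj)) //= [X in _ + X]big1 ?addr0 ?eqxx // => b hb.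
rewrite (_ : (b == j :> nat) = false) //; by apply: contraNF hb => /eqP e; apply/eqP/val_inj.
Qed.
Definition Kpoly p y : R := psum p (fun a b => cs false (a + b) * Hp2d a b y).
(** After integration, orthogonality leaves a single term, so the sequence of integrals is constant
    once [N] exceeds [i] and [j]. *)
Lemma integral_KN_limit c (K : R * R -> R) i j : ebnd c -> (forall y, (fun N => KN false c N y) @ \oo --> K y) ->
  mu2.-integrable setT (fun y => (K y * Hp2d i j y * gam2 y)%:E) /\
  Rintegral mu2 setT (fun y => K y * Hp2d i j y * gam2 y) =
  2 * pi * (c i j * cs false (i + j) * (i`!%:R * j`!%:R)).
Proof.
move=> hc hK; have [C [M [C0 M0 hb]]] := KN_bound false hc.
pose m a b y : R := c a b * cs false (a + b) * (Hp2d a b y * Hp2d i j y * gam2 y).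
have im a b : mu2.-integrable setT (EFin \o m a b).
  have [h _] := integral_Hp2d a b i j.
  by apply: eq_integrable (integrableZl measurableT (c a b * cs false (a + b)) h).
have vm a b : Rintegral mu2 setT (m a b) =
    if (a == i) && (b == j) then c a b * cs false (a + b) * (2 * pi * (i`!%:R * j`!%:R)) else 0.
  have [h e] := integral_Hp2d a b i j.
  by rewrite /m RintegralZl // e; case: ifP => //; rewrite mulr0.
have E N y : KN false c N y * Hp2d i j y * gam2 y = \sum_(a < N) \sum_(b < N) m a b y.
  rewrite /KN !mulr_suml; apply: eq_bigr => a _; rewrite !mulr_suml; apply: eq_bigr => b _.
  by rewrite /m; ring.
have [C1 C10 h1] := horner_le (Hp i : {poly R}); have [C2 C20 h2] := horner_le (Hp j : {poly R}).
have [||||h3 h4] := @dominated_Rintegral R _ _ mu2 (fun N y => KN false c N y * Hp2d i j y * gam2 y)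
   (fun y => K y * Hp2d i j y * gam2 y) (fun y => (C * (C1 * C2)) * (egam (M + 1) y.1 * egam (M + 1) y.2)).
- move=> N; under eq_fun do rewrite E.
  have [h _] := integrable_sum_box N im.
  by case/integrableP: h => /measurable_EFinP.
- move=> y; apply: cvgM; last exact: cvg_cst.
  by apply: cvgM; [exact: hK | exact: cvg_cst].
- have := integrableZl measurableT (C * (C1 * C2)) (integrable_tensorT (integrable_egam (M + 1)) (integrable_egam (M + 1))).
  by apply: eq_integrable.
- move=> N y; rewrite normrM [`|gam2 y|]ger0_norm ?(ltW (gam2_gt0 _)) //.
  rewrite (_ : _ * (egam _ _ * _) = (C * (expR (M * `|y.1|) * expR (M * `|y.2|))) * ((C1 * expR `|y.1|) * (C2 * expR `|y.2|)) * gam2 y); last first.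
    by rewrite /egam /gam2 !mulrDl !mul1r !expRD; ring.
  rewrite ler_wpM2r ?(ltW (gam2_gt0 _)) // normrM ler_pM //.
  by rewrite /Hp2d normrM ler_pM.
split=> //; apply: (cvg_unique _ h4) => //.
apply: cvg_near_cst; near=> N.
under eq_Rintegral do rewrite E.
have [_ ->] := integrable_sum_box N im.
under eq_bigr do under eq_bigr do rewrite vm.
rewrite (sum_delta_box (fun a b => c a b * cs false (a + b) * (2 * pi * (i`!%:R * j`!%:R)))).
- by ring.
- by near: N; exact: nbhs_infty_gt.
- by near: N; exact: nbhs_infty_gt.
Unshelve. all: by end_near. Qed.
(** Both transforms carry the factor [(-1)^(n / 2)] in even degree [n], and the two factors cancel;
    in odd degrees the coefficients [c] are 0. *)
Lemma integral_Kpoly c (K : R * R -> R) p : ebnd c -> (forall a b, odd (a + b) -> c a b = 0) ->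
  (forall y, (fun N => KN false c N y) @ \oo --> K y) ->
  mu2.-integrable setT (fun y => (K y * Kpoly p y * gam2 y)%:E) /\
  Rintegral mu2 setT (fun y => K y * Kpoly p y * gam2 y) =
  2 * pi * psum p (fun a b => a`!%:R * b`!%:R * c a b).
Proof.
move=> hc ho hK; elim/poly2_lin_ind: p => [p q [ip hp] [iq hq]|r p [ip hp]|i j].
- have e y : K y * Kpoly (p + q) y * gam2 y = K y * Kpoly p y * gam2 y + K y * Kpoly q y * gam2 y.
    by rewrite /Kpoly psumD; ring.
  under eq_fun do rewrite e EFinD.
  split; first exact: integrableD.
  under eq_Rintegral do rewrite e.
  rewrite RintegralD //.
  rewrite hp hq psumD.
  by ring.
- have e y : K y * Kpoly (CC r * p) y * gam2 y = r * (K y * Kpoly p y * gam2 y).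
    by rewrite /Kpoly psumZ; ring.
  under eq_fun do rewrite e EFinM.
  split; first exact: integrableZl.
  by under eq_Rintegral do rewrite e; rewrite RintegralZl // hp psumZ; ring.
have [h1 h2] := integral_KN_limit i j hc hK.
have e y : K y * Kpoly (X1 R ^+ i * X2 R ^+ j) y * gam2 y = cs false (i + j) * (K y * Hp2d i j y * gam2 y).
  by rewrite /Kpoly psum_mono; ring.
under eq_fun do rewrite e EFinM.
split; first exact: integrableZl.
under eq_Rintegral do rewrite e; rewrite RintegralZl // h2 psum_mono.
have [ij|ij] := boolP (odd (i + j)); first by rewrite ho // ?mulr0 ?mul0r ?mulr0.
rewrite [LHS](_ : _ = 2 * pi * (cs false (i + j) * cs false (i + j) * (i`!%:R * j`!%:R * c i j))); last by ring.
by rewrite cs_sqr // mul1r.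
Qed.

Lemma ent_pcoef p : ent (pcoef p) (peval p).
Proof.
have [N hN] := pcoef_eq0 p; split.
  exists (\sum_(a < N) \sum_(b < N) `|pcoef p a b| * (a`!%:R * b`!%:R)), 1; split=> // [|a b].
    by apply: sumr_ge0 => a _; apply: sumr_ge0 => b _; rewrite !mulr_ge0.
  have f0 : 0 < a`!%:R * b`!%:R :> R by rewrite mulr_gt0 // ltr0n fact_gt0.
  rewrite expr1n mulr1 ler_pdivlMr //.
  have [ha|ha] := leqP N a; first by rewrite hN ?ha // normr0 mul0r; apply: sumr_ge0 => i _; apply: sumr_ge0 => j _; rewrite !mulr_ge0.
  have [hb|hb] := leqP N b; first by rewrite hN ?hb ?orbT // normr0 mul0r; apply: sumr_ge0 => i _; apply: sumr_ge0 => j _; rewrite !mulr_ge0.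
  rewrite (bigD1 (Ordinal ha)) //= (bigD1 (Ordinal hb)) //= -addrA lerDl.
  by rewrite addr_ge0 //; do ?(apply: sumr_ge0 => ? _); rewrite !mulr_ge0.
move=> w; apply: cvg_near_cst; near=> M.
rewrite peval_psum (@psum_widen _ _ _ M) /box; first by rewrite exchange_big; apply: eq_bigr => a _; apply: eq_bigr => b _; rewrite mulrA.
have NM : (N <= M)%N by near: M; exact: nbhs_infty_ge.
by move=> a b /orP[h|h]; rewrite hN // (leq_trans NM h) ?orbT.
Unshelve. all: by end_near. Qed.
Lemma Kf_poly p y : Kf (peval p) y = Kpoly p y.
Proof.
have h := KN_cvg (y := y) (ent_pcoef p); apply: (cvg_unique _ h) => //.
have [N hN] := pcoef_eq0 p; apply: cvg_near_cst; near=> M.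
rewrite /Kpoly (@psum_widen _ _ _ M) /KN; first by rewrite exchange_big.
have NM : (N <= M)%N by near: M; exact: nbhs_infty_ge.
by move=> a b /orP[h'|h']; rewrite hN // (leq_trans NM h') ?orbT.
Unshelve. all: by end_near. Qed.
(** The rotation of index [k] is [z -> - z]. *)
Lemma invariant_even k p : (0 < k)%N -> dihedral_invariant k p -> forall a b, odd (a + b) -> pcoef p a b = 0.
Proof.
move=> k0 hp a b ob.
have [q [hq1 hq2]] : exists q : P2, (forall x, peval q x = peval p (- x.1, - x.2)) /\
    forall i j, pcoef q i j = (-1) ^+ (i + j) * pcoef p i j.
  elim/poly2_lin_ind: (p) => [p1 p2 [q1 [h1 h1']] [q2 [h2 h2']]|r p1 [q1 [h1 h1']]|i j].
  - exists (q1 + q2); split=> [x|i j]; first by rewrite !pevalD h1 h2.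
    by rewrite !pcoefD h1' h2' mulrDr.
  - exists (CC r * q1); split=> [x|i j]; first by rewrite !pevalM !pevalC h1.
    by rewrite !pcoefZ h1' mulrCA.
  exists (CC ((-1) ^+ (i + j)) * (X1 R ^+ i * X2 R ^+ j)); split=> [x|i' j'].
    by rewrite !pevalE /= (exprNn x.1) (exprNn x.2) exprD; ring.
  rewrite pcoefZ pcoef_mono; case: eqP => [->|]; last by rewrite !mulr0.
  by case: eqP => [->|] //; rewrite !mulr0.
have e : q = p.
  apply: peval_inj => x; rewrite hq1.
  have [<- _] := hp k x ltac:(by rewrite mul2n -addnn -addn1 leq_add2l).
  rewrite /rotI /ang mulrAC divff ?pnatr_eq0 -?lt0n // mul1r cospi sinpi.
  by congr (peval _ (_, _)); ring.
have := hq2 a b; rewrite e -signr_odd ob expr1 mulN1r => h.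
by lra.
Qed.

Lemma fourier_pairing k c F p : (0 < k)%N -> dihedral_invariant k p ->
  ent c F -> (forall a b, odd (a + b) -> c a b = 0) ->
  let G := fun y : R * R =>
    fourier (fun w => expR (- nrm w ^+ 2 / 2) * F w) y *
    fourier (fun w => expR (- nrm w ^+ 2 / 2) * peval p w) y *
    Creal (expR (nrm y ^+ 2 / 2)) in
  Cintegrable G /\ Creal (psum p (fun a b => a`!%:R * b`!%:R * c a b)) = Creal (2 * pi)^-1 * Cint G.
Proof.
move=> k0 hp hF ho G.
have GE : G = fun y => Creal (Kf F y * Kpoly p y * gam2 y).
  apply/funext => y; rewrite /G (fourierE y hF ho) (fourierE y (ent_pcoef p) (invariant_even k0 hp)).
  rewrite !CrealM Kf_poly; congr Creal.
  (* Each transform carries a Gaussian in [y]; the exponential factor removes one of them, and the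
     other is the weight of the Hermite polynomials. *)
  have e : gam2 y * expR (nrm y ^+ 2 / 2) = 1 by rewrite gam2E -expRD mulNr addNr expR0.
  rewrite [LHS](_ : _ = Kf F y * Kpoly p y * gam2 y * (gam2 y * expR (nrm y ^+ 2 / 2))); last by ring.
  by rewrite e mulr1.
have [h1 h2] := integral_Kpoly p hF.1 ho (fun y => KN_cvg (y := y) hF).
rewrite GE /Cintegrable /Cint /=; split; first by split=> //; exact: integrable0.
have -> : Rintegral mu2 setT (fun=> 0) = 0 :> R by rewrite /Rintegral integral0.
rewrite -[Complex _ 0]/(Creal _) CrealM h2 mulrA mulVf ?mul1r // gt_eqF // mulr_gt0 //; exact: pi_gt0.
Qed.
End PlaneFourier.

Theorem mainTheorem16 (R : realType) (k : nat) (al be : R)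
    (p : {poly {poly R}}) :
  (2 <= k)%N -> 0 < al -> 0 < be -> dihedral_invariant k p ->
  [/\
   (* J_{u,v}(z, .) is an everywhere convergent power series in w *)
   (forall (z : R * R) (u v : R), u \in `[-1, 1] -> v \in `[-1, 1] ->
      exists c : nat -> nat -> R, forall w : R * R,
        cvgn (fun N => \sum_(a < N) \sum_(b < N) `|c a b * w.1 ^+ a * w.2 ^+ b|)
        /\ (fun N => \sum_(a < N) \sum_(b < N) c a b * w.1 ^+ a * w.2 ^+ b)
             @ \oo --> Jfun k al be u v z w),
   (* integral representation of the intertwining operator *)
   (forall (V : {poly {poly R}} -> {poly {poly R}}) (z : R * R),
      dunkl_intertwiner k al be V ->
      (@leb2 R).-integrable (@I11 R `*` @I11 R)
         (fun uv => (nu_dens al uv.1 * nu_dens be uv.2 *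
                     p_uv k al be p uv.1 uv.2 z)%:E)
      /\ peval (V p) z =
         Rintegral (@lebesgue_measure R) (@I11 R) (fun v =>
           Rintegral (@lebesgue_measure R) (@I11 R) (fun u =>
             p_uv k al be p u v z * nu_dens al u) * nu_dens be v)) &
   (* Fourier representation of p_{u,v} *)
   (forall (z : R * R) (u v : R), u \in `[-1, 1] -> v \in `[-1, 1] ->
      let G := fun y : R * R =>
        fourier (fun w => expR (- nrm w ^+ 2 / 2) * Jfun k al be u v z w) y *
        fourier (fun w => expR (- nrm w ^+ 2 / 2) * peval p w) y *
        Creal (expR (nrm y ^+ 2 / 2)) in
      Cintegrable G /\
      Creal (p_uv k al be p u v z) = Creal (2 * pi)^-1 * Cint G)].
Proof.
move=> k2 al0 be0 hp; have k0 : (0 < k)%N by exact: ltnW.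
have I1 (x : R) : x \in `[-1, 1] -> -1 <= x <= 1 by rewrite inE /= in_itv.
split.
- move=> z u v /I1 hu /I1 hv; exists (cJ k al be u v z) => w.
  have [hc hJ] := ent_J k0 al0 be0 z hu hv.
  by split; [exact: abox_cvg | exact: hJ].
- by move=> V z; exact: intertwiner_integral.
- move=> z u v /I1 hu /I1 hv G.
  rewrite (p_uv_cJ k0 al0 be0 z hu hv p).
  apply: (fourier_pairing k0 hp (ent_J k0 al0 be0 z hu hv)) => a b ab.
  by rewrite /cJ ab.
Qed.
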